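(* Let $\omega\subset\mathbb{T}^1$ be a nonempty open set, let $T>0$ and $k\ge2$. Let $\mathcal{C}=\{\gamma(x)\in\mathbb{S}^k:x\in\mathbb{T}^1\}$ be a closed constant-speed geodesic on $\mathbb{S}^k$ with energy $2\pi$, that is, $$\gamma(x)\in\mathbb{S}^k,\quad \gamma_{xx}(x)+|\gamma_x|^2(x)\gamma(x)=0\ \ \forall x\in\mathbb{T}^1,\qquad \int_{\mathbb{T}^1}|\gamma_x(x)|^2dx=2\pi.$$ Let $v_0\in H^1(\mathbb{T}^1;\mathbb{S}^k)$ be an initial state and $v_1\in H^1(\mathbb{T}^1;\mathbb{S}^k)$ a target state, both with values in $\mathcal{C}$. Assume that there exist $N_1\in\mathbb{Z}$ and $r\in\mathbb{R}$ such that $$v_1(x)=\gamma(N_1x+r)\qquad\forall x\in\mathbb{T}^1.$$ Then there exists an explicit function $f\in L^\infty(0,T;L^2(\mathbb{T}^1))$ such that the unique solution $u(t,x)$, $t\in(0,T)$, $x\in\mathbb{T}^1$, of the controlled harmonic map heat flow $$\partial_tu-\Delta u=|\partial_xu|^2u+\mathbf{1}_\omega f^{u^\perp}$$ with initial state $u(0,\cdot)=v_0$ satisfies $$u(T,x)=v_1(x)\qquad\forall x\in\mathbb{T}^1.$$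
   Context: $\mathbb{T}^1=\mathbb{R}/2\pi\mathbb{Z}$, $\mathbb{S}^k=\{u\in\mathbb{R}^{k+1}:|u|=1\}$, $\Delta=\partial_{xx}$. Controls $f$ take values in $\mathbb{R}^{k+1}$. For $u\in\mathbb{S}^k$, $f^{u^\perp}=f-\langle f,u\rangle u$ is the projection of $f$ onto $T_u\mathbb{S}^k$. $\mathbf{1}_\omega$ is the characteristic function of $\omega$. Solutions are in $C([0,T];H^1(\mathbb{T}^1;\mathbb{S}^k))$. *)

(* Defs.v *)
From HB Require Import structures.
From mathcomp Require Export all_boot all_order all_algebra.
From mathcomp Require Export all_classical all_reals all_analysis.
Set Implicit Arguments.
Unset Strict Implicit.
Unset Printing Implicit Defensive.
Import Order.TTheory GRing.Theory Num.Theory.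
Import numFieldNormedType.Exports.
Local Open Scope classical_set_scope.
Local Open Scope ring_scope.

(* The circle R/2piZ has no type of its own: a function on it is a function on
   R of period 2 pi, a subset of it is a 2 pi-periodic subset of R, and
   integrals over it are Lebesgue integrals over circle := [0, 2 pi]. *)

Section Definitions.
Context {R : realType}.

Definition period : R := 2 * pi.

Definition circle : set R := `[0, period].

Notation mu := (@lebesgue_measure R).

(* The library norm on row vectors is the sup norm, hence these two. *)
Definition dotv n (a b : 'rV[R]_n) : R := \sum_(i < n) a 0 i * b 0 i.

Definition enorm n (a : 'rV[R]_n) : R := Num.sqrt (dotv a a).

Definition sphere k : set 'rV[R]_k.+1 := [set a | enorm a = 1].

Definition tangent_proj k (p a : 'rV[R]_k.+1) : 'rV[R]_k.+1 :=
  a - dotv a p *: p.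

Definition smooth_circle (phi : R -> R) : Prop :=
  periodic phi period /\ forall n x, derivable (derive1n n phi) x 1.

Definition L2_circle n (g : R -> 'rV[R]_n) : Prop :=
  [/\ periodic g period,
      forall i, measurable_fun circle (fun x => g x 0 i) &
      (\int[mu]_(x in circle) (enorm (g x) ^+ 2)%:E < +oo)%E].

Definition weak_derivative n (u g : R -> 'rV[R]_n) : Prop :=
  forall phi, smooth_circle phi -> forall i,
    \int[mu]_(x in circle) (u x 0 i * derive1 phi x) =
    - \int[mu]_(x in circle) (g x 0 i * phi x).

(* u is the continuous representative of an element of H^1(T^1; S^k), and g
   represents its weak derivative. *)
Definition H1_sphere_with k (u g : R -> 'rV[R]_k.+1) : Prop :=
  [/\ periodic u period,
      continuous u,
      forall x, sphere (u x),
      L2_circle g &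
      weak_derivative u g].

Definition H1_sphere k (u : R -> 'rV[R]_k.+1) : Prop :=
  exists g, H1_sphere_with u g.

(* The H^1 norm of a function w whose weak derivative is wx. *)
Definition H1_norm n (w wx : R -> 'rV[R]_n) : R :=
  Num.sqrt (\int[mu]_(x in circle) (enorm (w x) ^+ 2) +
            \int[mu]_(x in circle) (enorm (wx x) ^+ 2)).

(* u \in C([0, T]; H^1(T^1; S^k)), with spatial weak derivative ux. *)
Definition C_H1_sphere_with k (T : R) (u ux : R -> R -> 'rV[R]_k.+1) : Prop :=
  (forall t, t \in `[0, T] -> H1_sphere_with (u t) (ux t)) /\
  (forall t, t \in `[0, T] ->
     H1_norm (u s \- u t) (ux s \- ux t)
       @[s --> within `[0, T]%classic (nbhs t)] --> (0 : R)).

(* f \in L^oo(0, T; L^2(T^1; R^n)).  L^2(T^1) being separable, strong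
   measurability in time amounts to joint measurability. *)
Definition Loo_L2 n (T : R) (f : R -> R -> 'rV[R]_n) : Prop :=
  [/\ forall t, periodic (f t) period,
      forall i, measurable_fun (`]0, T[%classic `*` circle)
        (fun p : measurableTypeR R * measurableTypeR R => f p.1 p.2 0 i) &
      exists M : R, {ae mu, forall t, t \in `]0, T[ ->
        (\int[mu]_(x in circle) (enorm (f t x) ^+ 2)%:E <= M%:E)%E}].

(* Solutions in C([0, T]; H^1(T^1; S^k)) of
     u_t - u_xx = |u_x|^2 u + 1_omega f^{u^perp},   u(0, .) = v0,
   weakly in x (tested against C^oo(T^1)) and integrated in time from 0. *)
Definition HMHF_solution k (omega : set R) (T : R)
    (f : R -> R -> 'rV[R]_k.+1) (v0 : R -> 'rV[R]_k.+1)
    (u : R -> R -> 'rV[R]_k.+1) : Prop :=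
  exists ux,
    [/\ C_H1_sphere_with T u ux,
        forall x, u 0 x = v0 x &
        forall phi, smooth_circle phi -> forall i t, t \in `[0, T] ->
          \int[mu]_(x in circle) (u t x 0 i * phi x) -
          \int[mu]_(x in circle) (u 0 x 0 i * phi x) =
          \int[mu]_(s in `[0, t]) \int[mu]_(x in circle)
            (- (ux s x 0 i * derive1 phi x) +
             (enorm (ux s x) ^+ 2 *: u s x +
              \1_omega x *: tangent_proj (u s x) (f s x)) 0 i * phi x)].

Definition closed_geodesic k (gamma : R -> 'rV[R]_k.+1) : Prop :=
  [/\ periodic gamma period,
      forall x, sphere (gamma x),
      forall x, derivable gamma x 1 /\ derivable (derive1 gamma) x 1,
      forall x, derive1n 2 gamma x + enorm (derive1 gamma x) ^+ 2 *: gamma x = 0 &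
      \int[mu]_(x in circle) (enorm (derive1 gamma x) ^+ 2) = period].

End Definitions.

(* Main.v *)
(* The states with values in C are v = gamma(theta), and for those the harmonic
   map heat flow is the linear heat equation theta_t = theta_xx for the angle, whose
   winding number on the circle cannot change.  It can be changed by leaving C at
   one point: with e3 a unit vector orthogonal to the plane of C (this is where
   k >= 2 is used) look for
     u(t, x) = cos B(t, x) gamma(theta(t, x)) + sin B(t, x) e3,
   with B = beta(t) chi(x) and chi a bump supported in omega, equal to 1 near a
   point c of omega.  The control f = u_t - u_xx - |u_x|^2 u is tangent to the
   sphere and, as theta solves the heat equation, vanishes together with B and its
   derivatives, so that it is supported in omega.  When B(t, .) = pi/2 near c, the
   value u = e3 at c does not depend on theta, and theta need only solve the heat
   equation on the interval (c, c + 2 pi), with boundary values that are free.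
   There the flatness method applies: the free flow from the lifting of v0 is
     sum_j y_0^(j)(t) x^(2j) / (2j)! + sum_j y_1^(j)(t) x^(2j+1) / (2j+1)!,
   where y_0 and y_1 are its value and its slope at x = 0; multiplying their
   differences to those of the target N1 x + r by a cut-off in time in the
   Gevrey class |phi^(j)| <= C (2j)! / Q^j, with Q large, keeps the series
   convergent and brings theta exactly to N1 x + r.  Finally beta goes back to 0.

   Uniqueness is an energy estimate.  For two solutions u, u' and w = u - u',
   |u| = |u'| = 1 turns the nonlinear terms tested against w into
   |w|^2 / 2 (|u_x|^2 + |u'_x|^2 - 1_omega f . (u + u')), which interpolation between
   L^2 and H^1 and Gronwall's lemma absorb. *)
Require Import Defs.
From mathcomp Require Import ring lra measurable_realfun zify.
Import Order.TTheory GRing.Theory Num.Theory.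
Import numFieldNormedType.Exports.
Set Implicit Arguments.
Unset Strict Implicit.
Unset Printing Implicit Defensive.
Local Open Scope classical_set_scope.
Local Open Scope ring_scope.

(** * Integrals over intervals *)

Section integrals.
Context {R : realType}.
Notation mu := (@lebesgue_measure R).
Implicit Types (f g : R -> R) (a b x : R).

(** The initial state is only H^1, so the delicate time is [t = 0], where the solution must be
    continuous with values in H^1. Two choices deal with it. The bump in time vanishes before
    [T / 8]: the control is then zero near the initial time and jointly continuous on the whole
    plane, and its boundedness, its measurability and the energy estimate rest on that continuity.
    And the slope of the free flow converges in L^2 to the derivative of the initial angle by
    Parseval's identity, whose nontrivial inequality comes from difference quotients and Fatou's
    lemma.

    A solution is tested against smooth functions fixed in time, whereas an energy estimate tests it
    against itself; the same L^2 convergence of differentiated Fourier sums bridges this gap.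

    The size of [Q] is a matter of bookkeeping: the flat series must converge on an interval longer
    than a period, and multiplying Gevrey functions, then differentiating once more, each cost a
    factor 2. *)

Definition itg (a b : R) f := mu.-integrable `[a, b] (EFin \o f).

Lemma itg_cont f a b : continuous f -> itg a b f.
Proof.
move=> cf; apply: continuous_compact_integrable; first exact: segment_compact.
exact: continuous_subspaceT.
Qed.

Lemma itgS f a b a' b' : itg a b f -> a <= a' -> b' <= b -> itg a' b' f.
Proof.
move=> fab aa bb; apply: integrableS fab => //.
by apply: subset_itvScc; rewrite bnd_simp.
Qed.

Lemma eq_itg f g a b : {in `[a, b], f =1 g} -> itg a b f -> itg a b g.
Proof.
move=> fg; apply: eq_integrable => // x; rewrite inE /= => xab.
by rewrite fg.
Qed.

Lemma itgD f g a b : itg a b f -> itg a b g -> itg a b (fun x => f x + g x).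
Proof. by move=> fi gi; have := integrableD _ fi gi; apply. Qed.

Lemma itgN f a b : itg a b f -> itg a b (fun x => - f x).
Proof. by move=> fi; have := integrableN fi; apply. Qed.

Lemma itgB f g a b : itg a b f -> itg a b g -> itg a b (fun x => f x - g x).
Proof. by move=> fi /itgN; exact: itgD. Qed.

Lemma itgZ f (k : R) a b : itg a b f -> itg a b (fun x => k * f x).
Proof. by move=> fi; have := integrableZl _ k fi; apply. Qed.

Lemma itg_sum (I : Type) (s : seq I) (F : I -> R -> R) a b :
  (forall i, itg a b (F i)) -> itg a b (fun x => \sum_(i <- s) F i x).
Proof.
move=> Fi; elim: s => [|i s IH].
  by apply: (@eq_itg (cst 0)) => [x _|]; [rewrite big_nil|apply/itg_cont/cst_continuous].
by apply: (@eq_itg (fun x => F i x + \sum_(i <- s) F i x)) => [x _|];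
  [rewrite big_cons|exact: itgD].
Qed.

Lemma itg_abs f a b : itg a b f -> itg a b (fun x => `|f x|).
Proof. by move=> /integrable_norm. Qed.

Lemma itg_le f g a b : measurable_fun `[a, b] f ->
  (forall x, x \in `[a, b] -> `|f x| <= g x) -> itg a b g -> itg a b f.
Proof.
move=> mf fg gi; apply: le_integrable gi => //=.
  exact/measurable_EFinP.
by move=> x xab; rewrite lee_fin (le_trans (fg _ _))// ler_norm.
Qed.

Lemma itg_meas f a b : itg a b f -> measurable_fun `[a, b] f.
Proof. by move=> /integrableP[/measurable_EFinP]. Qed.

Lemma bounded_itg f a b (M : R) : measurable_fun `[a, b] f ->
  (forall x, x \in `[a, b] -> `|f x| <= M) -> itg a b f.
Proof.
move=> mf fM; apply: (itg_le mf fM).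
exact/itg_cont/cst_continuous.
Qed.

Lemma intD f g a b : itg a b f -> itg a b g ->
  \int[mu]_(x in `[a, b]) (f x + g x) =
  \int[mu]_(x in `[a, b]) f x + \int[mu]_(x in `[a, b]) g x.
Proof. exact: RintegralD. Qed.

Lemma intB f g a b : itg a b f -> itg a b g ->
  \int[mu]_(x in `[a, b]) (f x - g x) =
  \int[mu]_(x in `[a, b]) f x - \int[mu]_(x in `[a, b]) g x.
Proof. exact: RintegralB. Qed.

Lemma intZ f (k : R) a b : itg a b f ->
  \int[mu]_(x in `[a, b]) (k * f x) = k * \int[mu]_(x in `[a, b]) f x.
Proof. exact: RintegralZl. Qed.

Lemma intN f a b : itg a b f ->
  \int[mu]_(x in `[a, b]) (- f x) = - \int[mu]_(x in `[a, b]) f x.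
Proof.
move=> fi; rewrite -mulN1r -intZ//.
by apply: eq_Rintegral => x _; rewrite mulN1r.
Qed.

Lemma eq_int f g a b : {in `[a, b], f =1 g} ->
  \int[mu]_(x in `[a, b]) f x = \int[mu]_(x in `[a, b]) g x.
Proof. by move=> fg; apply: eq_Rintegral => x; rewrite inE/=; exact: fg. Qed.

Lemma int_sum (I : Type) (s : seq I) (F : I -> R -> R) a b :
  (forall i, itg a b (F i)) ->
  \int[mu]_(x in `[a, b]) (\sum_(i <- s) F i x) =
  \sum_(i <- s) \int[mu]_(x in `[a, b]) F i x.
Proof.
move=> Fi; elim: s => [|i s IH].
  rewrite big_nil (@eq_int _ (fun x => 0)); last by move=> x _; rewrite big_nil.
  by rewrite Rintegral_cst// mul0r.
rewrite big_cons -IH -intD//; last exact: itg_sum.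
by apply: eq_int => x _; rewrite big_cons.
Qed.

Lemma le_int f g a b : itg a b f -> itg a b g ->
  (forall x, x \in `[a, b] -> f x <= g x) ->
  \int[mu]_(x in `[a, b]) f x <= \int[mu]_(x in `[a, b]) g x.
Proof. by move=> fi gi fg; apply: le_Rintegral. Qed.

Lemma int_ge0 f a b : (forall x, x \in `[a, b] -> 0 <= f x) ->
  0 <= \int[mu]_(x in `[a, b]) f x.
Proof. by move=> f0; apply: Rintegral_ge0. Qed.

Lemma int_abs f a b : itg a b f ->
  `|\int[mu]_(x in `[a, b]) f x| <= \int[mu]_(x in `[a, b]) `|f x|.
Proof. by move=> fi; apply: le_normr_Rintegral. Qed.

Lemma int_cst (k : R) a b : a <= b -> \int[mu]_(x in `[a, b]) k = k * (b - a).
Proof.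
move=> ab; rewrite Rintegral_cst//; congr (k * _).
transitivity (fine (mu `[a, b]%classic)) => //.
rewrite lebesgue_measure_itv/= lte_fin.
by case: ltgtP ab => //= -> _; rewrite subrr.
Qed.

Lemma int_bound f a b (M : R) : a <= b -> itg a b f ->
  (forall x, x \in `[a, b] -> `|f x| <= M) ->
  `|\int[mu]_(x in `[a, b]) f x| <= M * (b - a).
Proof.
move=> ab fi fM; rewrite (le_trans (int_abs fi))// -(int_cst M ab).
apply: le_int => //; first exact: itg_abs.
exact/itg_cont/cst_continuous.
Qed.

Lemma int_split f a b c : a <= c -> c <= b -> itg a b f ->
  \int[mu]_(x in `[a, b]) f x =
  \int[mu]_(x in `[a, c]) f x + \int[mu]_(x in `[c, b]) f x.
Proof.
move=> ac cb fi.
have := @Rintegral_itvB _ f (BLeft a) (BRight b) c fi.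
rewrite !bnd_simp => /(_ ac cb) H.
rewrite -[in RHS](@Rintegral_itv_obnd_cbnd _ c) -?H; first by rewrite addrC subrK.
apply: integrableS fi => //.
by apply: subset_itvr; rewrite bnd_simp.
Qed.

Lemma int_le_sub f a b a' b' : a <= a' -> a' <= b' -> b' <= b -> itg a b f ->
  (forall x, x \in `[a, b] -> 0 <= f x) ->
  \int[mu]_(x in `[a', b']) f x <= \int[mu]_(x in `[a, b]) f x.
Proof.
move=> aa ab bb fi f0.
rewrite (int_split (le_trans aa ab) bb fi) (int_split aa ab); last first.
  exact: itgS fi _ _.
rewrite -addrA ler_wpDl//.
  by apply: int_ge0 => x /[!in_itv]/= /andP[ax xa]; apply: f0; rewrite in_itv/=; lra.
rewrite ler_wpDr//; apply: int_ge0 => x /[!in_itv]/= /andP[ax xa].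
by apply: f0; rewrite in_itv/=; lra.
Qed.

Lemma is_derive_continuous f (f' : R -> R) :
  (forall x, is_derive x 1 f (f' x)) -> continuous f.
Proof.
move=> df x; apply: (@differentiable_continuous _ R^o R^o).
by apply/derivable1_diffP; case: (df x).
Qed.

Lemma int_derive f (f' : R -> R) a b : a <= b -> continuous f' ->
  (forall x, is_derive x 1 f (f' x)) ->
  \int[mu]_(x in `[a, b]) f' x = f b - f a.
Proof.
rewrite le_eqVlt => /predU1P[<-|ab] cf' df.
  by rewrite set_itv1 Rintegral_set1 subrr.
have cf := is_derive_continuous df.
rewrite /Rintegral (@continuous_FTC2 _ f' f)//.
- exact: continuous_subspaceT.
- split; [by move=> x _; case: (df x)|exact/cvg_at_right_filter/cf|exact/cvg_at_left_filter/cf].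
- by move=> x _; rewrite derive1E; case: (df x).
Qed.

Lemma is_derive_parameterized_integral f a x : continuous f -> a < x ->
  is_derive x (1:R) (fun y : R => \int[mu]_(t in `[a, y]) f t : R) (f x).
Proof.
move=> cf ax; have xx : x < x + 1 by rewrite ltrDl.
have [dF F'] := @continuous_FTC1_closed _ f a x (x + 1) xx (@itg_cont f a (x + 1) cf) ax (cf x).
by apply: DeriveDef; [exact: dF | rewrite -derive1E; exact: F'].
Qed.

Lemma primitive_ex f : continuous f -> exists F : R -> R, forall x, is_derive x 1 F (f x).
Proof.
move=> cf.
pose G (B x : R) := \int[mu]_(t in `[- B, x]) f t - \int[mu]_(t in `[- B, 0]) f t.
have GE B B' x : - B <= x -> - B <= 0 -> - B' <= - B -> G B x = G B' x.
  move=> Bx B0 BB; rewrite /G [in RHS](int_split BB Bx) ?[in X in _ = _ - X](int_split BB B0).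
  - by ring.
  - exact: itg_cont.
  - exact: itg_cont.
exists (fun x => G (`|x| + 1) x) => x.
have dG : is_derive x 1 (G (`|x| + 2)) (f x).
  have xB : - (`|x| + 2) < x by have := ler_norm (- x); rewrite normrN; lra.
  have dF' := is_derive_parameterized_integral cf xB.
  rewrite /G.
  pose c := \int[mu]_(t in `[- (`|x| + 2), 0]) f t.
  have dc : is_derive x (1 : R) (fun _ : R => c) (0 : R) by exact: is_derive_cst.
  by apply: (is_derive_eq (is_deriveB dF' dc)); rewrite subr0.
apply: near_eq_is_derive dG; near=> y.
have yx : `|x - y| < 1 by near: y; apply: cvgr_dist_lt.
have ly : `|y| < `|x| + 1.
  rewrite (_ : y = x - (x - y)); last by ring.
  by apply: le_lt_trans (ler_normB _ _) _; lra.
have := ler_norm (- y); rewrite normrN => y1.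
have x0 := normr_ge0 x; have y0 := normr_ge0 y.
by symmetry; apply: GE; lra.
Unshelve. all: by end_near. Qed.

End integrals.

(** * Square integrable and absolutely continuous functions *)

Section L2_AC.
Context {R : realType}.
Notation mu := (@lebesgue_measure R).
Implicit Types (f g p q : R -> R) (a b x : R).

(** Limit arguments are run through this criterion. Only [e <= 1] has to be tested, so that a
    product of two errors can be bounded linearly in [e]. *)
Lemma small_eq0 (A K : R) : (forall e, 0 < e -> e <= 1 -> `|A| <= K * e) -> A = 0.
Proof.
move=> H; apply/eqP; rewrite -normr_eq0 eq_le normr_ge0 andbT leNgt.
apply/negP => A0.
have K0 : 0 < K.
  by have := H 1 ltr01 (lexx _); rewrite mulr1; apply: lt_le_trans.
(* At this [e] the hypothesis gives [|A| <= |A| / 2]. *)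
pose e := Num.min 1 (`|A| / (2 * K)).
have e0 : 0 < e by rewrite lt_min ltr01 divr_gt0// mulr_gt0.
have e1 : e <= 1 by rewrite ge_min lexx.
have := H _ e0 e1.
have : K * e <= K * (`|A| / (2 * K)) by rewrite ler_pM2l// ge_min lexx orbT.
rewrite (_ : K * (`|A| / (2 * K)) = `|A| / 2); last by field; rewrite gt_eqF.
by move: A0; lra.
Qed.

Lemma continuous_bounded f a b : continuous f ->
  exists2 M, 0 < M & forall x, x \in `[a, b] -> `|f x| <= M.
Proof.
move=> cf; have [ab|ab] := leP a b; last first.
  by exists 1 => // x; rewrite in_itv/= => /andP[ax xb]; move: ab; lra.
have : {within `[a, b], continuous (fun x => `|f x|)}.
  by apply: continuous_subspaceT => x; apply: cvg_norm; exact: cf.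
move=> /(EVT_max ab)[c _ H]; exists (`|f c| + 1).
  by rewrite ltr_wpDl.
by move=> x /H; move=> /le_trans; apply; lra.
Qed.

(** Measurability of [g] is a separate clause, since that of its square does not imply it. *)
Definition L2i a b g := measurable_fun `[a, b] g /\ itg a b (fun x => g x ^+ 2).

Lemma eq_L2i f g a b : {in `[a, b], f =1 g} -> L2i a b f -> L2i a b g.
Proof.
move=> fg [mf f2]; split.
  by apply: eq_measurable_fun mf => x; rewrite inE; exact: fg.
by apply: eq_itg f2 => x /fg ->.
Qed.

Lemma L2i_cont f a b : continuous f -> L2i a b f.
Proof.
move=> cf; split.
  by apply: measurable_funS (continuous_measurable_fun cf).
by apply: itg_cont => x; apply: (@continuousM _ _ f f); exact: cf.
Qed.

Lemma L2iM f g a b : L2i a b f -> L2i a b g -> itg a b (fun x => f x * g x).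
Proof.
move=> [mf f2] [mg g2].
apply: (@itg_le _ _ (fun x => f x ^+ 2 + g x ^+ 2)).
- exact: measurable_funM.
- move=> x _; rewrite ler_norml.
  have := sqr_ge0 (f x + g x); have := sqr_ge0 (f x - g x).
  have := sqr_ge0 (f x); have := sqr_ge0 (g x).
  by rewrite !expr2 => *; apply/andP; split; nra.
- exact: itgD.
Qed.

Lemma L2i_itg f a b : L2i a b f -> itg a b f.
Proof.
move=> fi; apply: eq_itg (L2iM fi (L2i_cont a b (@cst_continuous _ _ (1 : R)))).
by move=> x _ /=; rewrite mulr1.
Qed.

Lemma L2iZ f (k : R) a b : L2i a b f -> L2i a b (fun x => k * f x).
Proof.
move=> [mf f2]; split; first exact: measurable_funM.
by apply: eq_itg (itgZ (k ^+ 2) f2) => x _; rewrite exprMn.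
Qed.

Lemma L2iD f g a b : L2i a b f -> L2i a b g -> L2i a b (fun x => f x + g x).
Proof.
move=> fi gi; have := L2iM fi gi; case: fi gi => [mf f2] [mg g2] fg.
split; first exact: measurable_funD.
apply: eq_itg (itgD (itgD f2 g2) (itgZ 2 fg)) => x _.
by rewrite /=; ring.
Qed.

Lemma L2iN f a b : L2i a b f -> L2i a b (fun x => - f x).
Proof. by move=> /(L2iZ (-1)); apply: eq_L2i => x _; rewrite mulN1r. Qed.

Lemma L2iB f g a b : L2i a b f -> L2i a b g -> L2i a b (fun x => f x - g x).
Proof. by move=> fi /L2iN; exact: L2iD. Qed.

Lemma L2i_abs f a b : L2i a b f -> L2i a b (fun x => `|f x|).
Proof.
move=> [mf f2]; split; first exact: measurableT_comp.
by apply: eq_itg f2 => x _; rewrite real_normK// num_real.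
Qed.

Lemma L2i_contM f g a b : continuous f -> L2i a b g -> L2i a b (fun x => f x * g x).
Proof.
move=> cf [mg g2]; have [M M0 fM] := continuous_bounded a b cf.
have mf : measurable_fun `[a, b] f.
  exact: measurable_funS (continuous_measurable_fun cf).
split; first exact: measurable_funM.
apply: (@itg_le _ _ (fun x => M ^+ 2 * g x ^+ 2)).
- by apply/measurable_funX/measurable_funM.
- move=> x /fM H; rewrite exprMn normrM.
  rewrite [X in _ * X]ger0_norm ?sqr_ge0// ler_wpM2r ?sqr_ge0//.
  by rewrite normrX lerXn2r ?nnegrE// ltW.
- exact: itgZ.
Qed.

Lemma int_sqrD f g a b (s t : R) : L2i a b f -> L2i a b g ->
  \int[mu]_(x in `[a, b]) ((s * f x + t * g x) ^+ 2) =
  s ^+ 2 * \int[mu]_(x in `[a, b]) (f x ^+ 2) +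
  2 * s * t * \int[mu]_(x in `[a, b]) (f x * g x) +
  t ^+ 2 * \int[mu]_(x in `[a, b]) (g x ^+ 2).
Proof.
move=> fi gi; have fg := L2iM fi gi; case: fi gi => [_ f2] [_ g2].
rewrite -!intZ// -!intD//; try by repeat (apply: itgD || apply: itgZ).
by apply: eq_int => x _ /=; ring.
Qed.

(** Write [A], [B], [C] for the integrals of [f^2], [f g], [g^2]. The nonnegative form
    [A s^2 + 2 B s t + C t^2] takes the value [C (A C - B^2)] at [(C, - B)], which settles [C > 0];
    if [C = 0] and [B <> 0], it would take the value [- 1]. *)
Lemma cauchy_schwarz f g a b : L2i a b f -> L2i a b g ->
  (\int[mu]_(x in `[a, b]) (f x * g x)) ^+ 2 <=
  \int[mu]_(x in `[a, b]) (f x ^+ 2) * \int[mu]_(x in `[a, b]) (g x ^+ 2).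
Proof.
move=> fi gi.
have H s t := int_sqrD s t fi gi.
have H0 (s t : R) : 0 <= \int[mu]_(x in `[a, b]) ((s * f x + t * g x) ^+ 2).
  by apply: int_ge0 => x _; exact: sqr_ge0.
have A0 : 0 <= \int[mu]_(x in `[a, b]) (f x ^+ 2).
  by apply: int_ge0 => x _; exact: sqr_ge0.
have C0 : 0 <= \int[mu]_(x in `[a, b]) (g x ^+ 2).
  by apply: int_ge0 => x _; exact: sqr_ge0.
have {}H0 s t : 0 <= s ^+ 2 * \int[mu]_(x in `[a, b]) (f x ^+ 2) + 2 * s * t * \int[mu]_(x in `[a, b]) (f x * g x) + t ^+ 2 * \int[mu]_(x in `[a, b]) (g x ^+ 2) by rewrite -H.
move: H0 A0 C0 {H}.
move: (\int[mu]_(x in `[a, b]) (f x ^+ 2)) => A.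
move: (\int[mu]_(x in `[a, b]) (f x * g x)) => B.
move: (\int[mu]_(x in `[a, b]) (g x ^+ 2)) => C.
move=> H0 A0; rewrite le_eqVlt => /predU1P[C0|C0].
  have [->|B0] := eqVneq B 0; first by rewrite expr0n /= -C0 mulr0.
  have := H0 1 (- (A + 1) / (2 * B)); rewrite -C0 mulr0 addr0.
  rewrite (_ : _ + _ = - (1 : R)) ?ler0N1//.
  by rewrite expr1n; field.
have := H0 C (- B).
rewrite (_ : _ + _ = C * (A * C - B ^+ 2)); last by ring.
by rewrite pmulr_rge0// subr_ge0.
Qed.

Lemma L1_density f a b (e : R) : itg a b f -> 0 < e ->
  exists2 c : R -> R, continuous c & \int[mu]_(x in `[a, b]) `|f x - c x| < e.
Proof.
move=> fi e0.
have [||c [cc ci cf]] := @approximation_continuous_integrable R `[a, b] f _ _ fi.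
- by [].
- have := lebesgue_measure_itv `[a, b]; move=> /= ->.
  by case: ifP; rewrite ltry.
have : (fine (\int[mu]_(z in `[a, b]) `|(f z - c n z)%:E|)) @[n --> \oo] --> (0 : R).
  exact: (fine_cvg cf).
move/cvgrPdist_lt => /(_ e e0)[N _ /(_ N (leqnn _))].
rewrite sub0r normrN => H; exists (c N) => //.
exact: le_lt_trans (ler_norm _) H.
Qed.

(** Absolute continuity in integral form, with the almost everywhere derivative [g] as a parameter.
    In one dimension this is what having [g] as weak derivative amounts to. *)
Definition AC a b p g := itg a b g /\
  forall x, x \in `[a, b] -> p x = p a + \int[mu]_(t in `[a, x]) g t.

Lemma AC_meas a b p g : AC a b p g -> measurable_fun `[a, b] p.
Proof.
move=> [gi pE]; have [ab|ab] := leP a b; last first.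
  by rewrite set_itv_ge -?leNgt ?bnd_simp//; exact: measurable_fun_set0.
have : {within `[a, b], continuous (fun x => \int[mu]_(t in `[a, x]) g t)}.
  exact: parameterized_integral_continuous.
move=> /subspace_continuous_measurable_fun H.
apply: (@eq_measurable_fun _ _ _ _ _ (fun x => p a + \int[mu]_(t in `[a, x]) g t)).
  by move=> x; rewrite inE/= => /pE ->.
by apply: measurable_funD => //; apply: H.
Qed.

Lemma AC_bounded a b p g x : AC a b p g -> x \in `[a, b] ->
  `|p x| <= `|p a| + \int[mu]_(t in `[a, b]) `|g t|.
Proof.
move=> [gi pE] xab; rewrite pE//.
have /andP[ax xb] : a <= x <= b by rewrite in_itv/= in xab.
apply: le_trans (ler_normD _ _) _; rewrite lerD2l.
apply: le_trans (int_abs _) _; first exact: itgS gi _ _.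
by apply: int_le_sub => //; exact: itg_abs.
Qed.

(** The approximant is a primitive of a continuous function close to [g] in L^1, and equality at [a]
    makes it uniformly close to [p]. The product and chain rules below are the classical ones for
    such approximants, up to an error linear in [e]. *)
Lemma AC_approx a b p g (e : R) : AC a b p g -> a <= b -> 0 < e ->
  exists C c : R -> R, [/\ continuous c, forall x, is_derive x 1 C (c x),
    \int[mu]_(x in `[a, b]) `|g x - c x| < e, C a = p a &
    forall x, x \in `[a, b] -> `|p x - C x| <= e].
Proof.
move=> [gi pE] ab e0; have [c cc ce] := L1_density gi e0.
have [C dC] := primitive_ex cc.
pose D x := C x + (p a - C a).
have dD x : is_derive x 1 D (c x).
  have dc : is_derive x (1 : R) (fun _ : R => p a - C a) (0 : R) by exact: is_derive_cst.
  by apply: (is_derive_eq (is_deriveD (dC x) dc)); rewrite addr0.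
exists D, c; split => //; first by rewrite /D addrC subrK.
move=> x xab; have /andP[ax xb] : a <= x <= b by rewrite in_itv/= in xab.
have -> : D x = p a + \int[mu]_(t in `[a, x]) c t.
  by rewrite (int_derive ax cc dC) /D; ring.
have gx : itg a x g by apply: itgS gi _ _.
rewrite pE// opprD addrACA subrr add0r -intB//; last exact: itg_cont.
have gc : itg a b (fun t : R => g t - c t) by apply: itgB => //; exact: itg_cont.
apply: le_trans (int_abs _) _; first exact: itgS gc _ _.
apply/ltW/(le_lt_trans _ ce).
by apply: int_le_sub => //; exact: itg_abs.
Qed.


Lemma AC_itgM a b p g k : AC a b p g -> itg a b k -> itg a b (fun x => p x * k x).
Proof.
move=> pg ik.
apply: (@itg_le _ _ (fun x => (`|p a| + \int[mu]_(t in `[a, b]) `|g t|) * `|k x|)).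
- by apply: measurable_funM; [exact: AC_meas pg|exact: itg_meas].
- by move=> x xab; rewrite normrM ler_wpM2r// (AC_bounded pg).
- exact/itgZ/itg_abs.
Qed.

Lemma AC_mul a b p g q k : a <= b -> AC a b p g -> AC a b q k ->
  AC a b (fun x => p x * q x) (fun x => p x * k x + q x * g x).
Proof.
move=> ab pg qk; have [gi _] := pg; have [ki _] := qk.
have ipk := AC_itgM pg ki; have iqg := AC_itgM qk gi.
split; first exact: itgD.
move=> x xab; have /andP[ax xb] : a <= x <= b by rewrite in_itv/= in xab.
pose P : R := `|p a| + \int[mu]_(t in `[a, b]) `|g t|.
pose Q : R := `|q a| + \int[mu]_(t in `[a, b]) `|k t|.
have Pp y : y \in `[a, b] -> `|p y| <= P by exact: AC_bounded.
have Qq y : y \in `[a, b] -> `|q y| <= Q by exact: AC_bounded.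
have ig0 : 0 <= \int[mu]_(t in `[a, b]) `|g t| by exact: int_ge0.
have ik0 : 0 <= \int[mu]_(t in `[a, b]) `|k t| by exact: int_ge0.
have P0 : 0 <= P by rewrite addr_ge0.
have Q0 : 0 <= Q by rewrite addr_ge0.
have sub f : itg a b f -> itg a x f by move=> fi; exact: itgS fi _ _.
have subx y : y \in `[a, x] -> y \in `[a, b].
  by rewrite !in_itv/= => /andP[-> /le_trans]; exact.
apply/eqP; rewrite -subr_eq0; apply/eqP.
(* Dominates the sum of the constants of [H1] and [H2] below. *)
apply: (@small_eq0 _ (2 * P + 2 * Q + 1 + 1 + \int[mu]_(t in `[a, b]) `|g t| + 1
  + \int[mu]_(t in `[a, b]) `|k t| + 1)) => e e0 e1.
have [C [c [cc dC gc Ca pC]]] := AC_approx pg ab e0.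
have [D [d [cd dD kd Da qD]]] := AC_approx qk ab e0.
have cC := is_derive_continuous dC; have cD := is_derive_continuous dD.
have ci : itg a b c by exact: itg_cont.
have di : itg a b d by exact: itg_cont.
have dCD (y : R) : is_derive y (1 : R) (fun y : R => C y * D y) (C y * d y + D y * c y).
  by apply: is_derive_eq.
have CDi : itg a x (fun y : R => C y * d y + D y * c y).
  apply: itg_cont => y; apply: (@continuousD _ _ _ (fun y : R => C y * d y) (fun y : R => D y * c y)).
    by apply: continuousM; [exact: cC|exact: cd].
  by apply: continuousM; [exact: cD|exact: cc].
have := int_derive ax _ dCD.
rewrite Ca Da => CDE.
have -> : p x * q x - (p a * q a + \int[mu]_(t in `[a, x]) (p t * k t + q t * g t)) =
  (p x * q x - C x * D x) - \int[mu]_(t in `[a, x])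
   ((p t * k t + q t * g t) - (C t * d t + D t * c t)).
  rewrite intB//; last by apply: itgD; exact: sub.
  rewrite CDE; first by ring.
  move=> y; apply: (@continuousD _ _ _ (fun y : R => C y * d y) (fun y : R => D y * c y)).
    by apply: continuousM; [exact: cC|exact: cd].
  by apply: continuousM; [exact: cD|exact: cc].
apply: le_trans (ler_normB _ _) _.
have ikd : itg a b (fun t : R => k t - d t) by exact: itgB.
have igc : itg a b (fun t : R => g t - c t) by exact: itgB.
have H1 : `|p x * q x - C x * D x| <= (P + Q + 1) * e.
  have -> : p x * q x - C x * D x =
    p x * (q x - D x) + (q x - (q x - D x)) * (p x - C x) by ring.
  have := Pp _ xab; have := Qq _ xab; have := pC _ xab; have := qD _ xab.
  move: (p x) (q x) (q x - D x) (p x - C x) => p1 q1 A B Ae Be qQ pP.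
  rewrite (le_trans (ler_normD _ _))// !normrM.
  have H : `|q1 - A| <= Q + 1 by apply: le_trans (ler_normB _ _) _; apply: lerD => //; exact: le_trans Ae e1.
  rewrite (_ : _ * e = P * e + (Q + 1) * e); last by ring.
  by rewrite lerD// ler_pM.
have igd : \int[mu]_(t in `[a, b]) `|d t| <= \int[mu]_(t in `[a, b]) `|k t| + 1.
  apply: le_trans (_ : _ <= \int[mu]_(t in `[a, b]) (`|k t| + `|k t - d t|)) _.
    apply: le_int; [exact: itg_abs|by apply: itgD; exact: itg_abs|].
    move=> y _; have := ler_normB (k y) (k y - d y).
    by rewrite opprB addrC subrK.
  by rewrite intD; [|exact: itg_abs..]; rewrite lerD2l (le_trans (ltW kd)).
have igc' : \int[mu]_(t in `[a, b]) `|c t| <= \int[mu]_(t in `[a, b]) `|g t| + 1.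
  apply: le_trans (_ : _ <= \int[mu]_(t in `[a, b]) (`|g t| + `|g t - c t|)) _.
    apply: le_int; [exact: itg_abs|by apply: itgD; exact: itg_abs|].
    move=> y _; have := ler_normB (g y) (g y - c y).
    by rewrite opprB addrC subrK.
  by rewrite intD; [|exact: itg_abs..]; rewrite lerD2l (le_trans (ltW gc)).
have H2 : `|\int[mu]_(t in `[a, x])
   ((p t * k t + q t * g t) - (C t * d t + D t * c t))| <=
   (P + Q + (\int[mu]_(t in `[a, b]) `|g t| + 1) + (\int[mu]_(t in `[a, b]) `|k t| + 1)) * e.
  pose M (t : R) : R := (P * `|k t - d t| + Q * `|g t - c t|) + (e * `|d t| + e * `|c t|).
  have iM : itg a b M.
    by rewrite /M; repeat apply: itgD; apply: itgZ; exact: itg_abs.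
  apply: le_trans (int_abs _) _.
    by apply: itgB => //; apply: itgD; exact: sub.
  apply: le_trans (_ : _ <= \int[mu]_(t in `[a, x]) M t) _.
    apply: le_int.
    - by apply: itg_abs; apply: itgB => //; apply: itgD; exact: sub.
    - exact: sub.
    move=> y /subx yab.
    have -> : (p y * k y + q y * g y) - (C y * d y + D y * c y) =
      (p y * (k y - d y) + q y * (g y - c y)) + ((p y - C y) * d y + (q y - D y) * c y) by ring.
    rewrite /M (le_trans (ler_normD _ _))// lerD//.
      by rewrite (le_trans (ler_normD _ _))// lerD// normrM ler_wpM2r//; [exact: Pp|exact: Qq].
    by rewrite (le_trans (ler_normD _ _))// lerD// normrM ler_wpM2r//; [exact: pC|exact: qD].
  apply: le_trans (int_le_sub (lexx _) ax xb iM _) _.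
    by move=> y _; rewrite /M !addr_ge0// mulr_ge0// ltW.
  rewrite /M intD; [|by apply: itgD; apply: itgZ; exact: itg_abs..].
  rewrite !intD; try by apply: itgZ; exact: itg_abs.
  rewrite !intZ; try exact: itg_abs.
  have := ler_wpM2l P0 (ltW kd); have := ler_wpM2l Q0 (ltW gc).
  have := ler_wpM2l (ltW e0) igd; have := ler_wpM2l (ltW e0) igc'.
  by lra.
by apply: le_trans (lerD H1 H2) _; lra.
Qed.

(** The hypotheses on [F] and [f] are those met by sine and cosine, the functions to be composed
    with. They allow a C^1 approximant to be substituted for [p] in both [F] and [f]. *)
Lemma AC_comp a b p g (F f : R -> R) : a <= b ->
  (forall x, is_derive x 1 F (f x)) ->
  (forall x y, `|f x - f y| <= `|x - y|) -> (forall x, `|f x| <= 1) ->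
  AC a b p g -> AC a b (fun x => F (p x)) (fun x => f (p x) * g x).
Proof.
move=> ab dF lip f1 pg; have [gi _] := pg.
have cf : continuous f.
  move=> x; apply/cvgrPdist_le => e e0; near=> y.
  apply: le_trans (lip _ _) _; near: y.
  by apply: cvgr_dist_le.
have mfp : measurable_fun `[a, b] (fun x => f (p x)).
  exact: measurableT_comp (continuous_measurable_fun cf) (AC_meas pg).
have ifg : itg a b (fun x => f (p x) * g x).
  apply: (@itg_le _ _ (fun x => `|g x|)); last exact: itg_abs.
    by apply: measurable_funM => //; exact: itg_meas.
  by move=> x _; rewrite normrM ler_piMl.
split => // x xab; have /andP[ax xb] : a <= x <= b by rewrite in_itv/= in xab.
have sub h : itg a b h -> itg a x h by move=> fi; exact: itgS fi _ _.
have subx y : y \in `[a, x] -> y \in `[a, b].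
  by rewrite !in_itv/= => /andP[-> /le_trans]; exact.
have lipF y z : `|F y - F z| <= `|y - z|.
  wlog yz : y z / y <= z.
    by move=> H; have [/H//|/ltW/H] := leP y z; rewrite distrC (distrC y).
  have cF : {within `[y, z], continuous F}.
    exact/continuous_subspaceT/is_derive_continuous.
  have [c _ E] := MVT_segment yz (fun x _ => dF x) cF.
  by rewrite distrC E normrM distrC ler_piMl.
apply/eqP; rewrite -subr_eq0; apply/eqP.
apply: (@small_eq0 _ (1 + (1 + \int[mu]_(t in `[a, b]) `|g t|))) => e e0 e1.
have [C [c [cc dC gc Ca pC]]] := AC_approx pg ab e0.
have cC := is_derive_continuous dC.
have dFC (y : R) : is_derive y (1 : R) (fun y : R => F (C y)) (f (C y) * c y).
  exact: is_derive1_comp (dF _) (dC _).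
have cfC : continuous (fun y => f (C y) * c y).
  move=> y; apply: (@continuousM _ _ (fun y => f (C y)) c); last exact: cc.
  by apply: (@continuous_comp _ _ _ C f); [exact: cC|exact: cf].
have := int_derive ax cfC dFC; rewrite Ca => E.
have -> : F (p x) - (F (p a) + \int[mu]_(t in `[a, x]) (f (p t) * g t)) =
  (F (p x) - F (C x)) - \int[mu]_(t in `[a, x]) (f (p t) * g t - f (C t) * c t).
  rewrite intB; [|exact: sub|exact: itg_cont].
  by rewrite E; ring.
apply: le_trans (ler_normB _ _) _.
rewrite mulrDl mul1r lerD//; first by apply: le_trans (lipF _ _) (pC _ _).
have igc : itg a b (fun t : R => g t - c t) by apply: itgB => //; exact: itg_cont.
have iM : itg a b (fun t : R => `|g t - c t| + e * `|g t|).
  by apply: itgD; [exact: itg_abs|apply: itgZ; exact: itg_abs].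
apply: le_trans (int_abs _) _.
  by apply: itgB; [exact: sub|exact: itg_cont].
apply: le_trans (_ : _ <= \int[mu]_(t in `[a, x]) (`|g t - c t| + e * `|g t|)) _.
  apply: le_int; [|exact: sub|].
    by apply: itg_abs; apply: itgB; [exact: sub|exact: itg_cont].
  move=> y /subx yab.
  have -> : f (p y) * g y - f (C y) * c y =
    f (C y) * (g y - c y) + (f (p y) - f (C y)) * g y by ring.
  rewrite (le_trans (ler_normD _ _))// !normrM lerD//.
    by rewrite ler_piMl.
  by rewrite ler_wpM2r// (le_trans (lip _ _))// pC.
apply: le_trans (int_le_sub (lexx _) ax xb iM _) _.
  by move=> y _; rewrite addr_ge0// mulr_ge0// ltW.
rewrite intD; [|exact: itg_abs|by apply: itgZ; exact: itg_abs].
rewrite intZ; last exact: itg_abs.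
by move: gc; lra.
Unshelve. all: by end_near. Qed.

End L2_AC.

(** * Series and Fourier series *)

Section series_lemmas.
Context {R : realType}.

Lemma is_derive_epsP (f : R -> R) (x l : R) : is_derive x (1 : R) f l <->
  forall e, 0 < e -> exists2 d, 0 < d &
    forall h, `|h| < d -> `|f (x + h) - f x - h * l| <= e * `|h|.
Proof.
split=> [df e e0|H].
- have [dv dE] := df; move: dv; rewrite /derivable => /cvg_ex[m Hm].
  have : m = l.
    by rewrite -dE /derive; symmetry; apply: cvg_lim => //; exact: Rhausdorff.
  move=> ml; move: Hm; rewrite ml => /cvgrPdist_le /(_ e e0).
  rewrite near_withinE => -[d /= d0 Hd]; exists d => // h hd.
  have [->|h0] := eqVneq h 0; first by rewrite addr0 subrr mul0r subr0 normr0 mulr0.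
  have := Hd h; rewrite /ball /= sub0r normrN => /(_ hd h0).
  rewrite /GRing.scale /= mulr1 (addrC h) => H.
  have -> : f (x + h) - f x - h * l = - (h * (l - h^-1 * (f (x + h) - f x))).
    by field.
  by rewrite normrN normrM mulrC ler_wpM2r.
- have C : (fun h : R => h^-1 *: (f (h *: (1 : R) + x) - f x)) @ 0^' --> l.
    apply/cvgrPdist_le => e e0; have [d d0 Hd] := H e e0.
    rewrite near_withinE; exists d => // h /=; rewrite sub0r normrN => hd h0.
    have := Hd h hd; rewrite /GRing.scale /= mulr1 (addrC h) => {}Hd.
    rewrite -(ler_pM2r (_ : 0 < `|h|)) ?normr_gt0// -normrM.
    rewrite (_ : (l - _) * h = - (f (x + h) - f x - h * l)) ?normrN//.
    by field.
  apply: DeriveDef; first by apply/cvg_ex; exists l.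
  by apply: cvg_lim => //; exact: Rhausdorff.
Qed.

Definition abs_summable (u : nat -> R) := cvgn (series (fun n => `|u n|)).

Lemma abs_summable_bounded (u : nat -> R) (M : R) :
  (forall N, \sum_(0 <= n < N) `|u n| <= M) -> abs_summable u.
Proof.
move=> H; apply: nondecreasing_is_cvgn.
  by apply/nondecreasing_seqP => n; rewrite /series /= big_nat_recr//= lerDl.
by exists M => _ [n _ <-]; exact: H.
Qed.

Lemma abs_summable_le (u v : nat -> R) : (forall n, `|u n| <= v n) ->
  abs_summable v -> abs_summable u.
Proof.
move=> uv; apply: series_le_cvg => // n.
by rewrite (le_trans (uv n))// ler_norm.
Qed.

Lemma abs_summable_cvg (u : nat -> R) : abs_summable u -> cvgn (series u).
Proof. by move=> H; apply: normed_cvg. Qed.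

Lemma abs_summableZ (u : nat -> R) (k : R) : abs_summable u -> abs_summable (fun n => k * u n).
Proof.
move=> H; rewrite /abs_summable.
rewrite (_ : (fun n => `|k * u n|) = `|k| *: (fun n => `|u n|)).
  exact: is_cvg_seriesZ.
by apply/funext => n; rewrite normrM.
Qed.

Lemma abs_summableD (u v : nat -> R) : abs_summable u -> abs_summable v ->
  abs_summable (fun n => u n + v n).
Proof.
move=> hu hv; have := is_cvg_seriesD hu hv.
apply: series_le_cvg => // n; first by rewrite addr_ge0.
exact: ler_normD.
Qed.

Definition tailsum (M : nat -> R) n := limn (series M) - series M n.

Lemma tailsum_cvg M : abs_summable M -> tailsum M @ \oo --> (0 : R).
Proof.
move=> /abs_summable_cvg cM; rewrite -(subrr (limn (series M))).
by apply: cvgB => //; exact: cvg_cst.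
Qed.

Lemma tailsum_small M (e : R) : abs_summable M -> 0 < e ->
  exists N, forall n, (N <= n)%N -> `|tailsum M n| <= e.
Proof.
move=> /tailsum_cvg /cvgrPdist_le H e0; have [N _ HN] := H _ e0.
by exists N => n Nn; have := HN n Nn; rewrite sub0r normrN.
Qed.

Lemma tail_le (u M : nat -> R) n : (forall k, `|u k| <= M k) -> abs_summable M ->
  `|limn (series u) - series u n| <= tailsum M n.
Proof.
move=> uM sM; have cM := abs_summable_cvg sM.
have cu := abs_summable_cvg (abs_summable_le uM sM).
have H : forall m, (n <= m)%N -> `|series u m - series u n| <= series M m - series M n.
  move=> m nm; rewrite !sub_series nm.
  by apply: le_trans (ler_norm_sum _ _ _) _; apply: ler_sum.
have H1 : (fun m => `|series u m - series u n|) @ \oo --> `|limn (series u) - series u n|.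
  by apply: cvg_norm; apply: cvgB => //; exact: cvg_cst.
have H2 : (fun m => series M m - series M n) @ \oo --> tailsum M n.
  by apply: cvgB => //; exact: cvg_cst.
apply: (ler_cvg_to H1 H2); exists n => // m /= nm; exact: H.
Qed.

Lemma series_lim_le (u M : nat -> R) : (forall k, `|u k| <= M k) -> abs_summable M ->
  `|limn (series u)| <= limn (series M).
Proof.
move=> uM sM; have := tail_le 0 uM sM.
by rewrite /tailsum /series /= !big_geq// !subr0.
Qed.

Lemma lim_seriesM (u : nat -> R) k : abs_summable u ->
  limn (series (fun n => k * u n)) = k * limn (series u).
Proof. by move=> /abs_summable_cvg /lim_seriesZ H; exact: H. Qed.

Lemma lim_seriesDD (u v : nat -> R) : abs_summable u -> abs_summable v ->
  limn (series (fun n => u n + v n)) = limn (series u) + limn (series v).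
Proof. by move=> /abs_summable_cvg hu /abs_summable_cvg hv; exact: lim_seriesD. Qed.

Lemma continuous_series_partial (T : topologicalType) (f : nat -> T -> R) (x : T) N :
  (forall n, {for x, continuous (f n)}) ->
  {for x, continuous (fun y => series (f ^~ y) N)}.
Proof.
move=> cf; elim: N => [|N IH].
  rewrite (_ : (fun _ => _) = cst 0); first exact: cst_continuous.
  by apply/funext => y; rewrite /series /= big_geq.
rewrite (_ : (fun _ => _) = (fun y => series (f ^~ y) N + f N y)).
  by apply: continuousD => //; exact: cf.
by apply/funext => y; rewrite /series /= big_nat_recr.
Qed.

(** Weierstrass' test. The majorant is asked for near [x] only, because those of heat series
    degenerate as time tends to [0]. *)
Lemma continuous_series (T : topologicalType) (f : nat -> T -> R) (M : nat -> R) (x : T) :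
  abs_summable M -> (\forall y \near x, forall n, `|f n y| <= M n) ->
  (forall n, {for x, continuous (f n)}) ->
  {for x, continuous (fun y => limn (series (f ^~ y)))}.
Proof.
move=> sM fM cf; apply/cvgrPdist_le => e e0.
have e3 : 0 < e / 3 by rewrite divr_gt0.
have [N HN] := tailsum_small sM e3.
have cS : {for x, continuous (fun y => series (f ^~ y) N)}.
  exact: continuous_series_partial.
have fMx := nbhs_singleton fM.
near=> y.
have fMy : forall n, `|f n y| <= M n by near: y.
have H : `|series (f ^~ x) N - series (f ^~ y) N| <= e / 3.
  by near: y; move/cvgrPdist_le : cS; apply.
have := tail_le N fMx sM; have := tail_le N fMy sM.
have := ler_norm (tailsum M N); have := HN N (leqnn _).
move: H; rewrite !ler_norml => /andP[? ?] ? ? /andP[? ?] /andP[? ?].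
by apply/andP; split; lra.
Unshelve. all: by end_near. Qed.

(** By the mean value theorem [M] bounds the difference quotients of all terms at once. The tails of
    the difference quotient and of the derivative are therefore small together, and only a finite
    sum is differentiated in between. *)
Lemma is_derive_series (f f' : nat -> R -> R) (M : nat -> R) (x r : R) :
  0 < r -> abs_summable M ->
  (forall y, `|y - x| < r -> abs_summable (f ^~ y)) ->
  (forall n y, `|y - x| < r -> is_derive y (1 : R) (f n) (f' n y)) ->
  (forall n y, `|y - x| < r -> `|f' n y| <= M n) ->
  is_derive x (1 : R) (fun y => limn (series (f ^~ y))) (limn (series (f' ^~ x))).
Proof.
move=> r0 sM sf df fM; apply/is_derive_epsP => e e0.
have e3 : 0 < e / 3 by rewrite divr_gt0.
have [N HN] := tailsum_small sM e3.
have dN : is_derive x (1 : R) (fun y => series (f ^~ y) N) (series (f' ^~ x) N).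
  have -> : (fun y => series (f ^~ y) N) = \sum_(i < N) f i.
    by apply/funext => y; rewrite /series /= big_mkord fct_sumE.
  rewrite /series /= big_mkord; apply: is_derive_sum => i.
  by apply: df; rewrite subrr normr0.
have [d d0 Hd] := (is_derive_epsP _ _ _).1 dN _ e3.
exists (Num.min d r); first by rewrite lt_min d0.
move=> h; rewrite lt_min => /andP[hd hr].
have lipf n : `|f n (x + h) - f n x| <= `|h| * M n.
  pose a := Num.min x (x + h); pose b := Num.max x (x + h).
  have ab : a <= b by rewrite /a /b ge_min le_max lexx.
  have inr y : y \in `[a, b] -> `|y - x| < r.
    rewrite in_itv/= /a /b ge_min le_max => H.
    apply: le_lt_trans hr; case/andP: H => /orP[] H1 /orP[] H2; rewrite ler_norml;
     have := ler_norm h; have := ler_norm (- h); rewrite normrN => *; apply/andP; split; lra.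
  have [||c cab E] := @MVT_segment _ (f n) (f' n) a b ab.
  - by move=> y yab; apply/df/inr; apply: subset_itv_oo_cc yab.
  - apply: derivable_within_continuous => y yab.
    by have := df n y (inr _ yab) => -[].
  have -> : `|f n (x + h) - f n x| = `|f n b - f n a|.
    by rewrite /a /b minEle maxEle; case: ifP => //; rewrite distrC.
  rewrite E normrM mulrC; apply: ler_pM => //; last exact/fM/inr.
  rewrite ger0_norm ?subr_ge0// /a /b minEle maxEle.
  case: ifPn => _; first by rewrite addrAC subrr add0r ler_norm.
  by rewrite opprD addrA subrr add0r -normrN ler_norm.
have xx : `|x - x| < r by rewrite subrr normr0.
have xh : `|x + h - x| < r by rewrite addrAC subrr add0r.
have sx := sf _ xx; have sxh := sf _ xh.
have D : limn (series (f ^~ (x + h))) - limn (series (f ^~ x)) =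
    limn (series (fun n => f n (x + h) - f n x)).
  by rewrite -lim_seriesB//; exact: abs_summable_cvg.
have T1 := @tail_le (fun n => f n (x + h) - f n x) (fun n => `|h| * M n) N lipf
  (abs_summableZ sM).
have T2 := @tail_le (f' ^~ x) M N (fun n => fM n x xx) sM.
have tE : tailsum (fun n => `|h| * M n) N = `|h| * tailsum M N.
  by rewrite /tailsum lim_seriesM// /series /= -mulr_sumr mulrBr.
have := Hd _ hd; have tN := le_trans (ler_norm _) (HN N (leqnn _)).
rewrite D.
have -> : series (f ^~ (x + h)) N - series (f ^~ x) N =
  series (fun n => f n (x + h) - f n x) N by rewrite /series /= -sumrB.
rewrite tE in T1.
move: T1 T2; move: (limn _) (limn _) (series _ _) (series _ _) => A B C D'.
move=> T1 T2 T3.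
have -> : B - h * A = (B - D') + (D' - h * C) + h * (C - A) by ring.
have H1 : `|h| * tailsum M N <= `|h| * (e / 3) by rewrite ler_wpM2l.
have H2 : `|h * (C - A)| <= `|h| * (e / 3).
  by rewrite normrM ler_wpM2l// distrC (le_trans T2).
rewrite (le_trans (ler_normD _ _))//.
have := ler_normD (B - D') (D' - h * C); lra.
Qed.

End series_lemmas.

(** * Uniqueness of the Fourier coefficients of a continuous function *)

Section fourier_uniqueness.
Context {R : realType}.
Notation mu := (@lebesgue_measure R).
Notation P := (@period R).
Implicit Types (f g h p q w : R -> R) (a b x : R).

Lemma period_gt0 : 0 < P.
Proof. by rewrite mulr_gt0// pi_gt0. Qed.

Lemma cos_natmul_period n x : cos (n%:R * (x + P)) = cos (n%:R * x).
Proof.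
rewrite mulrDr -[RHS](periodicn (@cosD2pi R) n); congr cos.
by rewrite -[pi *+ 2 *+ n]mulr_natl -[pi *+ 2]mulr_natl.
Qed.

Lemma sin_natmul_period n x : sin (n%:R * (x + P)) = sin (n%:R * x).
Proof.
rewrite mulrDr -[RHS](periodicn (@sinD2pi R) n); congr sin.
by rewrite -[pi *+ 2 *+ n]mulr_natl -[pi *+ 2]mulr_natl.
Qed.

Lemma is_derive_cosM (k x : R) :
  is_derive x (1 : R) (fun y => cos (k * y)) (- k * sin (k * x)).
Proof.
have d1 : is_derive x (1 : R) (fun y : R => k * y) k.
  by apply: is_derive_eq; rewrite /GRing.scale /= mulr1.
have := is_derive1_comp (is_derive_cos (k * x)) d1.
by move=> H; apply: is_derive_eq H _; ring.
Qed.

Lemma is_derive_sinM (k x : R) :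
  is_derive x (1 : R) (fun y => sin (k * y)) (k * cos (k * x)).
Proof.
have d1 : is_derive x (1 : R) (fun y : R => k * y) k.
  by apply: is_derive_eq; rewrite /GRing.scale /= mulr1.
have := is_derive1_comp (is_derive_sin (k * x)) d1.
by move=> H; apply: is_derive_eq H _; ring.
Qed.

Lemma continuous_cosM (k : R) : continuous (fun y => cos (k * y)).
Proof. exact: is_derive_continuous (is_derive_cosM k). Qed.

Lemma continuous_sinM (k : R) : continuous (fun y => sin (k * y)).
Proof. exact: is_derive_continuous (is_derive_sinM k). Qed.

Lemma continuousM_fun f g : continuous f -> continuous g -> continuous (fun x => f x * g x).
Proof. by move=> cf cg x; apply: (@continuousM _ _ f g); [exact: cf|exact: cg]. Qed.

Lemma continuousD_fun f g : continuous f -> continuous g -> continuous (fun x => f x + g x).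
Proof. by move=> cf cg x; apply: (@continuousD _ _ _ f g); [exact: cf|exact: cg]. Qed.

Lemma continuousZ_fun (k : R) f : continuous f -> continuous (fun x => k * f x).
Proof. by move=> cf; apply: continuousM_fun => //; exact: cst_continuous. Qed.

Lemma continuousX_fun f n : continuous f -> continuous (fun x => f x ^+ n).
Proof.
move=> cf; elim: n => [|n IH]; first exact: cst_continuous.
rewrite (_ : (fun x => _) = (fun x => f x * f x ^+ n)); first exact: continuousM_fun.
by apply/funext => x; rewrite exprS.
Qed.

Definition trig_orth w := forall n, \int[mu]_(x in `[0, P]) (w x * cos (n%:R * x)) = 0 /\
  \int[mu]_(x in `[0, P]) (w x * sin (n%:R * x)) = 0.

Lemma int_lin2 f g (s t a b : R) : itg a b f -> itg a b g ->
  \int[mu]_(x in `[a, b]) (s * f x + t * g x) =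
  s * \int[mu]_(x in `[a, b]) f x + t * \int[mu]_(x in `[a, b]) g x.
Proof. by move=> fi gi; rewrite -!intZ// -intD//; exact: itgZ. Qed.

Lemma trig_orthD w1 w2 (s t : R) : continuous w1 -> continuous w2 ->
  trig_orth w1 -> trig_orth w2 -> trig_orth (fun x => s * w1 x + t * w2 x).
Proof.
move=> c1 c2 o1 o2 n; have [A1 B1] := o1 n; have [A2 B2] := o2 n.
have cC := @continuous_cosM n%:R; have cS := @continuous_sinM n%:R.
split.
- transitivity (\int[mu]_(x in `[0, P]) (s * (w1 x * cos (n%:R * x)) + t * (w2 x * cos (n%:R * x)))).
    by apply: eq_int => x _; ring.
  by rewrite int_lin2 ?A1 ?A2 ?mulr0 ?addr0//; exact/itg_cont/continuousM_fun.
- transitivity (\int[mu]_(x in `[0, P]) (s * (w1 x * sin (n%:R * x)) + t * (w2 x * sin (n%:R * x)))).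
    by apply: eq_int => x _; ring.
  by rewrite int_lin2 ?B1 ?B2 ?mulr0 ?addr0//; exact/itg_cont/continuousM_fun.
Qed.

(** Product-to-sum formulas; frequency [0] is treated apart because [n - 1] would leave the natural
    numbers. *)
Lemma trig_orth_cos w : continuous w -> trig_orth w -> trig_orth (fun x => w x * cos x).
Proof.
move=> cw o n; have cC k := @continuous_cosM k; have cS k := @continuous_sinM k.
case: n => [|n].
  split; first rewrite -[RHS](proj1 (o 1%N)).
    by apply: eq_int => x _; rewrite mul0r cos0 mul1r mulr1.
  by rewrite -[RHS](proj2 (o 0%N)); apply: eq_int => x _; rewrite mul0r sin0 !mulr0.
have [A1 B1] := o n.+2; have [A2 B2] := o n.
have E1 x : n.+2%:R * x = n.+1%:R * x + x by rewrite -[n.+2%:R]natr1; ring.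
have E2 x : n%:R * x = n.+1%:R * x - x by rewrite -[n.+1%:R]natr1; ring.
split.
- transitivity (\int[mu]_(x in `[0, P]) (2^-1 * (w x * cos (n.+2%:R * x)) + 2^-1 * (w x * cos (n%:R * x)))).
    by apply: eq_int => x _; rewrite E1 E2 cosD cosB; field.
  by rewrite int_lin2 ?A1 ?A2 ?mulr0 ?addr0//; exact/itg_cont/continuousM_fun.
- transitivity (\int[mu]_(x in `[0, P]) (2^-1 * (w x * sin (n.+2%:R * x)) + 2^-1 * (w x * sin (n%:R * x)))).
    by apply: eq_int => x _; rewrite E1 E2 sinD sinB; field.
  by rewrite int_lin2 ?B1 ?B2 ?mulr0 ?addr0//; exact/itg_cont/continuousM_fun.
Qed.

Lemma trig_orth_sin w : continuous w -> trig_orth w -> trig_orth (fun x => w x * sin x).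
Proof.
move=> cw o n; have cC k := @continuous_cosM k; have cS k := @continuous_sinM k.
case: n => [|n].
  split; first rewrite -[RHS](proj2 (o 1%N)).
    by apply: eq_int => x _; rewrite mul0r cos0 mul1r mulr1.
  by rewrite -[RHS](proj2 (o 0%N)); apply: eq_int => x _; rewrite mul0r sin0 !mulr0.
have [A1 B1] := o n.+2; have [A2 B2] := o n.
have E1 x : n.+2%:R * x = n.+1%:R * x + x by rewrite -[n.+2%:R]natr1; ring.
have E2 x : n%:R * x = n.+1%:R * x - x by rewrite -[n.+1%:R]natr1; ring.
split.
- transitivity (\int[mu]_(x in `[0, P]) (2^-1 * (w x * sin (n.+2%:R * x)) + (- 2^-1) * (w x * sin (n%:R * x)))).
    by apply: eq_int => x _; rewrite E1 E2 sinD sinB; field.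
  by rewrite int_lin2 ?B1 ?B2 ?mulr0 ?addr0//; exact/itg_cont/continuousM_fun.
- transitivity (\int[mu]_(x in `[0, P]) ((- 2^-1) * (w x * cos (n.+2%:R * x)) + 2^-1 * (w x * cos (n%:R * x)))).
    by apply: eq_int => x _; rewrite E1 E2 cosD cosB; field.
  by rewrite int_lin2 ?A1 ?A2 ?mulr0 ?addr0//; exact/itg_cont/continuousM_fun.
Qed.

(** Multiplication by a trigonometric polynomial preserves orthogonality to all modes; the powers of
    [k + cos (x - x0)] are the peaks used next. *)
Lemma trig_orth_peak w (k x0 : R) n : continuous w -> trig_orth w ->
  trig_orth (fun x => w x * (k + cos (x - x0)) ^+ n).
Proof.
move=> cw o; elim: n => [|n IH].
  by rewrite (_ : (fun x => _) = w)//; apply/funext => x; rewrite expr0 mulr1.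
have cT : continuous (fun x => k + cos (x - x0)).
  apply: continuousD_fun; first exact: cst_continuous.
  move=> x; apply: (@continuous_comp _ _ _ (fun y => y - x0) cos); last exact: continuous_cos.
  by apply: (@continuousB _ _ _ id (cst x0)) => //; exact: cst_continuous.
pose v x := w x * (k + cos (x - x0)) ^+ n.
have cv : continuous v by apply: continuousM_fun => //; exact: continuousX_fun.
rewrite (_ : (fun x => _) = (fun x => 1 * (k * v x + cos x0 * (v x * cos x)) + sin x0 * (v x * sin x))).
  have ccos : continuous (@cos R) by move=> x; exact: continuous_cos.
  have csin : continuous (@sin R) by move=> x; exact: continuous_sin.
  apply: trig_orthD; last exact: trig_orth_sin.
  - by apply: continuousD_fun; apply: continuousZ_fun => //; exact: continuousM_fun.
  - exact: continuousM_fun.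
  - apply: trig_orthD => //; first exact: continuousM_fun.
    exact: trig_orth_cos.
by apply/funext => x; rewrite /v exprSr cosB; ring.
Qed.

Lemma bernoulli_le (r : R) n : 0 <= r -> 1 + n%:R * r <= (1 + r) ^+ n.
Proof.
move=> r0; elim: n => [|n IH]; first by rewrite mul0r addr0 expr0.
rewrite exprSr -natr1; apply: le_trans (ler_wpM2r _ IH); last lra.
by have := mulr_ge0 (ler0n R n) (sqr_ge0 r); rewrite expr2; lra.
Qed.

Lemma cos_ndecr (s t : R) : 0 <= s -> s <= t -> t <= pi -> cos t <= cos s.
Proof.
move=> s0; rewrite le_eqVlt => /predU1P[->//|st] tpi.
by apply/ltW; rewrite ltr_cos// in_itv/=; lra.
Qed.

(* With k = 1 - cos e, the trigonometric polynomial (k + cos (x - x0))^n is at most 1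
   at distance e from x0 and grows geometrically near x0, which rules out w x0 > 0. *)
Lemma trig_orth_le0 w x0 : continuous w -> trig_orth w -> 0 < x0 -> x0 < P -> w x0 <= 0.
Proof.
move=> cw o x00 x0P; rewrite leNgt; apply/negP => wx0.
have pi0 := pi_gt0 R; have PE : P = 2 * pi by [].
have [d d0 Hd] : exists2 d, 0 < d & forall y, `|y - x0| <= d -> w x0 / 2 <= w y.
  have w2 : 0 < w x0 / 2 by rewrite divr_gt0.
  have := cw x0 => /cvgrPdist_le/(_ _ w2)[e /= e0 He]; exists (e / 2); first by rewrite divr_gt0.
  move=> y ye; have := He y; rewrite /ball /= distrC => /(_ _).
  by rewrite ler_norml => /(_ ltac:(lra))/andP[]; lra.
(* On [[x0 - e, x0 + e]], which stays inside [(0, P)], [w] is at least half of [w x0], and [e] lies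
   in the range where the cosine decreases. *)
pose e := Num.min d (Num.min (x0 / 2) (Num.min ((P - x0) / 2) (pi / 2))).
have e0 : 0 < e by rewrite !lt_min d0 !divr_gt0// subr_gt0.
have [ed [e1 [e2 e3]]] : e <= d /\ e <= x0 / 2 /\ e <= (P - x0) / 2 /\ e <= pi / 2.
  by rewrite /e !ge_min !lexx !orbT.
have [M M0 HM] := continuous_bounded 0 P cw.
pose k := 1 - cos e; pose T x := k + cos (x - x0).
pose r := cos (e / 2) - cos e.
have r0 : 0 < r by rewrite subr_gt0 ltr_cos ?in_itv/=; lra.
have T1 x : `|x - x0| <= e -> 1 <= T x.
  move=> xe; have := @cos_ndecr `|x - x0| e (normr_ge0 _) xe.
  by rewrite cos_norm /T /k; lra.
have T2 x : `|x - x0| <= e / 2 -> 1 + r <= T x.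
  move=> xe; have := @cos_ndecr `|x - x0| (e / 2) (normr_ge0 _) xe.
  by rewrite cos_norm /T /k /r; lra.
have T3 x : x \in `[0, P] -> e <= `|x - x0| -> `|T x| <= 1.
  rewrite in_itv/= => /andP[xx0 xP] ex.
  have c1 := cos_geN1 (x - x0); have c2 := cos_le1 e.
  have xle : `|x - x0| <= P - e by rewrite ler_norml; apply/andP; split; lra.
  suff : cos (x - x0) <= cos e.
    by move=> H; rewrite /T /k ler_norml; apply/andP; split; lra.
  rewrite -cos_norm; have [H|H] := leP `|x - x0| pi; first by apply: cos_ndecr => //; lra.
  rewrite (_ : cos `|x - x0| = cos (P - `|x - x0|)); last first.
    rewrite -[RHS]cosN opprB -[RHS](cosD2pi (`|x - x0| - P)); congr cos.
    by rewrite PE mulr2n; ring.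
  by apply: cos_ndecr; lra.
have cT : continuous T.
  apply: continuousD_fun; first exact: cst_continuous.
  move=> x; apply: (@continuous_comp _ _ _ (fun y => y - x0) cos); last exact: continuous_cos.
  by apply: (@continuousB _ _ _ id (cst x0)) => //; exact: cst_continuous.
have cwT n : continuous (fun x => w x * T x ^+ n) by apply/continuousM_fun/continuousX_fun.
have L1 n x : x \in `[0, P] -> - M <= w x * T x ^+ n.
  move=> xP; have [xe|xe] := leP `|x - x0| e.
    rewrite (@le_trans _ _ 0)//; first by rewrite oppr_le0 ltW.
    have w20 : 0 <= w x0 / 2 by rewrite divr_ge0// ltW.
    have wx : w x0 / 2 <= w x by apply: Hd; lra.
    rewrite mulr_ge0 ?(le_trans w20 wx)//.
    by rewrite exprn_ge0// (le_trans _ (T1 _ xe)).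
  have := HM _ xP; have := T3 _ xP (ltW xe) => H1 H2.
  have : `|w x * T x ^+ n| <= M.
    by rewrite normrM normrX -[M]mulr1 ler_pM// exprn_ile1.
  by rewrite ler_norml => /andP[].
have L2 n x : `|x - x0| <= e / 2 -> w x0 / 2 * (1 + n%:R * r) <= w x * T x ^+ n.
  move=> xe; apply: ler_pM; [by rewrite divr_ge0// ltW| |by apply: Hd; lra|].
    by rewrite addr_ge0// mulr_ge0// ltW.
  apply: le_trans (bernoulli_le n (ltW r0)) _.
  have r1 : 0 <= 1 + r by lra.
  by rewrite lerXn2r ?nnegrE ?(le_trans r1 (T2 _ xe)) ?T2.
(* The integral of [w T^n] vanishes. By Bernoulli's inequality the middle interval contributes at
   least linear growth in [n], while the rest is bounded below independently of [n]. *)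
have key n : w x0 / 2 * (1 + n%:R * r) * e <= M * P.
  have := trig_orth_peak k x0 n cw o => /(_ 0%N)[+ _].
  rewrite (@eq_int _ _ (fun x => w x * T x ^+ n)); last first.
    by move=> x _; rewrite mul0r cos0 mulr1.
  have ci := itg_cont 0 P (cwT n).
  have [q1 [q2 [q3 q4]]] : 0 <= x0 - e / 2 /\ x0 - e / 2 <= P /\
      x0 - e / 2 <= x0 + e / 2 /\ x0 + e / 2 <= P by lra.
  have ci' := itgS ci q1 (lexx P).
  rewrite (int_split q1 q2 ci) (int_split q3 q4 ci').
  have cc (k' : R) : continuous (fun _ : R => k') by exact: cst_continuous.
  have I1 : - M * (x0 - e / 2 - 0) <= \int[mu]_(x in `[0, (x0 - e / 2)]) (w x * T x ^+ n).
    rewrite -int_cst; last lra.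
    apply: le_int; [exact: itg_cont|exact: itg_cont|] => x; rewrite in_itv/= => H.
    by apply: L1; rewrite in_itv/=; lra.
  have I3 : - M * (P - (x0 + e / 2)) <= \int[mu]_(x in `[(x0 + e / 2), P]) (w x * T x ^+ n).
    rewrite -int_cst; last lra.
    apply: le_int; [exact: itg_cont|exact: itg_cont|] => x; rewrite in_itv/= => H.
    by apply: L1; rewrite in_itv/=; lra.
  have I2 : w x0 / 2 * (1 + n%:R * r) * (x0 + e / 2 - (x0 - e / 2)) <=
     \int[mu]_(x in `[(x0 - e / 2), (x0 + e / 2)]) (w x * T x ^+ n).
    rewrite -int_cst; last lra.
    apply: le_int; [exact: itg_cont|exact: itg_cont|] => x; rewrite in_itv/= => H.
    by apply: L2; rewrite ler_norml; apply/andP; split; lra.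
  move: I1 I2 I3; move: (\int[mu]_(x in _) _) (\int[mu]_(x in _) _) (\int[mu]_(x in _) _).
  move=> A B C I1 I2 I3 E.
  have Me : 0 <= M * e by rewrite mulr_ge0// ltW.
  by move: I2; rewrite (_ : x0 + e / 2 - (x0 - e / 2) = e); [lra|field].
have [n Hn] : exists n : nat, M * P / (w x0 / 2 * r * e) < n%:R.
  exists (Num.bound (M * P / (w x0 / 2 * r * e))).
  by apply: archi_boundP; rewrite divr_ge0 ?mulr_ge0 ?divr_ge0 ?ltW.
have := key n; rewrite ltr_pdivrMr in Hn; last by rewrite !mulr_gt0// divr_gt0.
have : 0 < w x0 / 2 * e by rewrite mulr_gt0// divr_gt0.
by move: Hn; lra.
Qed.

(** The sign lemma for [w] and [- w] gives the open interval; the two ends follow by continuity. *)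
Lemma trig_orth_eq0 w : continuous w -> trig_orth w -> forall x, x \in `[0, P] -> w x = 0.
Proof.
move=> cw o.
have Nw : continuous (fun x => - w x) by move=> x; apply: (@continuousN _ _ _ w); exact: cw.
have oN : trig_orth (fun x => - w x).
  rewrite (_ : (fun x => _) = (fun x => (-1) * w x + 0 * w x)); first exact: trig_orthD.
  by apply/funext => x; ring.
have in0 x : 0 < x -> x < P -> w x = 0.
  move=> x0 xP; apply/eqP; rewrite eq_le trig_orth_le0//=.
  by rewrite -oppr_le0; exact: (trig_orth_le0 Nw).
move=> x; rewrite in_itv/= => /andP[x0 xP]; have P0 := period_gt0.
apply/eqP/negP => /negP wx.
have wx0 : 0 < `|w x| by rewrite normr_gt0.
have := cw x => /cvgrPdist_lt/(_ _ wx0)[e /= e0 He].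
pose d := Num.min (e / 2) (P / 4).
have d0 : 0 < d by rewrite lt_min !divr_gt0.
have [de dP] : d <= e / 2 /\ d <= P / 4 by rewrite /d !ge_min !lexx orbT.
have H y : `|x - y| < e -> 0 < y -> y < P -> False.
  by move=> xy y0 yP; have := He y xy; rewrite (in0 y)// subr0 ltxx.
have [xh|xh] := leP x (P / 2).
  by apply: (H (x + d)); [rewrite opprD addrA subrr add0r normrN gtr0_norm//; lra|lra..].
by apply: (H (x - d)); [rewrite opprB addrCA subrr addr0 gtr0_norm//; lra|lra..].
Qed.

End fourier_uniqueness.

(** * Orthogonality of the trigonometric modes *)

Section fourier_series.
Context {R : realType}.
Notation mu := (@lebesgue_measure R).
Notation P := (@period R).
Implicit Types (f g h p q w : R -> R) (x : R) (a b : nat -> R).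

Lemma int_cosM_eq0 (k : R) : k != 0 -> sin (k * P) = 0 ->
  \int[mu]_(x in `[0, P]) cos (k * x) = 0.
Proof.
move=> k0 sk.
have d x : is_derive x (1 : R) (fun y => k^-1 * sin (k * y)) (cos (k * x)).
  have d1 := is_derive_sinM k x.
  by apply: is_derive_eq; rewrite /GRing.scale /= mulrA mulVf// mul1r.
rewrite (int_derive (ltW period_gt0) (continuous_cosM (k := k)) d).
by rewrite sk !mulr0 sin0 mulr0 subrr.
Qed.

Lemma int_sinM_eq0 (k : R) : cos (k * P) = 1 ->
  \int[mu]_(x in `[0, P]) sin (k * x) = 0.
Proof.
move=> sk; have [->|k0] := eqVneq k 0.
  rewrite (@eq_int _ _ (fun=> 0)) ?int_cst ?mul0r// ?ltW ?period_gt0//.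
  by move=> x _; rewrite mul0r sin0.
have d x : is_derive x (1 : R) (fun y => (- k^-1) * cos (k * y)) (sin (k * x)).
  have d1 := is_derive_cosM k x.
  by apply: is_derive_eq; rewrite /GRing.scale /=; field.
rewrite (int_derive (ltW period_gt0) (continuous_sinM (k := k)) d).
by rewrite sk mulr0 cos0 subrr.
Qed.

Lemma cos_natP n : cos (n%:R * P) = 1.
Proof. by have := cos_natmul_period n (0 : R); rewrite add0r mulr0 cos0. Qed.

Lemma sin_natP n : sin (n%:R * P) = 0.
Proof. by have := sin_natmul_period n (0 : R); rewrite add0r mulr0 sin0. Qed.

Lemma int_cosB n m : n != m -> \int[mu]_(x in `[0, P]) cos ((n%:R - m%:R) * x) = 0.
Proof.
move=> nm; apply: int_cosM_eq0; first by rewrite subr_eq0 eqr_nat.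
by rewrite mulrBl sinB !sin_natP mul0r mulr0 subrr.
Qed.

Lemma int_cosD n m : (0 < n + m)%N -> \int[mu]_(x in `[0, P]) cos ((n%:R + m%:R) * x) = 0.
Proof.
move=> nm; apply: int_cosM_eq0; first by rewrite -natrD pnatr_eq0 -lt0n.
by rewrite mulrDl sinD !sin_natP mul0r mulr0 addr0.
Qed.

Lemma int_sinB n m : \int[mu]_(x in `[0, P]) sin ((n%:R - m%:R) * x) = 0.
Proof. by apply: int_sinM_eq0; rewrite mulrBl cosB !cos_natP !sin_natP mul0r addr0 mulr1. Qed.

Lemma int_sinD n m : \int[mu]_(x in `[0, P]) sin ((n%:R + m%:R) * x) = 0.
Proof. by apply: int_sinM_eq0; rewrite mulrDl cosD !cos_natP !sin_natP mul0r subr0 mulr1. Qed.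

Lemma int_cos_cos n m : \int[mu]_(x in `[0, P]) (cos (n%:R * x) * cos (m%:R * x)) =
  if n == m then (if n == 0%N then P else pi) else 0.
Proof.
have cC k := @continuous_cosM R k.
transitivity (2^-1 * \int[mu]_(x in `[0, P]) cos ((n%:R - m%:R) * x) +
   2^-1 * \int[mu]_(x in `[0, P]) cos ((n%:R + m%:R) * x)).
  rewrite -int_lin2; [|exact: itg_cont..].
  by apply: eq_int => x _; rewrite mulrBl mulrDl cosB cosD; field.
case: (eqVneq n m) => [<-|nm].
  rewrite (@eq_int _ (fun x => cos ((n%:R - n%:R) * x)) (fun=> 1)); last first.
    by move=> x _; rewrite subrr mul0r cos0.
  rewrite int_cst; last exact/ltW/period_gt0.
  case: (eqVneq n 0%N) => [->|n0].
    rewrite (@eq_int _ _ (fun=> 1)); last by move=> x _; rewrite addr0 mul0r cos0.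
    rewrite int_cst; last exact/ltW/period_gt0.
    by field.
  rewrite int_cosD; last by rewrite addn_gt0 lt0n n0.
  by rewrite /period; field.
rewrite int_cosB// int_cosD ?mulr0 ?addr0// addn_gt0 !lt0n.
by case: n nm => [|n _]//=; rewrite eq_sym.
Qed.

Lemma int_sin_sin n m : \int[mu]_(x in `[0, P]) (sin (n%:R * x) * sin (m%:R * x)) =
  if (n == m) && (n != 0%N) then pi else 0.
Proof.
have cC k := @continuous_cosM R k.
transitivity (2^-1 * \int[mu]_(x in `[0, P]) cos ((n%:R - m%:R) * x) +
   (- 2^-1) * \int[mu]_(x in `[0, P]) cos ((n%:R + m%:R) * x)).
  rewrite -int_lin2; [|exact: itg_cont..].
  by apply: eq_int => x _; rewrite mulrBl mulrDl cosB cosD; field.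
case: (eqVneq n m) => [<-|nm]/=.
  rewrite (@eq_int _ (fun x => cos ((n%:R - n%:R) * x)) (fun=> 1)); last first.
    by move=> x _; rewrite subrr mul0r cos0.
  rewrite int_cst; last exact/ltW/period_gt0.
  case: (eqVneq n 0%N) => [->|n0]/=.
    rewrite (@eq_int _ _ (fun=> 1)); last by move=> x _; rewrite addr0 mul0r cos0.
    rewrite int_cst; last exact/ltW/period_gt0.
    by field.
  rewrite int_cosD; last by rewrite addn_gt0 lt0n n0.
  by rewrite /period; field.
rewrite int_cosB// int_cosD ?mulr0 ?addr0// addn_gt0 !lt0n.
by case: n nm => [|n _]//=; rewrite eq_sym.
Qed.

Lemma int_cos_sin n m : \int[mu]_(x in `[0, P]) (cos (n%:R * x) * sin (m%:R * x)) = 0.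
Proof.
have cS k := @continuous_sinM R k.
transitivity (2^-1 * \int[mu]_(x in `[0, P]) sin ((n%:R + m%:R) * x) +
   (- 2^-1) * \int[mu]_(x in `[0, P]) sin ((n%:R - m%:R) * x)).
  rewrite -int_lin2; [|exact: itg_cont..].
  by apply: eq_int => x _; rewrite mulrBl mulrDl sinB sinD; field.
by rewrite int_sinB int_sinD !mulr0 addr0.
Qed.

Definition mode a b n x := a n * cos (n%:R * x) + b n * sin (n%:R * x).

Lemma continuous_mode a b n : continuous (mode a b n).
Proof.
apply: continuousD_fun; apply: continuousZ_fun;
  [exact: continuous_cosM|exact: continuous_sinM].
Qed.

Lemma is_derive_mode a b n x :
  is_derive x (1 : R) (mode a b n) (mode (fun n => n%:R * b n) (fun n => - (n%:R * a n)) n x).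
Proof.
have d1 := is_derive_cosM n%:R x; have d2 := is_derive_sinM n%:R x.
have d3 : is_derive x (1 : R) (fun y => a n * cos (n%:R * y)) (a n * (- n%:R * sin (n%:R * x))).
  by apply: is_derive_eq.
have d4 : is_derive x (1 : R) (fun y => b n * sin (n%:R * y)) (b n * (n%:R * cos (n%:R * x))).
  by apply: is_derive_eq.
by apply: is_derive_eq; rewrite /mode; ring.
Qed.

Lemma mode_periodic a b n x : mode a b n (x + P) = mode a b n x.
Proof. by rewrite /mode cos_natmul_period sin_natmul_period. Qed.

Lemma mode_le a b n x : `|mode a b n x| <= `|a n| + `|b n|.
Proof.
rewrite /mode (le_trans (ler_normD _ _))// lerD// normrM ler_piMr//;
  [exact: cos_max|exact: sin_max].
Qed.

Lemma int_lin2_mul f g h (s t u v : R) : itg u v (fun x => f x * h x) -> itg u v (fun x => g x * h x) ->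
  \int[mu]_(x in `[u, v]) ((s * f x + t * g x) * h x) =
  s * \int[mu]_(x in `[u, v]) (f x * h x) + t * \int[mu]_(x in `[u, v]) (g x * h x).
Proof.
move=> fi gi; rewrite -int_lin2//.
by apply: eq_int => x _; ring.
Qed.

Lemma int_mode_cos a b n m : \int[mu]_(x in `[0, P]) (mode a b n x * cos (m%:R * x)) =
  if n == m then (if n == 0%N then a n * P else a n * pi) else 0.
Proof.
have cC k := @continuous_cosM R k; have cS k := @continuous_sinM R k.
rewrite int_lin2_mul; [|exact/itg_cont/continuousM_fun..].
rewrite int_cos_cos (@eq_int _ (fun x => sin (n%:R * x) * _) (fun x => cos (m%:R * x) * sin (n%:R * x))).
  by rewrite int_cos_sin mulr0 addr0; case: ifP => _; [case: ifP|rewrite mulr0].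
by move=> x _; rewrite mulrC.
Qed.

Lemma int_mode_sin a b n m : \int[mu]_(x in `[0, P]) (mode a b n x * sin (m%:R * x)) =
  if (n == m) && (n != 0%N) then b n * pi else 0.
Proof.
have cC k := @continuous_cosM R k; have cS k := @continuous_sinM R k.
rewrite int_lin2_mul; [|exact/itg_cont/continuousM_fun..].
rewrite int_cos_sin int_sin_sin mulr0 add0r.
by case: ifP => // _; rewrite mulr0.
Qed.

(** The constant function has square norm [P] and not [pi], whence [a 0 = 0]; the coefficients of a
    derivative satisfy it. *)
Lemma int_mode_mode a b n m : a 0%N = 0 -> \int[mu]_(x in `[0, P]) (mode a b n x * mode a b m x) =
  if (n == m) && (n != 0%N) then (a n ^+ 2 + b n ^+ 2) * pi else 0.
Proof.
move=> a0; have cC k := @continuous_cosM R k; have cS k := @continuous_sinM R k.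
transitivity (a m * \int[mu]_(x in `[0, P]) (mode a b n x * cos (m%:R * x)) +
  b m * \int[mu]_(x in `[0, P]) (mode a b n x * sin (m%:R * x))).
  rewrite -int_lin2; [|by apply/itg_cont/continuousM_fun => //; exact: continuous_mode..].
  by apply: eq_int => x _; rewrite /mode; ring.
rewrite int_mode_cos int_mode_sin.
case: (eqVneq n m) => [<-|nm]/=; last by rewrite !mulr0 addr0.
case: (eqVneq n 0%N) => [->|n0]/=; first by rewrite a0; ring.
by ring.
Qed.

Lemma continuous_partial a b N : continuous (fun x => series (mode a b ^~ x) N).
Proof. by move=> x; apply: continuous_series_partial => n; exact: continuous_mode. Qed.

Lemma int_partial_mul a b N w : itg 0 P w ->
  (forall n, itg 0 P (fun x => mode a b n x * w x)) ->
  \int[mu]_(x in `[0, P]) (series (mode a b ^~ x) N * w x) =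
  \sum_(0 <= n < N) \int[mu]_(x in `[0, P]) (mode a b n x * w x).
Proof.
move=> iw im; rewrite -int_sum//.
by apply: eq_int => x _; rewrite /series /= mulr_suml.
Qed.

Lemma int_partial_sqr a b N : a 0%N = 0 -> b 0%N = 0 ->
  \int[mu]_(x in `[0, P]) ((series (mode a b ^~ x) N) ^+ 2) =
  pi * \sum_(0 <= n < N) (a n ^+ 2 + b n ^+ 2).
Proof.
move=> a0 b0; have cm n := @continuous_mode a b n; have cp k := @continuous_partial a b k.
rewrite (@eq_int _ _ (fun x => series (mode a b ^~ x) N * series (mode a b ^~ x) N)); last first.
  by move=> x _; rewrite expr2.
rewrite int_partial_mul; [|exact: itg_cont|by move=> n; exact/itg_cont/continuousM_fun].
rewrite mulr_sumr; apply: eq_big_nat => n /andP[_ nN].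
rewrite (@eq_int _ _ (fun x => series (mode a b ^~ x) N * mode a b n x)); last first.
  by move=> x _; rewrite mulrC.
rewrite int_partial_mul; [|exact: itg_cont|by move=> i; exact/itg_cont/continuousM_fun].
rewrite (eq_bigr (fun i => if i == n then pi * (a n ^+ 2 + b n ^+ 2) else 0)).
  rewrite big_mkord (bigD1 (Ordinal nN))//= eqxx big1 ?addr0// => i.
  by rewrite -val_eqE /= => /negbTE ->.
move=> i _; rewrite int_mode_mode//; case: (eqVneq i n) => [->|]//=.
by case: (eqVneq n 0%N) => [->|]/=; rewrite 1?mulrC// a0 b0 expr0n /= addr0 mul0r.
Qed.

End fourier_series.

(** * Taylor remainders of sine and cosine *)

Section taylor_trig.
Context {R : realType}.
Implicit Types (F G : R -> R) (x y : R).

(** Both [G + F] and [G - F] vanish at [0] and are nondecreasing on the positive half-line. *)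
Lemma norm_le_of_derive F G (f g : R -> R) y : 0 <= y ->
  (forall x, is_derive x (1 : R) F (f x)) -> (forall x, is_derive x (1 : R) G (g x)) ->
  (forall x, 0 <= x -> `|f x| <= g x) -> F 0 = 0 -> G 0 = 0 -> `|F y| <= G y.
Proof.
move=> y0 dF dG fg F0 G0.
have step H (h : R -> R) : (forall x, is_derive x (1 : R) H (h x)) -> H 0 = 0 ->
    (forall x, 0 <= x -> 0 <= h x) -> 0 <= H y.
  move=> dH H0 h0.
  have cH : {within `[0, y], continuous H}.
    exact/continuous_subspaceT/is_derive_continuous.
  have [c cy] := MVT_segment y0 (fun x _ => dH x) cH.
  rewrite H0 !subr0 => ->; rewrite mulr_ge0// h0//.
  by move: cy; rewrite in_itv/= => /andP[].
rewrite ler_norml; apply/andP; split.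
- suff : 0 <= G y + F y by lra.
  have d x : is_derive x (1 : R) (fun x => G x + F x) (g x + f x).
    by have := dF x; have := dG x => ? ?; exact: is_deriveD.
  have z : G 0 + F 0 = 0 by rewrite F0 G0 addr0.
  by apply: (step _ _ d z) => x /fg; rewrite ler_norml => /andP[]; lra.
- suff : 0 <= G y - F y by lra.
  have d x : is_derive x (1 : R) (fun x => G x - F x) (g x - f x).
    by have := dF x; have := dG x => ? ?; exact: is_deriveB.
  have z : G 0 - F 0 = 0 by rewrite F0 G0 subr0.
  by apply: (step _ _ d z) => x /fg; rewrite ler_norml => /andP[]; lra.
Qed.

Definition cos_term (y : R) j : R := (-1) ^+ j * y ^+ (j.*2) / (j.*2)`!%:R.
Definition sin_term (y : R) j : R := (-1) ^+ j * y ^+ (j.*2.+1) / (j.*2.+1)`!%:R.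

Lemma is_derive_exprn n x :
  is_derive x (1 : R) (fun y : R => y ^+ n.+1) (n.+1%:R * x ^+ n).
Proof.
elim: n => [|n IH]; first by apply: is_derive_eq; rewrite expr0 mulr1.
rewrite (_ : (fun y => _) = (fun y => y * y ^+ n.+1)); last first.
  by apply/funext => y; rewrite exprS.
apply: is_derive_eq; rewrite /GRing.scale /= -[n.+2%:R]natr1 exprS.
by ring.
Qed.

Lemma is_derive_exprn_fact n (k : R) x :
  is_derive x (1 : R) (fun y => k * y ^+ n.+1 / (n.+1)`!%:R) (k * x ^+ n / n`!%:R).
Proof.
have d1 : is_derive x (1 : R) (fun y : R => y ^+ n.+1) (n.+1%:R * x ^+ n).
  exact: is_derive_exprn.
have d2 : is_derive x (1 : R) (fun y => (k / (n.+1)`!%:R) * y ^+ n.+1)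
    ((k / (n.+1)`!%:R) * (n.+1%:R * x ^+ n)) by apply: is_derive_eq.
rewrite (_ : (fun y => _) = (fun y => (k / (n.+1)`!%:R) * y ^+ n.+1)); last first.
  by apply/funext => y; rewrite mulrAC.
apply: is_derive_eq d2 _; rewrite factS natrM.
field; apply/andP; split; first by rewrite pnatr_eq0 -lt0n fact_gt0.
by rewrite addrC natr1 pnatr_eq0.
Qed.

Lemma is_derive_sin_terms J x : is_derive x (1 : R)
  (fun y => series (sin_term y) J) (series (cos_term x) J).
Proof.
rewrite (_ : (fun y => _) = \sum_(j < J) (sin_term ^~ j)); last first.
  by apply/funext => y; rewrite /series /= big_mkord fct_sumE.
rewrite /series /= big_mkord; apply: is_derive_sum => j.
exact: is_derive_exprn_fact.
Qed.

(** One term more than in the sine sum: the constant differentiates away. *)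
Lemma is_derive_cos_terms J x : is_derive x (1 : R)
  (fun y => series (cos_term y) J.+1) (- series (sin_term x) J).
Proof.
rewrite (_ : (fun y => _) = (\sum_(j < J) (cos_term ^~ j.+1)) + cst 1); last first.
  apply/funext => y; rewrite /series /= big_nat_recl// addrC.
  rewrite /GRing.add /= fct_sumE big_mkord.
  by rewrite /cos_term expr0 mul1r expr0 fact0 divr1.
rewrite /series /= big_mkord -sumrN -[X in is_derive _ _ _ X]addr0.
apply: is_deriveD; apply: is_derive_sum => j.
have := is_derive_exprn_fact (j.*2.+1) ((-1) ^+ j.+1) x.
by move=> H; apply: is_derive_eq H _; rewrite /sin_term exprS; ring.
Qed.

(** Integrating the remainder of the cosine gives that of the sine with the same number of terms;
    integrating the latter gives that of the cosine with one term more. The bound [|cos y| <= 1]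
    starts the induction. *)
Lemma trig_terms_ge0 J y : 0 <= y ->
  `|cos y - series (cos_term y) J| <= y ^+ (J.*2) / (J.*2)`!%:R /\
  `|sin y - series (sin_term y) J| <= y ^+ (J.*2.+1) / (J.*2.+1)`!%:R.
Proof.
have d0 n x : is_derive x (1 : R) (fun y => y ^+ n.+1 / (n.+1)`!%:R) (x ^+ n / n`!%:R).
  have := is_derive_exprn_fact n 1 x; rewrite mul1r.
  by rewrite (_ : (fun y => 1 * y ^+ n.+1 / (n.+1)`!%:R) = (fun y => y ^+ n.+1 / (n.+1)`!%:R))//;
    apply/funext => z; rewrite mul1r.
have S0 K : series (sin_term 0) K = 0.
  by rewrite /series /= big1// => j _; rewrite /sin_term expr0n /= mulr0 mul0r.
have C0 K : series (cos_term 0) K.+1 = 1.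
  rewrite /series /= big_nat_recl//= big1 ?addr0; last first.
    by move=> j _; rewrite /cos_term doubleS expr0n /= mulr0 mul0r.
  by rewrite /cos_term /= !expr0 mulr1 fact0 divr1.
have cs K : (forall y, 0 <= y -> `|cos y - series (cos_term y) K| <= y ^+ (K.*2) / (K.*2)`!%:R) ->
    forall y, 0 <= y -> `|sin y - series (sin_term y) K| <= y ^+ (K.*2.+1) / (K.*2.+1)`!%:R.
  move=> H z z0.
  have dF x : is_derive x (1 : R) (fun x => sin x - series (sin_term x) K)
      (cos x - series (cos_term x) K).
    by have := is_derive_sin_terms K x => ?; exact: is_deriveB.
  apply: (norm_le_of_derive z0 dF (d0 _) H); first by rewrite sin0 S0 subr0.
  by rewrite expr0n mul0r.
suff {y} H : forall y, 0 <= y -> `|cos y - series (cos_term y) J| <= y ^+ (J.*2) / (J.*2)`!%:R.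
  by move=> y0; split; [exact: H|exact: cs].
elim: J => [|J IH] y y0.
  by rewrite /series /= big_geq// subr0 expr0 fact0 divr1 cos_max.
have H := cs _ IH.
have dF x : is_derive x (1 : R) (fun x => cos x - series (cos_term x) J.+1)
    (- sin x - - series (sin_term x) J).
  by have := is_derive_cos_terms J x => ?; exact: is_deriveB.
apply: (norm_le_of_derive y0 dF (d0 _)).
- by move=> x x0; rewrite -opprD normrN; exact: H.
- by rewrite cos0 C0 subrr.
- by rewrite expr0n mul0r.
Qed.

Lemma cos_terms_le J y :
  `|cos y - series (cos_term y) J| <= `|y| ^+ (J.*2) / (J.*2)`!%:R.
Proof.
have := (trig_terms_ge0 J (normr_ge0 y)).1; rewrite cos_norm.
rewrite (_ : series (cos_term `|y|) J = series (cos_term y) J)//.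
apply: eq_bigr => j _; rewrite /cos_term -mul2n exprM.
by rewrite real_normK ?num_real// -exprM.
Qed.

Lemma sin_terms_le J y :
  `|sin y - series (sin_term y) J| <= `|y| ^+ (J.*2.+1) / (J.*2.+1)`!%:R.
Proof.
have [y0|y0] := leP 0 y; first by rewrite [`|y|]ger0_norm//; exact: (trig_terms_ge0 J y0).2.
have := (trig_terms_ge0 J (normr_ge0 y)).2; rewrite [`|y|]ltr0_norm// sinN.
rewrite (_ : series (sin_term (- y)) J = - series (sin_term y) J).
  by rewrite -opprD normrN.
rewrite /series /= -sumrN; apply: eq_bigr => j _; rewrite /sin_term.
by rewrite [(- y) ^+ _]exprNn -[(-1) ^+ (j.*2.+1)]signr_odd /= odd_double /= expr1; ring.
Qed.

(** Serves as [2 - 2 cos (n h) <= (n h)^2], the comparison of difference quotients with derivatives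
    frequency by frequency. *)
Lemma cos_ge_sqr y : 1 - y ^+ 2 / 2 <= cos y.
Proof.
have := cos_terms_le 1 y; rewrite /series /= big_nat1 /cos_term.
rewrite (_ : (1.*2)%N = 2%N)// (_ : (2`!)%N = 2%N)//.
rewrite real_normK ?num_real// !expr0 mul1r fact0 divr1 ler_norml => /andP[+ _].
by lra.
Qed.

End taylor_trig.

(** * Fourier series of absolutely continuous periodic functions *)

Section fourier_H1.
Context {R : realType}.
Notation mu := (@lebesgue_measure R).
Notation P := (@period R).
Implicit Types (f g h p q w : R -> R) (x : R) (a b : nat -> R).

Lemma AC_C1 p (p' : R -> R) u v : continuous p' -> (forall x, is_derive x (1 : R) p (p' x)) ->
  AC u v p p'.
Proof.
move=> cp' dp; split; first exact: itg_cont.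
by move=> x; rewrite in_itv/= => /andP[ux _]; rewrite (int_derive ux cp' dp) addrC subrK.
Qed.

Lemma AC_by_parts p g q (q' : R -> R) : AC 0 P p g -> p P = p 0 ->
  continuous q' -> (forall x, is_derive x (1 : R) q (q' x)) -> q P = q 0 ->
  \int[mu]_(x in `[0, P]) (g x * q x) = - \int[mu]_(x in `[0, P]) (p x * q' x).
Proof.
move=> pg pP cq' dq qP; have P0 := ltW (@period_gt0 R).
have [gi _] := pg; have qg := AC_C1 0 P cq' dq.
have [_] := AC_mul P0 pg qg; move=> /(_ P).
rewrite in_itv/= P0 lexx => /(_ isT); rewrite pP qP.
have i1 := AC_itgM pg (itg_cont 0 P cq'); have i2 := AC_itgM qg gi.
rewrite intD// => E.
rewrite (@eq_int _ (fun x => g x * q x) (fun x => q x * g x)); last by move=> x _; rewrite mulrC.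
by lra.
Qed.

(** The divisor at [n = 0] makes the constant term of the series the mean itself, without the usual
    factor one half. *)
Definition coefc p n := (\int[mu]_(x in `[0, P]) (p x * cos (n%:R * x))) / (if n == 0%N then P else pi).
Definition coefs p n := if n == 0%N then 0 else (\int[mu]_(x in `[0, P]) (p x * sin (n%:R * x))) / pi.

Lemma coefcE p n : \int[mu]_(x in `[0, P]) (p x * cos (n%:R * x)) =
  (if n == 0%N then P else pi) * coefc p n.
Proof.
rewrite /coefc mulrC divfK//.
by case: ifP => _; rewrite gt_eqF ?period_gt0 ?pi_gt0.
Qed.

Lemma coefsE p n : \int[mu]_(x in `[0, P]) (p x * sin (n%:R * x)) = pi * coefs p n.
Proof.
rewrite /coefs; case: ifP => [/eqP->|_]; last by rewrite mulrC divfK// gt_eqF ?pi_gt0.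
rewrite mulr0 (@eq_int _ _ (fun=> 0)) ?int_cst ?mul0r ?(ltW period_gt0)//.
by move=> x _; rewrite mul0r sin0 mulr0.
Qed.

(** The term [n = 0] is [0] by the convention on inverses; the sum up to [n >= 1] is at most
    [2 - 1 / n], by telescoping. *)
Lemma inv_sqr_summable : abs_summable (fun n => (n%:R ^+ 2)^-1 : R).
Proof.
apply: (@abs_summable_bounded _ _ 2) => N.
suff H : forall n, \sum_(0 <= i < n.+2) `|(i%:R ^+ 2)^-1 : R| <= 2 - n.+1%:R^-1.
  case: N => [|[|N]]; first by rewrite big_geq.
    by rewrite big_nat1 expr0n /= invr0 normr0.
  by apply: le_trans (H N) _; rewrite gerBl.
elim=> [|n IH].
  by rewrite big_nat_recl//= big_nat1 expr0n /= invr0 normr0 add0r expr1n invr1 normr1; lra.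
rewrite big_nat_recr//=; apply: le_trans (lerD IH (lexx _)) _.
rewrite ger0_norm ?invr_ge0 ?sqr_ge0//.
have n1 : (0 : R) < n.+1%:R by rewrite ltr0n.
have -> : n.+2%:R = n.+1%:R + 1 :> R by rewrite natr1.
move: (n.+1%:R) n1 => y y0.
suff : (y + 1) ^- 2 <= y^-1 - (y + 1)^-1 by lra.
have -> : y^-1 - (y + 1)^-1 = (y * (y + 1))^-1 by field; rewrite !gt_eqF//; lra.
by rewrite lef_pV2 ?posrE ?exprn_gt0 ?mulr_gt0 ?expr2//; nra.
Qed.

Lemma dcoef_int p g n : AC 0 P p g -> p P = p 0 ->
  \int[mu]_(x in `[0, P]) (g x * cos (n%:R * x)) = pi * (n%:R * coefs p n) /\
  \int[mu]_(x in `[0, P]) (g x * sin (n%:R * x)) = - (pi * (n%:R * coefc p n)).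
Proof.
move=> pg pP; have [gi _] := pg; split.
- have cq : continuous (fun x : R => - n%:R * sin (n%:R * x)).
    exact/continuousZ_fun/continuous_sinM.
  rewrite (AC_by_parts pg pP cq (is_derive_cosM n%:R)); last by rewrite cos_natP mulr0 cos0.
  rewrite (@eq_int _ _ (fun x => - n%:R * (p x * sin (n%:R * x)))); last by move=> x _; ring.
  rewrite intZ ?coefsE; first by ring.
  exact: AC_itgM pg (itg_cont _ _ (continuous_sinM (k := _))).
- have cq : continuous (fun x : R => n%:R * cos (n%:R * x)).
    exact/continuousZ_fun/continuous_cosM.
  rewrite (AC_by_parts pg pP cq (is_derive_sinM n%:R)); last by rewrite sin_natP mulr0 sin0.
  rewrite (@eq_int _ _ (fun x => n%:R * (p x * cos (n%:R * x)))); last by move=> x _; ring.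
  rewrite intZ ?coefcE; last exact: AC_itgM pg (itg_cont _ _ (continuous_cosM (k := _))).
  by case: eqP => [->|_]; rewrite ?mul0r ?mulr0//; ring.
Qed.

Section fixed.
Variables (p g : R -> R).
Hypotheses (cp : continuous p) (pg : AC 0 P p g) (pP : p P = p 0) (g2 : L2i 0 P g).

Let a := coefc p.
Let b := coefs p.
Let da n := n%:R * b n.
Let db n := - (n%:R * a n).

(** Bessel's inequality before the square is dropped. The coefficients of [g] are obtained by parts
    from those of [p]; the equality is kept because the remainder is estimated later. *)
Lemma int_sub_partial N :
  \int[mu]_(x in `[0, P]) ((g x - series (mode da db ^~ x) N) ^+ 2) =
  \int[mu]_(x in `[0, P]) (g x ^+ 2) - pi * \sum_(0 <= n < N) (da n ^+ 2 + db n ^+ 2).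
Proof.
have sN2 : L2i 0 P (fun x => series (mode da db ^~ x) N).
  exact: L2i_cont (@continuous_partial _ _ _ _).
have := int_sqrD 1 (- 1) g2 sN2.
rewrite int_partial_sqr; [|by rewrite /da mul0r|by rewrite /db mul0r oppr0].
rewrite (@eq_int _ (fun x => g x * _) (fun x => series (mode da db ^~ x) N * g x)); last first.
  by move=> x _; rewrite mulrC.
have im f : continuous f -> itg 0 P (fun x => g x * f x).
  by move=> cf; apply: L2iM => //; exact: L2i_cont.
rewrite int_partial_mul; last 2 first.
- exact: L2i_itg.
- move=> n; apply: (eq_itg _ (im _ (@continuous_mode _ da db n))) => x _ /=.
  by rewrite mulrC.
rewrite (eq_bigr (fun n => pi * (da n ^+ 2 + db n ^+ 2))); last first.
  move=> n _; have [E1 E2] := dcoef_int n pg pP.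
  transitivity (da n * \int[mu]_(x in `[0, P]) (g x * cos (n%:R * x)) +
    db n * \int[mu]_(x in `[0, P]) (g x * sin (n%:R * x))).
    rewrite -int_lin2; [|exact/im/continuous_cosM|exact/im/continuous_sinM].
    by apply: eq_int => x _; rewrite /mode; ring.
  by rewrite E1 E2 /da /db /a /b; ring.
rewrite -mulr_sumr => H.
rewrite (@eq_int _ _ (fun x => (1 * g x + -1 * series (mode da db ^~ x) N) ^+ 2)).
  by rewrite H; ring.
by move=> x _; congr (_ ^+ 2); ring.
Qed.

Lemma dcoef_summable : abs_summable (fun n => da n ^+ 2 + db n ^+ 2).
Proof.
apply: (@abs_summable_bounded _ _ (\int[mu]_(x in `[0, P]) (g x ^+ 2) / pi)) => N.
rewrite (eq_bigr (fun n => da n ^+ 2 + db n ^+ 2)); last first.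
  by move=> n _; rewrite ger0_norm// addr_ge0 ?sqr_ge0.
rewrite ler_pdivlMr ?pi_gt0// mulrC -subr_ge0 -int_sub_partial.
by apply: int_ge0 => x _; exact: sqr_ge0.
Qed.

(** A coefficient [z] of frequency [n > 0] satisfies [2 |z| <= (n z)^2 + n^-2], a sum of two
    summable terms. *)
Lemma coef_summable : abs_summable (fun n => `|a n| + `|b n|).
Proof.
(* Carries frequency [0], on which the weight [n^2] gives no control. *)
pose d n : R := if n == 0%N then `|a 0%N| + `|b 0%N| else 0.
have sd : abs_summable d.
  apply: (@abs_summable_bounded _ _ (`|a 0%N| + `|b 0%N|)) => -[|N].
    by rewrite big_geq// addr_ge0.
  rewrite big_nat_recl//= big1 ?addr0; last by move=> i _; rewrite /d /= normr0.
  by rewrite /d /= ger0_norm// addr_ge0.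
apply: (abs_summable_le _ (abs_summableD sd (abs_summableD dcoef_summable inv_sqr_summable))).
case=> [|n]; rewrite ger0_norm ?addr_ge0// /d /=.
  by rewrite lerDl addr_ge0 ?addr_ge0 ?sqr_ge0// invr_ge0 sqr_ge0.
rewrite add0r /da /db.
have : (0 : R) < n.+1%:R by rewrite ltr0n.
move: (n.+1%:R) (a n.+1) (b n.+1) => y a1 b1 y0.
have H z : `|z| <= ((y * z) ^+ 2 + y ^- 2) / 2.
  have := sqr_ge0 (y * `|z| - y^-1).
  rewrite (_ : (y * `|z| - y^-1) ^+ 2 = (y * `|z|) ^+ 2 - 2 * `|z| + y ^- 2); last by field; rewrite gt_eqF.
  by rewrite exprMn real_normK ?num_real// -exprMn; lra.
have := sqr_ge0 (y * a1); have := sqr_ge0 (y * b1).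
by have := H a1; have := H b1; rewrite [(- _) ^+ 2]sqrrN; lra.
Qed.

Lemma mode_series_continuous (al be : nat -> R) : abs_summable (fun n => `|al n| + `|be n|) ->
  continuous (fun x => limn (series (mode al be ^~ x))).
Proof.
move=> sab x; apply: continuous_series sab _ _.
- by near=> y => n; exact: mode_le.
- by move=> n; exact: continuous_mode.
Unshelve. all: by end_near. Qed.

(** Absolute summability of the coefficients makes the series a continuous function with the same
    coefficients as [p]; uniqueness concludes, ends of the interval included. *)
Lemma fourier_sum x : x \in `[0, P] -> p x = limn (series (mode a b ^~ x)).
Proof.
pose S x := limn (series (mode a b ^~ x)).
have cS : continuous S by exact/mode_series_continuous/coef_summable.
have P0 := ltW (@period_gt0 R).
have pi0 := @pi_gt0 R.
pose tau := tailsum (fun n => `|a n| + `|b n|).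
have unif w N : continuous w -> (forall x, `|w x| <= 1) ->
    `|\int[mu]_(x in `[0, P]) (S x * w x) - \int[mu]_(x in `[0, P]) (series (mode a b ^~ x) N * w x)|
      <= tau N * P.
  move=> cw w1; have cN := @continuous_partial _ a b N.
  have i1 : itg 0 P (fun x => S x * w x) by exact/itg_cont/continuousM_fun.
  have i2 : itg 0 P (fun x => series (mode a b ^~ x) N * w x) by exact/itg_cont/continuousM_fun.
  rewrite -intB// -[X in _ <= _ * X]subr0.
  apply: int_bound => //; first exact: itgB.
  move=> y _; rewrite -mulrBl normrM.
  apply: (@le_trans _ _ (`|S y - series (mode a b ^~ y) N| * 1)).
    by rewrite ler_wpM2l.
  rewrite mulr1; apply: tail_le coef_summable => n; exact: mode_le.
have lim0 (A B : R) (N0 : nat) : (forall N, (N0 <= N)%N -> `|A - B| <= tau N * P) -> A = B.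
  move=> H; apply/eqP; rewrite -subr_eq0; apply/eqP.
  apply: (@small_eq0 _ _ P) => e e0 _.
  have [N HN] := tailsum_small coef_summable e0.
  apply: le_trans (H (maxn N0 N) (leq_maxl _ _)) _.
  rewrite mulrC ler_wpM2l// (le_trans (ler_norm _))//.
  by apply: HN; exact: leq_maxr.
have cC k := @continuous_cosM R k; have cs k := @continuous_sinM R k.
have So n : \int[mu]_(x in `[0, P]) (S x * cos (n%:R * x)) = \int[mu]_(x in `[0, P]) (p x * cos (n%:R * x)) /\
   \int[mu]_(x in `[0, P]) (S x * sin (n%:R * x)) = \int[mu]_(x in `[0, P]) (p x * sin (n%:R * x)).
  split.
  - apply: (lim0 _ _ n.+1) => N nN.
    have -> : \int[mu]_(x in `[0, P]) (p x * cos (n%:R * x)) =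
      \int[mu]_(x in `[0, P]) (series (mode a b ^~ x) N * cos (n%:R * x)).
      rewrite int_partial_mul; [|exact: itg_cont|].
        rewrite big_mkord (bigD1 (Ordinal nN))//= big1 ?addr0; last first.
          by move=> i; rewrite -val_eqE /= => /negbTE ni; rewrite int_mode_cos ni.
        by rewrite int_mode_cos eqxx coefcE /a; case: ifP => _; rewrite mulrC.
      by move=> i; apply/itg_cont/continuousM_fun => //; exact: continuous_mode.
    by apply: unif => // y; exact: cos_max.
  - apply: (lim0 _ _ n.+1) => N nN.
    have -> : \int[mu]_(x in `[0, P]) (p x * sin (n%:R * x)) =
      \int[mu]_(x in `[0, P]) (series (mode a b ^~ x) N * sin (n%:R * x)).
      rewrite int_partial_mul; [|exact: itg_cont|].
        rewrite big_mkord (bigD1 (Ordinal nN))//= big1 ?addr0; last first.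
          by move=> i; rewrite -val_eqE /= => /negbTE ni; rewrite int_mode_sin ni.
        rewrite int_mode_sin eqxx coefsE /b; case: ifPn => [_|/negPn/eqP->].
          by rewrite mulrC.
        by rewrite /coefs /= mulr0.
      by move=> i; apply/itg_cont/continuousM_fun => //; exact: continuous_mode.
    by apply: unif => // y; exact: sin_max.
move=> xP; apply/eqP; rewrite -subr_eq0; apply/eqP.
apply: (@trig_orth_eq0 _ (fun x => p x - S x)) xP.
  by move=> y; apply: (@continuousB _ _ _ p S); [exact: cp|exact: cS].
move=> n; have [E1 E2] := So n.
have cpw w : continuous w -> itg 0 P (fun x => p x * w x) by move=> cw; exact/itg_cont/continuousM_fun.
have cSw w : continuous w -> itg 0 P (fun x => S x * w x) by move=> cw; exact/itg_cont/continuousM_fun.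
split.
- rewrite (@eq_int _ _ (fun x => p x * cos (n%:R * x) - S x * cos (n%:R * x))).
    by rewrite intB ?E1 ?subrr//; [exact: cpw|exact: cSw].
  by move=> y _; rewrite mulrBl.
- rewrite (@eq_int _ _ (fun x => p x * sin (n%:R * x) - S x * sin (n%:R * x))).
    by rewrite intB ?E2 ?subrr//; [exact: cpw|exact: cSw].
  by move=> y _; rewrite mulrBl.
Qed.

End fixed.
End fourier_H1.

(** * Parseval's inequality for the weak derivative *)

Section parseval.
Context {R : realType}.
Notation mu := (@lebesgue_measure R).
Notation P := (@period R).
Implicit Types (f g h p q w : R -> R) (x : R) (a b al be : nat -> R).

Lemma periodic_int (U : zmodType) (f : R -> U) (m : int) x : periodic f P -> f (x + m%:~R * P) = f x.
Proof.
move=> fP.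
have H (n : nat) y : f (y + n%:R * P) = f y.
  elim: n y => [|n IH] y; first by rewrite mul0r addr0.
  by rewrite -natr1 mulrDl mul1r addrA fP IH.
case: m => n; first exact: H.
rewrite NegzE mulrNz mulNr; have := H n.+1 (x - n.+1%:R * P).
by rewrite subrK => <-.
Qed.

Lemma period_reduce x : exists m : int, x + m%:~R * P \in `[0, P].
Proof.
have P0 := @period_gt0 R.
exists (- Num.floor (x / P)); rewrite in_itv/= mulrNz mulNr.
have /andP[H1 H2] := floor_itv (x / P).
rewrite ler_pdivlMr// in H1; rewrite ltr_pdivrMr// in H2.
by move: H2; rewrite intrD mulrDl mul1r => H2; apply/andP; split; lra.
Qed.

Lemma periodic_ext (U : zmodType) (f g : R -> U) : periodic f P -> periodic g P ->
  (forall x, x \in `[0, P] -> f x = g x) -> forall x, f x = g x.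
Proof.
move=> fP gP fg x; have [m mP] := period_reduce x.
by rewrite -(periodic_int m x fP) -(periodic_int m x gP); exact: fg.
Qed.

Lemma mode_summable al be x : abs_summable (fun n => `|al n| + `|be n|) ->
  abs_summable (mode al be ^~ x).
Proof. by apply: abs_summable_le => n; exact: mode_le. Qed.

Lemma int_mode_series_le al be M : al 0%N = 0 -> be 0%N = 0 ->
  abs_summable (fun n => `|al n| + `|be n|) ->
  (forall n, al n ^+ 2 + be n ^+ 2 <= M n) -> abs_summable M ->
  \int[mu]_(x in `[0, P]) (limn (series (mode al be ^~ x)) ^+ 2) <= pi * limn (series M).
Proof.
move=> al0 be0 sab sM cM; pose f x := limn (series (mode al be ^~ x)).
have cf : continuous f by exact: mode_series_continuous.
have P0 := ltW (@period_gt0 R); have pi0 := @pi_gt0 R.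
pose B := limn (series (fun n => `|al n| + `|be n|)).
have fB x : `|f x| <= B by apply: series_lim_le => // n; exact: mode_le.
have B0 : 0 <= B by apply: le_trans (fB 0).
pose tau := tailsum (fun n => `|al n| + `|be n|).
have key N : \int[mu]_(x in `[0, P]) (f x ^+ 2) <= pi * limn (series M) + tau N * (2 * B + tau N) * P.
  have cN := @continuous_partial _ al be N.
  have H x : f x ^+ 2 <= series (mode al be ^~ x) N ^+ 2 + tau N * (2 * B + tau N).
    have := fB x; have : `|f x - series (mode al be ^~ x) N| <= tau N.
      by apply: tail_le => // n; exact: mode_le.
    move: (f x) (series _ _) => y z yz yB.
    have t0 : 0 <= tau N by apply: le_trans yz.
    have -> : y ^+ 2 = z ^+ 2 + (y - z) * (2 * y - (y - z)) by ring.
    rewrite lerD2l (le_trans (ler_norm _))// normrM ler_pM//.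
    by rewrite (le_trans (ler_normB _ _))// normrM ger0_norm// lerD// ler_pM2l.
  apply: (@le_trans _ _ (\int[mu]_(x in `[0, P]) (series (mode al be ^~ x) N ^+ 2 + tau N * (2 * B + tau N)))).
    apply: le_int => [||x _]; [exact/itg_cont/continuousX_fun| |exact: H].
    by apply: itg_cont; apply: continuousD_fun; [exact: continuousX_fun|exact: cst_continuous].
  rewrite intD; [|exact/itg_cont/continuousX_fun|by apply: itg_cont; exact: cst_continuous].
  rewrite int_cst// subr0 int_partial_sqr// lerD2r ler_pM2l//.
  apply: (@le_trans _ _ (series M N)); first by apply: ler_sum => n _.
  have M0 n : `|M n| <= M n.
    by rewrite ger0_norm// (le_trans _ (sM n))// addr_ge0 ?sqr_ge0.
  by have := le_trans (normr_ge0 _) (tail_le N M0 cM); rewrite /tailsum subr_ge0.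
rewrite leNgt; apply/negP => lt.
pose d := \int[mu]_(x in `[0, P]) (f x ^+ 2) - pi * limn (series M).
have d0 : 0 < d by rewrite subr_gt0.
pose e := Num.min 1 (d / (2 * ((2 * B + 1) * P))).
have BP : 0 < (2 * B + 1) * P by rewrite mulr_gt0 ?period_gt0//; lra.
have e0 : 0 < e by rewrite lt_min ltr01 divr_gt0// mulr_gt0.
have [N HN] := tailsum_small sab e0.
have := key N; rewrite -lerBlDl -/d => H.
have tN : `|tau N| <= e by exact: HN.
have e1 : e <= 1 by rewrite ge_min lexx.
have e2 : e * ((2 * B + 1) * P) <= d / 2.
  rewrite -ler_pdivlMr// (_ : d / 2 / _ = d / (2 * ((2 * B + 1) * P))) ?ge_min ?lexx ?orbT//.
  by field; rewrite gt_eqF ?period_gt0// gt_eqF//; lra.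
have : tau N * (2 * B + tau N) * P <= e * ((2 * B + 1) * P).
  rewrite -mulrA (le_trans (ler_norm _))// normrM ler_pM//.
  rewrite normrM [`|P|]ger0_norm// ler_wpM2r//.
  by rewrite (le_trans (ler_normD _ _))// normrM ger0_norm// ger0_norm// lerD2l (le_trans tN).
by lra.
Qed.

Section fixed.
Variables (p g : R -> R).
Hypotheses (cp : continuous p) (pg : AC 0 P p g) (pP : periodic p P) (g2 : L2i 0 P g).

Let a := coefc p.
Let b := coefs p.
Let da n := n%:R * b n.
Let db n := - (n%:R * a n).

Let pP0 : p P = p 0. Proof. by rewrite -[in LHS](add0r P) pP. Qed.

Lemma fourier_sumT x : p x = limn (series (mode a b ^~ x)).
Proof.
move: x; apply: periodic_ext => // [x|x xP]; last exact: fourier_sum pg pP0 g2 _ xP.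
by congr (limn (series _)); apply/funext => n; rewrite mode_periodic.
Qed.

Let S2 := limn (series (fun n => da n ^+ 2 + db n ^+ 2)).

(** Passing to the difference quotient multiplies the squared amplitude of frequency [n] by
    [(2 - 2 cos (n h)) / h^2], which is at most [n^2]. *)
Lemma int_diff_quotient_le (h : R) : h != 0 ->
  \int[mu]_(x in `[0, P]) (((p (x + h) - p x) / h) ^+ 2) <= pi * S2.
Proof.
move=> h0.
(* Coefficients of the difference quotient, by the addition formulas. *)
pose al n := (a n * (cos (n%:R * h) - 1) + b n * sin (n%:R * h)) / h.
pose be n := (b n * (cos (n%:R * h) - 1) - a n * sin (n%:R * h)) / h.
have sab := coef_summable pg pP0 g2; rewrite -/a -/b in sab.
have sal : abs_summable (fun n => `|al n| + `|be n|).
  apply: (abs_summable_le _ (abs_summableZ (k := 6 / `|h|) sab)) => n.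
  rewrite ger0_norm ?addr_ge0// /al /be; move: (a n) (b n) => an bn.
  rewrite !normf_div -mulrDl [X in _ <= X]mulrAC.
  rewrite ler_pM2r ?invr_gt0 ?normr_gt0//.
  have c := cos_max (n%:R * h); have s := sin_max (n%:R * h).
  have c1 : `|cos (n%:R * h) - 1| <= 2.
    by rewrite (le_trans (ler_normB _ _))// normr1; lra.
  have H (u v : R) : `|u * (cos (n%:R * h) - 1)| <= 2 * `|u| /\ `|v * sin (n%:R * h)| <= `|v|.
    split; first by rewrite normrM mulrC ler_wpM2r.
    by rewrite normrM ler_piMr.
  have [A1 A2] := H an bn; have [A3 A4] := H bn an.
  apply: le_trans (lerD (ler_normD _ _) (ler_normB _ _)) _.
  by have := normr_ge0 an; have := normr_ge0 bn; lra.
have E x : (p (x + h) - p x) / h = limn (series (mode al be ^~ x)).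
  rewrite !fourier_sumT -lim_seriesB; [|exact/abs_summable_cvg/mode_summable..].
  rewrite mulrC -lim_seriesM; last first.
    apply: (abs_summable_le (v := fun n => 2 * (`|a n| + `|b n|))); last exact: abs_summableZ.
    move=> n; rewrite (le_trans (ler_normB _ _))//.
    by have := mode_le a b n (x + h); have := mode_le a b n x; lra.
  congr (limn (series _)); apply/funext => n.
  transitivity (h^-1 * (mode a b n (x + h) - mode a b n x)) => //.
  by rewrite /al /be /mode (mulrDr n%:R) cosD sinD; field.
rewrite (@eq_int _ _ (fun x => limn (series (mode al be ^~ x)) ^+ 2)); last by move=> x _; rewrite E.
have z : 0%:R * h = 0 by rewrite mul0r.
apply: int_mode_series_le => //.
- by rewrite /al z cos0 sin0 subrr !mulr0 addr0 mul0r.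
- by rewrite /be z cos0 sin0 subrr !mulr0 subr0 mul0r.
- move=> n; have -> : al n ^+ 2 + be n ^+ 2 =
    (a n ^+ 2 + b n ^+ 2) * ((2 - 2 * cos (n%:R * h)) / h ^+ 2).
    transitivity ((a n ^+ 2 + b n ^+ 2) * (((cos (n%:R * h) - 1) ^+ 2 + sin (n%:R * h) ^+ 2) / h ^+ 2)).
      by rewrite /al /be; field.
    by rewrite sin2cos2; field.
  have -> : da n ^+ 2 + db n ^+ 2 = (a n ^+ 2 + b n ^+ 2) * n%:R ^+ 2 by rewrite /da /db; ring.
  rewrite ler_wpM2l ?addr_ge0 ?sqr_ge0//.
  rewrite ler_pdivrMr ?exprn_even_gt0//.
  by have := cos_ge_sqr (n%:R * h); rewrite exprMn; lra.
- exact: dcoef_summable pg pP0 g2.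
Qed.

Lemma limn_einf_le (u : (\bar R)^nat) (c : \bar R) : (forall n, (u n <= c)%E) ->
  (limn_einf u <= c)%E.
Proof.
move=> uc; rewrite limn_einf_lim; apply: lime_le; first exact: is_cvg_einfs.
near=> n; apply: le_trans (uc n); apply: ereal_inf_lbound.
by exists n => //=.
Unshelve. all: by end_near. Qed.

(* The difference quotients of [p] converge to [g] almost everywhere (Lebesgue),
   so Fatou's lemma passes to the limit in [int_diff_quotient_le]. *)
Lemma parseval_le : \int[mu]_(x in `[0, P]) (g x ^+ 2) <= pi * S2.
Proof.
have P0 := @period_gt0 R.
have [mg g2i] := g2; have gi := L2i_itg g2; have [_ pE] := pg.
(* Cut off outside [[0, P]], so that Lebesgue's differentiation theorem applies to a function
   integrable on the whole line. *)
pose f0 := g \_ `[0, P].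
have f0i : mu.-integrable [set: R] (EFin \o f0).
  by rewrite /f0 -restrict_EFin; apply/integrable_restrict => //; rewrite setTI.
have loc : locally_integrable [set: R] f0.
  split; [by move/integrableP : f0i => [/measurable_EFinP]|exact: openT|move=> K _ cK].
  have : mu.-integrable K (EFin \o f0) by apply: integrableS f0i => //; exact: compact_measurable.
  by move=> /integrableP[_].
have f0iy y : mu.-integrable [set` Interval (BLeft (0 : R)) (BRight y)] (EFin \o f0).
  exact: integrableS f0i.
have [Z [mZ Z0 HZ]] := FTC1 f0iy loc.
(* At every point of [D] the primitive is differentiable with derivative [g], and only a null set of
   [[0, P]] is left out. *)
pose D := `]0, P[%classic `\` Z.
have mD : measurable D by exact: measurableD.
pose h (k : nat) : R := k.+1%:R^-1.
have h0 k : 0 < h k by rewrite invr_gt0 ltr0n.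
pose G (k : nat) x := (((p (x + h k) - p x) / h k) ^+ 2)%:E.
have cG k : continuous (fun x => ((p (x + h k) - p x) / h k) ^+ 2).
  apply: continuousX_fun; apply: continuousM_fun; last exact: cst_continuous.
  move=> x; apply: (@continuousB _ _ _ (fun x => p (x + h k)) p); last exact: cp.
  apply: (@continuous_comp _ _ _ (fun x => x + h k) p); last exact: cp.
  by apply: (@continuousD _ _ _ id (cst (h k))) => //; exact: cst_continuous.
have mG k : measurable_fun setT (G k).
  by apply/measurable_EFinP; exact: continuous_measurable_fun (cG k).
have Dsub : D `<=` `[0, P].
  by move=> x [/= + _]; rewrite !in_itv/= => /andP[/ltW -> /ltW ->].
have lim x : D x -> G k x @[k --> \oo] --> ((g x) ^+ 2)%:E.
  move=> [/= xP Zx]; move: (xP); rewrite in_itv/= => /andP[x0 xlt].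
  have : derivable (fun y : R => \int[mu]_(t in [set` Interval (BLeft (0 : R)) (BRight y)]) f0 t) x 1 /\
    derive1 (fun y : R => \int[mu]_(t in [set` Interval (BLeft (0 : R)) (BRight y)]) f0 t) x = f0 x.
    by apply: contrapT => H; apply: Zx; apply: HZ => /= H'; apply: H; apply: H'; rewrite lte_fin.
  have -> : f0 x = g x by rewrite /f0 patchE mem_set//=; exact: subset_itv_oo_cc.
  move=> [dF F'].
  have dF1 : is_derive x (1 : R) (fun y : R => \int[mu]_(t in `[0, y]) f0 t : R) (g x).
    by apply: DeriveDef; [exact: dF|rewrite -derive1E; exact: F'].
  have H := (is_derive_epsP _ _ _).1 dF1.
  have C : (fun k => (p (x + h k) - p x) / h k) @ \oo --> g x.
    apply/cvgrPdist_le => e e0; have [d d0 Hd] := H e e0.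
    near=> k.
    have hd : `|h k| < d.
      rewrite gtr0_norm//; near: k.
      have /cvgrPdist_lt/(_ _ d0) := @cvg_harmonic R.
      by apply: filterS => k; rewrite sub0r normrN gtr0_norm ?invr_gt0.
    have hP : h k < P - x.
      near: k; have Px : 0 < P - x by rewrite subr_gt0.
      have /cvgrPdist_lt/(_ _ Px) := @cvg_harmonic R.
      by apply: filterS => k; rewrite sub0r normrN gtr0_norm ?invr_gt0.
    have := Hd _ hd.
    have FE y : 0 <= y -> y <= P -> \int[mu]_(t in `[0, y]) f0 t = p y - p 0.
      move=> y0 yP; rewrite (pE y) ?in_itv/= ?y0// addrC addKr.
      apply: eq_int => t; rewrite in_itv/= => /andP[t0 ty].
      by rewrite /f0 patchE mem_set//= in_itv/= t0 (le_trans ty).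
    rewrite !FE ?(ltW x0) ?(ltW xlt)//; last 2 first.
    - by rewrite addr_ge0// ltW.
    - by rewrite -lerBrDl ltW.
    move=> H1.
    have -> : g x - (p (x + h k) - p x) / h k =
        - ((p (x + h k) - p 0 - (p x - p 0) - h k * g x) / h k).
      by field; rewrite gt_eqF.
    by rewrite normrN normf_div ler_pdivrMr ?normr_gt0 ?gt_eqF.
  rewrite /G; apply: cvg_EFin; first by near=> k.
  have -> : (fine \o (fun k => (((p (x + h k) - p x) / h k) ^+ 2)%:E)) =
     (fun k => ((p (x + h k) - p x) / h k) * ((p (x + h k) - p x) / h k)).
    by apply/funext => k /=; rewrite expr2.
  by rewrite expr2; exact: cvgM.
have fat := fatou mu mD (fun k => measurable_funTS (mG k)).
have G0 k x : D x -> (0 <= G k x)%E by move=> _; rewrite lee_fin sqr_ge0.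
have {}fat := fat G0.
have ub : (limn_einf (fun n => \int[mu]_(x in D) G n x) <= (pi * S2)%:E)%E.
  apply: limn_einf_le => k.
  apply: (@le_trans _ _ (\int[mu]_(x in `[0%R, P]) G k x)%E).
    apply: ge0_subset_integral => //; first by apply: measurable_funTS; exact: mG.
    by move=> x _; rewrite lee_fin sqr_ge0.
  have := int_diff_quotient_le (lt0r_neq0 (h0 k)); rewrite -lee_fin.
  rewrite /Rintegral fineK//; apply: integrable_fin_num => //.
  exact: itg_cont (cG k).
have {fat}ub := le_trans fat ub.
rewrite -lee_fin; apply: le_trans ub.
rewrite /Rintegral fineK; last exact: integrable_fin_num.
have mg2 : measurable_fun `[0, P] (fun x => ((g x) ^+ 2)%:E).
  by apply/measurable_EFinP; exact: measurable_funX.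
have -> : (\int[mu]_(x in `[0%R, P]) ((g x) ^+ 2)%:E = \int[mu]_(x in `]0%R, P[) ((g x) ^+ 2)%:E)%E.
  rewrite -integral_itv_obnd_cbnd -?integral_itv_bndo_bndc//.
  - apply: measurable_funS mg2 => //; exact: subset_itv_oo_cc.
  - apply: measurable_funS mg2 => //; exact: subset_itv_oc_cc.
have -> : (\int[mu]_(x in `]0%R, P[) ((g x) ^+ 2)%:E = \int[mu]_(x in D) ((g x) ^+ 2)%:E)%E.
  apply: ge0_negligible_integral => //.
  - by apply: measurable_funS mg2 => //; exact: subset_itv_oo_cc.
  - by move=> x _; rewrite lee_fin sqr_ge0.
rewrite le_eqVlt; apply/orP; left; apply/eqP; apply: eq_integral => x; rewrite inE => /lim.
by move=> /cvg_limn_einf_sup[->].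
Unshelve. all: by end_near. Qed.

(** Bessel's identity and Parseval's inequality combined: the L^2 error of the differentiated
    partial sums is a tail of a convergent series. Both the enlargement of the class of test
    functions and the study of the initial time rely on it. *)
Lemma int_sub_partial_le N :
  \int[mu]_(x in `[0, P]) ((g x - series (mode da db ^~ x) N) ^+ 2) <=
  pi * tailsum (fun n => da n ^+ 2 + db n ^+ 2) N.
Proof.
rewrite (int_sub_partial pg pP0 g2) /tailsum mulrBr -/a -/b lerD2r.
exact: parseval_le.
Qed.

End fixed.
End parseval.

(** * Gevrey cut-off functions *)

Section box_averages.
Context {R : realType}.
Notation mu := (@lebesgue_measure R).
Implicit Types (f g F : R -> R) (t : R).

(** Average forwards over [[t, t + h]]. Its derivative is [dq h f], so that each derivative of an
    iterated average becomes a difference quotient of the function one started from. *)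
Definition avg (h : R) f t := h^-1 * \int[mu]_(s in `[t, (t + h)]) f s.
Definition dq (h : R) f t := (f (t + h) - f t) / h.

Lemma avg_primitive (h : R) f F t : 0 < h -> continuous f ->
  (forall x, is_derive x (1 : R) F (f x)) -> avg h f t = (F (t + h) - F t) / h.
Proof.
move=> h0 cf dF; have th : t <= t + h by rewrite lerDl ltW.
by rewrite /avg (int_derive th cf dF) mulrC.
Qed.

Lemma is_derive_shift F (l : R) t (h : R) : is_derive (t + h) (1 : R) F l ->
  is_derive t (1 : R) (fun s => F (s + h)) l.
Proof.
move=> dF; have dc : is_derive t (1 : R) (fun s : R => s + h) 1.
  by apply: is_derive_eq; rewrite addr0.
by have := is_derive1_comp (f := F) (g := fun s => s + h) dF dc; rewrite mulr1.
Qed.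

Lemma avg_derive (h : R) f t : 0 < h -> continuous f ->
  is_derive t (1 : R) (avg h f) (dq h f t).
Proof.
move=> h0 cf; have [F dF] := primitive_ex cf.
rewrite (_ : avg h f = (fun s => h^-1 * (F (s + h) - F s))); last first.
  by apply/funext => s; rewrite (avg_primitive s h0 cf dF) mulrC.
have d1 := @is_derive_shift F (f (t + h)) t h (dF _); have d2 := dF t.
by apply: is_derive_eq; rewrite /GRing.scale /= /dq mulrC.
Qed.

Definition lipschitz_by (L : R) f := forall s t, `|f s - f t| <= L * `|s - t|.

Lemma lipschitz_continuous L f : lipschitz_by L f -> continuous f.
Proof.
move=> lf t; apply/cvgrPdist_le => e e0.
have L0 : 0 <= L by have := le_trans (normr_ge0 _) (lf 1 0); rewrite subr0 normr1 mulr1.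
have d0 : 0 < e / (L + 1) by rewrite divr_gt0//; lra.
near=> s; apply: le_trans (lf _ _) _.
have : `|t - s| <= e / (L + 1) by near: s; apply: cvgr_dist_le.
rewrite ler_pdivlMr; last lra.
by have := normr_ge0 (t - s); lra.
Unshelve. all: by end_near. Qed.

Lemma avg_const (h : R) f t c : 0 < h ->
  (forall s, t <= s -> s <= t + h -> f s = c) -> avg h f t = c.
Proof.
move=> h0 H; rewrite /avg (@eq_int _ _ (fun=> c)); last first.
  by move=> s; rewrite in_itv/= => /andP[]; exact: H.
rewrite int_cst ?lerDl ?(ltW h0)// addrAC subrr add0r mulrCA mulVf ?mulr1//.
exact: lt0r_neq0.
Qed.

Lemma avg_dist (h : R) f g t c : 0 < h -> continuous f -> continuous g ->
  (forall s, `|f s - g s| <= c) -> `|avg h f t - avg h g t| <= c.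
Proof.
move=> h0 cf cg fg; rewrite /avg -mulrBr -intB; [|exact: itg_cont..].
rewrite normrM gtr0_norm ?invr_gt0// mulrC ler_pdivrMr//.
have th : t <= t + h by rewrite lerDl ltW.
rewrite -[X in _ <= _ * X](_ : t + h - t = h); last by ring.
by apply: int_bound => //; apply: itgB; exact: itg_cont.
Qed.

Lemma avg_near (h L : R) f t : 0 < h -> lipschitz_by L f -> `|avg h f t - f t| <= L * h.
Proof.
move=> h0 lf; have cf := lipschitz_continuous lf.
have L0 : 0 <= L by have := le_trans (normr_ge0 _) (lf 1 0); rewrite subr0 normr1 mulr1.
have -> : f t = avg h (fun=> f t) t by rewrite (avg_const (c := f t)).
rewrite /avg -mulrBr -intB; [|exact: itg_cont|by apply: itg_cont; exact: cst_continuous].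
rewrite normrM gtr0_norm ?invr_gt0// mulrC ler_pdivrMr//.
have th : t <= t + h by rewrite lerDl ltW.
rewrite -[X in _ <= _ * X](_ : t + h - t = h); last by ring.
apply: int_bound => //.
  by apply: itgB; [exact: itg_cont|apply: itg_cont; exact: cst_continuous].
move=> s; rewrite in_itv/= => /andP[ts sh]; apply: le_trans (lf _ _) _.
by rewrite ler_wpM2l// ger0_norm; lra.
Qed.

Lemma dq_avg (h k : R) f t : 0 < h -> continuous f -> dq k (avg h f) t = avg h (dq k f) t.
Proof.
move=> h0 cf; have [F dF] := primitive_ex cf.
have dG x : is_derive x (1 : R) (fun s => k^-1 * (F (s + k) - F s)) (dq k f x).
  have d1 := @is_derive_shift F (f (x + k)) x k (dF _); have d2 := dF x.
  by apply: is_derive_eq; rewrite /GRing.scale /= /dq mulrC.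
have cd : continuous (dq k f).
  apply: continuousM_fun; last exact: cst_continuous.
  apply: continuousD_fun.
    move=> x; apply: (@continuous_comp _ _ _ (fun s => s + k) f); last exact: cf.
    by apply: (@continuousD _ _ _ id (cst k)) => //; exact: cst_continuous.
  by move=> x; apply: (@continuousN _ _ _ f); exact: cf.
rewrite (avg_primitive t h0 cd dG) /dq !(avg_primitive _ h0 cf dF).
by rewrite (addrAC t h k); ring.
Qed.

Lemma avg_lipschitz (h L : R) f : 0 < h -> lipschitz_by L f -> lipschitz_by L (avg h f).
Proof.
move=> h0 lf s t; have cf := lipschitz_continuous lf.
have sh : avg h f s = avg h (fun x => f (x + (s - t))) t.
  have [F dF] := primitive_ex cf.
  have dG x : is_derive x (1 : R) (fun y => F (y + (s - t))) (f (x + (s - t))).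
    exact: is_derive_shift.
  have cfs : continuous (fun x => f (x + (s - t))).
    move=> x; apply: (@continuous_comp _ _ _ (fun y => y + (s - t)) f); last exact: cf.
    by apply: (@continuousD _ _ _ id (cst (s - t))) => //; exact: cst_continuous.
  rewrite (avg_primitive _ h0 cf dF) (avg_primitive _ h0 cfs dG).
  by congr ((F _ - F _) / _); ring.
rewrite sh; apply: avg_dist => //.
- move=> x; apply: (@continuous_comp _ _ _ (fun y => y + (s - t)) f); last exact: cf.
  by apply: (@continuousD _ _ _ id (cst (s - t))) => //; exact: cst_continuous.
- by move=> x; apply: le_trans (lf _ _) _; rewrite addrAC subrr add0r.
Qed.

Lemma dq_lipschitz (h L : R) f : 0 < h -> lipschitz_by L f -> lipschitz_by (2 / h * L) (dq h f).
Proof.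
move=> h0 lf s t; rewrite /dq -mulrBl normrM [`|h^-1|]gtr0_norm ?invr_gt0//.
rewrite ler_pdivrMr// (_ : 2 / h * L * _ * h = L * `|s - t| + L * `|s - t|); last by field; rewrite gt_eqF.
have -> : f (s + h) - f s - (f (t + h) - f t) = (f (s + h) - f (t + h)) - (f s - f t) by ring.
apply: le_trans (ler_normB _ _) _; apply: lerD; last exact: lf.
by apply: le_trans (lf _ _) _; rewrite opprD addrACA subrr addr0.
Qed.

Lemma dq_bound (h M : R) f : 0 < h -> (forall t, `|f t| <= M) -> forall t, `|dq h f t| <= 2 / h * M.
Proof.
move=> h0 fM t; rewrite /dq normrM [`|h^-1|]gtr0_norm ?invr_gt0// ler_pdivrMr//.
rewrite (_ : 2 / h * M * h = M + M); last by field; rewrite gt_eqF.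
by apply: le_trans (ler_normB _ _) _; apply: lerD.
Qed.

Section iteration.
Variables (h : nat -> R) (sg : R).
Hypotheses (h0 : forall n, 0 < h n) (sh : forall n m, \sum_(0 <= k < m) h (n + k)%N <= sg).

(** The widths are [h n, ..., h (n + m - 1)] with [h n] outermost, so that the limit in [m]
    satisfies [lavg n g = avg (h n) (lavg n.+1 g)]. *)
Fixpoint iavg n m g := if m is m'.+1 then avg (h n) (iavg n.+1 m' g) else g.

Lemma iavg_lipschitz L n m g : lipschitz_by L g -> lipschitz_by L (iavg n m g).
Proof. by move=> lg; elim: m n => [|m IH] n //=; exact: avg_lipschitz. Qed.

(** The new innermost average moves a Lipschitz function by at most [L] times its width, and the
    outer averages do not enlarge a uniform distance. *)
Lemma iavg_step L n m g t : lipschitz_by L g ->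
  `|iavg n m.+1 g t - iavg n m g t| <= L * h (n + m)%N.
Proof.
move=> lg; elim: m n t => [|m IH] n t; first by rewrite addn0; exact: avg_near.
rewrite addnS -addSn /=; apply: avg_dist => //; last by move=> s; exact: IH.
- by apply: lipschitz_continuous; apply: (iavg_lipschitz n.+1 m.+1 lg).
- by apply: lipschitz_continuous; apply: (iavg_lipschitz n.+1 m lg).
Qed.

Definition lavg n g t := limn (fun m => iavg n m g t).

Lemma iavgE n m g t : iavg n m g t = g t + series (fun k => iavg n k.+1 g t - iavg n k g t) m.
Proof. by rewrite /series /= telescope_sumr// addrC subrK. Qed.

Lemma sumh_shift n : abs_summable (fun k => h (n + k)%N).
Proof.
apply: (@abs_summable_bounded _ _ sg) => N.
rewrite (eq_bigr (fun k => h (n + k)%N)); last by move=> i _; rewrite gtr0_norm.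
exact: sh.
Qed.

Lemma lavg_tail L n m g t : lipschitz_by L g ->
  `|lavg n g t - iavg n m g t| <= L * tailsum (fun k => h (n + k)%N) m.
Proof.
move=> lg; pose u k := iavg n k.+1 g t - iavg n k g t.
have uL k : `|u k| <= L * h (n + k)%N by exact: iavg_step.
have sL : abs_summable (fun k => L * h (n + k)%N) by exact/abs_summableZ/sumh_shift.
have -> : lavg n g t = g t + limn (series u).
  rewrite /lavg (_ : (fun m => _) = (fun m => cst (g t) m + series u m)); last first.
    by apply/funext => k; rewrite iavgE.
  rewrite limD; [|exact: is_cvg_cst|exact/abs_summable_cvg/(abs_summable_le uL)].
  by rewrite lim_cst//; exact: Rhausdorff.
rewrite iavgE opprD addrACA subrr add0r; apply: le_trans (tail_le m uL sL) _.
by rewrite /tailsum lim_seriesM ?mulrBr; [rewrite /series /= -mulr_sumr|exact: sumh_shift].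
Qed.

Lemma lavg_approx L n g (e : R) : lipschitz_by L g -> 0 < e ->
  exists N, forall m, (N <= m)%N -> forall t, `|lavg n g t - iavg n m g t| <= e.
Proof.
move=> lg e0.
have L0 : 0 <= L by have := le_trans (normr_ge0 _) (lg 1 0); rewrite subr0 normr1 mulr1.
have d0 : 0 < e / (L + 1) by rewrite divr_gt0//; lra.
have [N HN] := tailsum_small (@sumh_shift n) d0.
exists N => m Nm t; apply: le_trans (lavg_tail n m t lg) _.
have := HN m Nm; rewrite ler_pdivlMr; last lra.
have := ler_norm (tailsum (fun k => h (n + k)%N) m).
move: (tailsum _ _) => x; have := normr_ge0 x; move=> x0 xx xe.
by apply: le_trans (ler_wpM2l L0 xx) _; lra.
Qed.

Lemma lavg_lipschitz L n g : lipschitz_by L g -> lipschitz_by L (lavg n g).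
Proof.
move=> lg s t; apply/ler_addgt0Pr => e e0.
have e2 : 0 < e / 2 by rewrite divr_gt0.
have [N HN] := lavg_approx n lg e2.
have H1 := HN N (leqnn _) s; have H2 := HN N (leqnn _) t.
have H3 := iavg_lipschitz n N lg s t.
have -> : lavg n g s - lavg n g t = (lavg n g s - iavg n N g s) - (lavg n g t - iavg n N g t)
  + (iavg n N g s - iavg n N g t) by ring.
apply: le_trans (ler_normD _ _) _; rewrite addrC lerD//.
by apply: le_trans (ler_normB _ _) _; lra.
Qed.

Lemma lavg_avg L n g t : lipschitz_by L g -> lavg n g t = avg (h n) (lavg n.+1 g) t.
Proof.
move=> lg; apply/eqP; rewrite -subr_eq0; apply/eqP.
apply: (@small_eq0 _ _ 2) => e e0 _.
have [N1 H1] := lavg_approx n lg e0; have [N2 H2] := lavg_approx n.+1 lg e0.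
have A1 := H1 (maxn N1 N2).+1 (leqW (leq_maxl _ _)) t.
have A2 := H2 (maxn N1 N2) (leq_maxr _ _).
have A3 : `|iavg n (maxn N1 N2).+1 g t - avg (h n) (lavg n.+1 g) t| <= e.
  apply: avg_dist => //.
  - exact/lipschitz_continuous/(iavg_lipschitz _ _ lg).
  - exact/lipschitz_continuous/(lavg_lipschitz _ lg).
  - by move=> s; rewrite distrC.
move: A1 A3; move: (iavg _ _ _ _) (avg _ _ _) => A B A1 A3.
have -> : lavg n g t - B = (lavg n g t - A) + (A - B) by ring.
by apply: le_trans (ler_normD _ _) _; lra.
Qed.

Lemma iavg_dq k L n m g t : lipschitz_by L g -> dq k (iavg n m g) t = iavg n m (dq k g) t.
Proof.
move=> lg; elim: m n t => [|m IH] n t //=.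
rewrite dq_avg//; last exact/lipschitz_continuous/(iavg_lipschitz _ _ lg).
by congr (avg _ _ _); apply/funext => s; exact: IH.
Qed.

Lemma lavg_dq k L n g t : 0 < k -> lipschitz_by L g -> dq k (lavg n g) t = lavg n (dq k g) t.
Proof.
move=> k0 lg; apply/eqP; rewrite -subr_eq0; apply/eqP.
apply: (@small_eq0 _ _ (2 / k + 1)) => e e0 _.
have ldg := dq_lipschitz k0 lg.
have [N1 H1] := lavg_approx n lg e0; have [N2 H2] := lavg_approx n ldg e0.
have A1 s := H1 (maxn N1 N2) (leq_maxl _ _) s.
have A2 := H2 (maxn N1 N2) (leq_maxr _ _) t.
rewrite -(iavg_dq k _ _ _ lg) in A2.
have -> : dq k (lavg n g) t - lavg n (dq k g) t =
  dq k (fun s => lavg n g s - iavg n (maxn N1 N2) g s) t -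
  (lavg n (dq k g) t - dq k (iavg n (maxn N1 N2) g) t) by rewrite /dq; ring.
apply: le_trans (ler_normB _ _) _; rewrite mulrDl mul1r lerD//.
exact: dq_bound.
Qed.

(** Only the outermost average is differentiated; the difference quotient that results commutes with
    all the others. *)
Lemma lavg_derive L n g t : lipschitz_by L g ->
  is_derive t (1 : R) (lavg n g) (lavg n.+1 (dq (h n) g) t).
Proof.
move=> lg; rewrite -(lavg_dq n.+1 t (h0 n) lg).
rewrite (_ : lavg n g = avg (h n) (lavg n.+1 g)); last first.
  by apply/funext => s; exact: lavg_avg lg.
by apply: avg_derive => //; exact/lipschitz_continuous/(lavg_lipschitz _ lg).
Qed.

Lemma iavg_bound L n m g M t : lipschitz_by L g -> (forall s, `|g s| <= M) -> `|iavg n m g t| <= M.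
Proof.
move=> lg gM; elim: m n t => [|m IH] n t //=.
have -> : avg (h n) (iavg n.+1 m g) t = avg (h n) (iavg n.+1 m g) t - avg (h n) (fun=> 0) t.
  by rewrite (avg_const (f := fun=> 0) (c := 0)) ?subr0.
apply: avg_dist => //; last by move=> s; rewrite subr0.
- exact/lipschitz_continuous/(iavg_lipschitz _ _ lg).
- by move=> x; exact: cst_continuous.
Qed.

Lemma lavg_bound L n g M t : lipschitz_by L g -> (forall s, `|g s| <= M) -> `|lavg n g t| <= M.
Proof.
move=> lg gM; apply/ler_addgt0Pr => e e0.
have [N HN] := lavg_approx n lg e0; have := HN N (leqnn _) t.
have := iavg_bound n N t lg gM; move: (iavg _ _ _ _) (lavg _ _ _) => A B AM BA.
have -> : B = A + (B - A) by ring.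
by apply: le_trans (ler_normD _ _) _; lra.
Qed.

(** Averages look forwards: a constant value on the left survives up to the total width of the
    windows, whereas on the right nothing is lost. *)
Lemma iavg_const_left n m g c a t : (forall s, s <= a -> g s = c) ->
  t + \sum_(0 <= k < m) h (n + k)%N <= a -> iavg n m g t = c.
Proof.
move=> ga; elim: m n t => [|m IH] n t; first by rewrite big_geq// addr0; exact: ga.
rewrite big_nat_recl//= addn0 => H; apply: avg_const => // s ts sh'; apply: IH.
rewrite (eq_bigr (fun k => h (n + k.+1)%N)); last by move=> k _; rewrite addSnnS.
by lra.
Qed.

Lemma iavg_const_right n m g c b t : (forall s, b <= s -> g s = c) ->
  b <= t -> iavg n m g t = c.
Proof.
move=> gb; elim: m n t => [|m IH] n t bt; first exact: gb.
by apply: avg_const => // s ts _; apply: IH; lra.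
Qed.

Lemma lavg_const_left L n g c a t : lipschitz_by L g -> (forall s, s <= a -> g s = c) ->
  t + sg <= a -> lavg n g t = c.
Proof.
move=> lg ga ta; apply/eqP; rewrite -subr_eq0; apply/eqP.
apply: (@small_eq0 _ _ 1) => e e0 _; have [N HN] := lavg_approx n lg e0.
have := HN N (leqnn _) t; rewrite (iavg_const_left ga) ?mul1r//.
by apply: le_trans ta; rewrite lerD2l.
Qed.

Lemma lavg_const_right L n g c b t : lipschitz_by L g -> (forall s, b <= s -> g s = c) ->
  b <= t -> lavg n g t = c.
Proof.
move=> lg gb bt; apply/eqP; rewrite -subr_eq0; apply/eqP.
apply: (@small_eq0 _ _ 1) => e e0 _; have [N HN] := lavg_approx n lg e0.
by have := HN N (leqnn _) t; rewrite (iavg_const_right _ _ gb bt) mul1r.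
Qed.

Fixpoint dqs n g := if n is n'.+1 then dq (h n') (dqs n' g) else g.

Lemma dqs_lipschitz L n g : lipschitz_by L g -> exists L', lipschitz_by L' (dqs n g).
Proof.
move=> lg; elim: n => [|n [L' IH]]; first by exists L.
by exists (2 / h n * L'); exact: dq_lipschitz.
Qed.

Lemma dqs_bound n g M t : (forall s, `|g s| <= M) ->
  `|dqs n g t| <= (\prod_(0 <= k < n) (2 / h k)) * M.
Proof.
move=> gM; elim: n t => [|n IH] t; first by rewrite big_geq// mul1r.
by rewrite big_nat_recr//= (mulrC (\prod_(_ <= _ < _) _)) -mulrA; exact: dq_bound.
Qed.

End iteration.

(** Ratio test against [(2 n)! / Q^n], whose consecutive ratio is [(2 n + 2) (2 n + 1) / Q]. The
    constant absorbs the finitely many indices up to [M]. *)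
Lemma growth_bound (d : nat -> R) (Q : R) M : 0 < Q -> (forall n, 0 <= d n) ->
  (forall n, (M <= n)%N -> d n.+1 <= d n * ((n.*2.+2)%:R * (n.*2.+1)%:R / Q)) ->
  exists2 C, 0 < C & forall n, d n <= C * ((n.*2)`!%:R / Q ^+ n).
Proof.
move=> Q0 d0 H.
pose r n := d n * (Q ^+ n / (n.*2)`!%:R).
have f0 n : (0 : R) < n`!%:R by rewrite ltr0n fact_gt0.
have r0 n : 0 <= r n by rewrite mulr_ge0// divr_ge0 ?exprn_ge0 ?ltW.
have dr n : d n = r n * ((n.*2)`!%:R / Q ^+ n).
  by rewrite /r; field; rewrite !gt_eqF ?exprn_gt0.
have rdec n : (M <= n)%N -> r n.+1 <= r n.
  move=> Mn; rewrite /r; apply: le_trans (ler_wpM2r _ (H n Mn)) _.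
    by rewrite divr_ge0 ?exprn_ge0 ?ltW.
  rewrite le_eqVlt; apply/orP; left; apply/eqP.
  rewrite doubleS !factS !natrM exprS; field.
  by rewrite !gt_eqF ?ltr0n ?fact_gt0//=; rewrite -natrM.
exists (\sum_(0 <= i < M.+1) r i + 1); first by rewrite ltr_wpDl// sumr_ge0.
move=> n; rewrite dr ler_wpM2r ?divr_ge0 ?exprn_ge0 ?(ltW Q0)//.
have big i : (i <= M)%N -> r i <= \sum_(0 <= i < M.+1) r i.
  by move=> iM; rewrite big_mkord (bigD1 (inord i))//= inordK// lerDl; apply: sumr_ge0.
apply: (@le_trans _ _ (\sum_(0 <= i < M.+1) r i)); last by rewrite lerDl.
have [nM|/ltnW Mn] := leqP n M; first exact: big.
elim: n Mn => [|n IH]; first by rewrite leqn0 => /eqP MM; apply: big; rewrite MM.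
rewrite leq_eqVlt => /predU1P[<-|]; first exact: big.
by rewrite ltnS => Mn; apply: le_trans (rdec _ Mn) (IH Mn).
Qed.

Definition ramp (a b t : R) : R := Num.max 0 (Num.min 1 ((b - t) / (b - a))).

Lemma ramp_lipschitz a b : a < b -> lipschitz_by (b - a)^-1 (ramp a b).
Proof.
move=> ab s t; have ba : 0 < b - a by rewrite subr_gt0.
have -> : (b - a)^-1 * `|s - t| = `|(b - s) / (b - a) - (b - t) / (b - a)|.
  rewrite -mulrBl normrM [`|(b - a)^-1|]gtr0_norm ?invr_gt0// mulrC; congr (_ * _).
  by rewrite distrC; congr `|_|; ring.
rewrite /ramp; move: ((b - s) / _) ((b - t) / _) => x y.
by rewrite !maxEle !minEle; case: (leP 1 x) => ?; case: (leP 1 y) => ?; rewrite ?ler01;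
  try (case: (leP 0 x) => ?); try (case: (leP 0 y) => ?); rewrite ler_norml; apply/andP; split; have := ler_norm (x - y); have := ler_norm (- (x - y));
  rewrite normrN; lra.
Qed.

(* Iterated box averages of widths [h_n = K / ((n + M) (n + M + 1))] have total
   width [K / M], as small as we please, while the ratio of the bounds on
   successive derivatives is [2 / h_n ~ 2 n^2 / K]. *)
Lemma cutoff_ex (a b Q : R) : a < b -> 0 < Q -> exists phi : nat -> R -> R,
  [/\ forall n t, is_derive t (1 : R) (phi n) (phi n.+1 t),
      forall t, t <= a -> phi 0%N t = 1, forall t, b <= t -> phi 0%N t = 0 &
      exists2 C, 0 < C & forall n t, `|phi n t| <= C * ((n.*2)`!%:R / Q ^+ n)].
Proof.
(* The ramp occupies [[c, b]], and the averages spread it to the left by at most [c - a]. *)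
move=> ab Q0; pose c := (a + b) / 2.
have [ac cb] : a < c /\ c < b by rewrite /c; split; lra.
(* Makes [2 / h n] equal to [(n + M) (n + M + 1) / Q], which is at most [(2 n + 2) (2 n + 1) / Q]
   once [M <= n]. *)
pose K := 2 * Q.
have K0 : 0 < K by rewrite mulr_gt0.
pose M := (Num.bound (K / (c - a))).+1.
have M0 : (0 : R) < M%:R by rewrite ltr0n.
have KM : K / M%:R <= c - a.
  rewrite ler_pdivrMr// mulrC -ler_pdivrMr ?subr_gt0//.
  apply: ltW; apply: lt_le_trans (archi_boundP _) _; first by rewrite divr_ge0 ?(ltW K0)// subr_ge0 ltW.
  by rewrite ler_nat.
pose h (n : nat) : R := K / ((n + M)%:R * (n + M).+1%:R).
have p0 n : (0 : R) < (n + M)%:R by rewrite ltr0n addn_gt0 orbT.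
have h0 n : 0 < h n by rewrite divr_gt0// mulr_gt0.
have sh n m : \sum_(0 <= k < m) h (n + k)%N <= c - a.
  have -> : \sum_(0 <= k < m) h (n + k)%N = K * ((n + M)%:R^-1 - (n + m + M)%:R^-1).
    elim: m => [|m IH]; first by rewrite big_geq// addn0 subrr mulr0.
    rewrite big_nat_recr//= IH /h addnS addSn -[(n + m + M).+1%:R]natr1.
    have := p0 (n + m)%N; move: ((n + m + M)%:R) => y y0.
    by field; rewrite !gt_eqF -?natrD ?p0//; lra.
  apply: le_trans KM; rewrite ler_pM2l//.
  apply: (@le_trans _ _ (n + M)%:R^-1); first by rewrite gerBl invr_ge0.
  by rewrite lef_pV2 ?posrE// ler_nat leq_addl.
pose g := ramp c b; have lg := ramp_lipschitz cb; rewrite -/g in lg.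
have gb t : `|g t| <= 1.
  rewrite /g /ramp ger0_norm; last by rewrite le_max lexx.
  by rewrite ge_max ler01 ge_min lexx.
exists (fun n => lavg h n (dqs h n g)); split.
- move=> n t; have [L' lL] := dqs_lipschitz h0 n lg.
  exact: (lavg_derive h0 sh n t lL).
- move=> t ta; apply: (lavg_const_left h0 sh (a := c) _ lg); last lra.
  move=> s sc; rewrite /g /ramp; have : 1 <= (b - s) / (b - c).
    by rewrite ler_pdivlMr ?subr_gt0//; lra.
  by rewrite maxEle minEle; case: (leP 1 ((b - s) / (b - c))) => ?; rewrite ?ler01;
      try (case: (leP 0 ((b - s) / (b - c))) => ?); lra.
- move=> t bt; apply: (lavg_const_right h0 sh _ lg _ bt) => s sb.
  rewrite /g /ramp; have : (b - s) / (b - c) <= 0.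
    by rewrite pmulr_lle0 ?invr_gt0 ?subr_gt0//; lra.
  by rewrite maxEle minEle; case: (leP 1 ((b - s) / (b - c))) => ?; rewrite ?ler01;
      try (case: (leP 0 ((b - s) / (b - c))) => ?); lra.
- have [|n Mn|C C0 HC] := @growth_bound (fun n => \prod_(0 <= k < n) (2 / h k)) Q M Q0.
  + by move=> n; apply: prodr_ge0 => k _; rewrite divr_ge0// ltW.
  + rewrite big_nat_recr//= ler_wpM2l ?prodr_ge0// => [k _|].
      by rewrite divr_ge0// ltW.
    have -> : 2 / h n = ((n + M)%:R * (n + M).+1%:R) / Q.
      rewrite /h /K; move: (p0 n) (ltr0Sn R (n + M)).
      move: ((n + M)%:R) ((n + M).+1%:R) => u v u0 v0.
      by field; rewrite !gt_eqF.
    rewrite ler_pM2r ?invr_gt0// -!natrM ler_nat mulnC leq_mul//.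
      by rewrite ltnS leqW// -addnn leq_add2l.
    by rewrite leqW// -addnn leq_add2l.
  exists C => // n t; have [L' lL] := dqs_lipschitz h0 n lg.
  apply: (lavg_bound h0 sh n t lL) => s.
  by apply: le_trans (dqs_bound h0 n s gb) _; rewrite mulr1.
Qed.

End box_averages.

(** * Flat series for the heat equation *)

Section chains.
Context {R : realType}.
Implicit Types (y z : nat -> R -> R) (t tau Q : R) (c s : nat -> R).

Definition fact_ratio Q n : R := (n.*2)`!%:R / Q ^+ n.

(** Gevrey class of order 2 on every [[tau, +oo)]. The constant depends on [tau], because the traces
    of a rough initial state may blow up at time [0]; the radius [Q] does not. *)
Definition class_bound Q y := forall tau, 0 < tau -> exists2 C, 0 < C &
  forall n t, tau <= t -> `|y n t| <= C * fact_ratio Q n.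

(** Carrying all derivatives of [y 0] along as one sequence keeps iterated derivative operators out
    of the estimates. *)
Definition chain y := forall n t, 0 < t -> is_derive t (1 : R) (y n) (y n.+1 t).

Definition shift y n := y n.+1.

Lemma chain_shift y : chain y -> chain (shift y).
Proof. by move=> cy n; exact: cy. Qed.

Lemma fact_ratio_gt0 Q n : 0 < Q -> 0 < fact_ratio Q n.
Proof. by move=> Q0; rewrite divr_gt0 ?exprn_gt0// ltr0n fact_gt0. Qed.

Lemma fact_ratioS Q n : 0 < Q ->
  fact_ratio Q n.+1 = fact_ratio Q n * ((n.*2.+2)%:R * (n.*2.+1)%:R / Q).
Proof.
move=> Q0; rewrite /fact_ratio doubleS !factS !natrM exprS; field.
by rewrite gt_eqF ?expf_neq0 ?gt_eqF.
Qed.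

Lemma fact_ratio_half Q n : 0 < Q -> fact_ratio (Q / 2) n = 2 ^+ n * fact_ratio Q n.
Proof.
by move=> Q0; rewrite /fact_ratio expr_div_n; field; rewrite !expf_neq0 ?gt_eqF.
Qed.

(** One derivative multiplies the bound by [(2 n + 2) (2 n + 1) / Q], a polynomial growth that
    halving [Q] absorbs. *)
Lemma class_shift Q y : 0 < Q -> class_bound Q y -> class_bound (Q / 2) (shift y).
Proof.
move=> Q0 cy tau t0; have [C C0 HC] := cy _ t0.
have Q2 : 0 < Q / 2 by rewrite divr_gt0.
(* From [n = 2] on, [(2 n + 4) (2 n + 3) <= 2 (2 n + 2) (2 n + 1)]. *)
have [|n n2|D D0 HD] := @growth_bound R (fun n => fact_ratio Q n.+1) (Q / 2) 2 Q2.
- by move=> n; rewrite ltW// fact_ratio_gt0.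
- rewrite (fact_ratioS n.+1 Q0) ler_wpM2l ?(ltW (fact_ratio_gt0 _ _))//.
  rewrite invf_div mulrA ler_pdivrMr// mulfVK ?gt_eqF// -!natrM ler_nat.
  have n' : (n.*2 = n + n)%N by rewrite -addnn.
  rewrite doubleS n'; move: n2; clear; nia.
exists (C * D) => [|n t tt]; first by rewrite mulr_gt0.
by apply: le_trans (HC _ _ tt) _; rewrite -mulrA ler_pM2l.
Qed.

Lemma class_le Q Q' y : 0 < Q' -> Q' <= Q -> class_bound Q y -> class_bound Q' y.
Proof.
move=> Q0 QQ cy tau t0; have [C C0 HC] := cy _ t0; exists C => // n t tt.
apply: le_trans (HC _ _ tt) _; rewrite ler_pM2l// ler_pM2l ?ltr0n ?fact_gt0//.
have Q0' : 0 < Q by apply: lt_le_trans QQ.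
by rewrite lef_pV2 ?posrE ?exprn_gt0// lerXn2r// nnegrE ltW.
Qed.

Lemma class_addr Q y z : class_bound Q y -> class_bound Q z ->
  class_bound Q (fun n t => y n t + z n t).
Proof.
move=> cy cz tau t0; have [C C0 HC] := cy _ t0; have [D D0 HD] := cz _ t0.
exists (C + D) => [|n t tt]; first exact: addr_gt0.
by rewrite mulrDl; apply: le_trans (ler_normD _ _) _; apply: lerD; [exact: HC|exact: HD].
Qed.

Lemma chain_addr y z : chain y -> chain z -> chain (fun n t => y n t + z n t).
Proof. by move=> cy cz n t t0; have := cy n t t0; have := cz n t t0 => ? ?; exact: is_deriveD. Qed.

Definition const_chain (k : R) n (t : R) : R := if n == 0%N then k else 0.

Lemma chain_const k : chain (const_chain k).
Proof. by move=> [|n] t _; rewrite /const_chain /=; exact: is_derive_cst. Qed.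

Lemma class_const Q k : 0 < Q -> class_bound Q (const_chain k).
Proof.
move=> Q0 tau _; exists (`|k| + 1) => [|[|n] t _]; first by rewrite ltr_wpDl.
  by rewrite /const_chain /= /fact_ratio fact0 expr0 divr1 mulr1; lra.
by rewrite /const_chain /= normr0 mulr_ge0 ?ltW ?fact_ratio_gt0// ltr_wpDl.
Qed.

(* The successive derivatives of a product, arranged so that Leibniz' formula
   never appears: [(y z)' = y' z + y z'] at the level of whole chains. *)
Fixpoint prod_chain n y z (t : R) : R :=
  if n is n'.+1 then prod_chain n' (shift y) z t + prod_chain n' y (shift z) t
  else y 0%N t * z 0%N t.

Lemma chain_prod y z : chain y -> chain z -> chain (fun n => prod_chain n y z).
Proof.
move=> cy cz n; elim: n y z cy cz => [|n IH] y z cy cz t t0.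
  have d1 := cy 0%N t t0; have d2 := cz 0%N t t0; rewrite /= /shift.
  have d3 : is_derive t (1 : R) (fun t => y 0%N t * z 0%N t) (y 1%N t * z 0%N t + y 0%N t * z 1%N t).
    by apply: is_derive_eq; rewrite /GRing.scale /=; ring.
  exact: d3.
have d1 := IH (shift y) z (chain_shift cy) cz t t0.
have d2 := IH y (shift z) cy (chain_shift cz) t t0.
exact: (is_deriveD d1 d2).
Qed.

(** The [2^n] products of the expansion obey [(2 i)! (2 j)! <= (2 i + 2 j)!], and halving [Q] pays
    for their number. The induction runs over all shifts [i], [j] of the two chains. *)
Lemma class_prod Q y z : 0 < Q -> class_bound Q y -> class_bound Q z ->
  class_bound (Q / 2) (fun n => prod_chain n y z).
Proof.
move=> Q0 cy cz tau t0; have [C C0 HC] := cy _ t0; have [D D0 HD] := cz _ t0.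
exists (C * D) => [|n t tt]; first exact: mulr_gt0.
suff H i j : `|prod_chain n (fun k => y (i + k)%N) (fun k => z (j + k)%N) t| <=
   C * D * (2 ^+ n * fact_ratio Q (i + j + n)).
  by have := H 0%N 0%N; rewrite fact_ratio_half.
elim: n i j => [|n IH] i j.
  rewrite /= !addn0 normrM expr0 mul1r.
  apply: le_trans (ler_pM _ _ (HC _ _ tt) (HD _ _ tt)) _ => //.
  rewrite mulrACA ler_pM2l ?mulr_gt0// /fact_ratio mulrACA -invfM -exprD.
  rewrite ler_pM2r ?invr_gt0 ?exprn_gt0// -natrM ler_nat doubleD.
  by rewrite -(@bin_fact (i.*2 + j.*2) i.*2) ?leq_addr// addKn leq_pmull// bin_gt0 leq_addr.
have E1 : shift (fun k => y (i + k)%N) = (fun k => y (i.+1 + k)%N).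
  by apply/funext => k; rewrite /shift addSnnS.
have E2 : shift (fun k => z (j + k)%N) = (fun k => z (j.+1 + k)%N).
  by apply/funext => k; rewrite /shift addSnnS.
rewrite /= E1 E2; apply: le_trans (ler_normD _ _) _.
have := IH i.+1 j; have := IH i j.+1.
rewrite addnS !addSn -addnS exprS; lra.
Qed.

Lemma prod_chain0 n y z t : (forall k, y k t = 0) -> prod_chain n y z t = 0.
Proof.
elim: n y z => [|n IH] y z y0 /=; first by rewrite y0 mul0r.
by rewrite !IH ?addr0// => k; exact: y0.
Qed.

Lemma prod_chain1 n y z t : y 0%N t = 1 -> (forall k, y k.+1 t = 0) -> prod_chain n y z t = z n t.
Proof.
elim: n z => [|n IH] z y1 y0 /=; first by rewrite y1 mul1r.
by rewrite prod_chain0// add0r IH.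
Qed.

Definition freq2 (n : nat) : R := n%:R ^+ 2.

Lemma freq2_ge0 n : 0 <= freq2 n. Proof. exact: sqr_ge0. Qed.

(** A single term of the exponential series: [(k t)^j / j! <= exp (k t)]. *)
Lemma exp_decay (k t : R) j : 0 <= k -> 0 < t -> k ^+ j * expR (- (k * t)) <= j`!%:R / t ^+ j.
Proof.
move=> k0 t0; have kt : 0 <= k * t by rewrite mulr_ge0// ltW.
rewrite expRN ler_pdivrMr ?expR_gt0// mulrAC ler_pdivlMr ?exprn_gt0// -exprMn.
rewrite [leRHS]mulrC -ler_pdivrMr ?ltr0n ?fact_gt0//.
case: j => [|j]; first by rewrite expr0 fact0 divr1 -expR0 ler_expR.
by apply: le_trans (expR_ge1Dxn j kt); rewrite lerDr.
Qed.

(** Bounds [(1 + k) k^j exp (- k t)] over all [k >= 0]; the weight [1 + k] makes room for the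
    coefficients [n b_n] of a slope. *)
Definition heat_bound t j : R := j`!%:R / t ^+ j + (j.+1)`!%:R / t ^+ j.+1.

Lemma heat_bound_ge0 t j : 0 < t -> 0 <= heat_bound t j.
Proof. by move=> t0; rewrite addr_ge0// divr_ge0// exprn_ge0// ltW. Qed.

(** [j!] beats no geometric factor against [(2 j)!]: the heat flow is analytic at positive times,
    hence in the Gevrey class for every [Q]. *)
Lemma heat_bound_growth t Q : 0 < t -> 0 < Q ->
  exists2 C, 0 < C & forall j, heat_bound t j <= C * fact_ratio Q j.
Proof.
move=> t0 Q0.
apply: (@growth_bound R (heat_bound t) Q (Num.bound (Q / t)).+1) => // [n|n Mn].
  exact: heat_bound_ge0.
have Qt : Q / t <= n.+2%:R.
  apply: ltW; apply: lt_le_trans (archi_boundP _) _; first by rewrite divr_ge0 ?ltW.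
  by rewrite ler_nat (leq_trans (ltnW Mn))// ltnW// ltnW.
apply: (@le_trans _ _ (heat_bound t n * (n.+2%:R / t))).
  rewrite /heat_bound !factS !natrM !exprS.
  have T0 : 0 < t ^+ n by rewrite exprn_gt0.
  have A0 : (0 : R) < n`!%:R by rewrite ltr0n fact_gt0.
  have n12 : n.+1%:R <= n.+2%:R :> R by rewrite ler_nat.
  move: T0 A0 n12; move: (t ^+ n) (n`!%:R) (n.+1%:R) (n.+2%:R) => T A u v T0 A0 uv.
  have -> : (A / T + u * A / (t * T)) * (v / t) = v * A / (t * T) + v * (u * A) / (t * (t * T)).
    by field; rewrite !gt_eqF.
  by rewrite lerD2r ler_pM2r ?invr_gt0 ?mulr_gt0// ler_pM2r.
rewrite ler_wpM2l ?heat_bound_ge0//.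
rewrite ler_pdivrMr// in Qt.
rewrite ler_pdivrMr// mulrAC ler_pdivlMr//.
rewrite (le_trans (ler_wpM2l _ Qt))//.
rewrite mulrA ler_wpM2r ?(ltW t0)// -!natrM ler_nat.
have -> : (n.*2 = n + n)%N by rewrite -addnn.
have n0 : (0 < n)%N by apply: leq_trans Mn.
by move: n0; clear; nia.
Qed.

Section heat_chain.
Variables (c s : nat -> R).
Hypotheses (cs : forall n, `|c n| <= (1 + freq2 n) * s n) (ss : abs_summable s)
  (s0 : forall n, 0 <= s n).

(** The [j]-th time derivative of [c n exp (- n^2 t)]. *)
Definition hterm j n t := c n * (- freq2 n) ^+ j * expR (- (freq2 n * t)).
Definition hchain j t := limn (series (fun n => hterm j n t)).

Lemma hterm_le j n t tau : 0 < tau -> tau <= t -> `|hterm j n t| <= heat_bound tau j * s n.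
Proof.
move=> tau0 taut; rewrite /hterm !normrM normrX normrN.
rewrite (ger0_norm (freq2_ge0 n)) (ger0_norm (expR_ge0 _)).
have e1 : expR (- (freq2 n * t)) <= expR (- (freq2 n * tau)).
  by rewrite ler_expR lerN2 ler_wpM2l ?freq2_ge0.
have f0 := freq2_ge0 n.
apply: (@le_trans _ _ ((1 + freq2 n) * s n * freq2 n ^+ j * expR (- (freq2 n * tau)))).
  by apply: ler_pM; rewrite ?mulr_ge0 ?exprn_ge0 ?expR_ge0// ler_wpM2r ?exprn_ge0.
have := exp_decay j f0 tau0; have := exp_decay j.+1 f0 tau0.
rewrite exprS /heat_bound; move: (_ / _) (_ / _) (expR _) (freq2 n ^+ j) => A B E F H1 H2.
have := ler_wpM2r (s0 n) (lerD H2 H1); lra.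
Qed.

Lemma hterm_summable j t : 0 < t -> abs_summable (fun n => hterm j n t).
Proof.
move=> t0; apply: (abs_summable_le (v := fun n => heat_bound t j * s n)).
  by move=> n; exact: hterm_le.
exact: abs_summableZ.
Qed.

Lemma chain_hchain : chain hchain.
Proof.
move=> j t t0; have t2 : 0 < t / 2 by rewrite divr_gt0.
have near_t u : `|u - t| < t / 2 -> t / 2 <= u.
  by rewrite ltr_norml => /andP[]; lra.
apply: (@is_derive_series R (fun n => hterm j n) (fun n => hterm j.+1 n)
  (fun n => heat_bound (t / 2) j.+1 * s n) t (t / 2) t2).
- exact: abs_summableZ.
- by move=> u /near_t ut; apply: hterm_summable; lra.
- move=> n u _; rewrite /hterm.
  have d1 : is_derive u (1 : R) (fun v => - freq2 n * v) (- freq2 n).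
    by apply: is_derive_eq; rewrite /GRing.scale /= mulr1.
  have d2 := is_derive1_comp (is_derive_expR (- freq2 n * u)) d1.
  have d3 : is_derive u (1 : R) (fun v => (c n * (- freq2 n) ^+ j) * expR (- freq2 n * v))
     ((c n * (- freq2 n) ^+ j) * (expR (- freq2 n * u) * - freq2 n)).
    have d2' : is_derive u (1 : R) (fun v => expR (- freq2 n * v)) (expR (- freq2 n * u) * - freq2 n).
      exact: d2.
    by apply: is_derive_eq.
  rewrite (_ : (fun t => _) = (fun v => (c n * (- freq2 n) ^+ j) * expR (- freq2 n * v))); last first.
    by apply/funext => v; rewrite mulNr.
  by apply: is_derive_eq d3 _; rewrite exprSr mulNr; ring.
- by move=> n u /near_t ut; exact: hterm_le.
Qed.

Lemma class_hchain Q : 0 < Q -> class_bound Q hchain.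
Proof.
move=> Q0 tau tau0; have [C C0 HC] := heat_bound_growth tau0 Q0.
have S0 : 0 <= limn (series s).
  by apply: le_trans (series_lim_le (M := s) (u := s) _ ss) => // n; rewrite ger0_norm.
exists (C * (limn (series s) + 1)) => [|j t tt]; first by rewrite mulr_gt0// ltr_wpDl.
apply: le_trans (series_lim_le (fun n => hterm_le j n tau0 tt) (abs_summableZ ss)) _.
rewrite lim_seriesM// mulrAC ler_pM ?heat_bound_ge0//.
by rewrite lerDl.
Qed.

End heat_chain.
End chains.

(** * Power series in space with prescribed value and slope at the origin *)

Section flat_series.
Context {R : realType}.
Implicit Types (y z : nat -> R -> R) (t x tau Q : R).

Lemma lim_series_recl (u : nat -> R) : abs_summable u -> u 0%N = 0 ->
  limn (series u) = limn (series (fun n => u n.+1)).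
Proof.
move=> su u0; have cu := abs_summable_cvg su.
symmetry; apply/cvg_lim; first exact: Rhausdorff.
rewrite (_ : series (fun n => u n.+1) = (fun n => series u n.+1)); first by rewrite cvg_shiftS.
by apply/funext => n; rewrite /series /= [in RHS]big_nat_recl// u0 add0r.
Qed.

Lemma geometric_summable (k : R) : abs_summable (fun j => k * 2^-1 ^+ j).
Proof.
apply: abs_summableZ.
rewrite /abs_summable (_ : (fun n => _) = geometric 1 (2^-1)).
  by apply: is_cvg_geometric_series; rewrite ger0_norm ?invr_ge0// invf_lt1// ltr1n.
by apply/funext => n; rewrite /geometric /= mul1r ger0_norm// exprn_ge0// invr_ge0.
Qed.

Variable X : R.
Hypothesis X0 : 0 < X.
(** The radius for which the terms of the series decay like [2^-j] as long as [|x| <= X]. *)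
Let Q := 2 * X ^+ 2.
Let Q0 : 0 < Q. Proof. by rewrite mulr_gt0// exprn_gt0. Qed.

(** [e = 0] gives the even part of the flat solution, fed by the value at the origin, and [e = 1]
    the odd part, fed by the slope. *)
Definition pterm e y j t x := y j t * x ^+ (j.*2 + e) / (j.*2 + e)`!%:R.
Definition psi e y t x := limn (series (fun j => pterm e y j t x)).

Lemma pterm_le e y tau C : (forall n t, tau <= t -> `|y n t| <= C * fact_ratio Q n) ->
  forall j t x, tau <= t -> `|x| <= X -> `|pterm e y j t x| <= C * X ^+ e * 2^-1 ^+ j.
Proof.
move=> HC j t x tt xX; rewrite /pterm !normrM normrX normfV [`|_%:R|]ger0_norm//.
have C0 : 0 <= C.
  have := le_trans (normr_ge0 _) (HC 0%N _ (lexx tau)).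
  by rewrite pmulr_lge0// fact_ratio_gt0.
have f0 n : (0 : R) < n`!%:R by rewrite ltr0n fact_gt0.
apply: (@le_trans _ _ (C * fact_ratio Q j * X ^+ (j.*2 + e) / (j.*2 + e)`!%:R)).
  rewrite ler_pM2r ?invr_gt0// ler_pM ?exprn_ge0 ?HC//.
  by rewrite lerXn2r ?nnegrE ?(ltW X0).
have ff : ((j.*2)`!%:R : R) <= (j.*2 + e)`!%:R by rewrite ler_nat leq_fact// leq_addr.
apply: (@le_trans _ _ (C * fact_ratio Q j * X ^+ (j.*2 + e) / (j.*2)`!%:R)).
  rewrite ler_wpM2l ?lef_pV2 ?posrE// mulr_ge0 ?exprn_ge0 ?(ltW X0)// mulr_ge0//.
  by rewrite ltW// fact_ratio_gt0.
rewrite le_eqVlt; apply/orP; left; apply/eqP.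
rewrite /fact_ratio /Q exprD -mul2n exprM exprMn exprVn; field.
by rewrite !gt_eqF ?exprn_gt0// mul2n.
Qed.

Section one_chain.
Variable y : nat -> R -> R.
Hypotheses (cy : chain y) (by_ : class_bound Q y) (bsy : class_bound Q (shift y)).

Lemma pterm_summable e t x : 0 < t -> `|x| <= X -> abs_summable (fun j => pterm e y j t x).
Proof.
move=> t0 xX; have [C C0 HC] := by_ t0.
apply: (abs_summable_le (v := fun j => C * X ^+ e * 2^-1 ^+ j)); last exact: geometric_summable.
by move=> j; exact: (pterm_le e HC j (lexx t) xX).
Qed.

Lemma psi_continuous e t x : 0 < t -> `|x| < X ->
  {for (t, x), continuous (fun p : R * R => psi e y p.1 p.2)}.
Proof.
move=> t0 xX; have t2 : 0 < t / 2 by rewrite divr_gt0.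
have Xx : 0 < X - `|x| by rewrite subr_gt0.
have [C C0 HC] := by_ t2.
apply: (@continuous_series R _ (fun j (p : R * R) => pterm e y j p.1 p.2)
   (fun j => C * X ^+ e * 2^-1 ^+ j)); first exact: geometric_summable.
- near=> p => j; apply: (pterm_le e HC j).
  + suff : `|t - p.1| <= t / 2 by rewrite ler_norml => /andP[]; lra.
    near: p; apply: (@cvgr_dist_le _ _ _ _ _ (fun p : R * R => p.1) t (@cvg_fst _ _ _ _ _) _ t2).
  + suff : `|x - p.2| <= X - `|x|.
      move=> H; rewrite (_ : p.2 = x - (x - p.2)); last by ring.
      by apply: le_trans (ler_normB _ _) _; lra.
    near: p; apply: (@cvgr_dist_le _ _ _ _ _ (fun p : R * R => p.2) x (@cvg_snd _ _ _ _ _) _ Xx).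
- move=> j; rewrite /pterm.
  have c1 : {for (t, x), continuous (fun p : R * R => y j p.1)}.
    apply: (@continuous_comp _ _ _ (fun p : R * R => p.1) (y j)); first exact: cvg_fst.
    apply: differentiable_continuous; apply/derivable1_diffP.
    by have := cy j t0 => -[].
  have c2 : {for (t, x), continuous (fun p : R * R => p.2 ^+ (j.*2 + e))}.
    apply: (@continuous_comp _ _ _ (fun p : R * R => p.2) (fun x => x ^+ (j.*2 + e))); first exact: cvg_snd.
    exact: exprn_continuous.
  apply: (@continuousM _ _ (fun p : R * R => y j p.1 * p.2 ^+ (j.*2 + e)) (cst _)).
    exact: (continuousM c1 c2).
  exact: cst_continuous.
Unshelve. all: by end_near. Qed.

Lemma psi_dt e t x : 0 < t -> `|x| <= X ->
  is_derive t (1 : R) (fun t => psi e y t x) (psi e (shift y) t x).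
Proof.
move=> t0 xX; have t2 : 0 < t / 2 by rewrite divr_gt0.
have [C C0 HC] := bsy t2.
have near_t u : `|u - t| < t / 2 -> t / 2 <= u by rewrite ltr_norml => /andP[]; lra.
apply: (@is_derive_series R (fun j t => pterm e y j t x) (fun j t => pterm e (shift y) j t x)
  (fun j => C * X ^+ e * 2^-1 ^+ j) t (t / 2) t2); first exact: geometric_summable.
- by move=> u /near_t ut; apply: pterm_summable => //; lra.
- move=> j u /near_t ut; rewrite /pterm.
  have u0 : 0 < u by lra.
  have d1 := cy j u0.
  rewrite (_ : (fun t0 => _) = (fun v => (x ^+ (j.*2 + e) / (j.*2 + e)`!%:R) * y j v)); last first.
    by apply/funext => v; ring.
  by apply: is_derive_eq; rewrite /GRing.scale /= /shift; ring.
- by move=> j u /near_t ut; exact: (pterm_le e HC j ut xX).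
Qed.

Lemma psi_dx1 t x : 0 < t -> `|x| < X ->
  is_derive x (1 : R) (fun x => psi 1 y t x) (psi 0 y t x).
Proof.
move=> t0 xX; have Xx : 0 < X - `|x| by rewrite subr_gt0.
have [C C0 HC] := by_ t0.
have near_x u : `|u - x| < X - `|x| -> `|u| <= X.
  move=> H; rewrite (_ : u = x + (u - x)); last by ring.
  by apply: le_trans (ler_normD _ _) _; lra.
apply: (@is_derive_series R (fun j x => pterm 1 y j t x) (fun j x => pterm 0 y j t x)
  (fun j => C * X ^+ 0 * 2^-1 ^+ j) x (X - `|x|) Xx); first exact: geometric_summable.
- by move=> u /near_x; exact: pterm_summable.
- by move=> j u _; rewrite /pterm addn1 addn0; exact: is_derive_exprn_fact.
- by move=> j u /near_x ut; exact: (pterm_le 0 HC j (lexx t) ut).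
Qed.

(** The leading term is constant in [x] and drops out, and the other indices move by one. Combined
    with the derivative of the odd part, two space derivatives amount to one shift of the chain,
    which is also the time derivative: the heat equation. *)
Lemma psi_dx0 t x : 0 < t -> `|x| < X ->
  is_derive x (1 : R) (fun x => psi 0 y t x) (psi 1 (shift y) t x).
Proof.
move=> t0 xX; have Xx : 0 < X - `|x| by rewrite subr_gt0.
have [C C0 HC] := bsy t0.
have near_x u : `|u - x| < X - `|x| -> `|u| <= X.
  move=> H; rewrite (_ : u = x + (u - x)); last by ring.
  by apply: le_trans (ler_normD _ _) _; lra.
(* Index [0] is padded with [0], so that the termwise derivative keeps the numbering of the
   series. *)
pose f' j x := if j is j'.+1 then pterm 1 (shift y) j' t x else 0.
pose M j := if j is j'.+1 then C * X ^+ 1 * 2^-1 ^+ j' else 0.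
have ME j : M j <= 2 * (C * X ^+ 1) * 2^-1 ^+ j.
  case: j => [|j] /=; first by rewrite !mulr_ge0 ?exprn_ge0 ?(ltW X0) ?(ltW C0)//.
  by rewrite (exprS (2^-1) j) le_eqVlt; apply/orP; left; apply/eqP; field.
have sM : abs_summable M.
  apply: (abs_summable_le (v := fun j => 2 * (C * X ^+ 1) * 2^-1 ^+ j)); last exact: geometric_summable.
  move=> j.
  apply: le_trans (ME j); rewrite ger0_norm//; case: j => //= j.
  by rewrite !mulr_ge0 ?exprn_ge0 ?(ltW X0) ?(ltW C0)// invr_ge0.
have f'M j u : `|u| <= X -> `|f' j u| <= M j.
  case: j => [|j] uX /=; first by rewrite normr0.
  exact: (pterm_le 1 HC j (lexx t) uX).
have -> : psi 1 (shift y) t x = limn (series (f' ^~ x)).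
  rewrite lim_series_recl//.
  by apply: (abs_summable_le _ sM) => j; apply: f'M; exact: ltW.
apply: (@is_derive_series R (fun j x => pterm 0 y j t x) f' M x (X - `|x|) Xx sM).
- by move=> u /near_x; exact: pterm_summable.
- move=> [|j] u _.
    rewrite /pterm (_ : (fun x => _) = cst (y 0%N t)); first exact: is_derive_cst.
    by apply/funext => v; rewrite expr0 fact0 divr1 mulr1.
  rewrite /f' /pterm doubleS addn0 addn1 /shift.
  exact: is_derive_exprn_fact.
- by move=> j u /near_x; exact: f'M.
Qed.

End one_chain.

Lemma psiD e y z t x : class_bound Q y -> class_bound Q z -> 0 < t -> `|x| <= X ->
  psi e (fun n t => y n t + z n t) t x = psi e y t x + psi e z t x.
Proof.
move=> cy cz t0 xX; rewrite /psi -lim_seriesDD; [|exact: pterm_summable..].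
congr (limn (series _)); apply/funext => n.
by rewrite /pterm -mulrDl -mulrDl.
Qed.

Lemma psi_const e k t x : psi e (const_chain k) t x = k * x ^+ e / e`!%:R.
Proof.
apply/cvg_lim; first exact: Rhausdorff.
rewrite -cvg_shiftS (_ : (fun n => _) = cst (k * x ^+ e / e`!%:R)); first exact: cvg_cst.
apply/funext => n; rewrite /series /= big_nat_recl// big1 => [|j _].
  by rewrite /pterm /const_chain /= addr0.
by rewrite /pterm /const_chain /= !mul0r.
Qed.

Lemma eq_psi e y z t x : (forall n, y n t = z n t) -> psi e y t x = psi e z t x.
Proof.
move=> yz; congr (limn (series _)); apply/funext => n.
by rewrite /pterm yz.
Qed.

(** Exchange of a sum in [j] with a sum in [n]: [v J n] is the inner sum truncated at [J],
    geometrically close to its limit [w n] with weight [s n]. *)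
Lemma lim_series_exchange (p w s : nat -> R) (v : nat -> nat -> R) (D : R) :
  0 <= D -> abs_summable p -> abs_summable s -> (forall n, 0 <= s n) -> abs_summable w ->
  (forall J, series p J = limn (series (v J)) /\ abs_summable (v J)) ->
  (forall J n, `|v J n - w n| <= D * 2^-1 ^+ J * s n) ->
  limn (series p) = limn (series w).
Proof.
move=> D0 sp ss s0 sw pv vw; apply/eqP; rewrite -subr_eq0; apply/eqP.
have S0 : 0 <= limn (series s).
  by apply: le_trans (series_lim_le (M := s) (u := s) _ ss) => // n; rewrite ger0_norm.
apply: (@small_eq0 _ _ (1 + D * limn (series s))) => e e0 _.
have cc := abs_summable_cvg sp.
have [J0 HJ0] : exists J0, forall J, (J0 <= J)%N -> `|limn (series p) - series p J| <= e.
  by have := cc => /cvgrPdist_le/(_ e e0)[J0 _ H]; exists J0.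
have [J1 HJ1] : exists J1, forall J, (J1 <= J)%N -> (2^-1 : R) ^+ J <= e.
  have := @cvg_geometric R 1 2^-1; rewrite ger0_norm ?invr_ge0// invf_lt1// ltr1n => /(_ isT).
  move=> /cvgrPdist_le/(_ e e0)[J1 _ H]; exists J1 => J /H.
  by rewrite /geometric /= mul1r sub0r normrN => /(le_trans (ler_norm _)).
pose J := maxn J0 J1.
have A1 := HJ0 J (leq_maxl _ _); have A2 := HJ1 J (leq_maxr _ _).
have [p1 p2] := pv J; rewrite p1 in A1.
have A3 : `|limn (series (v J)) - limn (series w)| <= D * 2^-1 ^+ J * limn (series s).
  rewrite -lim_seriesB; [|exact: abs_summable_cvg..].
  by rewrite -lim_seriesM//; apply: series_lim_le; [exact: vw|exact: abs_summableZ].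
rewrite mulrDl mul1r -[X in `|X|](subrKA (limn (series (v J)))).
apply: le_trans (ler_normD _ _) _; apply: lerD => //.
by apply: le_trans A3 _; rewrite mulrAC ler_wpM2l// mulr_ge0.
Qed.

Section heat_flat.
Variables (s : nat -> R) (t x : R).
Hypotheses (ss : abs_summable s) (t0 : 0 < t) (xX : `|x| <= X).

Let decay (b : nat -> R) n : R := b n * expR (- (freq2 n * t)).

Let decay_le b : (forall n, `|b n| <= s n) -> forall n, `|decay b n| <= s n.
Proof.
move=> bs n; rewrite /decay normrM [`|expR _|]ger0_norm ?expR_ge0// -[s n]mulr1.
by rewrite ler_pM ?expR_ge0// -expR0 ler_expR oppr_le0 mulr_ge0 ?freq2_ge0// ltW.
Qed.

(** The Fourier series of the free flow agrees with its expansion in powers of [x]: each mode is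
    replaced by its Taylor polynomial, and the exponential factor controls the remainder uniformly
    in [n]. The function [term] covers both parities. *)
Lemma psi_hchain_gen e (c b f : nat -> R) (term : R -> nat -> R) :
  (forall n, `|c n| <= (1 + freq2 n) * s n) -> (forall n, `|b n| <= s n) ->
  (forall n, `|f n| <= 1) ->
  (forall J n, hterm c J n t * (x ^+ (J.*2 + e) / (J.*2 + e)`!%:R) = decay b n * term (n%:R * x) J) ->
  (forall J n, `|f n - series (term (n%:R * x)) J| <=
     (n%:R * X) ^+ (J.*2 + e) / (J.*2 + e)`!%:R) ->
  (e <= 1)%N ->
  psi e (hchain c) t x = limn (series (fun n => decay b n * f n)).
Proof.
move=> cs bs f1 ht rem e1.
have s0 n : 0 <= s n by exact: le_trans (bs n).
have hs j : abs_summable (fun n => hterm c j n t) by exact: (hterm_summable cs ss).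
have clsQ := class_hchain cs ss s0.
pose u := decay b; have us := decay_le bs; have su := abs_summable_le us ss.
have [C C0 HC] := heat_bound_growth t0 Q0.
apply: (@lim_series_exchange _ _ s (fun J n => u n * series (term (n%:R * x)) J) (C * X ^+ e)) => //.
- by rewrite mulr_ge0 ?exprn_ge0 ?(ltW X0) ?(ltW C0).
- exact: (pterm_summable (clsQ Q Q0)).
- apply: (abs_summable_le _ ss) => n; rewrite normrM -[s n]mulr1 ler_pM//.
- elim=> [|J [IH1 IH2]].
    have z : (fun n => u n * series (term (n%:R * x)) 0) = (fun n => 0 * u n).
      by apply/funext => n; rewrite /series /= big_geq// mulr0 mul0r.
    rewrite z; split; last exact: abs_summableZ.
    by rewrite (lim_seriesM _ su) mul0r /series /= big_geq.
  have E : (fun n => u n * series (term (n%:R * x)) J.+1) =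
      (fun n => u n * series (term (n%:R * x)) J + (x ^+ (J.*2 + e) / (J.*2 + e)`!%:R) * hterm c J n t).
    apply/funext => n; rewrite /series /= big_nat_recr//= mulrDr; congr (_ + _).
    by rewrite -ht mulrC.
  have sz : abs_summable (fun n => (x ^+ (J.*2 + e) / (J.*2 + e)`!%:R) * hterm c J n t).
    exact: (abs_summableZ (hs J)).
  rewrite E; split; last exact: abs_summableD.
  rewrite (lim_seriesDD IH2 sz) -IH1 (lim_seriesM _ (hs J)) {1}/series /= big_nat_recr//=; congr (_ + _).
  by rewrite /pterm /hchain; ring.
- move=> J n; rewrite -mulrBr normrM distrC.
  have f0 m : (0 : R) < m`!%:R by rewrite ltr0n fact_gt0.
  apply: le_trans (ler_wpM2l (normr_ge0 _) (rem J n)) _.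
  have n0 := ler0n R n.
  (* For [e = 1] the odd power [2 J + 1] of [n] is bounded by the even power [2 J + 2], which the
     second term of [heat_bound] covers. *)
  have uJ : `|u n| * n%:R ^+ (J.*2 + e) <= s n * heat_bound t J.
    rewrite /u /decay normrM [`|expR _|]ger0_norm ?expR_ge0// -mulrA ler_pM ?mulr_ge0 ?expR_ge0 ?exprn_ge0//.
    apply: (@le_trans _ _ (freq2 n ^+ J * expR (- (freq2 n * t)) + freq2 n ^+ J.+1 * expR (- (freq2 n * t)))).
      rewrite -mulrDl mulrC ler_wpM2r ?expR_ge0// /freq2 -!exprM !mul2n doubleS.
      case: e e1 {clsQ rem ht} => [|[|//]] _; first by rewrite addn0 lerDl exprn_ge0.
      rewrite addn1; case: n {us su n0} => [|n]; first by rewrite exprS mul0r addr_ge0// exprn_ge0.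
      by rewrite ler_wpDl ?exprn_ge0// ler_weXn2l// ler1n.
    by rewrite /heat_bound lerD// exp_decay ?freq2_ge0.
  have H1 : `|u n| * n%:R ^+ (J.*2 + e) <= s n * (C * fact_ratio Q J).
    by apply: le_trans uJ _; rewrite ler_wpM2l.
  rewrite exprMn !mulrA.
  apply: (@le_trans _ _ (s n * (C * fact_ratio Q J) * X ^+ (J.*2 + e) / (J.*2)`!%:R)).
    apply: ler_pM; rewrite ?mulr_ge0 ?exprn_ge0 ?invr_ge0 ?(ltW X0)//.
      by rewrite ler_wpM2r ?exprn_ge0 ?(ltW X0).
    by rewrite lef_pV2 ?posrE// ler_nat leq_fact// leq_addr.
  rewrite le_eqVlt; apply/orP; left; apply/eqP.
  rewrite /fact_ratio /Q exprD exprMn -exprM mul2n exprVn; field.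
  by rewrite !gt_eqF ?exprn_gt0.
Qed.

Lemma psi_hchain0 b : (forall n, `|b n| <= s n) ->
  psi 0 (hchain b) t x = limn (series (fun n => b n * expR (- (freq2 n * t)) * cos (n%:R * x))).
Proof.
move=> bs; have s0 n : 0 <= s n by exact: le_trans (bs n).
apply: (@psi_hchain_gen 0 b b (fun n => cos (n%:R * x)) cos_term) => //.
- by move=> n; rewrite (le_trans (bs n))// ler_peMl// lerDl freq2_ge0.
- by move=> n; exact: cos_max.
- move=> J n; rewrite addn0 /hterm /decay /cos_term /freq2 exprMn.
  by rewrite -[- _ ^+ 2]mulN1r exprMn -exprM mul2n; ring.
- move=> J n; rewrite addn0; apply: le_trans (cos_terms_le _ _) _.
  rewrite ler_pM2r ?invr_gt0 ?ltr0n ?fact_gt0// lerXn2r ?nnegrE ?mulr_ge0 ?(ltW X0)//.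
  by rewrite normrM ger0_norm// ler_wpM2l.
Qed.

(** [n b_n] is the slope at the origin of the sine mode [b_n sin (n x)]. *)
Lemma psi_hchain1 b : (forall n, `|b n| <= s n) ->
  psi 1 (hchain (fun n => n%:R * b n)) t x =
  limn (series (fun n => b n * expR (- (freq2 n * t)) * sin (n%:R * x))).
Proof.
move=> bs; have s0 n : 0 <= s n by exact: le_trans (bs n).
apply: (@psi_hchain_gen 1 _ b (fun n => sin (n%:R * x)) sin_term) => //.
- move=> n; rewrite normrM ger0_norm// ler_pM//.
  by have := sqr_ge0 (n%:R - 1 : R); have := ler0n R n; rewrite /freq2 !expr2; nra.
- by move=> n; exact: sin_max.
- move=> J n; rewrite addn1 /hterm /decay /sin_term /freq2 exprMn.
  by rewrite -[- _ ^+ 2]mulN1r exprMn -exprM mul2n (exprS n%:R J.*2); ring.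
- move=> J n; rewrite addn1; apply: le_trans (sin_terms_le _ _) _.
  rewrite ler_pM2r ?invr_gt0 ?ltr0n ?fact_gt0// lerXn2r ?nnegrE ?mulr_ge0 ?(ltW X0)//.
  by rewrite normrM ger0_norm// ler_wpM2l.
Qed.

End heat_flat.
End flat_series.

(** * Steering the heat equation on an interval *)

Section controlled_heat.
Context {R : realType}.
Implicit Types (t x : R).

Lemma is_derive_unique (f : R -> R) x (l l' : R) :
  is_derive x (1 : R) f l -> is_derive x (1 : R) f l' -> l = l'.
Proof. by move=> [_ <-] [_ <-]. Qed.

Lemma is_derive_locally_cst (f : R -> R) x (l k d : R) : 0 < d ->
  (forall y, `|y - x| < d -> f y = k) -> is_derive x (1 : R) f l -> l = 0.
Proof.
move=> d0 fk df; apply: (is_derive_unique df).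
apply: near_eq_is_derive (is_derive_cst k x 1); near=> y; symmetry; apply: fk.
by rewrite distrC; near: y; apply: cvgr_dist_lt.
Unshelve. all: by end_near. Qed.

(** With all derivatives zero where the cut-off is constant, a product chain reduces there to its
    second factor or to zero. *)
Lemma cutoff_flat (phi : nat -> R -> R) (c k : R) :
  (forall n t, is_derive t (1 : R) (phi n) (phi n.+1 t)) ->
  (forall t, t < c -> phi 0%N t = k) -> forall n t, t < c -> phi n.+1 t = 0.
Proof.
move=> dphi pc; elim=> [|n IH] t tc.
  apply: (is_derive_locally_cst (k := k) (d := c - t) _ _ (dphi 0%N t)).
    by rewrite subr_gt0.
  by move=> y; rewrite ltr_norml => /andP[_ H]; apply: pc; lra.
apply: (is_derive_locally_cst (k := 0) (d := c - t) _ _ (dphi n.+1 t)).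
  by rewrite subr_gt0.
by move=> y; rewrite ltr_norml => /andP[_ H]; apply: IH; lra.
Qed.

Lemma cutoff_flat_right (phi : nat -> R -> R) (c k : R) :
  (forall n t, is_derive t (1 : R) (phi n) (phi n.+1 t)) ->
  (forall t, c < t -> phi 0%N t = k) -> forall n t, c < t -> phi n.+1 t = 0.
Proof.
move=> dphi pc; elim=> [|n IH] t tc.
  apply: (is_derive_locally_cst (k := k) (d := t - c) _ _ (dphi 0%N t)).
    by rewrite subr_gt0.
  by move=> y; rewrite ltr_norml => /andP[H _]; apply: pc; lra.
apply: (is_derive_locally_cst (k := 0) (d := t - c) _ _ (dphi n.+1 t)).
  by rewrite subr_gt0.
by move=> y; rewrite ltr_norml => /andP[H _]; apply: IH; lra.
Qed.

Definition decay t (a : nat -> R) n : R := expR (- (freq2 n * t)) * a n.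

Lemma continuousD_at (T : topologicalType) (f g : T -> R) (p : T) :
  {for p, continuous f} -> {for p, continuous g} -> {for p, continuous (fun q => f q + g q)}.
Proof. by move=> cf cg; apply: (@continuousD _ _ _ f g). Qed.

Lemma continuousM_at (T : topologicalType) (f g : T -> R) (p : T) :
  {for p, continuous f} -> {for p, continuous g} -> {for p, continuous (fun q => f q * g q)}.
Proof. by move=> cf cg; apply: (@continuousM _ _ f g). Qed.

(* The flat series of the cut-off boundary data: the temperature is that of the
   free flow up to time [t1] and has reached the target [N1 x + r] at time [t2]. *)
Lemma heat_control (X N0 N1 r t1 t2 : R) (a b : nat -> R) : 0 < X -> t1 < t2 ->
  abs_summable (fun n => `|a n| + `|b n|) ->
  exists Th Thx Thxx : R -> R -> R,
  [/\ forall t x, 0 < t -> `|x| < X ->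
        [/\ is_derive t (1 : R) (Th ^~ x) (Thxx t x),
            is_derive x (1 : R) (Th t) (Thx t x) & is_derive x (1 : R) (Thx t) (Thxx t x)],
      forall t x, 0 < t -> `|x| < X ->
        [/\ {for (t, x), continuous (fun p : R * R => Th p.1 p.2)},
            {for (t, x), continuous (fun p : R * R => Thx p.1 p.2)} &
            {for (t, x), continuous (fun p : R * R => Thxx p.1 p.2)}],
      forall t x, 0 < t -> t < t1 -> `|x| < X ->
        Th t x = N0 * x + limn (series (mode (decay t a) (decay t b) ^~ x)) &
      forall t x, t2 < t -> Th t x = N1 * x + r].
Proof.
move=> X0 t12 sab.
(* Multiplication by the cut-off costs a factor 2 on the radius and one further derivative another,
   leaving the [2 X^2] required for convergence on [|x| <= X]. *)
pose Q := 8 * X ^+ 2.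
have Q0 : 0 < Q by rewrite mulr_gt0// exprn_gt0.
have Q1 : 0 < 2 * X ^+ 2 by rewrite mulr_gt0// exprn_gt0.
have [phi [dphi phi1 phi0 [C C0 phiC]]] := cutoff_ex t12 Q0.
pose s n := `|a n| + `|b n|.
have s0 n : 0 <= s n by rewrite addr_ge0.
have as_ n : `|a n| <= s n by rewrite lerDl.
have bs n : `|b n| <= s n by rewrite lerDr.
have as1 n : `|a n| <= (1 + freq2 n) * s n.
  by rewrite (le_trans (as_ n))// ler_peMl// lerDl freq2_ge0.
have bs1 n : `|n%:R * b n| <= (1 + freq2 n) * s n.
  rewrite normrM ger0_norm// ler_pM//.
  by have := sqr_ge0 (n%:R - 1 : R); have := ler0n R n; rewrite /freq2 !expr2; nra.
(* Traces at [x = 0] of the free flow minus the target: the value in [ze], the slope in [zo]. *)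
pose ze n t := hchain a n t + const_chain (- r) n t.
pose zo n t := hchain (fun n => n%:R * b n) n t + const_chain (N0 - N1) n t.
have cze : chain ze by apply: chain_addr; [exact: (chain_hchain as1 sab s0)|exact: chain_const].
have czo : chain zo by apply: chain_addr; [exact: (chain_hchain bs1 sab s0)|exact: chain_const].
have bha q : 0 < q -> class_bound q (hchain a) by exact: (class_hchain as1 sab s0).
have bhb q : 0 < q -> class_bound q (hchain (fun n => n%:R * b n)) by exact: (class_hchain bs1 sab s0).
have bze q : 0 < q -> class_bound q ze.
  by move=> q0; apply: class_addr; [exact: bha|exact: class_const].
have bzo q : 0 < q -> class_bound q zo.
  by move=> q0; apply: class_addr; [exact: bhb|exact: class_const].
have bphi : class_bound Q phi by move=> tau _; exists C => // n t _; exact: phiC.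
have cphi : chain phi by move=> n t _; exact: dphi.
pose ye n t := prod_chain n phi ze t; pose yo n t := prod_chain n phi zo t.
have cye : chain ye by exact: chain_prod.
have cyo : chain yo by exact: chain_prod.
have bye : class_bound (Q / 2) ye by apply: class_prod => //; exact: bze.
have byo : class_bound (Q / 2) yo by apply: class_prod => //; exact: bzo.
have Q2 : 0 < Q / 2 by rewrite divr_gt0.
have le2 : 2 * X ^+ 2 <= Q / 2 by rewrite /Q; have := sqr_ge0 X; lra.
have bye1 : class_bound (2 * X ^+ 2) ye by apply: class_le bye.
have byo1 : class_bound (2 * X ^+ 2) yo by apply: class_le byo.
have E4 : 2 * X ^+ 2 = Q / 2 / 2 by rewrite /Q; field.
have bsye : class_bound (2 * X ^+ 2) (shift ye) by rewrite E4; exact: class_shift.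
have bsyo : class_bound (2 * X ^+ 2) (shift yo) by rewrite E4; exact: class_shift.
have csye := chain_shift cye; have csyo := chain_shift cyo.
exists (fun t x => N1 * x + r + (psi 0 ye t x + psi 1 yo t x)).
exists (fun t x => N1 + (psi 1 (shift ye) t x + psi 0 yo t x)).
exists (fun t x => psi 0 (shift ye) t x + psi 1 (shift yo) t x).
split.
- move=> t x t0 xX; have xX' := ltW xX; split.
  + have d1 := psi_dt X0 cye bye1 bsye 0 t0 xX'.
    have d2 := psi_dt X0 cyo byo1 bsyo 1 t0 xX'.
    have d3 : is_derive t (1 : R) (fun _ : R => N1 * x + r) (0 : R) by exact: is_derive_cst.
    by apply: (is_derive_eq (is_deriveD d3 (is_deriveD d1 d2))); rewrite add0r.
  + have d1 := psi_dx0 X0 bye1 bsye t0 xX; have d2 := psi_dx1 X0 byo1 t0 xX.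
    have d3 : is_derive x (1 : R) (fun x => N1 * x + r) N1.
      by apply: is_derive_eq; rewrite /GRing.scale /= mulr1 addr0.
    exact: (is_deriveD d3 (is_deriveD d1 d2)).
  + have d1 := psi_dx1 X0 bsye t0 xX; have d2 := psi_dx0 X0 byo1 bsyo t0 xX.
    have d3 : is_derive x (1 : R) (fun _ : R => N1) (0 : R) by exact: is_derive_cst.
    by apply: (is_derive_eq (is_deriveD d3 (is_deriveD d1 d2))); rewrite add0r.
- move=> t x t0 xX.
  have k1 := psi_continuous (e := 0%N) X0 cye bye1 t0 xX.
  have k2 := psi_continuous (e := 1%N) X0 cyo byo1 t0 xX.
  have k3 := psi_continuous (e := 1%N) X0 csye bsye t0 xX.
  have k4 := psi_continuous (e := 0%N) X0 cyo byo1 t0 xX.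
  have k5 := psi_continuous (e := 0%N) X0 csye bsye t0 xX.
  have k6 := psi_continuous (e := 1%N) X0 csyo bsyo t0 xX.
  have kc (k : R) : {for (t, x), continuous (fun _ : R * R => k)} by exact: cst_continuous.
  split; last exact: continuousD_at.
  + apply: continuousD_at; last exact: continuousD_at.
    apply: continuousD_at => //; apply: continuousM_at => //; exact: cvg_snd.
  + by apply: continuousD_at => //; exact: continuousD_at.
- move=> t x t0 tt1 xX; have xX' := ltW xX.
  have p1 : phi 0%N t = 1 by apply: phi1; exact: ltW.
  have p0 k : phi k.+1 t = 0.
    by apply: (cutoff_flat (k := 1) dphi _ _ tt1) => u ut; apply: phi1; exact: ltW.
  have e1 : psi 0 ye t x = psi 0 ze t x by apply: eq_psi => n; exact: prod_chain1.
  have e2 : psi 1 yo t x = psi 1 zo t x by apply: eq_psi => n; exact: prod_chain1.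
  rewrite e1 e2 /ze /zo.
  rewrite (psiD X0 0 (bha _ Q1) (@class_const _ _ (- r) Q1) t0 xX').
  rewrite (psiD X0 1 (bhb _ Q1) (@class_const _ _ (N0 - N1) Q1) t0 xX').
  rewrite !psi_const (psi_hchain0 X0 sab t0 xX' as_) (psi_hchain1 X0 sab t0 xX' bs).
  have ds (c : nat -> R) (f : nat -> R) : (forall n, `|c n| <= s n) -> (forall n, `|f n| <= 1) ->
      abs_summable (fun n => c n * expR (- (freq2 n * t)) * f n).
    move=> cs f1; apply: (abs_summable_le _ sab) => n.
    rewrite !normrM [`|expR _|]ger0_norm ?expR_ge0//.
    have e1' : expR (- (freq2 n * t)) <= 1.
      by rewrite -expR0 ler_expR oppr_le0 mulr_ge0 ?freq2_ge0// ltW.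
    apply: (@le_trans _ _ (`|c n| * 1 * 1)); last by rewrite !mulr1; exact: cs.
    by rewrite !ler_pM ?mulr_ge0 ?expR_ge0.
  have -> : limn (series (mode (decay t a) (decay t b) ^~ x)) =
    limn (series (fun n => a n * expR (- (freq2 n * t)) * cos (n%:R * x))) +
    limn (series (fun n => b n * expR (- (freq2 n * t)) * sin (n%:R * x))).
    rewrite -lim_seriesDD; last 2 first.
    + by apply: ds => // n; exact: cos_max.
    + by apply: ds => // n; exact: sin_max.
    congr (limn (series _)); apply/funext => n.
    by rewrite /mode /decay !(mulrC (expR _)).
  by rewrite !expr0 !expr1 (_ : 0`! = 1%N)// (_ : 1`! = 1%N)// !divr1 mulr1; ring.
- move=> t x tt2.
  have p0 k : phi k t = 0.
    case: k => [|k]; first by apply: phi0; exact: ltW.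
    by apply: (cutoff_flat_right (k := 0) dphi _ _ tt2) => u ut; apply: phi0; exact: ltW.
  have e1 : psi 0 ye t x = psi 0 (const_chain 0) t x.
    by apply: eq_psi => n; rewrite /ye prod_chain0// /const_chain; case: eqP.
  have e2 : psi 1 yo t x = psi 1 (const_chain 0) t x.
    by apply: eq_psi => n; rewrite /yo prod_chain0// /const_chain; case: eqP.
  by rewrite e1 e2 !psi_const !mul0r !addr0.
Qed.

End controlled_heat.

(** * Geodesics, weak derivatives and liftings *)

Section geodesics.
Context {R : realType}.
Notation mu := (@lebesgue_measure R).
Notation P := (@period R).

Section dot.
Variable n : nat.
Implicit Types u v w : 'rV[R]_n.

Lemma dotvC u v : dotv u v = dotv v u.
Proof. by apply: eq_bigr => i _; rewrite mulrC. Qed.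

Lemma dotvDl u v w : dotv (u + v) w = dotv u w + dotv v w.
Proof. by rewrite /dotv -big_split /=; apply: eq_bigr => i _; rewrite mxE mulrDl. Qed.

Lemma dotvZl (k : R) u w : dotv (k *: u) w = k * dotv u w.
Proof. by rewrite /dotv mulr_sumr; apply: eq_bigr => i _; rewrite mxE mulrA. Qed.

Lemma dotvDr u v w : dotv w (u + v) = dotv w u + dotv w v.
Proof. by rewrite dotvC dotvDl !(dotvC w). Qed.

Lemma dotvZr (k : R) u w : dotv w (k *: u) = k * dotv w u.
Proof. by rewrite dotvC dotvZl dotvC. Qed.

Lemma dotv_ge0 u : 0 <= dotv u u.
Proof. by apply: sumr_ge0 => i _; rewrite -expr2 sqr_ge0. Qed.

Lemma enorm_sqr u : enorm u ^+ 2 = dotv u u.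
Proof. by rewrite /enorm sqr_sqrtr// dotv_ge0. Qed.

Lemma dotv_eq0 u : dotv u u = 0 -> u = 0.
Proof.
move=> /eqP; rewrite psumr_eq0 => [|i _]; last by rewrite -expr2 sqr_ge0.
move=> /allP H; apply/rowP => i; rewrite mxE; apply/eqP.
by have := H i (mem_index_enum _); rewrite mulf_eq0 orbb.
Qed.

End dot.

Lemma sphereP k (u : 'rV[R]_k.+1) : sphere u <-> dotv u u = 1.
Proof.
rewrite /sphere /mkset -enorm_sqr; split => [->|H]; first by rewrite expr1n.
have e0 : 0 <= enorm u by exact: sqrtr_ge0.
by apply/eqP; rewrite -(eqrXn2 (n := 2) isT e0 ler01) H expr1n.
Qed.

Lemma is_derive_coord n (f : R -> 'rV[R]_n) x i : derivable f x 1 ->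
  is_derive x (1 : R) (fun y => f y 0 i) (derive1 f x 0 i).
Proof.
move=> df; have dfi := (derivable_mxP f x 1).1 df 0 i.
apply: DeriveDef; first exact: dfi.
by rewrite derive1E (derive_mx df) mxE.
Qed.

(** Differentiating [|gamma|^2 = 1] gives [gamma'] orthogonal to [gamma], so the geodesic equation
    keeps [|gamma'|] constant, and the energy forces this constant to be [1]. Then
    [gamma'' = - gamma] coordinate by coordinate. *)
Lemma geodesic_form k (gamma : R -> 'rV[R]_k.+1) : closed_geodesic gamma ->
  exists e1 e2 : 'rV[R]_k.+1, [/\ dotv e1 e1 = 1, dotv e2 e2 = 1, dotv e1 e2 = 0 &
    forall x, gamma x = cos x *: e1 + sin x *: e2].
Proof.
move=> [_ sph der geo energy].
pose g1 := derive1 gamma; pose g2 x := - (enorm (g1 x) ^+ 2 *: gamma x).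
have g2E x : derive1 g1 x = g2 x.
  by apply/eqP; rewrite -subr_eq0 /g2 opprK -[X in _ == X](geo x).
have d1 x i : is_derive x (1 : R) (fun y => gamma y 0 i) (g1 x 0 i).
  by apply: is_derive_coord; have [] := der x.
have d2 x i : is_derive x (1 : R) (fun y => g1 y 0 i) (g2 x 0 i).
  by rewrite -g2E; apply: is_derive_coord; have [] := der x.
have dd (f g f' g' : R -> 'rV[R]_k.+1) x :
    (forall i, is_derive x (1 : R) (fun y => f y 0 i) (f' x 0 i)) ->
    (forall i, is_derive x (1 : R) (fun y => g y 0 i) (g' x 0 i)) ->
    is_derive x (1 : R) (fun y => dotv (f y) (g y)) (dotv (f' x) (g x) + dotv (f x) (g' x)).
  move=> df dg.
  rewrite (_ : (fun y => _) = \sum_(i < k.+1) (fun y => f y 0 i * g y 0 i)); last first.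
    by apply/funext => y; rewrite fct_sumE.
  rewrite /dotv -big_split /=; apply: is_derive_sum => i.
  by apply: is_derive_eq; rewrite /GRing.scale /=; ring.
have gg x : dotv (gamma x) (gamma x) = 1 by exact/sphereP.
have g1g x : dotv (gamma x) (g1 x) = 0.
  have := dd gamma gamma g1 g1 x (d1 x) (d1 x).
  rewrite (_ : (fun y => _) = (fun=> 1)); last by apply/funext => y; exact: gg.
  have dc : is_derive x (1 : R) (fun _ : R => 1 : R) (0 : R) by exact: is_derive_cst.
  move=> H; have := is_derive_unique H dc.
  by rewrite (dotvC (g1 x)); lra.
have cE x : dotv (g1 x) (g1 x) = dotv (g1 0) (g1 0).
  have dz y : is_derive y (1 : R) (fun y => dotv (g1 y) (g1 y)) (0 : R).
    apply: is_derive_eq (dd g1 g1 g2 g2 y (d2 y) (d2 y)) _.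
    by rewrite /g2 -scaleNr dotvZl dotvZr g1g (dotvC (g1 y)) g1g !mulr0 addr0.
  exact: (is_derive_0_is_cst x 0 dz).
have c1 x : dotv (g1 x) (g1 x) = 1.
  have P0 := @period_gt0 R; rewrite cE.
  have := energy; rewrite (@eq_int _ _ (fun=> dotv (g1 0) (g1 0))); last first.
    by move=> y _; rewrite enorm_sqr cE.
  rewrite int_cst ?(ltW P0)// subr0 => E.
  by apply: (mulIf (lt0r_neq0 P0)); rewrite E mul1r.
have g2N x i : g2 x 0 i = - gamma x 0 i.
  by rewrite /g2 enorm_sqr c1 scale1r mxE.
exists (gamma 0), (g1 0); split => //.
move=> x; apply/rowP => i; rewrite !mxE.
(* Rotating the pair [(gamma, gamma')] back by the angle [x] gives a constant pair; inverting the
   rotation yields the formula. *)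
have F1 : gamma x 0 i * cos x - g1 x 0 i * sin x = gamma 0 0 i * cos 0 - g1 0 0 i * sin 0.
  have dz y : is_derive y (1 : R) (fun x => gamma x 0 i * cos x - g1 x 0 i * sin x) (0 : R).
    have e1 := d1 y i; have e2 := d2 y i.
    by apply: is_derive_eq; rewrite /GRing.scale /= g2N; ring.
  exact: (is_derive_0_is_cst x 0 dz).
have F2 : gamma x 0 i * sin x + g1 x 0 i * cos x = gamma 0 0 i * sin 0 + g1 0 0 i * cos 0.
  have dz y : is_derive y (1 : R) (fun x => gamma x 0 i * sin x + g1 x 0 i * cos x) (0 : R).
    have e1 := d1 y i; have e2 := d2 y i.
    by apply: is_derive_eq; rewrite /GRing.scale /= g2N; ring.
  exact: (is_derive_0_is_cst x 0 dz).
rewrite cos0 sin0 !mulr1 !mulr0 subr0 add0r in F1 F2.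
rewrite -F1 -F2.
transitivity (gamma x 0 i * (cos x ^+ 2 + sin x ^+ 2)); first by rewrite cos2Dsin2 mulr1.
by ring.
Qed.

(** A matrix with [k + 1 >= 3] rows and two columns has a nonzero left kernel; a vector of it is
    normalised. *)
Lemma orthogonal_unit k (e1 e2 : 'rV[R]_k.+1) : (2 <= k)%N ->
  exists e3 : 'rV[R]_k.+1, [/\ dotv e3 e3 = 1, dotv e1 e3 = 0 & dotv e2 e3 = 0].
Proof.
move=> k2; pose A := row_mx e1^T e2^T.
have rA : (\rank A <= 1 + 1)%N by exact: rank_leq_col.
have : kermx A != 0.
  rewrite -mxrank_eq0 mxrank_ker subn_eq0 -ltnNge.
  by apply: leq_ltn_trans rA _; rewrite ltnS.
move=> /rowV0Pn[v vA v0].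
have vA0 : v *m A = 0 by apply/sub_kermxP.
rewrite mul_mx_row -[0]hsubmxK linear0 linear0 in vA0.
have [v1 v2] := eq_row_mx vA0.
have D (e : 'rV[R]_k.+1) : v *m e^T = 0 -> dotv e v = 0.
  move=> /matrixP/(_ 0 0); rewrite !mxE => H; rewrite -[RHS]H.
  by apply: eq_bigr => i _; rewrite !mxE mulrC.
have vv : 0 < dotv v v.
  rewrite lt_neqAle dotv_ge0 andbT eq_sym; apply: contra v0 => /eqP/dotv_eq0 ->.
  by rewrite eqxx.
exists ((enorm v)^-1 *: v); split.
- rewrite dotvZl dotvZr mulrA -invfM -expr2 enorm_sqr mulVf//.
  exact: lt0r_neq0.
- by rewrite dotvZr D ?mulr0.
- by rewrite dotvZr D ?mulr0.
Qed.

End geodesics.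

(** * Weak derivatives of periodic functions *)

Section weak_derivatives.
Context {R : realType}.
Notation mu := (@lebesgue_measure R).
Notation P := (@period R).
Implicit Types (w g p : R -> R).

Lemma smooth_mode (a b : R) n : smooth_circle (fun x => a * cos (n%:R * x) + b * sin (n%:R * x)).
Proof.
pose f (a b : R) x := a * cos (n%:R * x) + b * sin (n%:R * x).
have df (c d : R) x : is_derive x (1 : R) (f c d) (f (n%:R * d) (- (n%:R * c)) x).
  exact: (is_derive_mode (fun=> c) (fun=> d)).
split; first by move=> x; rewrite cos_natmul_period sin_natmul_period.
suff H m : exists c d, derive1n m (f a b) = f c d.
  by move=> m x; have [c [d ->]] := H m; have [] := df c d x.
elim: m => [|m [c [d E]]]; first by exists a, b.
exists (n%:R * d), (- (n%:R * c)); rewrite derive1nS E.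
by apply/funext => x; rewrite derive1E; have [] := df c d x.
Qed.

Lemma smooth_is_derive (phi : R -> R) : smooth_circle phi ->
  forall x, is_derive x (1 : R) phi (derive1 phi x).
Proof.
move=> [_ H] x; have := H 0%N x; rewrite derive1n0 => d.
by apply: DeriveDef => //; rewrite derive1E.
Qed.

Lemma smooth_derive_continuous (phi : R -> R) : smooth_circle phi -> continuous (derive1 phi).
Proof.
move=> [_ H] x; apply: differentiable_continuous; apply/derivable1_diffP.
by have := H 1%N x; rewrite derive1n1.
Qed.

Lemma smooth_period (phi : R -> R) : smooth_circle phi -> phi P = phi 0.
Proof. by move=> [H _]; rewrite -[in LHS](add0r P) H. Qed.

(** Retraction onto [[a, b]]: it turns continuity within a segment into continuity on the line, the
    form used by the lemmas on integrals. *)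
Definition clamp (a b x : R) := Num.max a (Num.min x b).

Lemma clamp_in a b x : a <= b -> clamp a b x \in `[a, b].
Proof.
move=> ab; rewrite in_itv/= /clamp le_max lexx /= ge_max ab /=.
by rewrite ge_min lexx orbT.
Qed.

Lemma clamp_id a b x : x \in `[a, b] -> clamp a b x = x.
Proof.
rewrite in_itv/= => /andP[ax xb]; rewrite /clamp minEle xb maxEle ax.
by [].
Qed.

Lemma clamp_lipschitz a b : a <= b -> lipschitz_by 1 (clamp a b).
Proof.
move=> ab s t; rewrite mul1r /clamp !maxEle !minEle.
by case: (leP s b) => ?; case: (leP t b) => ?; rewrite ?ab;
  try (case: (leP a s) => ?); try (case: (leP a t) => ?);
  rewrite ler_norml; apply/andP; split;
  have := ler_norm (s - t); have := ler_norm (- (s - t)); rewrite normrN; lra.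
Qed.

Lemma within_clamp (a b : R) (f : R -> R) : a <= b -> {within `[a, b], continuous f} ->
  continuous (fun x => f (clamp a b x)).
Proof.
move=> ab /subspace_continuousP cf x.
have cx := clamp_in x ab.
have cc := lipschitz_continuous (clamp_lipschitz ab).
apply/cvgrPdist_le => e e0; move: (cf (clamp a b x) cx) => /cvgrPdist_le/(_ e e0).
rewrite near_withinE => H.
have H' : \forall y \near x, `[a, b]%classic (clamp a b y) ->
    `|f (clamp a b x) - f (clamp a b y)| <= e by exact: (cc x _ H).
near=> y; apply: (near H' y) => //; exact: clamp_in.
Unshelve. all: by end_near. Qed.

Lemma AC_eq (a b : R) p q g : {in `[a, b], p =1 q} -> AC a b p g -> AC a b q g.
Proof.
move=> pq [gi H]; split => // x xab; rewrite -pq// H// pq//.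
by rewrite in_itv/= lexx; move: xab; rewrite in_itv/= => /andP[]; exact: le_trans.
Qed.

Lemma primitive_clamp (b : R) g : 0 <= b -> itg 0 b g ->
  exists G : R -> R, [/\ continuous G, G 0 = 0 & AC 0 b G g].
Proof.
move=> b0 gi; exists (fun x => \int[mu]_(t in `[0, (clamp 0 b x)]) g t).
have G0 : \int[mu]_(t in `[0, (clamp 0 b 0)]) g t = 0.
  by rewrite clamp_id ?in_itv/= ?lexx// set_itv1 Rintegral_set1.
split => //.
  apply: (@within_clamp 0 b (fun x => \int[mu]_(t in `[0, x]) g t) b0).
  exact: parameterized_integral_continuous.
by split => // x xb; rewrite G0 add0r clamp_id.
Qed.

(** Du Bois-Reymond's lemma. The difference of [w] and a primitive of [g] is orthogonal to the
    derivatives of test functions, hence to every nonconstant mode; after removal of its mean it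
    vanishes. *)
Lemma weak_AC w g : continuous w -> periodic w P -> L2i 0 P g ->
  (forall phi, smooth_circle phi ->
     \int[mu]_(x in `[0, P]) (w x * derive1 phi x) = - \int[mu]_(x in `[0, P]) (g x * phi x)) ->
  AC 0 P w g.
Proof.
move=> cw wP g2 wg; have P0 := @period_gt0 R; have gi := L2i_itg g2.
have [G [cG G0 GAC]] := primitive_clamp (ltW P0) gi.
have P0' : P \in `[0, P] by rewrite in_itv/= lexx ltW.
have sm := @smooth_mode.
(* Testing with the constant [1] shows that [g] has mean zero, so that the primitive closes up over
   a period. *)
have GP : G P = G 0.
  have [_ ->] := GAC; last exact: P0'.
  rewrite -[RHS]addr0; congr (_ + _).
  have H := wg _ (sm 1 0 0%N).
  transitivity (\int[mu]_(x in `[0, P]) (g x * (1 * cos (0%:R * x) + 0 * sin (0%:R * x)))).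
    by apply: eq_int => x _; rewrite mul0r cos0 sin0; ring.
  rewrite -[LHS]opprK -H (@eq_int _ _ (fun=> 0)); last first.
    move=> x _; rewrite derive1E.
    have [_ ->] := is_derive_mode (fun=> 1) (fun=> 0) 0 x.
    by rewrite /mode !mul0r oppr0 mul0r addr0 mulr0.
  by rewrite int_cst ?(ltW P0)// mul0r oppr0.
pose q x := w x - G x.
have cq : continuous q by move=> x; apply: (@continuousB _ _ _ w G); [exact: cw|exact: cG].
have qphi phi : smooth_circle phi -> \int[mu]_(x in `[0, P]) (q x * derive1 phi x) = 0.
  move=> sphi; have cphi := smooth_derive_continuous sphi.
  have := AC_by_parts GAC GP cphi (smooth_is_derive sphi) (smooth_period sphi).
  move=> E.
  rewrite (@eq_int _ _ (fun x => w x * derive1 phi x - G x * derive1 phi x)); last first.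
    by move=> x _; rewrite mulrBl.
  by rewrite intB ?(wg _ sphi) ?E ?opprK ?subrr//; exact/itg_cont/continuousM_fun.
pose m := (\int[mu]_(x in `[0, P]) q x) / P.
have cm : continuous (fun x => q x - m).
  by move=> x; apply: (@continuousB _ _ _ q (cst m)); [exact: cq|exact: cst_continuous].
have orth : trig_orth (fun x => q x - m).
  case=> [|n].
    split; last first.
      rewrite (@eq_int _ _ (fun=> 0)) ?int_cst ?mul0r ?(ltW P0)//.
      by move=> x _; rewrite mul0r sin0 mulr0.
    rewrite (@eq_int _ _ (fun x => q x - m)); last by move=> x _; rewrite mul0r cos0 mulr1.
    rewrite intB; [|exact: itg_cont|by apply: itg_cont; exact: cst_continuous].
    by rewrite int_cst ?(ltW P0)// subr0 /m divfK ?subrr// gt_eqF.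
  have n0 : n.+1%:R != 0 :> R by rewrite pnatr_eq0.
  have cC := @continuous_cosM R n.+1%:R; have cS := @continuous_sinM R n.+1%:R.
  have mC : \int[mu]_(x in `[0, P]) (m * cos (n.+1%:R * x)) = 0.
    by rewrite intZ ?int_cosM_eq0 ?mulr0 ?sin_natP//; exact: itg_cont.
  have mS : \int[mu]_(x in `[0, P]) (m * sin (n.+1%:R * x)) = 0.
    by rewrite intZ ?int_sinM_eq0 ?mulr0 ?cos_natP//; exact: itg_cont.
  have qC : \int[mu]_(x in `[0, P]) (q x * cos (n.+1%:R * x)) = 0.
    have := qphi _ (sm 0 (n.+1%:R^-1) n.+1); rewrite (@eq_int _ _ (fun x => q x * cos (n.+1%:R * x)))//.
    move=> x _; rewrite derive1E.
    have [_ ->] := is_derive_mode (fun=> 0) (fun=> n.+1%:R^-1) n.+1 x.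
    by rewrite /mode mulfV// mul1r mulr0 oppr0 mul0r addr0.
  have qS : \int[mu]_(x in `[0, P]) (q x * sin (n.+1%:R * x)) = 0.
    have := qphi _ (sm (- n.+1%:R^-1) 0 n.+1); rewrite (@eq_int _ _ (fun x => q x * sin (n.+1%:R * x)))//.
    move=> x _; rewrite derive1E.
    have [_ ->] := is_derive_mode (fun=> - n.+1%:R^-1) (fun=> 0) n.+1 x.
    by rewrite /mode mulrN mulfV// opprK mul1r mulr0 mul0r add0r.
  have cmm : continuous (fun _ : R => m) by move=> x; exact: cst_continuous.
  split.
  - rewrite (@eq_int _ _ (fun x => q x * cos (n.+1%:R * x) - m * cos (n.+1%:R * x))).
      by rewrite intB ?qC ?mC ?subrr//; exact/itg_cont/continuousM_fun.
    by move=> x _; rewrite mulrBl.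
  - rewrite (@eq_int _ _ (fun x => q x * sin (n.+1%:R * x) - m * sin (n.+1%:R * x))).
      by rewrite intB ?qS ?mS ?subrr//; exact/itg_cont/continuousM_fun.
    by move=> x _; rewrite mulrBl.
have q0 x : x \in `[0, P] -> w x = G x + m.
  by move=> xP; have := trig_orth_eq0 cm orth xP; rewrite /q; lra.
split => // x xP; have [_ GE] := GAC.
rewrite (q0 x xP) (q0 0) ?in_itv/= ?lexx ?(ltW P0)//.
by rewrite (GE x xP); ring.
Qed.

End weak_derivatives.

(** * Lifting a curve on the circle to an angle *)

Section lifting.
Context {R : realType}.
Notation mu := (@lebesgue_measure R).
Notation P := (@period R).

Lemma L2i_sum (I : Type) (s : seq I) (F : I -> R -> R) (a b : R) :
  (forall i, L2i a b (F i)) -> L2i a b (fun x => \sum_(i <- s) F i x).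
Proof.
move=> Fi; elim: s => [|i s IH].
  by apply: (@eq_L2i _ (cst 0)) => [x _|]; [rewrite big_nil|apply/L2i_cont/cst_continuous].
by apply: (@eq_L2i _ (fun x => F i x + \sum_(i <- s) F i x)) => [x _|];
  [rewrite big_cons|exact: L2iD].
Qed.

Lemma L2_circleP n (g : R -> 'rV[R]_n) : L2_circle g <->
  periodic g P /\ forall i, L2i 0 P (fun x => g x 0 i).
Proof.
have dE x : enorm (g x) ^+ 2 = \sum_(i < n) g x 0 i ^+ 2.
  by rewrite enorm_sqr; apply: eq_bigr => i _; rewrite expr2.
split=> [[gP gm gfin]|[gP g2]].
- split => // i; split; first exact: gm.
  have mE : measurable_fun `[0, P] (fun x => enorm (g x) ^+ 2).
    apply: (@eq_measurable_fun _ _ _ _ _ (fun x => \sum_(i < n) g x 0 i ^+ 2)).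
      by move=> x _; rewrite dE.
    by apply: measurable_sum => j; apply: measurable_funX; exact: gm.
  apply: (@itg_le _ _ (fun x => enorm (g x) ^+ 2)).
  + by apply: measurable_funX; exact: gm.
  + move=> x _; rewrite ger0_norm ?sqr_ge0// dE (bigD1 i)//= lerDl.
    by apply: sumr_ge0 => j _; exact: sqr_ge0.
  + apply/integrableP; split; first exact/measurable_EFinP.
    apply: le_lt_trans gfin; rewrite le_eqVlt; apply/orP; left; apply/eqP.
    by apply: eq_integral => x _; rewrite /= ger0_norm// sqr_ge0.
- split => //; first by move=> i; have [] := g2 i.
  have : itg 0 P (fun x => enorm (g x) ^+ 2).
    apply: (@eq_itg _ (fun x => \sum_(i < n) g x 0 i ^+ 2)) => [x _|]; first by rewrite dE.
    by apply: itg_sum => i; have [] := g2 i.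
  move=> /integrableP[_]; apply: le_lt_trans; rewrite le_eqVlt; apply/orP; left; apply/eqP.
  by apply: eq_integral => x _; rewrite /= ger0_norm// sqr_ge0.
Qed.

Lemma cos_eq1 (x : R) : cos x = 1 -> exists m : int, x = m%:~R * P.
Proof.
move=> cx; have [m xm] := period_reduce x; have P0 := @period_gt0 R.
have pi0 := @pi_gt0 R; have PE : P = 2 * pi by [].
have cosP : periodic (@cos R) P.
  by move=> u; have := cosD2pi u; rewrite mulr2n PE mulr_natl mulr2n.
have cy : cos (x + m%:~R * P) = 1 by rewrite (periodic_int m x cosP).
move: xm cy; set y := x + _; rewrite in_itv/= => /andP[y0 yP] cy.
suff [z|z] : y = 0 \/ y = P.
- by exists (- m); move: z; rewrite /y mulrNz; lra.
- by exists (1 - m); move: z; rewrite /y intrB; lra.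
have [ypi|ypi] := leP y pi.
  left; apply: (@cos_inj R); rewrite ?in_itv/= ?lexx ?y0 ?ypi ?(ltW pi0)//.
  by rewrite cos0.
right; suff : P - y = 0 by lra.
apply: (@cos_inj R); rewrite ?in_itv/= ?lexx ?(ltW pi0)//; first by rewrite PE; apply/andP; split; lra.
by rewrite cos0 -cy -[RHS]cosN -[RHS]cosP addrC.
Qed.

Lemma AC_scale (p g : R -> R) (c a b : R) : AC a b p g -> AC a b (fun x => c * p x) (fun x => c * g x).
Proof.
move=> [gi H]; split; first exact: itgZ.
move=> x xab; rewrite H// intZ ?mulrDr//.
by move: xab; rewrite in_itv/= => /andP[ax xb]; exact: itgS gi _ _.
Qed.

Lemma AC_add (p q g h : R -> R) (a b : R) : AC a b p g -> AC a b q h ->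
  AC a b (fun x => p x + q x) (fun x => g x + h x).
Proof.
move=> [gi H] [hi H']; split; first exact: itgD.
move=> x xab; rewrite H// H'//.
have /andP[ax xb] : a <= x <= b by rewrite in_itv/= in xab.
by rewrite intD; [ring|exact: itgS gi _ _|exact: itgS hi _ _].
Qed.

Lemma AC_derE (p g h : R -> R) (a b : R) : {in `[a, b], g =1 h} -> AC a b p g -> AC a b p h.
Proof.
move=> gh [gi H]; split; first exact: eq_itg gh gi.
move=> x xab; rewrite H//; congr (_ + _); apply: eq_int => y.
move=> yx; apply: gh; move: xab yx; rewrite !in_itv/= => /andP[_ xb] /andP[-> yx].
exact: le_trans xb.
Qed.

Lemma AC_sum (I : Type) (s : seq I) (p g : I -> R -> R) (a b : R) :
  (forall i, AC a b (p i) (g i)) -> AC a b (fun x => \sum_(i <- s) p i x) (fun x => \sum_(i <- s) g i x).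
Proof.
move=> H; elim: s => [|i s IH].
  split; first by apply: itg_sum => i; have [] := H i.
  move=> x xab; rewrite !big_nil add0r (@eq_int _ _ (fun=> 0)) => [|y _]; last by rewrite big_nil.
  by rewrite int_cst ?mul0r//; move: xab; rewrite in_itv/= => /andP[].
have [A1 A2] := AC_add (H i) IH.
split; first by apply: itg_sum => j; have [] := H j.
move=> x xab; rewrite !big_cons A2//; congr (_ + _).
by apply: eq_int => y _; rewrite big_cons.
Qed.

Lemma unit_derivative_lipschitz (F f : R -> R) : (forall x, is_derive x (1 : R) F (f x)) ->
  (forall x, `|f x| <= 1) -> forall x y, `|F x - F y| <= `|x - y|.
Proof.
move=> dF f1 x y; wlog xy : x y / x <= y.
  by move=> H; have [/H//|/ltW/H] := leP x y; rewrite distrC (distrC y).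
have cF : {within `[x, y], continuous F} by exact/continuous_subspaceT/(is_derive_continuous dF).
have [c _ E] := MVT_segment xy (fun x _ => dF x) cF.
by rewrite distrC E normrM distrC ler_piMl.
Qed.

Lemma sin_lipschitz (x y : R) : `|sin x - sin y| <= `|x - y|.
Proof. by apply: (unit_derivative_lipschitz (f := @cos R)) => *; exact: cos_max. Qed.

Lemma cos_lipschitz (x y : R) : `|cos x - cos y| <= `|x - y|.
Proof.
by apply: (unit_derivative_lipschitz (f := fun x => - sin x)) => *; rewrite normrN sin_max.
Qed.

Lemma AC_cos (p g : R -> R) (a b : R) : a <= b -> AC a b p g ->
  AC a b (fun x => cos (p x)) (fun x => - sin (p x) * g x).
Proof.
move=> ab; apply: (AC_comp ab (F := @cos R) (f := fun x => - sin x)) => [x y|x].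
  by rewrite -opprD normrN; exact: sin_lipschitz.
by rewrite normrN sin_max.
Qed.

Lemma AC_sin (p g : R -> R) (a b : R) : a <= b -> AC a b p g ->
  AC a b (fun x => sin (p x)) (fun x => cos (p x) * g x).
Proof.
by move=> ab; apply: (AC_comp ab (F := @sin R) (f := @cos R)); [exact: cos_lipschitz|exact: cos_max].
Qed.

(** The angle is the integral of [al be' - be al']. Its cosine and sine are [al] and [be] because
    [S = al cos th + be sin th] stays equal to [1], which makes two unit vectors coincide. *)
Lemma angle_AC (al be ga gb : R -> R) (th0 b : R) : 0 <= b -> continuous al -> continuous be ->
  (forall x, al x ^+ 2 + be x ^+ 2 = 1) -> AC 0 b al ga -> AC 0 b be gb ->
  L2i 0 b ga -> L2i 0 b gb -> al 0 = cos th0 -> be 0 = sin th0 ->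
  exists th : R -> R, [/\ continuous th, AC 0 b th (fun x => al x * gb x - be x * ga x) &
    forall x, x \in `[0, b] -> al x = cos (th x) /\ be x = sin (th x)].
Proof.
move=> b0 ca cb ab1 Aa Ab ga2 gb2 a0 be0.
pose g x := al x * gb x - be x * ga x.
have gi : itg 0 b g by apply: itgB; [exact: AC_itgM Aa (L2i_itg gb2)|exact: AC_itgM Ab (L2i_itg ga2)].
have [G [cG G0 GAC]] := primitive_clamp b0 gi.
pose th x := th0 + G x.
have z0 : 0 \in `[0, b] by rewrite in_itv/= lexx.
have thAC : AC 0 b th g.
  by split => // x xb; have [_ GE] := GAC; rewrite /th (GE x xb); ring.
exists th; split => //.
  by apply: continuousD_fun => //; exact: cst_continuous.
have E0 : AC 0 b (fun=> 1) (fun x => 2 * (al x * ga x + be x * gb x)).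
  have := AC_add (AC_mul b0 Aa Aa) (AC_mul b0 Ab Ab).
  move=> /(AC_derE (h := fun x => 2 * (al x * ga x + be x * gb x))) H.
  apply: AC_eq (H _) => x _; last by ring.
  by rewrite -(ab1 x); ring.
(* The density [al al' + be be'] integrates to zero over every [[0, x]]. It is treated as a
   derivative of the zero function, without being shown to vanish pointwise. *)
have K0 : AC 0 b (fun=> 0) (fun x => al x * ga x + be x * gb x).
  have [Ei EH] := E0.
  have Ei' : itg 0 b (fun x => al x * ga x + be x * gb x).
    by apply: itgD; [exact: AC_itgM Aa (L2i_itg ga2)|exact: AC_itgM Ab (L2i_itg gb2)].
  split => // x xb; have := EH x xb; rewrite intZ; first by lra.
  by move: xb; rewrite in_itv/= => /andP[? ?]; exact: itgS Ei' _ _.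
have Ac := AC_cos b0 thAC; have As := AC_sin b0 thAC.
have P1 := AC_add (AC_mul b0 Aa Ac) (AC_mul b0 Ab As).
have {}P1 : AC 0 b (fun x => al x * cos (th x) + be x * sin (th x))
   (fun x => (al x * cos (th x) + be x * sin (th x)) * (al x * ga x + be x * gb x)).
  apply: AC_derE P1 => x _; rewrite /g.
  have := ab1 x; move: (al x) (be x) (ga x) (gb x) (cos (th x)) (sin (th x)) => A B a1 b1 C D AB.
  have -> : (A * C + B * D) * (A * a1 + B * b1) =
    (A ^+ 2 * a1 * C + A * B * b1 * C + A * B * a1 * D + B ^+ 2 * b1 * D) by ring.
  have A2 : A ^+ 2 = 1 - B ^+ 2 by lra.
  have -> : A * (- D * (A * b1 - B * a1)) + C * a1 + (B * (C * (A * b1 - B * a1)) + D * b1) =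
    - A ^+ 2 * b1 * D + A * B * a1 * D + C * a1 + A * B * b1 * C - B ^+ 2 * a1 * C + D * b1 by ring.
  by rewrite A2; ring.
(* Here [S' = S (al al' + be be')]. The product rule for [S] times the zero function shows that this
   derivative integrates to zero, so [S] is constant. *)
have [_ P1H] := P1; have [_ KH] := AC_mul b0 P1 K0.
move=> x xb.
have : al x * cos (th x) + be x * sin (th x) = 1.
  rewrite P1H//; have := KH x xb; rewrite !mulr0 add0r => E.
  rewrite (@eq_int _ _ (fun x => (al x * cos (th x) + be x * sin (th x)) *
     (al x * ga x + be x * gb x) + 0 * ((al x * cos (th x) + be x * sin (th x)) * (al x * ga x + be x * gb x)))).
    by rewrite -E addr0 /th G0 addr0 -a0 -be0 -!expr2 ab1.
  by move=> y _; ring.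
have := ab1 x; have := cos2Dsin2 (th x).
move: (al x) (be x) (cos (th x)) (sin (th x)) => A B C D CD AB E.
have : (A - C) ^+ 2 + (B - D) ^+ 2 = 0.
  by rewrite (_ : _ + _ = (A ^+ 2 + B ^+ 2) + (C ^+ 2 + D ^+ 2) - 2 * (A * C + B * D)); [rewrite AB CD E|]; ring.
move/eqP; rewrite paddr_eq0 ?sqr_ge0// !sqrf_eq0 !subr_eq0 => /andP[/eqP -> /eqP ->].
by [].
Qed.

(** [N0] is the winding number, [p] the periodic part of the angle, and [g] the derivative of the
    whole angle. *)
Lemma lifting k (gamma v0 : R -> 'rV[R]_k.+1) (e1 e2 : 'rV[R]_k.+1) :
  dotv e1 e1 = 1 -> dotv e2 e2 = 1 -> dotv e1 e2 = 0 ->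
  (forall x, gamma x = cos x *: e1 + sin x *: e2) ->
  H1_sphere v0 -> (forall x, range gamma (v0 x)) ->
  exists (N0 : int) (p g : R -> R), [/\ continuous p, periodic p P /\ periodic g P, L2i 0 P g,
    AC 0 P p (fun x => g x - N0%:~R) &
    forall x, v0 x = gamma (N0%:~R * x + p x)].
Proof.
move=> e11 e22 e12 gE [g0 [v0P cv0 sv0 /L2_circleP[g0P g02] wd]] v0C.
have P0 := @period_gt0 R; have P0' := ltW P0.
have comb (e : 'rV[R]_k.+1) : [/\ continuous (fun x => dotv (v0 x) e), periodic (fun x => dotv (v0 x) e) P,
   L2i 0 P (fun x => dotv (g0 x) e) & AC 0 P (fun x => dotv (v0 x) e) (fun x => dotv (g0 x) e)].
  have cci i : continuous (fun x => v0 x 0 i).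
    by move=> x; apply: (@continuous_comp _ _ _ v0 (fun M : 'rV[R]_k.+1 => M 0 i));
      [exact: cv0|exact: coord_continuous].
  have ACi i : AC 0 P (fun x => v0 x 0 i) (fun x => g0 x 0 i).
    by apply: weak_AC => //; [move=> x; rewrite v0P|move=> phi sphi; exact: wd].
  split.
  - move=> x; rewrite /dotv.
    have H (s : seq 'I_k.+1) : {for x, continuous (fun y => \sum_(i <- s) v0 y 0 i * e 0 i)}.
      elim: s => [|i s IH].
        rewrite (_ : (fun y => _) = cst 0); first exact: cst_continuous.
        by apply/funext => y; rewrite big_nil.
      rewrite (_ : (fun y => _) = (fun y => v0 y 0 i * e 0 i + \sum_(i <- s) v0 y 0 i * e 0 i)).
        apply: continuousD_at => //; apply: continuousM_at; [exact: cci|exact: cst_continuous].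
      by apply/funext => y; rewrite big_cons.
    exact: H.
  - by move=> x; rewrite v0P.
  - apply: L2i_sum => i; apply: (@eq_L2i _ (fun x => e 0 i * g0 x 0 i)) => [x _|]; first exact: mulrC.
    exact: L2iZ.
  - apply: AC_sum => i; have := AC_scale (e 0 i) (ACi i).
    move=> H; apply: (AC_eq (p := fun x => e 0 i * v0 x 0 i)); first by move=> x _; exact: mulrC.
    by apply: AC_derE H => x _; exact: mulrC.
have [ca aP ga2 Aa] := comb e1; have [cb bP gb2 Ab] := comb e2.
pose al x := dotv (v0 x) e1; pose be x := dotv (v0 x) e2.
have form x : exists s, [/\ v0 x = gamma s, al x = cos s & be x = sin s].
  have [s _ sE] := v0C x; exists s; rewrite /al /be -sE gE; split => //.
    by rewrite dotvDl !dotvZl e11 (dotvC e2) e12 mulr0 mulr1 addr0.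
  by rewrite dotvDl !dotvZl e12 e22 mulr0 mulr1 add0r.
have ab1 x : al x ^+ 2 + be x ^+ 2 = 1 by have [s [_ -> ->]] := form x; exact: cos2Dsin2.
have [s0 [_ a0 b0]] := form 0.
have [th [cth thAC thE0]] := angle_AC P0' ca cb ab1 Aa Ab ga2 gb2 a0 b0.
have thE x : x \in `[0, P] -> al x = cos (th x) /\ be x = sin (th x) by exact: thE0.
have P0in : P \in `[0, P] by rewrite in_itv/= lexx P0'.
have zin : 0 \in `[0, P] by rewrite in_itv/= lexx P0'.
pose g x := al x * dotv (g0 x) e2 - be x * dotv (g0 x) e1.
have gP : periodic g P by move=> x; rewrite /g /al /be v0P g0P.
have g2 : L2i 0 P g by apply: L2iB; apply: L2i_contM.
have [N0 HN0] : exists N0 : int, th P - th 0 = N0%:~R * P.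
  apply: cos_eq1; rewrite cosB.
  have [<- <-] := thE P P0in; have [<- <-] := thE 0 zin.
  have -> : al P = al 0 by rewrite /al -[in LHS](add0r P) v0P.
  have -> : be P = be 0 by rewrite /be -[in LHS](add0r P) v0P.
  by rewrite -!expr2 ab1.
pose pc x := th x - N0%:~R * x.
have cpc : continuous pc.
  move=> x; apply: (@continuousB _ _ _ th (fun x => N0%:~R * x)); first exact: cth.
  by apply: (@continuousM _ _ (cst _) id) => //; exact: cst_continuous.
have pcP : pc P = pc 0 by rewrite /pc mulr0; lra.
have linAC : AC 0 P (fun x : R => - (N0%:~R * x)) (fun=> - N0%:~R : R).
  apply: AC_C1; first by move=> x; exact: cst_continuous.
  by move=> x; apply: is_derive_eq; rewrite /GRing.scale /= mulr1.
have pcAC : AC 0 P pc (fun x => g x - N0%:~R) := AC_add thAC linAC.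
have gN2 : L2i 0 P (fun x => g x - N0%:~R).
  by apply: L2iB => //; apply: L2i_cont => x; exact: cst_continuous.
(* The Fourier series serves as a continuous periodic extension of [pc] from [[0, P]] to the
   line. *)
pose p x := limn (series (mode (coefc pc) (coefs pc) ^~ x)).
have pE x : x \in `[0, P] -> pc x = p x by move=> xP; exact: (fourier_sum cpc pcAC pcP gN2 xP).
have pP : periodic p P.
  by move=> x; congr (limn (series _)); apply/funext => n; rewrite mode_periodic.
exists N0, p, g; split => //.
- exact/mode_series_continuous/(coef_summable pcAC pcP gN2).
- by apply: AC_eq pcAC => x; exact: pE.
have gaP : periodic gamma P.
  by move=> x; rewrite !gE; have := cos_natmul_period 1 x; have := sin_natmul_period 1 x; rewrite !mul1r => -> ->.
apply: periodic_ext => // [x|x xP].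
  by rewrite pP mulrDr addrAC (periodic_int N0 _ gaP).
rewrite -pE// /pc addrC subrK gE.
by have [<- <-] := thE x xP; have [s [-> -> ->]] := form x; rewrite gE.
Qed.

End lifting.

(** * Uniqueness *)

Section energy.
Context {R : realType}.
Notation mu := (@lebesgue_measure R).
Notation P := (@period R).
Implicit Types (f g h p : R -> R) (a b : R).

Definition l2n f : R := Num.sqrt (\int[mu]_(x in `[0, P]) (f x ^+ 2)).

Lemma l2n_ge0 f : 0 <= l2n f. Proof. exact: sqrtr_ge0. Qed.

Lemma l2n_sqr f : l2n f ^+ 2 = \int[mu]_(x in `[0, P]) (f x ^+ 2).
Proof. by rewrite sqr_sqrtr// int_ge0// => x _; exact: sqr_ge0. Qed.

Lemma l2n_mul f g : L2i 0 P f -> L2i 0 P g ->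
  `|\int[mu]_(x in `[0, P]) (f x * g x)| <= l2n f * l2n g.
Proof.
move=> f2 g2; have := cauchy_schwarz f2 g2; rewrite -!l2n_sqr -exprMn.
rewrite -real_normK ?num_real// ler_sqr ?nnegrE ?mulr_ge0 ?l2n_ge0//.
Qed.

Lemma l2n_add f g : L2i 0 P f -> L2i 0 P g -> l2n (fun x => f x + g x) <= l2n f + l2n g.
Proof.
move=> f2 g2; rewrite -ler_sqr ?nnegrE ?addr_ge0 ?l2n_ge0//.
have := int_sqrD 1 1 f2 g2; rewrite !expr1n !mul1r => H.
rewrite l2n_sqr (@eq_int _ _ (fun x => (1 * f x + 1 * g x) ^+ 2)); last by move=> x _; rewrite !mul1r.
rewrite H -!l2n_sqr; have := le_trans (ler_norm _) (l2n_mul f2 g2).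
by rewrite sqrrD mulr1 -mulr_natl; lra.
Qed.

Lemma l2n_opp f : l2n (fun x => - f x) = l2n f.
Proof. by congr Num.sqrt; apply: eq_int => x _; rewrite sqrrN. Qed.

Lemma l2n_le f (e : R) : 0 <= e -> \int[mu]_(x in `[0, P]) (f x ^+ 2) <= e ^+ 2 -> l2n f <= e.
Proof. by move=> e0 H; rewrite -ler_sqr ?nnegrE ?l2n_ge0// l2n_sqr. Qed.

Lemma l2n_sub f g h : L2i 0 P f -> L2i 0 P g -> L2i 0 P h ->
  l2n (fun x => f x - h x) <= l2n (fun x => f x - g x) + l2n (fun x => g x - h x).
Proof.
move=> f2 g2 h2; have := l2n_add (L2iB f2 g2) (L2iB g2 h2).
rewrite (_ : (fun x => f x - g x + (g x - h x)) = (fun x => f x - h x))//.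
by apply/funext => x; ring.
Qed.

Lemma int_mul_sup f g (K : R) : itg 0 P f -> itg 0 P (fun x => f x * g x) ->
  (forall x, x \in `[0, P] -> `|g x| <= K) ->
  `|\int[mu]_(x in `[0, P]) (f x * g x)| <= (\int[mu]_(x in `[0, P]) `|f x|) * K.
Proof.
move=> fi fgi gK; apply: le_trans (int_abs fgi) _.
rewrite mulrC -intZ; last exact: itg_abs.
apply: le_int; [exact: itg_abs|exact/itgZ/itg_abs|] => x /gK gx.
by rewrite normrM mulrC ler_wpM2r.
Qed.

(** The oscillation of [p^2] is at most the integral of [2 |p g| <= p^2 / e + e g^2], and averaging
    over the base point produces the term in [P^-1]. The free [e] makes the derivative term as small
    as desired. *)
Lemma sup_bound p g (e : R) : 0 < e -> continuous p -> AC 0 P p g -> L2i 0 P g ->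
  forall x, x \in `[0, P] -> p x ^+ 2 <=
    (P^-1 + e^-1) * \int[mu]_(x in `[0, P]) (p x ^+ 2) + e * \int[mu]_(x in `[0, P]) (g x ^+ 2).
Proof.
move=> e0 cp pg g2 x xP; have P0 := @period_gt0 R; have P0' := ltW P0.
have p2 : L2i 0 P p by exact: L2i_cont.
have [gi pE] := AC_mul P0' pg pg.
have [_ pi2] := p2; have [_ gi2] := g2.
pose M := e^-1 * \int[mu]_(x in `[0, P]) (p x ^+ 2) + e * \int[mu]_(x in `[0, P]) (g x ^+ 2).
have iM : itg 0 P (fun x => e^-1 * p x ^+ 2 + e * g x ^+ 2) by apply: itgD; apply: itgZ.
have ME : \int[mu]_(x in `[0, P]) (e^-1 * p x ^+ 2 + e * g x ^+ 2) = M by rewrite int_lin2.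
have key y z : y \in `[0, P] -> z \in `[0, P] -> y <= z -> `|p z ^+ 2 - p y ^+ 2| <= M.
  move=> yP zP yz; rewrite !expr2 pE// [X in _ - X]pE//.
  have [y0 _] : 0 <= y /\ y <= P by apply/andP; rewrite in_itv/= in yP.
  have [_ zP'] : 0 <= z /\ z <= P by apply/andP; rewrite in_itv/= in zP.
  rewrite (int_split y0 yz (itgS gi (lexx _) zP')).
  have -> : forall A B C : R, A + (B + C) - (A + B) = C by move=> *; ring.
  apply: le_trans (int_abs (itgS gi y0 zP')) _.
  apply: le_trans (int_le_sub y0 yz zP' (itg_abs gi) _) _; first by move=> *; exact: normr_ge0.
  rewrite -ME; apply: le_int; [exact: itg_abs|exact: iM|] => u _.
  have H : 0 <= (e^-1 * p u - g u) ^+ 2 /\ 0 <= (e^-1 * p u + g u) ^+ 2 by rewrite !sqr_ge0.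
  have E1 : e * (e^-1 * p u - g u) ^+ 2 = e^-1 * p u ^+ 2 + e * g u ^+ 2 - 2 * (p u * g u).
    by field; rewrite gt_eqF.
  have E2 : e * (e^-1 * p u + g u) ^+ 2 = e^-1 * p u ^+ 2 + e * g u ^+ 2 + 2 * (p u * g u).
    by field; rewrite gt_eqF.
  have [H1 H2] := H; have := mulr_ge0 (ltW e0) H1; have := mulr_ge0 (ltW e0) H2.
  by rewrite E1 E2 ler_norml => ? ?; apply/andP; split; lra.
have key2 y : y \in `[0, P] -> p x ^+ 2 <= p y ^+ 2 + M.
  move=> yP; have [xy|/ltW yx] := leP x y.
    by have := key x y xP yP xy; rewrite ler_norml => /andP[]; lra.
  by have := key y x yP xP yx; rewrite ler_norml => /andP[]; lra.
have cc (k : R) : itg 0 P (fun=> k) by apply: itg_cont; exact: cst_continuous.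
have := le_int (cc (p x ^+ 2)) (itgD pi2 (cc M)) (fun y yP => key2 y yP).
rewrite intD// !int_cst// subr0 => H.
rewrite mulrDl -addrA -/M -(ler_pM2r P0) mulrDl.
by rewrite (mulrC P^-1) mulfVK ?gt_eqF.
Qed.

Definition cont_in (T : R) (X : R -> R) := forall t, t \in `[0, T] -> forall e, 0 < e ->
  exists2 d, 0 < d & forall s, s \in `[0, T] -> `|s - t| < d -> `|X s - X t| <= e.

Lemma cont_in_clamp T X : 0 <= T -> cont_in T X -> continuous (fun s => X (clamp 0 T s)).
Proof.
move=> T0 cX x; apply/cvgrPdist_le => e e0.
have [d d0 Hd] := cX _ (clamp_in x T0) _ e0.
near=> y; rewrite distrC; apply: Hd; first exact: clamp_in.
apply: le_lt_trans (clamp_lipschitz T0 _ _) _; rewrite mul1r distrC.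
by near: y; apply: cvgr_dist_lt.
Unshelve. all: by end_near. Qed.

Lemma cont_in_itg T X : 0 <= T -> cont_in T X -> itg 0 T X.
Proof.
move=> T0 cX; apply: eq_itg (itg_cont 0 T (cont_in_clamp T0 cX)).
by move=> x xT; rewrite clamp_id.
Qed.

Lemma cont_in_bounded T X : 0 <= T -> cont_in T X ->
  exists2 M, 0 < M & forall t, t \in `[0, T] -> `|X t| <= M.
Proof.
move=> T0 cX; have [M M0 HM] := continuous_bounded 0 T (cont_in_clamp T0 cX).
by exists M => // t tT; have := HM t tT; rewrite clamp_id.
Qed.

(** Continuity in time with values in L^2, and in the two definitions below in the uniform norm and
    in L^1: the classes of [u_x], of [u] and of the nonlinear term. *)
Definition l2_cont (T : R) (g : R -> R -> R) := forall t, t \in `[0, T] -> forall e, 0 < e ->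
  exists2 d, 0 < d & forall s, s \in `[0, T] -> `|s - t| < d -> l2n (fun x => g s x - g t x) <= e.

Definition sup_cont (T : R) (w : R -> R -> R) := forall t, t \in `[0, T] -> forall e, 0 < e ->
  exists2 d, 0 < d & forall s, s \in `[0, T] -> `|s - t| < d ->
    forall x, x \in `[0, P] -> `|w s x - w t x| <= e.

Definition l1_cont (T : R) (N : R -> R -> R) := forall t, t \in `[0, T] -> forall e, 0 < e ->
  exists2 d, 0 < d & forall s, s \in `[0, T] -> `|s - t| < d ->
    \int[mu]_(x in `[0, P]) `|N s x - N t x| <= e.

Lemma l2n_cont_in (T : R) (g : R -> R -> R) : (forall t, t \in `[0, T] -> L2i 0 P (g t)) -> l2_cont T g ->
  cont_in T (fun t => l2n (g t)).
Proof.
move=> g2 cg t tT e e0; have [d d0 Hd] := cg t tT e e0; exists d => // s sT st.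
have := Hd s sT st; have A := g2 s sT; have B := g2 t tT.
have H1 := l2n_add (L2iB A B) B; have H2 := l2n_add (L2iB B A) A.
have E1 : (fun x => g s x - g t x + g t x) = g s by apply/funext => x; ring.
have E2 : (fun x => g t x - g s x + g s x) = g t by apply/funext => x; ring.
rewrite E1 in H1; rewrite E2 in H2.
have E3 : l2n (fun x => g t x - g s x) = l2n (fun x => g s x - g t x).
  by rewrite -l2n_opp; congr l2n; apply/funext => x; ring.
by rewrite E3 in H2; rewrite ler_norml => ?; apply/andP; split; lra.
Qed.

Lemma l1_cont_in (T : R) (N : R -> R -> R) : (forall t, t \in `[0, T] -> itg 0 P (N t)) -> l1_cont T N ->
  cont_in T (fun t => \int[mu]_(x in `[0, P]) `|N t x|).
Proof.
move=> Ni cN t tT e e0; have [d d0 Hd] := cN t tT e e0; exists d => // s sT st.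
have A := Ni s sT; have B := Ni t tT.
apply: le_trans (Hd s sT st); rewrite -intB; [|exact: itg_abs..].
apply: le_trans (int_abs (itgB (itg_abs A) (itg_abs B))) _.
apply: le_int; [by apply/itg_abs/itgB; exact: itg_abs|by apply/itg_abs/itgB|].
by move=> x _; exact: ler_dist_dist.
Qed.

Lemma is_derive_partial (a b : nat -> R) N x : is_derive x (1 : R)
  (fun y => series (mode a b ^~ y) N)
  (series (mode (fun n => n%:R * b n) (fun n => - (n%:R * a n)) ^~ x) N).
Proof.
elim: N => [|N IH].
  rewrite (_ : (fun y => _) = fun=> 0); last by apply/funext => y; rewrite /series/= big_geq.
  by rewrite /series/= big_geq//; exact: is_derive_cst.
rewrite (_ : (fun y => _) = (fun y => series (mode a b ^~ y) N + mode a b N y)).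
  have -> : series (mode (fun n => n%:R * b n) (fun n => - (n%:R * a n)) ^~ x) N.+1 =
    series (mode (fun n => n%:R * b n) (fun n => - (n%:R * a n)) ^~ x) N +
    mode (fun n => n%:R * b n) (fun n => - (n%:R * a n)) N x.
    by rewrite /series/= big_nat_recr.
  exact: is_deriveD IH (is_derive_mode a b N x).
by apply/funext => y; rewrite /series/= big_nat_recr.
Qed.

Lemma smooth_partial (a b : nat -> R) N : smooth_circle (fun x => series (mode a b ^~ x) N).
Proof.
split=> [x|]; first by apply: eq_bigr => n _; exact: mode_periodic.
suff H m : exists c d, derive1n m (fun x => series (mode a b ^~ x) N) =
    (fun x => series (mode c d ^~ x) N).
  by move=> m x; have [c [d ->]] := H m; have [] := is_derive_partial c d N x.
elim: m => [|m [c [d E]]]; first by exists a, b.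
exists (fun n => n%:R * d n), (fun n => - (n%:R * c n)); rewrite derive1nS E.
by apply/funext => x; rewrite derive1E; have [] := is_derive_partial c d N x.
Qed.

(** * Energy identity for weak solutions *)

Section energy_identity.
Variables (T : R) (w g N : R -> R -> R).
Hypotheses (T0 : 0 < T)
  (wc : forall t, t \in `[0, T] -> continuous (w t) /\ periodic (w t) P)
  (wg : forall t, t \in `[0, T] -> AC 0 P (w t) (g t))
  (g2 : forall t, t \in `[0, T] -> L2i 0 P (g t))
  (Ni : forall t, t \in `[0, T] -> itg 0 P (N t))
  (cw : sup_cont T w) (cg : l2_cont T g) (cN : l1_cont T N)
  (weak : forall phi, smooth_circle phi -> forall t, t \in `[0, T] ->
     \int[mu]_(x in `[0, P]) (w t x * phi x) - \int[mu]_(x in `[0, P]) (w 0 x * phi x) =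
     \int[mu]_(s in `[0, t]) (- (\int[mu]_(x in `[0, P]) (g s x * derive1 phi x)) +
                              \int[mu]_(x in `[0, P]) (N s x * phi x))).

(* Here [q] stands for the derivative of [p]. *)
Definition rhs (p q : R -> R) s := - (\int[mu]_(x in `[0, P]) (g s x * q x)) +
                              \int[mu]_(x in `[0, P]) (N s x * p x).

Lemma itg_contM f p a b : itg a b f -> continuous p -> itg a b (fun x => f x * p x).
Proof.
move=> fi cp; have [M M0 HM] := continuous_bounded a b cp.
apply: (itg_le (g := fun x => M * `|f x|)).
- by apply: measurable_funM; [exact: itg_meas|exact: itg_meas (itg_cont a b cp)].
- by move=> x xab; rewrite normrM mulrC ler_wpM2r//; exact: HM.
- exact/itgZ/itg_abs.
Qed.

(** [g] and [q] are paired in L^2, [N] in L^1 with [p] in the uniform norm; there is one term for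
    each factor that varies. *)
Let rhs_diff p q p' q' s t (K K' : R) : s \in `[0, T] -> t \in `[0, T] ->
  continuous p -> L2i 0 P q -> continuous p' -> L2i 0 P q' ->
  (forall x, x \in `[0, P] -> `|p x| <= K) ->
  (forall x, x \in `[0, P] -> `|p x - p' x| <= K') ->
  `|rhs p q s - rhs p' q' t| <= l2n (fun x => g s x - g t x) * l2n q
    + l2n (g t) * l2n (fun x => q x - q' x)
    + (\int[mu]_(x in `[0, P]) `|N s x - N t x|) * K
    + (\int[mu]_(x in `[0, P]) `|N t x|) * K'.
Proof.
move=> sT tT cp q2 cp' q2' pK pK'.
have gs := g2 sT; have gt := g2 tT; have Ns := Ni sT; have Nt := Ni tT.
have dcp : continuous (fun x => p x - p' x).
  by apply: continuousD_fun => // x; exact/continuousN/cp'.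
have -> : rhs p q s - rhs p' q' t =
    - (\int[mu]_(x in `[0, P]) ((g s x - g t x) * q x))
    - (\int[mu]_(x in `[0, P]) (g t x * (q x - q' x)))
    + \int[mu]_(x in `[0, P]) ((N s x - N t x) * p x)
    + \int[mu]_(x in `[0, P]) (N t x * (p x - p' x)).
  rewrite (@eq_int _ _ (fun x => g s x * q x - g t x * q x)); last by move=> x _; rewrite mulrBl.
  rewrite (intB (L2iM gs q2) (L2iM gt q2)).
  rewrite (@eq_int _ (fun x => g t x * (q x - q' x)) (fun x => g t x * q x - g t x * q' x)); last by move=> x _; rewrite mulrBr.
  rewrite (intB (L2iM gt q2) (L2iM gt q2')).
  rewrite (@eq_int _ (fun x => (N s x - N t x) * p x) (fun x => N s x * p x - N t x * p x)); last by move=> x _; rewrite mulrBl.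
  rewrite (intB (itg_contM Ns cp) (itg_contM Nt cp)).
  rewrite (@eq_int _ (fun x => N t x * (p x - p' x)) (fun x => N t x * p x - N t x * p' x)); last by move=> x _; rewrite mulrBr.
  rewrite (intB (itg_contM Nt cp) (itg_contM Nt cp')) /rhs.
  ring.
have H1 := l2n_mul (L2iB gs gt) q2.
have H2 := l2n_mul gt (L2iB q2 q2').
have H3 := int_mul_sup (itgB Ns Nt) (itg_contM (itgB Ns Nt) cp) pK.
have H4 := int_mul_sup Nt (itg_contM Nt dcp) pK'.
apply: le_trans (ler_normD _ _) _; apply: lerD H4.
apply: le_trans (ler_normD _ _) _; apply: lerD H3.
apply: le_trans (ler_normD _ _) _; rewrite !normrN; exact: lerD.
Qed.


Let l2n0 (f : R -> R) : (forall x, f x = 0) -> l2n f = 0.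
Proof.
move=> f0; rewrite /l2n (@eq_int _ _ (fun=> 0)) ?int_cst ?(ltW (@period_gt0 R))// ?mul0r ?sqrtr0//.
by move=> x _; rewrite f0 expr0n.
Qed.

Let l1n0 (f : R -> R) : (forall x, f x = 0) -> \int[mu]_(x in `[0, P]) `|f x| = 0.
Proof.
move=> f0; rewrite (@eq_int _ _ (fun=> 0)) ?int_cst ?(ltW (@period_gt0 R))// ?mul0r//.
by move=> x _; rewrite f0 normr0.
Qed.

Let rhs_diff_test p q p' q' s (K' : R) : s \in `[0, T] ->
  continuous p -> L2i 0 P q -> continuous p' -> L2i 0 P q' ->
  (forall x, x \in `[0, P] -> `|p x - p' x| <= K') ->
  `|rhs p q s - rhs p' q' s| <= l2n (g s) * l2n (fun x => q x - q' x)
    + (\int[mu]_(x in `[0, P]) `|N s x|) * K'.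
Proof.
move=> sT cp q2 cp' q2' pK'; have [K K0 HK] := continuous_bounded 0 P cp.
have := rhs_diff sT sT cp q2 cp' q2' HK pK'.
rewrite l2n0 => [|x]; last by rewrite subrr.
by rewrite l1n0 => [|x]; rewrite ?subrr// !mul0r addr0 add0r.
Qed.

Lemma rhs_cont p q : continuous p -> L2i 0 P q -> cont_in T (rhs p q).
Proof.
move=> cp q2 t tT e e0; have [K K0 HK] := continuous_bounded 0 P cp.
have C0 : 0 < l2n q + K by rewrite ltr_wpDl// l2n_ge0.
have e'0 : 0 < e / (l2n q + K) by rewrite divr_gt0.
have [d1 d10 H1] := cg tT e'0; have [d2 d20 H2] := cN tT e'0.
exists (Num.min d1 d2) => [|s sT]; first by rewrite lt_min d10 d20.
rewrite lt_min => /andP[s1 s2].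
have := rhs_diff (K' := 0) sT tT cp q2 cp q2 HK.
have -> : l2n (fun x => q x - q x) = 0 by apply: l2n0 => x; rewrite subrr.
rewrite !mulr0 !addr0 => /(_ (fun x _ => _))/wrap[] => [x|]; first by rewrite subrr normr0.
move=> /le_trans; apply.
have -> : e = e / (l2n q + K) * l2n q + e / (l2n q + K) * K.
  by rewrite -mulrDr mulfVK// gt_eqF.
by apply: lerD; apply: ler_wpM2r; rewrite ?l2n_ge0 ?(ltW K0)//; [exact: H1|exact: H2].
Qed.


(** The test function will be frozen at time [t] while [s] runs between [t0] and [t], hence two
    independent times. *)
Let rhs_near t0 e : t0 \in `[0, T] -> 0 < e -> exists2 d, 0 < d &
  forall t s, t \in `[0, T] -> s \in `[0, T] -> `|t - t0| < d -> `|s - t0| < d ->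
  `|rhs (fun x => w t x + w t0 x) (fun x => g t x + g t0 x) s -
    2 * rhs (w t0) (g t0) t0| <= e.
Proof.
move=> t0T e0.
have [G G0 HG] := cont_in_bounded (ltW T0) (l2n_cont_in g2 cg).
have [M M0 HM] := cont_in_bounded (ltW T0) (l1_cont_in Ni cN).
have [K K0 HK] := continuous_bounded 0 P (wc t0T).1.
(* [2 G] and [G] come from the two L^2 pairings, [2 K + 1] bounds the test function, and [M] the L^1
   norm of [N]. *)
pose C : R := 3 * G + M + (2 * K + 1).
have C0 : 0 < C by rewrite /C; lra.
pose e' : R := Num.min 1 (e / C).
have e'0 : 0 < e' by rewrite lt_min ltr01 divr_gt0.
have e'1 : e' <= 1 by rewrite ge_min lexx.
have [d1 d10 H1] := cg t0T e'0; have [d2 d20 H2] := cN t0T e'0.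
have [d3 d30 H3] := cw t0T e'0.
exists (Num.min d1 (Num.min d2 d3)) => [|t s tT sT]; first by rewrite !lt_min d10 d20 d30.
rewrite !lt_min => /and3P[t1 t2 t3] /and3P[s1 s2 s3].
have -> : 2 * rhs (w t0) (g t0) t0 =
    rhs (fun x => w t0 x + w t0 x) (fun x => g t0 x + g t0 x) t0.
  rewrite /rhs (@eq_int _ (fun x => g t0 x * (g t0 x + g t0 x)) (fun x => 2 * (g t0 x * g t0 x))); last by move=> x _ /=; ring.
  rewrite (@eq_int _ (fun x => N t0 x * (w t0 x + w t0 x)) (fun x => 2 * (N t0 x * w t0 x))); last by move=> x _ /=; ring.
  rewrite (intZ 2 (L2iM (g2 t0T) (g2 t0T))) (intZ 2 (itg_contM (Ni t0T) (wc t0T).1)).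
  by rewrite mulrDr mulrN.
have ct := (wc tT).1; have ct0 := (wc t0T).1.
have B1 x : x \in `[0, P] -> `|w t x + w t0 x| <= 2 * K + 1.
  move=> xP; have := H3 t tT t3 x xP; have := HK x xP.
  by rewrite !ler_norml => /andP[? ?] /andP[? ?]; apply/andP; split; lra.
have B2 x : x \in `[0, P] -> `|(w t x + w t0 x) - (w t0 x + w t0 x)| <= e'.
  by move=> xP; rewrite addrKA; exact: H3.
have := rhs_diff sT t0T (continuousD_fun ct ct0) (L2iD (g2 tT) (g2 t0T))
  (continuousD_fun ct0 ct0) (L2iD (g2 t0T) (g2 t0T)) B1 B2.
move/le_trans; apply.
have -> : (fun x => g t x + g t0 x - (g t0 x + g t0 x)) = (fun x => g t x - g t0 x).
  by apply/funext => x; rewrite addrKA.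
have L1 : l2n (fun x => g t x + g t0 x) <= 2 * G.
  apply: le_trans (l2n_add (g2 tT) (g2 t0T)) _.
  by have := HG t tT; have := HG t0 t0T; rewrite !ger0_norm ?l2n_ge0//; lra.
have Ce : e' * C <= e.
  by rewrite -ler_pdivlMr// /e' ge_min lexx orbT.
apply: le_trans Ce; rewrite /C !mulrDr.
have P1 : l2n (fun x => g s x - g t0 x) * l2n (fun x => g t x + g t0 x) <= e' * (2 * G).
  by apply: ler_pM; rewrite ?l2n_ge0// ; exact: H1.
have P2 : l2n (g t0) * l2n (fun x => g t x - g t0 x) <= G * e'.
  apply: ler_pM; rewrite ?l2n_ge0//; last exact: H1.
  by have := HG t0 t0T; rewrite ger0_norm ?l2n_ge0.
have P3 : (\int[mu]_(x in `[0, P]) `|N s x - N t0 x|) * (2 * K + 1) <= e' * (2 * K + 1).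
  by apply: ler_wpM2r; [lra|exact: H2].
have P4 : (\int[mu]_(x in `[0, P]) `|N t0 x|) * e' <= M * e'.
  apply: ler_wpM2r; first exact: ltW.
  by have := HM t0 t0T; rewrite ger0_norm// int_ge0// => x _; exact: normr_ge0.
by move: P1 P2 P3 P4; rewrite !mulrDr; lra.
Qed.


Let int_mul_cont (p q : R -> R) : continuous p -> continuous q ->
  itg 0 P (fun x => p x * q x).
Proof. by move=> cp cq; apply: itg_cont; exact: continuousM_fun. Qed.

(* The Fourier partial sums of [p] are smooth and converge to [p] uniformly, with
   derivatives converging in L^2, uniformly in time once paired with [g] and [N]. *)
Let weak_ext p q t : continuous p -> periodic p P -> AC 0 P p q -> L2i 0 P q -> t \in `[0, T] ->
  \int[mu]_(x in `[0, P]) (w t x * p x) - \int[mu]_(x in `[0, P]) (w 0 x * p x) =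
  \int[mu]_(s in `[0, t]) rhs p q s.
Proof.
move=> cp pP pq q2 tT.
have T0T : 0 \in `[0, T] by rewrite in_itv/= lexx ltW.
have /andP[t0 tT'] : 0 <= t <= T by move: tT; rewrite in_itv.
have pP0 : p P = p 0 by rewrite -[in LHS](add0r P) pP.
have [G G0 HG] := cont_in_bounded (ltW T0) (l2n_cont_in g2 cg).
have [M M0 HM] := cont_in_bounded (ltW T0) (l1_cont_in Ni cN).
have W t' : t' \in `[0, T] -> 0 <= \int[mu]_(x in `[0, P]) `|w t' x|.
  by move=> _; apply: int_ge0 => x _; exact: normr_ge0.
pose C : R := \int[mu]_(x in `[0, P]) `|w t x| + \int[mu]_(x in `[0, P]) `|w 0 x| + (G + M) * t.
apply/subr0_eq/(@small_eq0 _ _ C) => e e0 e1.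
have s1 := coef_summable pq pP0 q2; have s2 := dcoef_summable pq pP0 q2.
have [N1 HN1] := tailsum_small s1 e0.
have e20 : 0 < e ^+ 2 / pi by rewrite divr_gt0 ?exprn_gt0 ?pi_gt0.
have [N2 HN2] := tailsum_small s2 e20.
pose n := maxn N1 N2.
pose pn x := series (mode (coefc p) (coefs p) ^~ x) n.
pose qn x := series (mode (fun n => n%:R * coefs p n) (fun n => - (n%:R * coefc p n)) ^~ x) n.
have pnE x : `|p x - pn x| <= e.
  rewrite (fourier_sumT cp pq pP q2 x).
  apply: le_trans (tail_le _ (fun k => mode_le _ _ k x) s1) _.
  by apply: le_trans (ler_norm _) (HN1 _ (leq_maxl _ _)).
have qnE : l2n (fun x => q x - qn x) <= e.
  apply: l2n_le (ltW e0) _; apply: le_trans (int_sub_partial_le cp pq pP q2 n) _.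
  rewrite mulrC -ler_pdivlMr ?pi_gt0//.
  by apply: le_trans (ler_norm _) (HN2 _ (leq_maxr _ _)).
have cpn : continuous pn by exact: continuous_partial.
have cqn : continuous qn by exact: continuous_partial.
have dpn : derive1 pn = qn.
  by apply/funext => x; rewrite derive1E; have [_ ->] := is_derive_partial (coefc p) (coefs p) n x.
have dcp : continuous (fun x => p x - pn x).
  by apply: continuousD_fun => // x; exact/continuousN/cpn.
have qn2 := L2i_cont 0 P cqn.
have wk := weak (smooth_partial (coefc p) (coefs p) n) tT.
rewrite -/pn in wk.
have wk' : \int[mu]_(x in `[0, P]) (w t x * pn x) - \int[mu]_(x in `[0, P]) (w 0 x * pn x) =
    \int[mu]_(s in `[0, t]) rhs pn qn s by rewrite wk -dpn.
have sub t' : t' \in `[0, T] -> \int[mu]_(x in `[0, P]) (w t' x * p x) =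
   \int[mu]_(x in `[0, P]) (w t' x * pn x) + \int[mu]_(x in `[0, P]) (w t' x * (p x - pn x)).
  move=> t'T; have [cw' _] := wc t'T.
  rewrite -intD; [|exact: int_mul_cont..].
  by apply: eq_int => x _; rewrite mulrBr addrC subrK.
have st' s : s \in `[0, t] -> s \in `[0, T].
  by rewrite !in_itv/= => /andP[-> /le_trans->].
have i1 : itg 0 t (rhs p q) by apply: itgS (cont_in_itg (ltW T0) (rhs_cont cp q2)) _ tT'.
have i2 : itg 0 t (rhs pn qn) by apply: itgS (cont_in_itg (ltW T0) (rhs_cont cpn qn2)) _ tT'.
rewrite (sub t tT) (sub 0 T0T).
have -> : forall A B A' B' D : R, A + B - (A' + B') - D = (A - A') + (B - B') - D by move=> *; ring.
rewrite wk'.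
have -> : forall A B D : R, A + B - D = B - (D - A) by move=> *; ring.
rewrite -(intB i1 i2).
apply: le_trans (ler_normB _ _) _; rewrite /C mulrDl; apply: lerD.
  apply: le_trans (ler_normB _ _) _; rewrite mulrDl; apply: lerD.
    apply: int_mul_sup; [exact/itg_cont/(wc tT).1|exact: int_mul_cont (wc tT).1 dcp|by []].
  apply: int_mul_sup; [exact/itg_cont/(wc T0T).1|exact: int_mul_cont (wc T0T).1 dcp|by []].
rewrite mulrAC -[X in _ * X]subr0.
apply: int_bound t0 (itgB i1 i2) _ => s /st' sT.
apply: le_trans (rhs_diff_test sT cp q2 cpn qn2 (fun x _ => pnE x)) _.
rewrite mulrDl; apply: lerD; last first.
  apply: ler_wpM2r; first exact: ltW.
  by have := HM s sT; rewrite ger0_norm// int_ge0// => x _; exact: normr_ge0.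
apply: ler_pM; rewrite ?l2n_ge0//.
by have := HG s sT; rewrite ger0_norm ?l2n_ge0.
Qed.

(** Differentiability relative to [[0, T]], one-sided at the ends, as a first-order expansion. *)
Definition diff_in (X L : R -> R) := forall t, t \in `[0, T] -> forall e, 0 < e ->
  exists2 d, 0 < d & forall s, s \in `[0, T] -> `|s - t| < d ->
    `|X s - X t - (s - t) * L t| <= e * `|s - t|.

(* |w(t)|^2 - |w(t0)|^2 is the increment of [w] tested against [w t + w t0]. *)
Lemma energy_diff : diff_in (fun t => \int[mu]_(x in `[0, P]) (w t x ^+ 2))
   (fun t => 2 * rhs (w t) (g t) t).
Proof.
move=> t0 t0T e e0; have [d d0 Hd] := rhs_near t0T e0; exists d => // t tT tt0.
pose p x := w t x + w t0 x; pose q x := g t x + g t0 x.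
have [ct pt] := wc tT; have [ct0 pt0] := wc t0T.
have cp : continuous p by exact: continuousD_fun.
have q2 : L2i 0 P q by apply: L2iD; exact: g2.
have wk r (rT : r \in `[0, T]) := weak_ext cp (fun x => congr2 +%R (pt x) (pt0 x)) (AC_add (wg tT) (wg t0T)) q2 rT.
have E : \int[mu]_(x in `[0, P]) (w t x ^+ 2) - \int[mu]_(x in `[0, P]) (w t0 x ^+ 2) =
    \int[mu]_(s in `[0, t]) rhs p q s - \int[mu]_(s in `[0, t0]) rhs p q s.
  rewrite -(wk _ tT) -(wk _ t0T) opprB addrA subrK.
  rewrite -!intB; [|by apply: itg_cont; exact: continuousM_fun..| |]; last 2 first.
  - by apply: itg_cont; exact: continuousX_fun.
  - by apply: itg_cont; exact: continuousX_fun.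
  by apply: eq_int => x _; rewrite /p; ring.
have ir : itg 0 T (rhs p q) := cont_in_itg (ltW T0) (rhs_cont cp q2).
set L := 2 * _.
have key a b : 0 <= a -> a <= b -> b <= T -> (forall r, r \in `[a, b] -> `|r - t0| < d) ->
    `|\int[mu]_(s in `[0, b]) rhs p q s - \int[mu]_(s in `[0, a]) rhs p q s - (b - a) * L| <= e * `|b - a|.
  move=> a0 ab bT abd.
  rewrite (int_split a0 ab (itgS ir (lexx _) bT)) [X in X - _ * _]addrAC subrr add0r.
  have iab := itgS ir a0 bT.
  rewrite (mulrC (b - a)) -(@int_cst _ L a b ab) -(intB iab) => [|]; last by apply: itg_cont; exact: cst_continuous.
  rewrite (ger0_norm (x := b - a)) ?subr_ge0//.
  apply: int_bound ab _ _ => [|s sab].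
    by apply: itgB iab _; apply: itg_cont; exact: cst_continuous.
  apply: Hd => //; last exact: abd.
  by move: sab; rewrite !in_itv/= => /andP[as_ sb]; rewrite (le_trans a0 as_) (le_trans sb bT).
rewrite E; move: tT t0T; rewrite !in_itv/= => /andP[t_0 t_T] /andP[t0_0 t0_T].
have [le|/ltW le] := leP t0 t.
  apply: key => // r; rewrite in_itv/= => /andP[r1 r2].
  apply: le_lt_trans tt0; rewrite !ger0_norm ?subr_ge0//; lra.
rewrite -normrN (distrC t t0).
have -> : forall A B : R, - (A - B - (t - t0) * L) = B - A - (t0 - t) * L by move=> *; ring.
apply: key => // r; rewrite in_itv/= => /andP[r1 r2].
apply: le_lt_trans tt0; rewrite !ler0_norm ?subr_le0//; lra.
Qed.

End energy_identity.
End energy.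

(** * Gronwall's lemma and stability of the classes of curves *)

Section classes.
Context {R : realType}.
Notation mu := (@lebesgue_measure R).
Notation P := (@period R).
Variable T : R.
Hypothesis T0 : 0 < T.
Implicit Types (X L : R -> R) (w g N : R -> R -> R).

(** Mean value theorem for [X t exp (- C t)], whose derivative is nonpositive. *)
Lemma gronwall X L (C : R) : diff_in T X L -> X 0 = 0 ->
  (forall t, t \in `[0, T] -> 0 <= X t) -> (forall t, t \in `[0, T] -> L t <= C * X t) ->
  forall t, t \in `[0, T] -> X t = 0.
Proof.
move=> dX X0 Xge LX t tT; have T0' := ltW T0.
have cX : cont_in T X.
  move=> s sT e e0; have [d d0 Hd] := dX s sT 1 ltr01.
  have K0 : 0 < 1 + `|L s| by rewrite ltr_pwDl.
  exists (Num.min d (e / (1 + `|L s|))) => [|r rT]; first by rewrite lt_min d0 divr_gt0.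
  rewrite lt_min => /andP[rd re]; have := Hd r rT rd; rewrite mul1r => H.
  rewrite -[X in `|X|](subrK ((r - s) * L s)); apply: le_trans (ler_normD _ _) _.
  rewrite normrM; move/ltW: re; rewrite ler_pdivlMr// mulrDr mulr1; lra.
have cXc := cont_in_clamp T0' cX.
pose f s := X (clamp 0 T s) * expR (- (C * s)).
have cf : continuous f.
  apply: continuousM_fun => // s; apply: (@continuous_comp _ _ _ (fun s : R => - (C * s)) expR).
    by apply: (@continuousN _ _ _ (fun s : R => C * s)); apply: continuousZ_fun => r; exact: cvg_id.
  exact: continuous_expR.
have /andP[t0 tT'] : 0 <= t <= T by move: tT; rewrite in_itv.
move: t0; rewrite le_eqVlt => /orP[/eqP<-//|t0].
have df s : s \in `]0, t[ -> is_derive s (1 : R) f ((L s - C * X s) * expR (- (C * s))).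
  rewrite in_itv/= => /andP[s0 st].
  have sT : s \in `[0, T] by rewrite in_itv/= (ltW s0) (le_trans (ltW st) tT').
  have dXs : is_derive s (1 : R) (fun r => X (clamp 0 T r)) (L s).
    apply/is_derive_epsP => e e0; have [d d0 Hd] := dX s sT e e0.
    exists (Num.min d (Num.min s (T - s))) => [|h]; first by rewrite !lt_min d0 s0 subr_gt0 (lt_le_trans st tT').
    rewrite !lt_min => /and3P[hd hs hT].
    have hsT : s + h \in `[0, T].
      by move: hs hT; rewrite !ltr_norml in_itv/= => /andP[? ?] /andP[? ?]; apply/andP; split; lra.
    rewrite !clamp_id//.
    by have := Hd _ hsT; rewrite (addrC s) addrK; exact.
  have dE : is_derive s (1 : R) (fun r => expR (- (C * r))) (- C * expR (- (C * s))).
    have dl : is_derive s (1 : R) (fun r : R => - (C * r)) (- C).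
      by apply: is_derive_eq; rewrite /GRing.scale /= mulr1.
    apply: (is_derive_eq (is_derive1_comp (is_derive_expR _) dl)).
    by rewrite /GRing.scale /= mulrC.
  apply: (is_derive_eq (is_deriveM dXs dE)).
  by rewrite /GRing.scale /= !clamp_id//; ring.
have [c ct] := MVT t0 df (continuous_subspaceT cf).
have cT : c \in `[0, T] by move: ct; rewrite !in_itv/= => /andP[/ltW-> /ltW/le_trans->].
rewrite /f clamp_id// clamp_id ?in_itv/= ?lexx// X0 mul0r !subr0 => H.
have : X t * expR (- (C * t)) <= 0.
  rewrite H; apply: mulr_le0_ge0 => //; last exact: ltW.
  by apply: mulr_le0_ge0; rewrite ?expR_ge0// subr_le0; exact: LX.
by rewrite pmulr_lle0 ?expR_gt0// => H'; apply/le_anti; rewrite H' Xge.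
Qed.

Lemma diff_in_sum (I : Type) (s : seq I) (X L : I -> R -> R) :
  (forall i, diff_in T (X i) (L i)) ->
  diff_in T (fun t => \sum_(i <- s) X i t) (fun t => \sum_(i <- s) L i t).
Proof.
move=> dX; elim: s => [|i s IH] t tT e e0.
  by exists 1 => // r _ _; rewrite !big_nil mulr0 !subrr normr0 mulr_ge0// ltW.
have e20 : 0 < e / 2 by rewrite divr_gt0.
have [d1 d10 H1] := dX i t tT _ e20; have [d2 d20 H2] := IH t tT _ e20.
exists (Num.min d1 d2) => [|r rT]; first by rewrite lt_min d10 d20.
rewrite lt_min => /andP[r1 r2]; rewrite !big_cons.
have := H1 r rT r1; have := H2 r rT r2.
set A := \sum_(j <- s) X j r; set B := \sum_(j <- s) X j t; set D := \sum_(j <- s) L j t.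
have -> : X i r + A - (X i t + B) - (r - t) * (L i t + D) =
   (X i r - X i t - (r - t) * L i t) + (A - B - (r - t) * D) by ring.
by move=> ? ?; apply: le_trans (ler_normD _ _) _; lra.
Qed.

Definition in_CL1 N := (forall t, t \in `[0, T] -> itg 0 P (N t)) /\ l1_cont T N.
Definition in_CL2 g := (forall t, t \in `[0, T] -> L2i 0 P (g t)) /\ l2_cont T g.
Definition in_Csup w := (forall t, t \in `[0, T] -> continuous (w t)) /\ sup_cont T w.

Lemma in_CL1D N N' : in_CL1 N -> in_CL1 N' -> in_CL1 (fun t x => N t x + N' t x).
Proof.
move=> [Ni cN] [Ni' cN']; split=> [t tT|t tT e e0]; first by apply: itgD; [exact: Ni|exact: Ni'].
have e20 : 0 < e / 2 by rewrite divr_gt0.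
have [d1 d10 H1] := cN t tT _ e20; have [d2 d20 H2] := cN' t tT _ e20.
exists (Num.min d1 d2) => [|r rT]; first by rewrite lt_min d10 d20.
rewrite lt_min => /andP[r1 r2]; have := H1 r rT r1; have := H2 r rT r2 => h2 h1.
have iN := itgB (Ni r rT) (Ni t tT); have iN' := itgB (Ni' r rT) (Ni' t tT).
apply: le_trans (le_trans (lerD h1 h2) _); last by lra.
rewrite -intD; [|exact: itg_abs..].
apply: le_int => [| |x _].
- by apply: itg_abs; apply: itgB; apply: itgD; [exact: Ni|exact: Ni'|exact: Ni|exact: Ni'].
- by apply: itgD; exact: itg_abs.
- by rewrite opprD addrACA; exact: ler_normD.
Qed.

Lemma in_CL1M w N : in_Csup w -> in_CL1 N -> in_CL1 (fun t x => w t x * N t x).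
Proof.
move=> [wc cw] [Ni cN].
have Mi t (v : R -> R) (tT : t \in `[0, T]) : continuous v -> itg 0 P (fun x => v x * N t x).
  by move=> cv; apply: eq_itg (itg_contM (Ni t tT) cv) => x _; rewrite mulrC.
split=> [t tT|t tT e e0]; first exact/Mi/wc.
have [K K0 HK] := continuous_bounded 0 P (wc t tT).
pose A := \int[mu]_(x in `[0, P]) `|N t x|.
have A0 : 0 <= A by apply: int_ge0 => x _; exact: normr_ge0.
pose C : R := K + 1 + A.
have C0 : 0 < C by rewrite /C; lra.
pose e' : R := Num.min 1 (e / C).
have e'0 : 0 < e' by rewrite lt_min ltr01 divr_gt0.
have e'1 : e' <= 1 by rewrite ge_min lexx.
have [d1 d10 H1] := cN t tT _ e'0; have [d2 d20 H2] := cw t tT _ e'0.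
exists (Num.min d1 d2) => [|r rT]; first by rewrite lt_min d10 d20.
rewrite lt_min => /andP[r1 r2]; have h1 := H1 r rT r1; have h2 := H2 r rT r2.
have i1 := itg_abs (itgB (Ni r rT) (Ni t tT)); have i2 := itg_abs (Ni t tT).
have Ce : e' * C <= e by rewrite -ler_pdivlMr// /e' ge_min lexx orbT.
apply: (@le_trans _ _ (\int[mu]_(x in `[0, P]) ((K + 1) * `|N r x - N t x| + e' * `|N t x|))).
  apply: le_int => [| |x xP].
  - by apply: itg_abs; apply: itgB; apply: Mi => //; exact: wc.
  - by apply: itgD; exact: itgZ.
  - have -> : w r x * N r x - w t x * N t x = w r x * (N r x - N t x) + (w r x - w t x) * N t x by ring.
    apply: le_trans (ler_normD _ _) _; rewrite !normrM; apply: lerD; apply: ler_wpM2r => //; last exact: h2.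
    have := h2 x xP; have := HK x xP.
    by rewrite !ler_norml => /andP[? ?] /andP[? ?]; apply/andP; split; lra.
rewrite int_lin2//; apply: le_trans Ce; rewrite /C -/A mulrDr lerD2r mulrC ler_wpM2r//; lra.
Qed.

Lemma in_CL2M g h : in_CL2 g -> in_CL2 h -> in_CL1 (fun t x => g t x * h t x).
Proof.
move=> [g2 cg] [h2 ch]; split=> [t tT|t tT e e0]; first by apply: L2iM; [exact: g2|exact: h2].
pose C : R := l2n (g t) + 1 + l2n (h t).
have gt0 := l2n_ge0 (g t); have ht0 := l2n_ge0 (h t).
have C0 : 0 < C by rewrite /C; lra.
pose e' : R := Num.min 1 (e / C).
have e'0 : 0 < e' by rewrite lt_min ltr01 divr_gt0.
have e'1 : e' <= 1 by rewrite ge_min lexx.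
have [d1 d10 H1] := cg t tT _ e'0; have [d2 d20 H2] := ch t tT _ e'0.
exists (Num.min d1 d2) => [|r rT]; first by rewrite lt_min d10 d20.
rewrite lt_min => /andP[r1 r2]; have k1 := H1 r rT r1; have k2 := H2 r rT r2.
have Ce : e' * C <= e by rewrite -ler_pdivlMr// /e' ge_min lexx orbT.
have gr := g2 r rT; have gt := g2 t tT; have hr := h2 r rT; have ht := h2 t tT.
have gK : l2n (g r) <= l2n (g t) + 1.
  have := l2n_add (L2iB gr gt) gt.
  by rewrite (_ : (fun x => g r x - g t x + g t x) = g r); [lra|apply/funext => x; rewrite subrK].
have i1 := L2iM (L2i_abs gr) (L2i_abs (L2iB hr ht)).
have i2 := L2iM (L2i_abs (L2iB gr gt)) (L2i_abs ht).
have l2nabs (f : R -> R) : l2n (fun x => `|f x|) = l2n f.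
  by congr Num.sqrt; apply: eq_int => x _; rewrite real_normK ?num_real.
apply: (@le_trans _ _ (\int[mu]_(x in `[0, P]) (`|g r x| * `|h r x - h t x| + `|g r x - g t x| * `|h t x|))).
  apply: le_int => [| |x xP].
  - by apply: itg_abs; apply: itgB; exact: L2iM.
  - exact: itgD.
  - have -> : g r x * h r x - g t x * h t x = g r x * (h r x - h t x) + (g r x - g t x) * h t x by ring.
    by apply: le_trans (ler_normD _ _) _; rewrite !normrM.
rewrite intD//; apply: le_trans Ce; rewrite /C mulrDr; apply: lerD.
  apply: le_trans (ler_norm _) _; apply: le_trans (l2n_mul (L2i_abs gr) (L2i_abs (L2iB hr ht))) _.
  by rewrite !l2nabs mulrC; apply: ler_pM; rewrite ?l2n_ge0.
apply: le_trans (ler_norm _) _; apply: le_trans (l2n_mul (L2i_abs (L2iB gr gt)) (L2i_abs ht)) _.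
by rewrite !l2nabs; apply: ler_pM; rewrite ?l2n_ge0.
Qed.

Lemma in_CsupD w w' : in_Csup w -> in_Csup w' -> in_Csup (fun t x => w t x + w' t x).
Proof.
move=> [wc cw] [wc' cw']; split=> [t tT|t tT e e0].
  by apply: continuousD_fun; [exact: wc|exact: wc'].
have e20 : 0 < e / 2 by rewrite divr_gt0.
have [d1 d10 H1] := cw t tT _ e20; have [d2 d20 H2] := cw' t tT _ e20.
exists (Num.min d1 d2) => [|r rT]; first by rewrite lt_min d10 d20.
rewrite lt_min => /andP[r1 r2] x xP; have := H1 r rT r1 x xP; have := H2 r rT r2 x xP.
by rewrite opprD addrACA => ? ?; apply: le_trans (ler_normD _ _) _; lra.
Qed.

Lemma in_CsupM w w' : in_Csup w -> in_Csup w' -> in_Csup (fun t x => w t x * w' t x).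
Proof.
move=> [wc cw] [wc' cw']; split=> [t tT|t tT e e0].
  by apply: continuousM_fun; [exact: wc|exact: wc'].
have [K K0 HK] := continuous_bounded 0 P (wc t tT).
have [K' K'0 HK'] := continuous_bounded 0 P (wc' t tT).
pose C : R := K + 1 + K'.
have C0 : 0 < C by rewrite /C; lra.
pose e' : R := Num.min 1 (e / C).
have e'0 : 0 < e' by rewrite lt_min ltr01 divr_gt0.
have e'1 : e' <= 1 by rewrite ge_min lexx.
have Ce : e' * C <= e by rewrite -ler_pdivlMr// /e' ge_min lexx orbT.
have [d1 d10 H1] := cw t tT _ e'0; have [d2 d20 H2] := cw' t tT _ e'0.
exists (Num.min d1 d2) => [|r rT]; first by rewrite lt_min d10 d20.
rewrite lt_min => /andP[r1 r2] x xP; have h1 := H1 r rT r1 x xP; have h2 := H2 r rT r2 x xP.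
have -> : w r x * w' r x - w t x * w' t x = w r x * (w' r x - w' t x) + (w r x - w t x) * w' t x by ring.
apply: le_trans (ler_normD _ _) _; rewrite !normrM.
apply: le_trans Ce; rewrite /C mulrDr; apply: lerD; last by apply: ler_pM => //; exact: HK'.
rewrite mulrC; apply: ler_pM => //.
have := HK x xP; move: h1; rewrite !ler_norml => /andP[? ?] /andP[? ?]; apply/andP; split; lra.
Qed.

Lemma in_CsupN w : in_Csup w -> in_Csup (fun t x => - w t x).
Proof.
move=> [wc cw]; split=> [t tT x|t tT e e0]; first by apply: (@continuousN _ _ _ (w t)); exact: wc.
have [d d0 H] := cw t tT _ e0; exists d => // s sT st x xP.
by rewrite -opprD normrN; exact: H.
Qed.

Lemma in_Csup_cst (c : R) : in_Csup (fun _ _ => c).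
Proof.
split=> [t tT|t tT e e0]; first exact: cst_continuous.
by exists 1 => // s _ _ x _; rewrite subrr normr0 ltW.
Qed.

Lemma in_Csup_sum (I : Type) (s : seq I) (w : I -> R -> R -> R) :
  (forall i, in_Csup (w i)) -> in_Csup (fun t x => \sum_(i <- s) w i t x).
Proof.
move=> H; elim: s => [|i s IH].
  rewrite (_ : (fun t => _) = fun _ _ => 0); first exact: in_Csup_cst.
  by apply/funext => t; apply/funext => x; rewrite big_nil.
rewrite (_ : (fun t => _) = fun t x => w i t x + \sum_(j <- s) w j t x); first exact: in_CsupD.
by apply/funext => t; apply/funext => x; rewrite big_cons.
Qed.

Lemma in_CL1_cst (h : R -> R) : itg 0 P h -> in_CL1 (fun=> h).
Proof.
move=> hi; split=> // t tT e e0; exists 1 => // s _ _.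
rewrite (@eq_int _ _ (fun=> 0)) => [|x _]; last by rewrite subrr normr0.
by rewrite int_cst ?(ltW (@period_gt0 R))// mul0r ltW.
Qed.

Lemma in_CL1_sum (I : Type) (s : seq I) (w : I -> R -> R -> R) :
  (forall i, in_CL1 (w i)) -> in_CL1 (fun t x => \sum_(i <- s) w i t x).
Proof.
move=> H; elim: s => [|i s IH].
  rewrite (_ : (fun t => _) = fun _ _ => 0).
    by apply: in_CL1_cst; apply: itg_cont; exact: cst_continuous.
  by apply/funext => t; apply/funext => x; rewrite big_nil.
rewrite (_ : (fun t => _) = fun t x => w i t x + \sum_(j <- s) w j t x); first exact: in_CL1D.
by apply/funext => t; apply/funext => x; rewrite big_cons.
Qed.

Lemma continuous_slice (f : R * R -> R) t x : {for (t, x), continuous f} ->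
  {for x, continuous (fun y => f (t, y))}.
Proof.
move=> cf; apply: (@continuous_comp R (R * R)%type R (fun y : R => (t, y)) f x _ cf).
move=> A /= HA.
exact: (@cvg_pair R R R (nbhs x) (nbhs t) (nbhs x) _ _ _ (fun=> t) id (@cvg_cst _ t _ _ _) cvg_id A HA).
Qed.

(** Compactness of [[0, P]] makes the neighbourhood of [t] uniform in [x]. Joint continuity is asked
    for at the single time [t], so that the lemma applies at positive times to functions that are
    singular at [0]. *)
Lemma sup_near (f : R -> R -> R) t (e : R) :
  (forall x, {for (t, x), continuous (fun p : R * R => f p.1 p.2)}) -> 0 < e ->
  exists2 d, 0 < d & forall s, `|s - t| < d -> forall x, x \in `[0, P] -> `|f s x - f t x| <= e.
Proof.
move=> cf e0; have e20 : 0 < e / 2 by rewrite divr_gt0.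
have cft x : {for x, continuous (f t)}.
  exact: (continuous_slice (f := fun p : R * R => f p.1 p.2) (cf x)).
have near_cov : \forall s \near t, `[0, P]%classic `<=` (fun x => `|f s x - f t x| <= e).
  have nc := (compact_near_coveringP _).1 (@segment_compact R 0 P) R (nbhs t) (fun s x => `|f s x - f t x| <= e).
  apply: nc => x xP.
  have c1 : \forall q \near (t, x), `|f t x - f q.1 q.2| < e / 2.
    by move: (cf x) => /cvgrPdist_lt/(_ _ e20).
  have c2 : \forall x' \near x, `|f t x - f t x'| < e / 2.
    by move: (cft x) => /cvgrPdist_lt/(_ _ e20).
  move: c1 => [[U V] /= [Ut Vx] UV].
  near=> x' s.
  have h1 : `|f t x - f s x'| < e / 2.
    apply: (UV (s, x')); split => /=; first by near: s.
    by near: x'.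
  have h2 : `|f t x - f t x'| < e / 2 by near: x'.
  move: h1 h2; rewrite !ltr_norml ler_norml => /andP[? ?] /andP[? ?].
  by apply/andP; split; lra.
move: near_cov => /nbhs_ballP[d d0 H]; exists d => // s st x xP.
by apply: (H s) => //=; rewrite /ball/= distrC.
Unshelve. all: by end_near. Qed.

Lemma in_Csup_joint (f : R -> R -> R) : continuous (fun p : R * R => f p.1 p.2) -> in_Csup f.
Proof.
move=> cf; split=> [t _ x|t tT e e0].
  exact: (continuous_slice (f := fun p : R * R => f p.1 p.2) (cf (t, x))).
by have [d d0 H] := sup_near (fun x => cf (t, x)) e0; exists d => // s _ /H.
Qed.

End classes.

(** * Curves in H^1 coordinate by coordinate *)

Section uniqueness.
Context {R : realType}.
Notation mu := (@lebesgue_measure R).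
Notation P := (@period R).
Variable T : R.

Lemma int_enorm_sqr n (w : R -> 'rV[R]_n) : (forall i, L2i 0 P (fun x => w x 0 i)) ->
  \int[mu]_(x in `[0, P]) (enorm (w x) ^+ 2) = \sum_(i < n) l2n (fun x => w x 0 i) ^+ 2.
Proof.
move=> w2; rewrite (@eq_int _ _ (fun x => \sum_(i < n) w x 0 i ^+ 2)) => [|x _].
  by rewrite int_sum => [|i]; [apply: eq_bigr => i _; rewrite l2n_sqr|have [] := w2 i].
by rewrite enorm_sqr; apply: eq_bigr => i _; rewrite expr2.
Qed.

Lemma H1_norm_ge n (w wx : R -> 'rV[R]_n) : (forall i, L2i 0 P (fun x => w x 0 i)) ->
  (forall i, L2i 0 P (fun x => wx x 0 i)) -> forall i,
  l2n (fun x => w x 0 i) <= H1_norm w wx /\ l2n (fun x => wx x 0 i) <= H1_norm w wx.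
Proof.
move=> w2 wx2 i; rewrite /H1_norm /circle !int_enorm_sqr//.
set A := \sum_(i < n) _; set B := \sum_(i < n) _.
have A0 : 0 <= A by apply: sumr_ge0 => j _; exact: sqr_ge0.
have B0 : 0 <= B by apply: sumr_ge0 => j _; exact: sqr_ge0.
have Ai : l2n (fun x => w x 0 i) ^+ 2 <= A.
  by rewrite /A (bigD1 i)//= lerDl; apply: sumr_ge0 => j _; exact: sqr_ge0.
have Bi : l2n (fun x => wx x 0 i) ^+ 2 <= B.
  by rewrite /B (bigD1 i)//= lerDl; apply: sumr_ge0 => j _; exact: sqr_ge0.
split; rewrite -ler_sqr ?nnegrE ?l2n_ge0 ?sqrtr_ge0// [leRHS]sqr_sqrtr ?addr_ge0//.
  by apply: le_trans Ai _; rewrite lerDl.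
by apply: le_trans Bi _; rewrite lerDr.
Qed.

Lemma H1_norm_le n (w wx : R -> 'rV[R]_n) (e : R) : 0 <= e ->
  (forall i, L2i 0 P (fun x => w x 0 i)) -> (forall i, L2i 0 P (fun x => wx x 0 i)) ->
  (forall i, l2n (fun x => w x 0 i) <= e) -> (forall i, l2n (fun x => wx x 0 i) <= e) ->
  H1_norm w wx <= 2 * n%:R * e.
Proof.
move=> e0 w2 wx2 we wxe; rewrite /H1_norm /circle !int_enorm_sqr//.
have n0 : 0 <= n%:R :> R by exact: ler0n.
case: n w wx w2 wx2 we wxe n0 => [|n] w wx w2 wx2 we wxe n0.
  by rewrite !big_ord0 addr0 sqrtr0 mulr0 mul0r.
have S (v : 'I_n.+1 -> R) : (forall i, 0 <= v i <= e) -> \sum_(i < n.+1) v i ^+ 2 <= n.+1%:R * e ^+ 2.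
  move=> ve; apply: (@le_trans _ _ (\sum_(i < n.+1) e ^+ 2)).
    by apply: ler_sum => i _; have /andP[v0 v1] := ve i; rewrite ler_sqr ?nnegrE.
  by rewrite sumr_const card_ord mulr_natl.
have S1 := S (fun i => l2n (fun x => w x 0 i)); have S2 := S (fun i => l2n (fun x => wx x 0 i)).
rewrite -ler_sqr ?nnegrE ?sqrtr_ge0 ?mulr_ge0// [leLHS]sqr_sqrtr; last first.
  by apply: addr_ge0; apply: sumr_ge0 => i _; exact: sqr_ge0.
apply: le_trans (lerD (S1 _) (S2 _)) _ => [i|i|]; rewrite ?l2n_ge0 ?we ?wxe//.
rewrite !exprMn.
have H : n.+1%:R <= n.+1%:R ^+ 2 :> R by rewrite -natrX ler_nat leq_pmulr.
have := ler_wpM2r (sqr_ge0 e) H; have := mulr_ge0 (sqr_ge0 n.+1%:R) (sqr_ge0 e); lra.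
Qed.

(** Continuity in H^1 gives continuity of the slopes in L^2 and, by the Sobolev inequality
    [sup_bound], continuity of the values in the uniform norm. *)
Lemma C_H1_coord k (u ux : R -> R -> 'rV[R]_k.+1) : C_H1_sphere_with T u ux ->
  forall i, [/\ in_Csup T (fun t x => u t x 0 i), in_CL2 T (fun t x => ux t x 0 i) &
    forall t, t \in `[0, T] -> periodic (fun x => u t x 0 i) P /\
      AC 0 P (fun x => u t x 0 i) (fun x => ux t x 0 i)].
Proof.
move=> [H1 H2].
have cc t : t \in `[0, T] -> forall i, continuous (fun x => u t x 0 i).
  move=> tT i x; have [_ cu _ _ _] := H1 t tT.
  by apply: (@continuous_comp _ _ _ (u t) (fun M : 'rV[R]_k.+1 => M 0 i));
    [exact: cu|exact: coord_continuous].
have x2 t : t \in `[0, T] -> forall i, L2i 0 P (fun x => ux t x 0 i).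
  by move=> /H1[_ _ _ /L2_circleP[]].
have per t : t \in `[0, T] -> forall i, periodic (fun x => u t x 0 i) P.
  by move=> /H1[uP _ _ _ _] i x; rewrite uP.
have ac t : t \in `[0, T] -> forall i, AC 0 P (fun x => u t x 0 i) (fun x => ux t x 0 i).
  move=> tT i; have [_ _ _ _ wd] := H1 t tT.
  by apply: weak_AC; [exact: cc|exact: per|exact: x2|move=> phi sphi; exact: wd].
have dE (v v' : R -> 'rV[R]_k.+1) i : (fun x => (v \- v') x 0 i) = (fun x => v x 0 i - v' x 0 i).
  by apply/funext => x; rewrite /= !mxE.
have near t e : t \in `[0, T] -> 0 < e -> exists2 d, 0 < d & forall s, s \in `[0, T] -> `|s - t| < d ->
    forall i, l2n (fun x => u s x 0 i - u t x 0 i) <= e /\ l2n (fun x => ux s x 0 i - ux t x 0 i) <= e.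
  move=> tT e0; have /cvgrPdist_le/(_ e e0) := H2 t tT.
  rewrite near_withinE => /nbhs_ballP[d d0 Hd]; exists d => // s sT st i.
  have := Hd s; rewrite /ball/= distrC => /(_ st sT); rewrite sub0r normrN ger0_norm ?sqrtr_ge0// => He.
  have A j : L2i 0 P (fun x => (u s \- u t) x 0 j).
    by rewrite dE; apply: L2iB; apply: L2i_cont; exact: cc.
  have B j : L2i 0 P (fun x => (ux s \- ux t) x 0 j) by rewrite dE; apply: L2iB; exact: x2.
  have [] := H1_norm_ge A B i; rewrite !dE => h1 h2.
  by split; [exact: le_trans h1 He|exact: le_trans h2 He].
move=> i; split; last by move=> t tT; split; [exact: per|exact: ac].
- split=> [t tT|t tT e e0]; first exact: cc.
  have P0 := @period_gt0 R.
  have C0 : 0 < P^-1 + 1 + 1 :> R by rewrite !addr_gt0// invr_gt0.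
  (* Chosen so that [(P^-1 + 1 + 1) e'^2] is at most the square of [min (1, e)]. *)
  pose e' : R := Num.min 1 e / (P^-1 + 1 + 1).
  have m0 : 0 < Num.min 1 e by rewrite lt_min ltr01.
  have e'0 : 0 < e' by rewrite divr_gt0.
  have [d d0 Hd] := near t e' tT e'0; exists d => // s sT st x xP.
  have [h1 h2] := Hd s sT st i.
  have cd : continuous (fun x => u s x 0 i - u t x 0 i).
    by apply: continuousD_fun => [|y]; [exact: cc|apply/(@continuousN _ _ _ (fun x => u t x 0 i))/cc].
  have acd : AC 0 P (fun x => u s x 0 i - u t x 0 i) (fun x => ux s x 0 i - ux t x 0 i).
    have := AC_add (ac s sT i) (AC_scale (-1) (ac t tT i)).
    by congr (AC _ _ _ _); apply/funext => y; rewrite mulN1r.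
  have := sup_bound ltr01 cd acd (L2iB (x2 s sT i) (x2 t tT i)) xP.
  rewrite -!l2n_sqr invr1 mul1r => H.
  have K1 : l2n (fun x => u s x 0 i - u t x 0 i) ^+ 2 <= e' ^+ 2 by rewrite ler_sqr ?nnegrE ?l2n_ge0// ltW.
  have K2 : l2n (fun x => ux s x 0 i - ux t x 0 i) ^+ 2 <= e' ^+ 2 by rewrite ler_sqr ?nnegrE ?l2n_ge0// ltW.
  have C1 : 0 <= P^-1 + 1 :> R by rewrite addr_ge0// invr_ge0 ltW.
  have H' : (u s x 0 i - u t x 0 i) ^+ 2 <= (P^-1 + 1 + 1) * e' ^+ 2.
    by rewrite mulrDl mul1r; have := ler_wpM2l C1 K1; lra.
  have : (u s x 0 i - u t x 0 i) ^+ 2 <= Num.min 1 e ^+ 2.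
    apply: le_trans H' _; rewrite /e'; move: (Num.min 1 e) (m0) => m _.
    have -> : (P^-1 + 1 + 1) * (m / (P^-1 + 1 + 1)) ^+ 2 = m ^+ 2 * (P^-1 + 1 + 1)^-1.
      by move: (P^-1 + 1 + 1 : R) C0 => C C0'; field; rewrite gt_eqF.
    rewrite ler_piMr ?sqr_ge0// invf_le1//; have : 0 <= P^-1 :> R by rewrite invr_ge0 ltW.
    lra.
  rewrite -real_normK ?num_real// ler_sqr ?nnegrE ?normr_ge0 ?(ltW m0)// => /le_trans; apply.
  by rewrite ge_min lexx orbT.
- split=> [t tT|t tT e e0]; first exact: x2.
  by have [d d0 Hd] := near t e tT e0; exists d => // s sT st; have [] := Hd s sT st i.
Qed.

End uniqueness.

(** * Uniqueness of the controlled solution *)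

Section uniqueness.
Context {R : realType}.
Notation mu := (@lebesgue_measure R).
Notation P := (@period R).
Variable (k : nat) (omega : set R) (T : R) (f : R -> R -> 'rV[R]_k.+1).
Hypotheses (T0 : 0 < T) (omega_open : open omega)
  (cf : forall i, continuous (fun p : R * R => f p.1 p.2 0 i)).
Implicit Types u ux : R -> R -> 'rV[R]_k.+1.

Lemma joint_bounded (a b c d : R) (h : R -> R -> R) : continuous (fun p : R * R => h p.1 p.2) ->
  exists M : R, forall t x, t \in `[a, b] -> x \in `[c, d] -> `|h t x| <= M.
Proof.
move=> ch; have := @compact_setX R R _ _ (@segment_compact R a b) (@segment_compact R c d).
move=> /(continuous_compact (continuous_subspaceT ch))/compact_bounded[M [_ HM]].
exists (M + 1) => t x tab xcd; apply: (HM (M + 1)); first by rewrite ltrDl.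
by exists (t, x).
Qed.

Definition nonlin u ux s x : 'rV[R]_k.+1 :=
  enorm (ux s x) ^+ 2 *: u s x + \1_omega x *: tangent_proj (u s x) (f s x).

Lemma nonlinE u ux s x i : nonlin u ux s x 0 i =
  u s x 0 i * (\sum_j ux s x 0 j * ux s x 0 j) +
  (f s x 0 i - (\sum_j f s x 0 j * u s x 0 j) * u s x 0 i) * \1_omega x.
Proof. by rewrite /nonlin /tangent_proj enorm_sqr !mxE -/(dotv _ _) -/(dotv _ _); ring. Qed.

(* |p - q|^2 = 2 - 2 <p, q> on the sphere: the quadratic terms recombine into |p - q|^2. *)
Lemma nonlin_dot (p q v : 'rV[R]_k.+1) (a b I : R) : dotv p p = 1 -> dotv q q = 1 ->
  \sum_i ((p 0 i * a + (v 0 i - dotv v p * p 0 i) * I) -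
          (q 0 i * b + (v 0 i - dotv v q * q 0 i) * I)) * (p 0 i - q 0 i) =
  2^-1 * (\sum_i (p 0 i - q 0 i) ^+ 2) * (a + b) -
  2^-1 * I * (\sum_i (p 0 i - q 0 i) ^+ 2) * (dotv v p + dotv v q).
Proof.
move=> p1 q1; move: (dotv v p) (dotv v q) => F F'.
have -> : \sum_i (p 0 i - q 0 i) ^+ 2 = 2 - 2 * dotv p q.
  have -> : 2 - 2 * dotv p q = dotv p p - 2 * dotv p q + dotv q q by rewrite p1 q1; ring.
  by rewrite /dotv mulr_sumr -sumrB -big_split/=; apply: eq_bigr => i _; ring.
transitivity ((a - F * I) * dotv p p - (a - F * I + (b - F' * I)) * dotv p q + (b - F' * I) * dotv q q).
  by rewrite /dotv !mulr_sumr -sumrB -big_split/=; apply: eq_bigr => i _; ring.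
by rewrite p1 q1; field.
Qed.

Lemma dot_bound (p v : 'rV[R]_k.+1) (M : R) : dotv p p = 1 -> (forall i, `|v 0 i| <= M) ->
  `|dotv v p| <= k.+1%:R * M.
Proof.
move=> p1 vM; apply: le_trans (ler_norm_sum _ _ _) _.
apply: (@le_trans _ _ (\sum_(i < k.+1) M)); last by rewrite sumr_const card_ord mulr_natl.
apply: ler_sum => i _; rewrite normrM -[leRHS]mulr1; apply: ler_pM => //.
rewrite -[leRHS]normr1 -ler_sqr ?nnegrE// !real_normK ?num_real// expr1n -p1 /dotv (bigD1 i)//= expr2 lerDl.
by apply: sumr_ge0 => j _; rewrite -expr2 sqr_ge0.
Qed.

(** The values of [u] and [f] are continuous in the uniform norm and the slopes in L^2, so the
    quadratic term lies in L^1; the indicator is bounded and constant in time. *)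
Lemma nonlin_CL1 u ux : C_H1_sphere_with T u ux -> forall i,
  in_CL1 T (fun t x => nonlin u ux t x 0 i).
Proof.
move=> Cu i.
have cu j : in_Csup T (fun t x => u t x 0 j) by have [] := C_H1_coord Cu j.
have cux j : in_CL2 T (fun t x => ux t x 0 j) by have [] := C_H1_coord Cu j.
have cfj j : in_Csup T (fun t x => f t x 0 j).
  by have H := @in_Csup_joint R T (fun t x => f t x 0 j); apply: H; apply: cf.
have -> : (fun t x => nonlin u ux t x 0 i) = (fun t x =>
    u t x 0 i * (\sum_j ux t x 0 j * ux t x 0 j) +
    (f t x 0 i + - ((\sum_j f t x 0 j * u t x 0 j) * u t x 0 i)) * \1_omega x).
  by apply/funext => t; apply/funext => x; rewrite nonlinE.
apply: in_CL1D.
  by apply: in_CL1M => //; apply: in_CL1_sum => j; exact: in_CL2M.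
apply: in_CL1M.
  apply: in_CsupD => //; apply: in_CsupN; apply: in_CsupM => //.
  by apply: in_Csup_sum => j; exact: in_CsupM.
apply: in_CL1_cst; apply: (@bounded_itg _ _ _ _ 1).
  by apply: measurable_indic; exact: open_measurable.
by move=> x _; rewrite indicE; case: (_ \in _); rewrite ?normr1 ?normr0.
Qed.

Lemma test_split u ux (phi : R -> R) s i : C_H1_sphere_with T u ux -> smooth_circle phi ->
  s \in `[0, T] ->
  \int[mu]_(x in `[0, P]) (- (ux s x 0 i * derive1 phi x) + nonlin u ux s x 0 i * phi x) =
  - (\int[mu]_(x in `[0, P]) (ux s x 0 i * derive1 phi x)) +
  \int[mu]_(x in `[0, P]) (nonlin u ux s x 0 i * phi x).
Proof.
move=> Cu sphi sT; have cphi := smooth_derive_continuous sphi.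
have c0 : continuous phi := is_derive_continuous (smooth_is_derive sphi).
have [_ [u2 _] _] := C_H1_coord Cu i; have [Ni _] := nonlin_CL1 Cu i.
have i1 := L2iM (u2 s sT) (L2i_cont 0 P cphi).
by rewrite intD ?intN//; [exact: itgN|exact: itg_contM (Ni s sT) c0].
Qed.

Lemma solution_unique v0 u u' : HMHF_solution omega T f v0 u -> HMHF_solution omega T f v0 u' ->
  forall t, t \in `[0, T] -> forall x, u' t x = u t x.
Proof.
move=> [ux [Cu u0 wu]] [ux' [Cu' u0' wu']]; have P0 := @period_gt0 R.
pose w i t x := u t x 0 i - u' t x 0 i; pose g i t x := ux t x 0 i - ux' t x 0 i.
pose N i t x := nonlin u ux t x 0 i - nonlin u' ux' t x 0 i.
have Cs i : [/\ in_Csup T (w i), in_CL2 T (g i), in_CL1 T (N i) &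
   forall t, t \in `[0, T] -> periodic (w i t) P /\ AC 0 P (w i t) (g i t)].
  have [a1 a2 a3] := C_H1_coord Cu i; have [b1 b2 b3] := C_H1_coord Cu' i.
  split.
  - exact: in_CsupD a1 (in_CsupN b1).
  - split=> [t tT|t tT e e0]; first by apply: L2iB; [exact: a2.1|exact: b2.1].
    have e20 : 0 < e / 2 by rewrite divr_gt0.
    have [d1 d10 H1] := a2.2 t tT _ e20; have [d2 d20 H2] := b2.2 t tT _ e20.
    exists (Num.min d1 d2) => [|r rT]; first by rewrite lt_min d10 d20.
    rewrite lt_min => /andP[r1 r2]; have := H1 r rT r1; have := H2 r rT r2 => h2 h1.
    have := l2n_add (L2iB (a2.1 r rT) (a2.1 t tT)) (L2iN (L2iB (b2.1 r rT) (b2.1 t tT))).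
    rewrite l2n_opp (_ : (fun x => _) = (fun x => g i r x - g i t x)); first by lra.
    by apply/funext => x; rewrite /g; ring.
  - have nC := in_CL1M (in_Csup_cst T (-1)) (nonlin_CL1 Cu' i).
    have := in_CL1D (nonlin_CL1 Cu i) nC; congr (in_CL1 _ _).
    by apply/funext => t; apply/funext => x; rewrite mulN1r.
  - move=> t tT; have [pu au] := a3 t tT; have [pu' au'] := b3 t tT; split.
      by move=> x; rewrite /w pu pu'.
    have := AC_add au (AC_scale (-1) au').
    by congr (AC _ _ _ _); apply/funext => y; rewrite mulN1r.
have weak i phi : smooth_circle phi -> forall t, t \in `[0, T] ->
     \int[mu]_(x in `[0, P]) (w i t x * phi x) - \int[mu]_(x in `[0, P]) (w i 0 x * phi x) =
     \int[mu]_(s in `[0, t]) (- (\int[mu]_(x in `[0, P]) (g i s x * derive1 phi x)) +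
                              \int[mu]_(x in `[0, P]) (N i s x * phi x)).
  move=> sphi t tT.
  have T0T : 0 \in `[0, T] by rewrite in_itv/= lexx ltW.
  have c0 : continuous phi := is_derive_continuous (smooth_is_derive sphi).
  have c1 := smooth_derive_continuous sphi.
  have st s : s \in `[0, t] -> s \in `[0, T].
    by move: tT; rewrite !in_itv/= => /andP[_ tT] /andP[-> /le_trans->].
  have tT' : t <= T by move: tT; rewrite in_itv/= => /andP[].
  have W v vx : C_H1_sphere_with T v vx ->
      itg 0 t (rhs (fun s x => vx s x 0 i) (fun s x => nonlin v vx s x 0 i) phi (derive1 phi)).
    move=> Cv; have [_ v2 _] := C_H1_coord Cv i; have Nv := nonlin_CL1 Cv i.
    apply: itgS (cont_in_itg (ltW T0) _) (lexx 0) tT'.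
    by apply: rhs_cont; rewrite ?(v2.1, v2.2, Nv.1, Nv.2)//; [exact: v2.1|exact: Nv.1|exact: v2.2|exact: Nv.2|exact: L2i_cont].
  have e1 := wu phi sphi i t tT; have e2 := wu' phi sphi i t tT.
  rewrite (@eq_int _ _ (rhs (fun s x => ux s x 0 i) (fun s x => nonlin u ux s x 0 i) phi (derive1 phi)) 0 t) in e1;
    last by move=> s /st sT; exact: test_split.
  rewrite (@eq_int _ _ (rhs (fun s x => ux' s x 0 i) (fun s x => nonlin u' ux' s x 0 i) phi (derive1 phi)) 0 t) in e2;
    last by move=> s /st sT; exact: test_split.
  have cu v vx t' : C_H1_sphere_with T v vx -> t' \in `[0, T] -> itg 0 P (fun x => v t' x 0 i * phi x).
    move=> Cv t'T; have [[vc _] _ _] := C_H1_coord Cv i.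
    by apply: itg_cont; apply: continuousM_fun => //; exact: vc.
  have wE t' : t' \in `[0, T] -> \int[mu]_(x in `[0, P]) (w i t' x * phi x) =
     \int[mu]_(x in `[0, P]) (u t' x 0 i * phi x) - \int[mu]_(x in `[0, P]) (u' t' x 0 i * phi x).
    move=> t'T; rewrite -intB; [|exact: cu Cu t'T|exact: cu Cu' t'T].
    by apply: eq_int => x _; rewrite mulrBl.
  rewrite (wE t tT) (wE 0 T0T).
  have -> : forall A B C D : R, A - B - (C - D) = (A - C) - (B - D) by move=> *; ring.
  rewrite e1 e2 -intB; [|exact: W|exact: W]; apply: eq_int => s /st sT.
  have [_ v2 _] := C_H1_coord Cu i; have Nv := nonlin_CL1 Cu i.
  have [_ v2' _] := C_H1_coord Cu' i; have Nv' := nonlin_CL1 Cu' i.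
  have L2c := L2i_cont 0 P c1.
  rewrite (@eq_int _ (fun x => g i s x * _) (fun x => ux s x 0 i * derive1 phi x - ux' s x 0 i * derive1 phi x)); last by move=> x _; rewrite mulrBl.
  rewrite (@eq_int _ (fun x => N i s x * _) (fun x => nonlin u ux s x 0 i * phi x - nonlin u' ux' s x 0 i * phi x)); last by move=> x _; rewrite mulrBl.
  rewrite (intB (L2iM (v2.1 s sT) L2c) (L2iM (v2'.1 s sT) L2c)).
  rewrite (intB (itg_contM (Nv.1 s sT) c0) (itg_contM (Nv'.1 s sT) c0)) /rhs; ring.
pose X (t : R) : R := \sum_i \int[mu]_(x in `[0, P]) (w i t x ^+ 2).
pose G (t : R) : R := \sum_i \int[mu]_(x in `[0, P]) (g i t x ^+ 2).
pose L (t : R) : R := \sum_i 2 * rhs (g i) (N i) (w i t) (g i t) t.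
have dX : diff_in T X L.
  apply: diff_in_sum => i; have [[wc cw] [g2 cg] [Ni cN] pa] := Cs i.
  apply: energy_diff => // [t tT|t tT|]; last exact: weak.
    by split; [exact: wc|exact: (pa t tT).1].
  exact: (pa t tT).2.
have X0 : X 0 = 0.
  apply: big1 => i _; rewrite (@eq_int _ _ (fun=> 0)) => [|x _]; last by rewrite /w u0 u0' subrr expr0n.
  by rewrite int_cst ?mul0r// ltW.
have Xge t : t \in `[0, T] -> 0 <= X t.
  by move=> _; apply: sumr_ge0 => i _; apply: int_ge0 => x _; exact: sqr_ge0.
have [M M0 HM] : exists2 M, 0 < M & forall i t x, t \in `[0, T] -> x \in `[0, P] -> `|f t x 0 i| <= M.
  have bd (i : 'I_k.+1) := @joint_bounded 0 T 0 P (fun t x => f t x 0 i) (cf (i := i)).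
  have /choice[Mi HMi] := bd.
  exists (1 + \sum_i `|Mi i|) => [|i t x tT xP]; first by rewrite ltr_pwDl// sumr_ge0.
  apply: le_trans (HMi i t x tT xP) _; rewrite (bigD1 i)//= addrCA.
  by apply: le_trans (ler_norm _) _; rewrite lerDl addr_ge0// sumr_ge0.
pose D (v : R -> R -> 'rV[R]_k.+1) (t : R) : R := \sum_i l2n (fun x => v t x 0 i) ^+ 2.
have Db v vx : C_H1_sphere_with T v vx -> exists2 B, 0 < B & forall t, t \in `[0, T] -> D vx t <= B.
  move=> Cv; have /choice[Bi HBi] (i : 'I_k.+1) : exists B : R, forall t, t \in `[0, T] -> l2n (fun x => vx t x 0 i) <= B.
    have [_ [v2 cv] _] := C_H1_coord Cv i.
    have [B B0 HB] := cont_in_bounded (ltW T0) (l2n_cont_in v2 cv).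
    by exists B => t tT; apply: le_trans (ler_norm _) (HB t tT).
  exists (1 + \sum_i Bi i ^+ 2) => [|t tT].
    by rewrite ltr_pwDl// sumr_ge0// => i _; exact: sqr_ge0.
  rewrite ler_wpDl//; apply: ler_sum => i _; have := HBi i t tT => h.
  by rewrite ler_sqr ?nnegrE ?l2n_ge0// (le_trans (l2n_ge0 _) h).
have [B1 B10 HB1] := Db u ux Cu; have [B2 B20 HB2] := Db u' ux' Cu'.
pose B : R := B1 + B2; have B0 : 0 < B by exact: addr_gt0.
(* [B] bounds the squared L^2 norms of both slopes together. Hence [sup_bound] with parameter
   [1 / B] costs [G / 2], which the dissipation [- G] absorbs. *)
pose C : R := (P^-1 + B) * B + 2 * (k.+1%:R * M).
have LX t : t \in `[0, T] -> L t <= C * X t.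
  move=> tT.
  pose S : R := (P^-1 + B) * X t + B^-1 * G t.
  have WS x : x \in `[0, P] -> \sum_i w i t x ^+ 2 <= S.
    move=> xP; rewrite /S /X /G !mulr_sumr -big_split/=; apply: ler_sum => i _.
    have [[wc _] [g2 _] _ pa] := Cs i; have Bi : 0 < B^-1 by rewrite invr_gt0.
    by have := sup_bound Bi (wc t tT) (pa t tT).2 (g2 t tT) xP; rewrite invrK.
  have Nw i : itg 0 P (fun x => N i t x * w i t x).
    by have [[wc _] _ [Ni _] _] := Cs i; exact: itg_contM (Ni t tT) (wc t tT).
  have LE : L t = 2 * (- G t + \int[mu]_(x in `[0, P]) \sum_i N i t x * w i t x).
    rewrite int_sum; last exact: Nw.
    rewrite /L -mulr_sumr /rhs big_split/= sumrN; congr (2 * (- _ + _)).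
  have ux2 i : L2i 0 P (fun x => ux t x 0 i) by have [_ [H _] _] := C_H1_coord Cu i; exact: H.
  have ux2' i : L2i 0 P (fun x => ux' t x 0 i) by have [_ [H _] _] := C_H1_coord Cu' i; exact: H.
  have q2 (v : 'I_k.+1 -> R -> R) : (forall i, L2i 0 P (v i)) -> itg 0 P (fun x => \sum_i v i x ^+ 2).
    by move=> v2; apply: itg_sum => i; have [] := v2 i.
  have qD (v : R -> R -> 'rV[R]_k.+1) : (forall i, L2i 0 P (fun x => v t x 0 i)) ->
      \int[mu]_(x in `[0, P]) \sum_i v t x 0 i ^+ 2 = D v t.
    by move=> v2; rewrite int_sum => [|i]; [apply: eq_bigr => i _; rewrite l2n_sqr|have [] := v2 i].
  have w2 : itg 0 P (fun x => \sum_i w i t x ^+ 2).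
    by apply: q2 => i; have [[wc _] _ _ _] := Cs i; apply: L2i_cont; exact: wc.
  have S0 : 0 <= S.
    apply: le_trans (WS 0 _); last by rewrite in_itv/= lexx ltW.
    by apply: sumr_ge0 => i _; exact: sqr_ge0.
  have le1 : \int[mu]_(x in `[0, P]) \sum_i N i t x * w i t x <=
     \int[mu]_(x in `[0, P]) (2^-1 * S * (\sum_i ux t x 0 i ^+ 2 + \sum_i ux' t x 0 i ^+ 2) +
        k.+1%:R * M * \sum_i w i t x ^+ 2).
    apply: le_int => [| |x xP]; first exact: itg_sum.
      by apply: itgD; apply: itgZ => //; apply: itgD; exact: q2.
    have [[_ _ su _ _] [_ _ su' _ _]] := (Cu.1 t tT, Cu'.1 t tT).
    have p1 : dotv (u t x) (u t x) = 1 by exact/sphereP/su.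
    have p2 : dotv (u' t x) (u' t x) = 1 by exact/sphereP/su'.
    rewrite (_ : \sum_i N i t x * w i t x = \sum_i ((u t x 0 i * (\sum_j ux t x 0 j ^+ 2) +
        (f t x 0 i - dotv (f t x) (u t x) * u t x 0 i) * \1_omega x) -
        (u' t x 0 i * (\sum_j ux' t x 0 j ^+ 2) +
        (f t x 0 i - dotv (f t x) (u' t x) * u' t x 0 i) * \1_omega x)) * (u t x 0 i - u' t x 0 i)); last first.
      apply: eq_bigr => i _; rewrite /N !nonlinE /w -/(dotv _ _) -/(dotv _ _).
      by congr ((_ * _ + _ - (_ * _ + _)) * _); apply: eq_bigr => j _; rewrite expr2.
    rewrite nonlin_dot// -/(w _ _ _).
    have dot1 := dot_bound p1 (fun i => HM i t x tT xP).
    have dot2 := dot_bound p2 (fun i => HM i t x tT xP).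
    have W0 : 0 <= \sum_i w i t x ^+ 2 by apply: sumr_ge0 => i _; exact: sqr_ge0.
    move: (WS x xP) W0; rewrite -/(\sum_i w i t x ^+ 2); set W := \sum_i w i t x ^+ 2 => WS' W0.
    have A0 (v : R -> R -> 'rV[R]_k.+1) : 0 <= \sum_j v t x 0 j ^+ 2 by apply: sumr_ge0 => j _; exact: sqr_ge0.
    move: (A0 ux) (A0 ux'); set a := \sum_j ux t x 0 j ^+ 2; set b := \sum_j ux' t x 0 j ^+ 2 => a0 b0.
    rewrite -/W; apply: lerD.
      by rewrite ler_wpM2r ?addr_ge0// ler_wpM2l// invr_ge0.
    have I01 : 0 <= (\1_omega x : R) <= 1 by rewrite indicE; case: (_ \in _); rewrite /= ?lexx ler01.
    apply: le_trans (ler_norm _) _; rewrite normrN !normrM.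
    have -> : k.+1%:R * M * W = 2^-1 * 1 * W * (k.+1%:R * M + k.+1%:R * M) by field.
    have /andP[I0 I1] := I01.
    apply: ler_pM => //; rewrite ?mulr_ge0//; last exact: le_trans (ler_normD _ _) (lerD dot1 dot2).
    rewrite !ger0_norm ?invr_ge0// ler_wpM2r// ler_wpM2l// invr_ge0//.
  have le2 : \int[mu]_(x in `[0, P]) (2^-1 * S * (\sum_i ux t x 0 i ^+ 2 + \sum_i ux' t x 0 i ^+ 2) +
        k.+1%:R * M * \sum_i w i t x ^+ 2) <= 2^-1 * S * B + k.+1%:R * M * X t.
    rewrite int_lin2//; last by apply: itgD; exact: q2.
    have -> : \int[mu]_(x in `[0, P]) \sum_i w i t x ^+ 2 = X t.
      by rewrite int_sum// => i; have [[wc _] _ _ _] := Cs i; have [] := L2i_cont 0 P (wc t tT).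
    rewrite lerD2r ler_wpM2l ?mulr_ge0 ?invr_ge0// intD; [|exact: q2..].
    by rewrite !qD//; apply: lerD; [exact: HB1|exact: HB2].
  have SB : 2^-1 * S * B = 2^-1 * (P^-1 + B) * B * X t + 2^-1 * G t.
    by rewrite /S; field; rewrite !gt_eqF.
  have Gge : 0 <= G t by apply: sumr_ge0 => i _; apply: int_ge0 => x _; exact: sqr_ge0.
  rewrite LE; have := le_trans le1 le2; rewrite SB /C.
  have -> : ((P^-1 + B) * B + 2 * (k.+1%:R * M)) * X t =
    2 * (2^-1 * (P^-1 + B) * B * X t + k.+1%:R * M * X t) by field; rewrite gt_eqF.
  by move: (2^-1 * _ * B * X t) (k.+1%:R * M * X t) => x1 x2 H; rewrite ler_pM2l//; lra.
have Xz := gronwall T0 dX X0 Xge LX.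
move=> t tT.
(* [sup_bound] once more: with zero L^2 norm, the square of [w] is at most [e] times a constant, for
   every [e > 0]. *)
have wz i : forall x, w i t x = 0.
  have [[wc _] [g2 _] _ /(_ t tT)[pwi aw]] := Cs i.
  have z : \int[mu]_(x in `[0, P]) (w i t x ^+ 2) = 0.
    apply/le_anti/andP; split; last by apply: int_ge0 => y _; exact: sqr_ge0.
    rewrite -[leRHS](Xz t tT) /X (bigD1 i)//= lerDl; apply: sumr_ge0 => j _; apply: int_ge0 => y _; exact: sqr_ge0.
  apply: (periodic_ext pwi) => [y //|x xP].
  pose A := \int[mu]_(x in `[0, P]) (g i t x ^+ 2).
  have A0 : 0 <= A by apply: int_ge0 => y _; exact: sqr_ge0.
  apply/eqP; rewrite -sqrf_eq0; apply/eqP.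
  apply: (@small_eq0 _ _ A) => e e0 _; rewrite ger0_norm ?sqr_ge0//.
  have := sup_bound e0 (wc t tT) aw (g2 t tT) xP.
  by rewrite z mulr0 add0r mulrC.
by move=> x; apply/rowP => i; apply/esym/subr0_eq/wz.
Qed.

End uniqueness.

(** * The controlled solution *)

Section measurability.
Context {R : realType}.
Notation mu := (@lebesgue_measure R).
Notation P := (@period R).

(** The sigma-algebra on pairs is the product one; an open set of the plane is a countable union of
    rectangles with rational corners. *)
Lemma open_prod_measurable (U : set (R * R)) : open U ->
  measurable (U : set (measurableTypeR R * measurableTypeR R)).
Proof.
move=> oU.
pose rect (a b c d : rat) : set (measurableTypeR R * measurableTypeR R) :=
  (`]ratr a, ratr b[%classic : set R) `*` (`]ratr c, ratr d[%classic : set R).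
pose F a b c d := if `[< rect a b c d `<=` U >] then rect a b c d else set0.
have -> : U = \bigcup_a \bigcup_b \bigcup_c \bigcup_d F a b c d.
  apply/seteqP; split=> [[t x] Utx|y [a _ [b _ [c _ [d _]]]]]; last first.
    by rewrite /F; case: asboolP => // H; exact: H.
  have /nbhs_ballP[e /= e0 He] : nbhs (t, x) U by exact: open_nbhs_nbhs.
  have [a] : exists q : rat, ratr q \in `](t - e), t[ by apply: rat_in_itvoo; rewrite gtrBl.
  have [b] : exists q : rat, ratr q \in `]t, (t + e)[ by apply: rat_in_itvoo; rewrite ltrDl.
  have [c] : exists q : rat, ratr q \in `](x - e), x[ by apply: rat_in_itvoo; rewrite gtrBl.
  have [d] : exists q : rat, ratr q \in `]x, (x + e)[ by apply: rat_in_itvoo; rewrite ltrDl.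
  rewrite !in_itv/= => /andP[d1 d2] /andP[c1 c2] /andP[b1 b2] /andP[a1 a2].
  exists a => //; exists b => //; exists c => //; exists d => //.
  rewrite /F; case: asboolP => [_|[]].
    by rewrite /rect/=; split; rewrite /= in_itv/=; apply/andP.
  move=> [s y] /= [] /=; rewrite !in_itv/= => /andP[s1 s2] /andP[y1 y2].
  by apply: He; split; rewrite /ball/= ltr_norml; apply/andP; split; lra.
apply: bigcupT_measurable_rat => a; apply: bigcupT_measurable_rat => b.
apply: bigcupT_measurable_rat => c; apply: bigcupT_measurable_rat => d.
rewrite /F; case: ifP => _; last exact: measurable0.
by apply: measurableX; exact: measurable_itv.
Qed.

Lemma continuous_prod_measurable (h : R * R -> R) (D : set (measurableTypeR R * measurableTypeR R)) :
  measurable D -> continuous h -> measurable_fun D (h : measurableTypeR R * measurableTypeR R -> R).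
Proof.
move=> mD ch _; apply: (measurability _ (RGenOInfty.measurableE R)) => //.
move=> /= _ [_ [a ->] <-]; apply: measurableI => //.
apply: open_prod_measurable; apply: open_comp => [x _|]; [exact: ch|exact: interval_open].
Qed.

(** Compactness of [[0, T] x [0, P]] bounds the coordinates, and so the L^2 norm at every time of
    the interval. *)
Lemma Loo_L2_joint n (T : R) (f : R -> R -> 'rV[R]_n) : (forall t, periodic (f t) P) ->
  (forall i, continuous (fun p : R * R => f p.1 p.2 0 i)) -> Loo_L2 T f.
Proof.
move=> fP cf; split => //.
  move=> i; apply: (@continuous_prod_measurable (fun p => f p.1 p.2 0 i)); last exact: cf.
  by apply: measurableX; exact: measurable_itv.
have bd (i : 'I_n) := @joint_bounded R 0 T 0 P (fun t x => f t x 0 i) (cf i).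
have /choice[M HM] := bd.
have cft i t : continuous (fun x => f t x 0 i).
  move=> x; exact: (continuous_slice (f := fun p : R * R => f p.1 p.2 0 i) (cf i (t, x))).
exists ((\sum_i M i ^+ 2) * P); apply: aeW => t tT.
have tT' : t \in `[0, T] by move: tT; rewrite !in_itv/= => /andP[/ltW-> /ltW->].
have dE x : enorm (f t x) ^+ 2 = \sum_i f t x 0 i ^+ 2.
  by rewrite enorm_sqr; apply: eq_bigr => i _; rewrite expr2.
have i1 : itg 0 P (fun x => enorm (f t x) ^+ 2).
  apply: (@eq_itg _ (fun x => \sum_i f t x 0 i ^+ 2)) => [x _|]; first by rewrite dE.
  by apply: itg_sum => i; apply: itg_cont; exact: continuousX_fun.
have := le_int i1 (itg_cont 0 P (@cst_continuous _ _ (\sum_i M i ^+ 2))).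
rewrite int_cst ?subr0 ?(ltW (@period_gt0 R))// => /(_ _)/wrap[] => [x xP|H].
  rewrite dE; apply: ler_sum => i _; have h := HM i t x tT' xP.
  by rewrite -(real_normK (num_real _)) ler_sqr ?nnegrE// (le_trans _ h).
rewrite /circle; move: H; rewrite -lee_fin /Rintegral fineK//.
exact: integral_fune_fin_num.
Qed.

End measurability.

(** * Regular functions of time and space, and their periodization *)

Section regular_functions.
Context {R : realType}.
Notation P := (@period R).
Implicit Types (V W : R -> R -> R) (D : R -> Prop).

Definition jcont V (t x : R) := {for (t, x), continuous (fun p : R * R => V p.1 p.2)}.

Lemma jcontD V W t x : jcont V t x -> jcont W t x -> jcont (fun t x => V t x + W t x) t x.
Proof. exact: continuousD_at. Qed.

Lemma jcontM V W t x : jcont V t x -> jcont W t x -> jcont (fun t x => V t x * W t x) t x.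
Proof. exact: continuousM_at. Qed.

Lemma jcont_cst (k : R) t x : jcont (fun _ _ => k) t x.
Proof. exact: cst_continuous. Qed.

Lemma jcont_comp (F : R -> R) V t x : continuous F -> jcont V t x -> jcont (fun t x => F (V t x)) t x.
Proof.
by move=> cF cV; apply: (@continuous_comp _ _ _ (fun p : R * R => V p.1 p.2) F); [exact: cV|exact: cF].
Qed.

Lemma jcontN V t x : jcont V t x -> jcont (fun t x => - V t x) t x.
Proof. by apply: jcont_comp => y; exact: opp_continuous. Qed.

Lemma jcontB V W t x : jcont V t x -> jcont W t x -> jcont (fun t x => V t x - W t x) t x.
Proof. by move=> cV cW; apply: jcontD => //; exact: jcontN. Qed.

Lemma jcont_t (F : R -> R) t x : continuous F -> jcont (fun t _ => F t) t x.
Proof.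
by move=> cF; apply: (@continuous_comp _ _ _ (fun p : R * R => p.1) F); [exact: cvg_fst|exact: cF].
Qed.

Lemma jcont_x (F : R -> R) t x : continuous F -> jcont (fun _ x => F x) t x.
Proof.
by move=> cF; apply: (@continuous_comp _ _ _ (fun p : R * R => p.2) F); [exact: cvg_snd|exact: cF].
Qed.

Lemma jcont_near V W t x d : 0 < d ->
  (forall s y, `|s - t| < d -> `|y - x| < d -> V s y = W s y) -> jcont W t x -> jcont V t x.
Proof.
move=> d0 VW cW; rewrite /jcont /prop_for /continuous_at.
have -> : V t x = W t x by apply: VW; rewrite subrr normr0.
apply: cvg_trans cW; apply: near_eq_cvg; near=> q; symmetry; apply: VW.
- near: q; exists ([set s | `|s - t| < d], setT) => [|q [] //].
  split; last exact: filterT.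
  by apply/nbhs_ballP; exists d => // s; rewrite /ball/= distrC.
- near: q; exists (setT, [set s | `|s - x| < d]) => [|q [] //].
  split; first exact: filterT.
  by apply/nbhs_ballP; exists d => // s; rewrite /ball/= distrC.
Unshelve. all: by end_near. Qed.

Lemma jcont_shift V t x s : jcont V t (x - s) -> jcont (fun t y => V t (y - s)) t x.
Proof.
move=> cV; apply: (@continuous_comp _ _ _ (fun p : R * R => (p.1, p.2 - s)) (fun p : R * R => V p.1 p.2)) => //.
move=> A /= HA.
have c1 : (fun p : R * R => p.1) @ (t, x) --> t by exact: cvg_fst.
have c2 : (fun p : R * R => p.2 - s) @ (t, x) --> x - s.
  by apply: (@cvgB _ _ _ _ _ (fun p : R * R => p.2) (fun=> s)); [exact: cvg_snd|exact: cvg_cst].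
exact: (@cvg_pair (R * R)%type R R (nbhs (t, x)) (nbhs t) (nbhs (x - s)) _ _ _ _ _ c1 c2 A HA).
Qed.

(** The derivatives are named, so that those of products and compositions are formed symbolically.
    Only positive times count, the flow being rough at [0]; [D] restricts the space variable to
    where the angle is defined. *)
Definition regular D V (Vt Vx Vxx : R -> R -> R) := forall t x : R, 0 < t -> D x ->
  [/\ is_derive t (1 : R) (V ^~ x) (Vt t x), is_derive x (1 : R) (V t) (Vx t x) &
      is_derive x (1 : R) (Vx t) (Vxx t x)] /\
  [/\ jcont V t x, jcont Vt t x, jcont Vx t x & jcont Vxx t x].

Lemma regularD D V Vt Vx Vxx W Wt Wx Wxx : regular D V Vt Vx Vxx -> regular D W Wt Wx Wxx ->
  regular D (fun t x => V t x + W t x) (fun t x => Vt t x + Wt t x)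
    (fun t x => Vx t x + Wx t x) (fun t x => Vxx t x + Wxx t x).
Proof.
move=> rV rW t x t0 Dx; have [[v1 v2 v3] [v4 v5 v6 v7]] := rV t x t0 Dx.
have [[w1 w2 w3] [w4 w5 w6 w7]] := rW t x t0 Dx.
by split; split; try exact: is_deriveD; exact: jcontD.
Qed.

Lemma regularZ D V Vt Vx Vxx (k : R) : regular D V Vt Vx Vxx ->
  regular D (fun t x => k * V t x) (fun t x => k * Vt t x)
    (fun t x => k * Vx t x) (fun t x => k * Vxx t x).
Proof.
move=> rV t x t0 Dx; have [[v1 v2 v3] [v4 v5 v6 v7]] := rV t x t0 Dx.
by split; split; try exact: is_deriveZ; apply: jcontM => //; exact: jcont_cst.
Qed.

Lemma is_derive_mulE (f g : R -> R) x (f' g' : R) : is_derive x (1 : R) f f' ->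
  is_derive x (1 : R) g g' -> is_derive x (1 : R) (fun y => f y * g y) (f' * g x + f x * g').
Proof.
move=> df dg; apply: (is_derive_eq (is_deriveM df dg)).
by rewrite /GRing.scale /= addrC (mulrC (g x)).
Qed.

Lemma regularM D V Vt Vx Vxx W Wt Wx Wxx : regular D V Vt Vx Vxx -> regular D W Wt Wx Wxx ->
  regular D (fun t x => V t x * W t x) (fun t x => Vt t x * W t x + V t x * Wt t x)
    (fun t x => Vx t x * W t x + V t x * Wx t x)
    (fun t x => Vxx t x * W t x + Vx t x * Wx t x + (Vx t x * Wx t x + V t x * Wxx t x)).
Proof.
move=> rV rW t x t0 Dx; have [[v1 v2 v3] [v4 v5 v6 v7]] := rV t x t0 Dx.
have [[w1 w2 w3] [w4 w5 w6 w7]] := rW t x t0 Dx.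
split; split; [exact: is_derive_mulE v1 w1|exact: is_derive_mulE v2 w2| | | | |].
- exact: is_deriveD (is_derive_mulE v3 w2) (is_derive_mulE v2 w3).
- exact: jcontM.
- by apply: jcontD; exact: jcontM.
- by apply: jcontD; exact: jcontM.
- by repeat apply: jcontD; exact: jcontM.
Qed.

Lemma is_derive_chain (F f : R -> R) x (F' f' : R) : is_derive (f x) (1 : R) F F' ->
  is_derive x (1 : R) f f' -> is_derive x (1 : R) (fun y => F (f y)) (F' * f').
Proof. exact: is_derive1_comp. Qed.

Lemma regular_comp D V Vt Vx Vxx (F F' F'' : R -> R) :
  (forall y, is_derive y (1 : R) F (F' y)) -> (forall y, is_derive y (1 : R) F' (F'' y)) ->
  continuous F'' -> regular D V Vt Vx Vxx ->
  regular D (fun t x => F (V t x)) (fun t x => F' (V t x) * Vt t x)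
    (fun t x => F' (V t x) * Vx t x)
    (fun t x => F'' (V t x) * Vx t x * Vx t x + F' (V t x) * Vxx t x).
Proof.
move=> dF dF' cF'' rV t x t0 Dx; have [[v1 v2 v3] [v4 v5 v6 v7]] := rV t x t0 Dx.
have cF := is_derive_continuous dF; have cF' := is_derive_continuous dF'.
split; split; [exact: is_derive_chain (dF _) v1|exact: is_derive_chain (dF _) v2| |exact: jcont_comp| | |].
- exact: is_derive_mulE (is_derive_chain (dF' _) v2) v3.
- by apply: jcontM => //; exact: jcont_comp.
- by apply: jcontM => //; exact: jcont_comp.
- by apply: jcontD; repeat apply: jcontM => //; exact: jcont_comp.
Qed.

Lemma is_derive_near (f g : R -> R) x (l d : R) : 0 < d ->
  (forall y, `|y - x| < d -> f y = g y) -> is_derive x (1 : R) g l -> is_derive x (1 : R) f l.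
Proof.
move=> d0 fg; apply: near_eq_is_derive; near=> y; symmetry; apply: fg.
by rewrite distrC; near: y; apply: cvgr_dist_lt.
Unshelve. all: by end_near. Qed.

Section periodization.
Variables (c X : R).
Hypotheses (cX : - X < c) (cPX : c + P < X).
Notation D := (fun x : R => `|x| < X).

(** The representative of [x] modulo the period in [[c, c + P)]. *)
Definition cell x := x - (Num.floor ((x - c) / P))%:~R * P.

Lemma cell_in x : c <= cell x < c + P.
Proof.
have P0 := @period_gt0 R; have /andP[] := floor_itv ((x - c) / P).
rewrite ler_pdivlMr// ltr_pdivrMr// intrD mulr1z (mulrDl _ 1).
rewrite mul1r /cell => ? ?.
by apply/andP; split; lra.
Qed.

Lemma cell_eq x (m : int) : c <= x - m%:~R * P < c + P -> cell x = x - m%:~R * P.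
Proof.
have P0 := @period_gt0 R; move=> /andP[h1 h2]; rewrite /cell (@floor_def _ _ m)//.
rewrite ler_pdivlMr// ltr_pdivrMr// intrD mulr1z (mulrDl _ 1) mul1r.
by apply/andP; split; lra.
Qed.

Definition per V t x := V t (cell x).

Lemma per_periodic V t : periodic (per V t) P.
Proof.
move=> x; congr (V t _); set m := Num.floor ((x - c) / P).
have E : x + P - (m + 1)%:~R * P = x - m%:~R * P by rewrite intrD mulr1z (mulrDl _ 1) mul1r; ring.
by rewrite (@cell_eq _ (m + 1)) E//; exact: cell_in.
Qed.

(* The gluing condition at the point [c], where [cell] jumps. *)
Definition matched V := forall t0 : R, 0 < t0 -> exists2 d : R, 0 < d &
  forall t y, `|t - t0| < d -> `|y - c| < d -> V t (y + P) = V t y.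

(** Near any point [per V] is [V] translated by a fixed multiple of the period. The case to be
    proved is a copy of the cut [c]: to its left the representative is one period further, and the
    gluing condition brings it back. *)
Lemma per_local V t0 x0 : matched V -> 0 < t0 -> exists2 d : R, 0 < d &
  forall t y, `|t - t0| < d -> `|y - x0| < d -> per V t y = V t (y - (x0 - cell x0)).
Proof.
move=> mV t00; have P0 := @period_gt0 R.
have [d d0 Hd] := mV t0 t00; have /andP[c1 c2] := cell_in x0.
set m := Num.floor ((x0 - c) / P).
have sE : x0 - cell x0 = m%:~R * P by rewrite /cell; ring.
have [e [e0 ed eP eC]] : exists e : R, [/\ 0 < e, e <= d, e <= P & e <= c + P - cell x0].
  exists (Num.min d (Num.min P (c + P - cell x0))).
  by rewrite !lt_min d0 P0 subr_gt0 c2 !ge_min !lexx !orbT.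
have [cc|cc] := eqVneq (cell x0) c.
  exists e => // t y tt0 yx0; rewrite sE /per.
  have cy : y - m%:~R * P = cell x0 + (y - x0) by rewrite -sE; ring.
  move: yx0; rewrite ltr_norml => /andP[y1 y2].
  have [yge|ylt] := leP x0 y.
    by rewrite (@cell_eq y m)// cy cc; apply/andP; split; lra.
  have E : y - (m - 1)%:~R * P = y - m%:~R * P + P by rewrite intrB mulr1z mulrBl mul1r; ring.
  rewrite (@cell_eq y (m - 1)) E cy cc; last by apply/andP; split; lra.
  apply: Hd; first exact: lt_le_trans tt0 ed.
  by rewrite (addrC c) addrK ltr_norml; apply/andP; split; lra.
have c0 : 0 < cell x0 - c by rewrite subr_gt0 lt_neqAle eq_sym cc.
exists (Num.min e (cell x0 - c)) => [|t y _]; first by rewrite lt_min e0.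
rewrite lt_min => /andP[]; rewrite !ltr_norml => /andP[y1 y2] /andP[y3 y4].
have cy : y - m%:~R * P = cell x0 + (y - x0) by rewrite -sE; ring.
by rewrite sE /per (@cell_eq y m)// cy; apply/andP; split; lra.
Qed.

Lemma D_near : exists2 d : R, 0 < d & forall y, `|y - c| < d -> `|y| < X /\ `|y + P| < X.
Proof.
have P0 := @period_gt0 R; exists (Num.min (c + X) (X - (c + P))).
  by rewrite lt_min; apply/andP; split; [move: cX|move: cPX]; lra.
move=> y; rewrite lt_min => /andP[]; rewrite !ltr_norml => /andP[? ?] /andP[? ?].
by split; apply/andP; split; lra.
Qed.

(** The gluing condition is an identity on a neighbourhood, so it can be differentiated in either
    variable. The radius also keeps [y] and [y + P] in the domain of [V]. *)
Lemma matched_derive V Vt Vx Vxx : regular D V Vt Vx Vxx -> matched V ->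
  [/\ matched Vt, matched Vx & matched Vxx].
Proof.
move=> rV mV; have P0 := @period_gt0 R; have [e e0 He] := D_near.
have dx W Wx : (forall t x : R, 0 < t -> D x -> is_derive x (1 : R) (W t) (Wx t x)) -> matched W -> matched Wx.
  move=> dW mW t0 t00; have [d d0 Hd] := mW t0 t00.
  exists (Num.min t0 (Num.min (d / 2) e)) => [|t y]; first by rewrite !lt_min t00 e0 divr_gt0.
  rewrite !lt_min => /and3P[t1 t2 t3] /and3P[y1 y2 y3].
  have tp : 0 < t by move: t1; rewrite ltr_norml => /andP[]; lra.
  have [Dy DyP] := He y y3.
  have d1 := is_derive_shift (dW t (y + P) tp DyP).
  apply: is_derive_unique d1 _; apply: (is_derive_near (d := d / 2)) (dW t y tp Dy); first by rewrite divr_gt0.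
  move=> z zy; apply: Hd; first by apply: lt_trans t2 _; lra.
  by move: zy y2; rewrite !ltr_norml => /andP[? ?] /andP[? ?]; apply/andP; split; lra.
have mVx : matched Vx by apply: dx mV => t x t0 Dx; have [[]] := rV t x t0 Dx.
split => //; last by apply: dx mVx => t x t0 Dx; have [[]] := rV t x t0 Dx.
move=> t0 t00; have [d d0 Hd] := mV t0 t00.
exists (Num.min t0 (Num.min (d / 2) e)) => [|t y]; first by rewrite !lt_min t00 e0 divr_gt0.
rewrite !lt_min => /and3P[t1 t2 t3] /and3P[y1 y2 y3].
have tp : 0 < t by move: t1; rewrite ltr_norml => /andP[]; lra.
have [Dy DyP] := He y y3.
have [[d1 _ _] _] := rV t (y + P) tp DyP; have [[d2 _ _] _] := rV t y tp Dy.
apply: is_derive_unique d1 _; apply: (is_derive_near (d := d / 2)) d2; first by rewrite divr_gt0.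
move=> z zy; apply: Hd; last by apply: lt_trans y2 _; lra.
by move: zy t2; rewrite !ltr_norml => /andP[? ?] /andP[? ?]; apply/andP; split; lra.
Qed.

Lemma regular_per V Vt Vx Vxx : regular D V Vt Vx Vxx -> matched V ->
  regular (fun=> True) (per V) (per Vt) (per Vx) (per Vxx).
Proof.
move=> rV mV; have [mVt mVx mVxx] := matched_derive rV mV.
move=> t x t0 _; have /andP[c1 c2] := cell_in x.
have Dx : `|x - (x - cell x)| < X.
  by rewrite opprB addrCA subrr addr0 ltr_norml; apply/andP; split; move: cX cPX; lra.
have Ex : x - (x - cell x) = cell x by ring.
have [[v1 v2 v3] [v4 v5 v6 v7]] := rV t _ t0 Dx.
have jc W : matched W -> jcont W t (x - (x - cell x)) -> jcont (per W) t x.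
  move=> mW cW; have [d d0 Hd] := per_local x mW t0.
  by apply: (jcont_near d0 Hd); exact: jcont_shift.
have dd W Wx : matched W -> is_derive (x - (x - cell x)) (1 : R) (W t) (Wx t (x - (x - cell x))) ->
    is_derive x (1 : R) (per W t) (per Wx t x).
  move=> mW dW; have [d d0 Hd] := per_local x mW t0.
  apply: (is_derive_near d0 (fun y => Hd t y _)); first by rewrite subrr normr0.
  by have := is_derive_shift dW; rewrite Ex.
split; split; [|exact: dd|exact: dd|exact: jc..].
by move: v1; rewrite Ex.
Qed.

End periodization.
End regular_functions.

(** * The free flow near the initial time *)

Section initial_time.
Context {R : realType}.
Notation mu := (@lebesgue_measure R).
Notation P := (@period R).

Lemma decay_factor n (t : R) : 0 < t -> 0 < expR (- (freq2 n * t)) <= 1.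
Proof.
move=> t0; rewrite expR_gt0 /= -expR0 ler_expR oppr_le0 mulr_ge0 ?(ltW t0)//.
exact: freq2_ge0.
Qed.

Lemma decay_small (s : nat -> R) (e : R) : abs_summable s -> (forall n, 0 <= s n) -> 0 < e ->
  exists2 d : R, 0 < d & forall t, 0 < t -> t < d ->
    limn (series (fun n => (1 - expR (- (freq2 n * t))) * s n)) <= e.
Proof.
move=> sm s0 e0.
have b01 n (t : R) : 0 <= 1 - expR (- (freq2 n * `|t|)) <= 1.
  rewrite subr_ge0 gerBl expR_ge0 andbT -[leRHS]expR0 ler_expR oppr_le0 mulr_ge0//.
  exact: freq2_ge0.
(* The absolute value extends the series to negative times, so that continuity at [0] is
   two-sided. *)
pose F (t : R) : R := limn (series (fun n => (1 - expR (- (freq2 n * `|t|))) * s n)).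
have cF : {for 0, continuous F}.
  apply: (@continuous_series _ R (fun n t => (1 - expR (- (freq2 n * `|t|))) * s n) s) => //.
    apply: filterE => t n; have /andP[b0 b1] := b01 n t.
    by rewrite normrM (ger0_norm b0) (ger0_norm (s0 n)) ler_piMl.
  move=> n; apply: continuousM_at; last exact: cst_continuous.
  apply: (@continuous_comp R R R (fun t => `|t|) (fun t => 1 - expR (- (freq2 n * t)))).
    exact: norm_continuous.
  have : continuous (fun t : R => 1 - expR (- (freq2 n * t))).
    apply: (@is_derive_continuous R _ (fun t => freq2 n * expR (- (freq2 n * t)))) => t.
    have dl : is_derive t (1 : R) (fun r : R => - (freq2 n * r)) (- freq2 n).
      by apply: is_derive_eq; rewrite /GRing.scale /= mulr1.
    have d1 := is_derive_chain (is_derive_expR _) dl.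
    have d0 : is_derive t (1 : R) (fun _ : R => 1 : R) (0 : R) by exact: is_derive_cst.
    by apply: (is_derive_eq (is_deriveB d0 d1)); ring.
  by apply.
have F0 : F 0 = 0.
  rewrite /F (_ : (fun n => _) = fun=> 0); last first.
    by apply/funext => n; rewrite normr0 mulr0 oppr0 expR0 subrr mul0r.
  rewrite (_ : series _ = fun=> 0); first exact: lim_cst.
  by apply/funext => n; rewrite /series/= big1.
move: cF => /cvgrPdist_le/(_ e e0)/nbhs_ballP[d d0 Hd]; exists d => // t t0 td.
have := Hd t; rewrite /ball/= F0 !sub0r !normrN (gtr0_norm t0) => /(_ td) /(le_trans (ler_norm _)).
by rewrite /F (gtr0_norm t0).
Qed.

(** A partial sum written as a series, to be combined termwise with an infinite one. *)
Lemma lim_series_below (u : nat -> R) N :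
  abs_summable (fun n => if (n < N)%N then u n else 0) /\
  limn (series (fun n => if (n < N)%N then u n else 0)) = series u N.
Proof.
have E (v : nat -> R) n : (N <= n)%N ->
    series (fun n => if (n < N)%N then v n else 0) n = series v N.
  move=> Nn; rewrite /series/= (@big_cat_nat _ _ _ N 0 n)//=.
  rewrite (@eq_big_nat _ _ _ N n _ (fun=> 0)) => [|i /andP[Ni _]]; last by rewrite ltnNge Ni.
  by rewrite big1_eq addr0; apply: eq_big_nat => i /andP[_ ->].
have lim (v : nat -> R) : series (fun n => if (n < N)%N then v n else 0) @ \oo --> series v N.
  apply: cvg_near_cst; near=> n; apply: E; near: n; exact: nbhs_infty_ge.
split; last exact/cvg_lim/lim.
rewrite /abs_summable (_ : (fun n => `|_|) = (fun n => if (n < N)%N then `|u n| else 0)).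
  by apply/cvg_ex; exists (series (fun n => `|u n|) N); exact: lim.
by apply/funext => n; case: ifP => // _; rewrite normr0.
Unshelve. all: by end_near. Qed.

Section fixed.
Variables (p g : R -> R).
Hypotheses (cp : continuous p) (pg : AC 0 P p g) (pP : periodic p P) (g2 : L2i 0 P g).
Let a := coefc p.
Let b := coefs p.
Let da n := n%:R * b n.
Let db n := - (n%:R * a n).
Let pP0 : p P = p 0. Proof. by rewrite -[in LHS](add0r P) pP. Qed.
Let s1 := coef_summable pg pP0 g2.
Let s2 := dcoef_summable pg pP0 g2.

(** The linear heat flow issued from [p]: frequency [n] is damped by [exp (- n^2 t)]. *)
Definition free t x := limn (series (mode (decay t (coefc p)) (decay t (coefs p)) ^~ x)).
Definition free_x t x := limn (series (mode (fun n => expR (- (freq2 n * t)) * (n%:R * coefs p n))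
  (fun n => expR (- (freq2 n * t)) * - (n%:R * coefc p n)) ^~ x)).

(** Smoothing effect [n exp (- n^2 t) <= 1 / t], from [n t <= 1 + n^2 t] and
    [(1 + y) exp (- y) <= 1]. *)
Let dsum t : 0 < t -> abs_summable (fun n => `|expR (- (freq2 n * t)) * da n| +
  `|expR (- (freq2 n * t)) * db n|).
Proof.
move=> t0; apply: (abs_summable_le (v := fun n => t^-1 * (`|a n| + `|b n|))); last exact: abs_summableZ.
move=> n; rewrite ger0_norm ?addr_ge0// !normrM !normrN !normrM -!mulrDr addrC.
rewrite mulrA [X in _ * X]addrC [`|b n| + _]addrC; apply: ler_wpM2r; first by rewrite addr_ge0.
rewrite (ger0_norm (expR_ge0 _)) ger0_norm//.
have y0 : 0 <= freq2 n * t by rewrite mulr_ge0 ?freq2_ge0 ?ltW.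
have h : (1 + freq2 n * t) * expR (- (freq2 n * t)) <= 1.
  rewrite expRN -ler_pdivlMr ?invr_gt0 ?expR_gt0// invrK mul1r.
  exact: expR_ge1Dx.
have h2 : n%:R * t <= 1 + freq2 n * t.
  rewrite /freq2; case: n {y0 h} => [|n]; first by rewrite mul0r addr_ge0// mulr_ge0 ?sqr_ge0// ltW.
  rewrite ler_wpDl// ler_wpM2r ?(ltW t0)// expr2 ler_peMl//.
  by rewrite ler1n.
rewrite -[leRHS]mul1r ler_pdivlMr//; apply: le_trans h.
have -> : expR (- (freq2 n * t)) * n%:R * t = n%:R * t * expR (- (freq2 n * t)) by ring.
by apply: ler_wpM2r h2; exact: expR_ge0.
Qed.

Lemma free_summable t x : 0 < t -> abs_summable (mode (decay t a) (decay t b) ^~ x).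
Proof.
move=> t0; apply: mode_summable; apply: (abs_summable_le (v := fun n => `|a n| + `|b n|)) => // n.
rewrite ger0_norm ?addr_ge0// /decay !normrM -mulrDr.
have /andP[h0 h1] := decay_factor n t0.
by rewrite ger0_norm ?(ltW h0)// ler_piMl// addr_ge0.
Qed.

Lemma free_derive t x : 0 < t -> is_derive x (1 : R) (free t) (free_x t x).
Proof.
move=> t0; apply: (@is_derive_series _ _ (fun n => mode (fun n => expR (- (freq2 n * t)) * da n)
  (fun n => expR (- (freq2 n * t)) * db n) n) _ _ 1 ltr01 (dsum t0)) => [y _|n y _|n y _].
- exact: free_summable.
- have := is_derive_mode (decay t a) (decay t b) n y.
  by congr (is_derive _ _ _ (mode _ _ _ _)); apply/funext => m; rewrite /decay /da /db; ring.
- exact: mode_le.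
Qed.

Lemma free_x_continuous t : 0 < t -> continuous (free_x t).
Proof. by move=> t0; exact: (@mode_series_continuous _ _ _ (dsum t0)). Qed.

Lemma free_cvg e : 0 < e -> exists2 d : R, 0 < d &
  forall t, 0 < t -> t < d -> forall x, `|free t x - p x| <= e.
Proof.
move=> e0; have [d d0 Hd] := decay_small s1 (fun n => addr_ge0 (normr_ge0 (a n)) (normr_ge0 (b n))) e0.
exists d => // t t0 td x; apply: le_trans (Hd t t0 td).
rewrite (fourier_sumT cp pg pP g2 x) distrC.
have sp : abs_summable (mode a b ^~ x) by exact: mode_summable.
have sm1 : abs_summable (fun n => -1 * mode (decay t a) (decay t b) n x).
  by apply: abs_summableZ; exact: free_summable.
have -> : limn (series (mode a b ^~ x)) - free t x =
    limn (series (fun n => mode a b n x + -1 * mode (decay t a) (decay t b) n x)).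
  have L : limn (series (fun n => -1 * mode (decay t a) (decay t b) n x)) = -1 * free t x.
    exact: (@lim_seriesM _ (mode (decay t a) (decay t b) ^~ x) (-1) (@free_summable t x t0)).
  rewrite (lim_seriesDD sp sm1).
  congr (_ + _); transitivity (-1 * free t x); [by rewrite mulN1r|].
  exact: (esym L).
apply: series_lim_le => [n|].
  have /andP[h0 h1] := decay_factor n t0.
  have -> : mode a b n x + -1 * mode (decay t a) (decay t b) n x =
    (1 - expR (- (freq2 n * t))) * mode a b n x by rewrite /mode /decay; ring.
  rewrite normrM ger0_norm ?subr_ge0// ler_wpM2l ?subr_ge0//.
  exact: mode_le.
apply: (abs_summable_le (v := fun n => `|a n| + `|b n|)) => // n.
have /andP[h0 h1] := decay_factor n t0.
have h : 0 <= 1 - expR (- (freq2 n * t)) by rewrite subr_ge0.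
have h' : 0 <= `|a n| + `|b n| by rewrite addr_ge0.
by rewrite (ger0_norm (mulr_ge0 h h')) ler_piMl// gerBl ltW.
Qed.

(** The coefficients of [g] are only square summable, so the comparison goes through a partial sum:
    Parseval bounds its distance to [g], and the damped series differs from it by the damping and by
    a tail. *)
Lemma free_x_cvg e : 0 < e -> exists2 d : R, 0 < d &
  forall t, 0 < t -> t < d -> l2n (fun x => free_x t x - g x) <= e.
Proof.
move=> e0.
pose D n := da n ^+ 2 + db n ^+ 2.
have D0 n : 0 <= D n by rewrite addr_ge0 ?sqr_ge0.
have sD : abs_summable D by exact: s2.
(* So that [pi (eta + eta) = (e / 2)^2], with one [eta] for the damping and one for the tail. *)
pose eta : R := (e / 2) ^+ 2 / (2 * pi).
have pi0 := pi_gt0 R.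
have eta0 : 0 < eta by rewrite divr_gt0 ?exprn_gt0 ?divr_gt0// mulr_gt0.
have [d d0 Hd] := decay_small sD D0 eta0.
have [N HN] := tailsum_small sD eta0.
have tN : tailsum D N <= eta := le_trans (ler_norm _) (HN N (leqnn N)).
have etaE : pi * (eta + eta) = (e / 2) ^+ 2.
  by rewrite /eta; move: (pi : R) pi0 => q q0; field; rewrite gt_eqF.
exists d => // t t0 td.
pose E n : R := expR (- (freq2 n * t)).
have E01 n : 0 < E n <= 1 := decay_factor n t0.
pose SN x := series (mode da db ^~ x) N.
have cSN : continuous SN by exact: continuous_partial.
have cfx := free_x_continuous t0.
have S2 := L2i_cont 0 P cSN; have F2 := L2i_cont 0 P cfx.
have b1 : l2n (fun x => SN x - g x) <= e / 2.
  apply: l2n_le; first by rewrite ltW ?divr_gt0.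
  rewrite (@eq_int _ _ (fun x => (g x - SN x) ^+ 2)) => [|x _]; last by rewrite -sqrrN opprB.
  apply: le_trans (int_sub_partial_le cp pg pP g2 N) _; rewrite -etaE ler_wpM2l ?(ltW pi0)//.
  by apply: le_trans tN _; lra.
pose al n := ((if (n < N)%N then 1 else 0) - E n) * da n.
pose be n := ((if (n < N)%N then 1 else 0) - E n) * db n.
have b2 : l2n (fun x => free_x t x - SN x) <= e / 2.
  apply: l2n_le; first by rewrite ltW ?divr_gt0.
  have sb x : abs_summable (fun n => if (n < N)%N then mode da db n x else 0).
    by have [] := lim_series_below (mode da db ^~ x) N.
  have sf x : abs_summable (mode (fun n => E n * da n) (fun n => E n * db n) ^~ x).
    by apply: mode_summable; exact: dsum.
  have Ex x : SN x - free_x t x = limn (series (mode al be ^~ x)).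
    rewrite (_ : mode al be ^~ x = fun n => (if (n < N)%N then mode da db n x else 0) +
        -1 * mode (fun n => E n * da n) (fun n => E n * db n) n x); last first.
      by apply/funext => n; rewrite /mode /al /be; case: ifP => _; ring.
    have L : limn (series (fun n => -1 * mode (fun n => E n * da n) (fun n => E n * db n) n x)) = -1 * free_x t x.
      exact: (@lim_seriesM _ (mode (fun n => E n * da n) (fun n => E n * db n) ^~ x) (-1) (sf x)).
    have sf' : abs_summable (fun n => -1 * mode (fun n => E n * da n) (fun n => E n * db n) n x).
      by have := @abs_summableZ _ _ (-1) (sf x).
    rewrite (lim_seriesDD (sb x) sf'); congr (_ + _); last by transitivity (-1 * free_x t x); [by rewrite mulN1r|exact: (esym L)].
    by have [_ ->] := lim_series_below (mode da db ^~ x) N.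
  rewrite (@eq_int _ _ (fun x => limn (series (mode al be ^~ x)) ^+ 2)) => [|x _]; last first.
    by rewrite -Ex -sqrrN opprB.
  (* [M1] accounts for the damping of all frequencies, [M2] for the tail from [N] on. *)
  pose M1 n := (1 - E n) * D n; pose M2 n := D n + -1 * (if (n < N)%N then D n else 0).
  have sM1 : abs_summable M1.
    apply: (abs_summable_le (v := D)) => // n; have /andP[h0 h1] := E01 n.
    by rewrite /M1 ger0_norm ?mulr_ge0 ?subr_ge0// ler_piMl// gerBl ltW.
  have [sB lB] := lim_series_below D N.
  have sM2 : abs_summable M2 by apply: abs_summableD => //; exact: abs_summableZ.
  apply: (@le_trans _ _ (pi * limn (series (fun n => M1 n + M2 n)))).
    apply: int_mode_series_le; last exact: abs_summableD.
    - by rewrite /al /da mul0r mulr0.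
    - by rewrite /be /db mul0r oppr0 mulr0.
    - apply: (abs_summable_le (v := fun n => (if (n < N)%N then `|da n| + `|db n| else 0) + (`|E n * da n| + `|E n * db n|))).
        move=> n; rewrite (ger0_norm (addr_ge0 (normr_ge0 (al n)) (normr_ge0 (be n)))).
        have H y : `|((if (n < N)%N then 1 else 0) - E n) * y| <= (if (n < N)%N then `|y| else 0) + `|E n * y|.
          by rewrite mulrBl; case: ifP => _; rewrite ?mul1r ?mul0r ?sub0r ?normrN ?add0r// ler_normB.
        by have := H (da n); have := H (db n); rewrite /al /be; case: ifP => _; lra.
      by apply: abs_summableD (dsum t0); have [] := lim_series_below (fun n => `|da n| + `|db n|) N.
    - move=> n; have /andP[h0 h1] := E01 n.
      have -> : al n ^+ 2 + be n ^+ 2 = ((if (n < N)%N then 1 else 0) - E n) ^+ 2 * D n by rewrite /al /be /D; ring.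
      rewrite /M1 /M2; move: (D n) (E n) (D0 n) h0 h1 => y z y0 h0 h1.
      have z1 : 0 <= 1 - z by rewrite subr_ge0.
      have zz : 0 <= z * (1 - z) by rewrite mulr_ge0// ltW.
      case: ifP => _.
        have -> : (1 - z) * y + (y + -1 * y) = (1 - z) * y by ring.
        by apply: ler_wpM2r => //; rewrite expr2; lra.
      have -> : (1 - z) * y + (y + -1 * 0) = (1 - z + 1) * y by ring.
      by apply: ler_wpM2r => //; rewrite expr2; lra.
  rewrite -etaE ler_wpM2l ?(ltW pi0)// lim_seriesDD//; apply: lerD; first exact: Hd.
  rewrite lim_seriesDD//; last exact: abs_summableZ.
  by rewrite (@lim_seriesM _ (fun n => if (n < N)%N then D n else 0) (-1) sB) lB mulN1r.
by have := l2n_sub F2 S2 g2; lra.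
Qed.

End fixed.
End initial_time.

(** * From a regular flow at positive times to a solution *)

Section assembly.
Context {R : realType}.
Notation mu := (@lebesgue_measure R).
Notation P := (@period R).

(** The derivative is known inside [(0, T)] only; continuity of [G] and [F] up to the ends does the
    rest. *)
Lemma cont_in_ftc (T : R) (G F : R -> R) : 0 < T -> cont_in T G -> cont_in T F ->
  (forall t, t \in `]0, T[ -> is_derive t (1 : R) G (F t)) ->
  forall t, t \in `[0, T] -> G t - G 0 = \int[mu]_(s in `[0, t]) F s.
Proof.
move=> T0 cG cF dG t tT; have T0' := ltW T0.
have /andP[t0 tT'] : 0 <= t <= T by move: tT; rewrite in_itv.
have cFc := cont_in_clamp T0' cF; have cGc := cont_in_clamp T0' cG.
have [H dH] := primitive_ex cFc.
have -> : \int[mu]_(s in `[0, t]) F s = H t - H 0.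
  rewrite -(int_derive t0 cFc dH); apply: eq_int => s; rewrite in_itv/= => /andP[s0 st].
  by rewrite clamp_id// in_itv/= s0 (le_trans st tT').
move: t0; rewrite le_eqVlt => /orP[/eqP<-|t0]; first by rewrite !subrr.
pose D s := G (clamp 0 T s) - H s.
have cD : continuous D.
  by move=> s; apply: (@continuousB _ _ _ (fun s => G (clamp 0 T s)) H); [exact: cGc|exact: (is_derive_continuous dH)].
have dD s : s \in `]0, t[ -> is_derive s (1 : R) D ((fun=> 0) s).
  rewrite in_itv/= => /andP[s0 st]; have sT := lt_le_trans st tT'.
  have sT' : s \in `[0, T] by rewrite in_itv/= (ltW s0) (ltW sT).
  have d1 : is_derive s (1 : R) (fun s => G (clamp 0 T s)) (F s).
    have s_oo : s \in `]0, T[ by rewrite in_itv/= s0 sT.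
    apply: (is_derive_near (d := Num.min s (T - s))) (dG s s_oo).
      by rewrite lt_min s0 subr_gt0.
    move=> y; rewrite lt_min !ltr_norml => /andP[/andP[? ?] /andP[? ?]].
    by rewrite clamp_id// in_itv/=; apply/andP; split; lra.
  by apply: (is_derive_eq (is_deriveB d1 (dH s))); rewrite clamp_id// subrr.
have [s _] := MVT t0 dD (continuous_subspaceT cD).
by rewrite mul0r /D !clamp_id ?in_itv/= ?lexx ?T0'//; lra.
Qed.

(** The bound involves [f] only through the oscillation of [f'], hence is uniform in a parameter:
    this is what differentiation under the integral needs. *)
Lemma linear_approx (f f' : R -> R) t0 (d e h : R) :
  (forall s, `|s - t0| < d -> is_derive s (1 : R) f (f' s)) ->
  (forall s, `|s - t0| < d -> `|f' s - f' t0| <= e) -> `|h| < d ->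
  `|f (t0 + h) - f t0 - h * f' t0| <= e * `|h|.
Proof.
move=> df He hd.
have key a b : a < b -> (forall s, a <= s <= b -> `|s - t0| < d) ->
    `|f b - f a - (b - a) * f' t0| <= e * (b - a).
  move=> ab Hs.
  have dab s : a <= s <= b -> is_derive s (1 : R) f (f' s) by move=> /Hs; exact: df.
  have cf : {within `[a, b], continuous f}.
    apply: derivable_within_continuous => s; rewrite in_itv/= => /dab[]//.
  have dab' s : s \in `]a, b[ -> is_derive s (1 : R) f (f' s).
    by rewrite in_itv/= => /andP[sa sb]; apply: dab; rewrite !ltW.
  have [s sab ->] := MVT ab dab' cf.
  have sab' : a <= s <= b by move: sab; rewrite in_itv/= => /andP[sa sb]; rewrite !ltW.
  rewrite (mulrC (f' s)) -mulrBr normrM ger0_norm ?subr_ge0 ?(ltW ab)// mulrC.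
  by rewrite ler_wpM2r ?subr_ge0 ?(ltW ab)//; apply: He; exact: Hs.
have [h0|h0|->] := ltgtP h 0; last by rewrite addr0 subrr mul0r subrr normr0 mulr0.
  have := key (t0 + h) t0; rewrite gtrDl => /(_ h0).
  have -> : t0 - (t0 + h) = - h by ring.
  rewrite (ltr0_norm h0) -normrN.
  have -> : - (f t0 - f (t0 + h) - - h * f' t0) = f (t0 + h) - f t0 - h * f' t0 by ring.
  apply => s /andP[s1 s2]; apply: le_lt_trans hd.
  by rewrite (ltr0_norm h0) ler_norml; apply/andP; split; lra.
have := key t0 (t0 + h); rewrite ltrDl => /(_ h0).
have -> : t0 + h - t0 = h by ring.
rewrite (gtr0_norm h0); apply => s /andP[s1 s2]; apply: le_lt_trans hd.
by rewrite (gtr0_norm h0) ler_norml; apply/andP; split; lra.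
Qed.

Lemma continuous_coords n (f : R -> 'rV[R]_n.+1) : (forall i, continuous (fun x => f x 0 i)) ->
  continuous f.
Proof.
move=> cf x.
have H (s : seq 'I_n.+1) : {for x, continuous (fun y => \sum_(i <- s) f y 0 i *: 'e_i : 'rV[R]_n.+1)}.
  elim: s => [|i s IH].
    rewrite (_ : (fun y => _) = cst 0); first exact: cst_continuous.
    by apply/funext => y; rewrite big_nil.
  rewrite (_ : (fun y => _) = (fun y => f y 0 i *: 'e_i + \sum_(i <- s) f y 0 i *: 'e_i)).
    apply: (@continuousD _ _ _ (fun y => f y 0 i *: 'e_i : 'rV[R]_n.+1) (fun y => \sum_(i <- s) f y 0 i *: 'e_i)) => //.
    apply: (@continuousZ _ _ _ (fun y => f y 0 i) (fun=> 'e_i : 'rV[R]_n.+1)); [exact: cf|exact: cst_continuous].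
  by apply/funext => y; rewrite big_cons.
rewrite (_ : f = (fun y => \sum_i f y 0 i *: 'e_i)); first exact: H.
by apply/funext => y; exact: row_sum_delta.
Qed.

Lemma uniform_delta n (Q : 'I_n -> R -> Prop) :
  (forall i, exists2 d : R, 0 < d & forall s, `|s| < d -> Q i s) ->
  exists2 d : R, 0 < d & forall i s, `|s| < d -> Q i s.
Proof.
move=> /(_ _)/cid2-/all_sig2[d d0 Hd].
have S0 : 0 <= \sum_i (d i)^-1 by apply: sumr_ge0 => i _; rewrite invr_ge0 ltW.
(* Smaller than every [d i], with no minimum over a possibly empty index set. *)
exists ((1 + \sum_i (d i)^-1)^-1) => [|i s sd]; first by rewrite invr_gt0 ltr_pwDl.
apply: Hd; apply: lt_le_trans sd _.
rewrite -[leRHS]invrK lef_pV2 ?posrE ?invr_gt0 ?ltr_pwDl//.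
rewrite (bigD1 i)//= addrCA lerDl addr_ge0// sumr_ge0// => j _; by rewrite invr_ge0 ltW.
Qed.

Lemma in_CL1_int (T : R) (N : R -> R -> R) : in_CL1 T N ->
  cont_in T (fun t => \int[mu]_(x in `[0, P]) N t x).
Proof.
move=> [Ni cN] t tT e e0; have [d d0 Hd] := cN t tT e e0; exists d => // s sT st.
rewrite -intB; [|exact: Ni..]; apply: le_trans (int_abs (itgB (Ni s sT) (Ni t tT))) _.
exact: Hd.
Qed.

Lemma l2n_sup (f : R -> R) (e : R) : continuous f -> 0 <= e -> (forall x, x \in `[0, P] -> `|f x| <= e) ->
  l2n f <= (1 + P) * e.
Proof.
move=> cf e0 fe; have P0 := @period_gt0 R.
apply: l2n_le; first by rewrite mulr_ge0// addr_ge0// ltW.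
apply: (@le_trans _ _ (e ^+ 2 * P)).
  rewrite -[X in _ * X](subr0 P) -(int_cst _ (ltW P0)); apply: le_int => [| |x xP].
  - by apply: itg_cont; exact: continuousX_fun.
  - by apply: itg_cont; exact: cst_continuous.
  - by rewrite -(real_normK (num_real _)) ler_sqr ?nnegrE// fe.
have := mulr_ge0 (sqr_ge0 e) (ltW P0); have := mulr_ge0 (sqr_ge0 e) (sqr_ge0 P); have := sqr_ge0 e.
rewrite [X in _ -> _ -> _ -> _ <= X](_ : _ = e ^+ 2 + 2 * (e ^+ 2 * P) + e ^+ 2 * P ^+ 2); last by ring.
lra.
Qed.

Section fixed.
Variables (k : nat) (omega : set R) (T : R) (f : R -> R -> 'rV[R]_k.+1).
Variables (U Ut Ux Uxx : R -> R -> 'rV[R]_k.+1) (v0 v0x : R -> 'rV[R]_k.+1).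
Hypotheses (T0 : 0 < T) (omega_open : open omega)
  (cf : forall i, continuous (fun p : R * R => f p.1 p.2 0 i))
  (rU : forall i, regular (fun=> True) (fun t x => U t x 0 i) (fun t x => Ut t x 0 i)
     (fun t x => Ux t x 0 i) (fun t x => Uxx t x 0 i))
  (pU : forall t, periodic (U t) P) (pUx : forall t, periodic (Ux t) P)
  (sU : forall t x, 0 < t -> sphere (U t x))
  (eqU : forall t x, 0 < t -> Ut t x = Uxx t x + nonlin omega f U Ux t x)
  (H0 : H1_sphere_with v0 v0x)
  (U0 : forall e : R, 0 < e -> exists2 d : R, 0 < d & forall t, 0 < t -> t < d -> forall i,
     l2n (fun x => U t x 0 i - v0 x 0 i) <= e /\ l2n (fun x => Ux t x 0 i - v0x x 0 i) <= e).

(** The initial state is inserted at [t = 0] by hand, since the regular flow solves the equation at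
    positive times only. *)
Definition glue (V : R -> R -> 'rV[R]_k.+1) (w : R -> 'rV[R]_k.+1) t x :=
  if 0 < t then V t x else w x.
Notation u := (glue U v0).
Notation ux := (glue Ux v0x).

Let cU t i : 0 < t -> continuous (fun x => U t x 0 i).
Proof.
move=> t0 x; have [_ [c _ _ _]] := @rU i t x t0 I.
exact: (continuous_slice (f := fun p : R * R => U p.1 p.2 0 i) c).
Qed.

Let cUx t i : 0 < t -> continuous (fun x => Ux t x 0 i).
Proof.
move=> t0 x; have [_ [_ _ c _]] := @rU i t x t0 I.
exact: (continuous_slice (f := fun p : R * R => Ux p.1 p.2 0 i) c).
Qed.

Let cUxx t i : 0 < t -> continuous (fun x => Uxx t x 0 i).
Proof.
move=> t0 x; have [_ [_ _ _ c]] := @rU i t x t0 I.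
exact: (continuous_slice (f := fun p : R * R => Uxx p.1 p.2 0 i) c).
Qed.

Let H1u t : 0 <= t -> H1_sphere_with (u t) (ux t).
Proof.
rewrite le_eqVlt => /orP[/eqP<-|t0].
  by rewrite (_ : u 0 = v0) 1?(_ : ux 0 = v0x)//; apply/funext => x; rewrite /glue ltxx.
rewrite (_ : u t = U t) 1?(_ : ux t = Ux t); last 2 first.
- by apply/funext => x; rewrite /glue t0.
- by apply/funext => x; rewrite /glue t0.
split => //.
- by apply: continuous_coords => i; exact: cU.
- by move=> x; exact: sU.
- by apply/L2_circleP; split => // i; apply: L2i_cont; exact: cUx.
- move=> phi sphi i; rewrite /circle.
  have dUx x : is_derive x (1 : R) (fun x => U t x 0 i) (Ux t x 0 i).
    by have [[]] := @rU i t x t0 I.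
  have := AC_by_parts (AC_C1 0 P (@cUx t i t0) dUx) _ (smooth_derive_continuous sphi) (smooth_is_derive sphi) (smooth_period sphi).
  move=> -> //; first by rewrite opprK.
  by rewrite -[in LHS](add0r P) pU.
Qed.

(** At [0] continuity is the hypothesis [U0]; at positive times it follows from joint continuity and
    compactness of a period. *)
Lemma glue_C_H1 : C_H1_sphere_with T u ux.
Proof.
split=> [t|t tT]; first by rewrite in_itv/= => /andP[t0 _]; exact: H1u.
have cc s : 0 <= s -> forall i, L2i 0 P (fun x => u s x 0 i).
  move=> s0 i; have [_ cu _ _ _] := H1u s0; apply: L2i_cont => x.
  apply: (@continuous_comp _ _ _ (u s) (fun M : 'rV[R]_k.+1 => M 0 i)); [exact: cu|exact: coord_continuous].
have x2 s : 0 <= s -> forall i, L2i 0 P (fun x => ux s x 0 i).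
  by move=> /H1u[_ _ _ /L2_circleP[]].
have near e : 0 < e -> exists2 d : R, 0 < d & forall s, s \in `[0, T] -> `|s - t| < d ->
    forall i, l2n (fun x => u s x 0 i - u t x 0 i) <= e /\ l2n (fun x => ux s x 0 i - ux t x 0 i) <= e.
  move=> e0.
  have [t0|] := ltP 0 t; last first.
    move=> t_0; have tz : t = 0 by apply/le_anti; rewrite t_0; move: tT; rewrite in_itv/= => /andP[].
    have [d d0 Hd] := U0 e0; exists d => // s; rewrite tz subr0 in_itv/= => /andP[s0 _] sd i.
    rewrite /glue ltxx; move: s0 sd; rewrite le_eqVlt => /orP[/eqP<-|s0]; rewrite ?ltxx ?s0.
      move=> _; have z (h : R -> R) : l2n (fun x => h x - h x) <= e.
        apply: l2n_le; first exact: ltW.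
        rewrite (@eq_int _ _ (fun=> 0)) => [|x _]; last by rewrite subrr expr0n.
        by rewrite int_cst ?mul0r ?sqr_ge0// ltW// period_gt0.
      by split; exact: (z (fun x => _)).
    by rewrite gtr0_norm// => sd; exact: Hd.
  have P0 := @period_gt0 R.
  have P1 : 0 < 1 + P :> R by rewrite addr_gt0.
  have e'0 : 0 < e / (1 + P) by rewrite divr_gt0.
  have near1 (V : R -> R -> 'rV[R]_k.+1) : (forall i x, jcont (fun t x => V t x 0 i) t x) ->
      (forall s i, 0 < s -> continuous (fun x => V s x 0 i)) ->
      exists2 d : R, 0 < d & forall i s, `|s| < d -> l2n (fun x => V (t + s) x 0 i - V t x 0 i) <= e.
    move=> cV cVs; apply: uniform_delta => i.
    have [d d0 Hd] := @sup_near R (fun t x => V t x 0 i) t (e / (1 + P)) (cV i) e'0.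
    exists (Num.min t d) => [|s]; first by rewrite lt_min t0 d0.
    rewrite lt_min => /andP[st sd].
    have ts : 0 < t + s by move: st; rewrite ltr_norml => /andP[]; lra.
    have -> : e = (1 + P) * (e / (1 + P)) by rewrite mulrC mulfVK// gt_eqF.
    apply: l2n_sup (ltW e'0) _ => [|x xP].
      by apply: continuousD_fun => [|y]; [exact: cVs|apply: (@continuousN _ _ _ (fun x => V t x 0 i)); exact: cVs].
    by apply: Hd => //; rewrite (addrC t) addrK.
  have [d1 d10 H1] := near1 U (fun i x => let: conj _ (And4 c _ _ _) := @rU i t x t0 I in c) (fun s i => @cU s i).
  have [d2 d20 H2] := near1 Ux (fun i x => let: conj _ (And4 _ _ c _) := @rU i t x t0 I in c) (fun s i => @cUx s i).
  exists (Num.min t (Num.min d1 d2)) => [|s _]; first by rewrite !lt_min t0 d10 d20.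
  rewrite !lt_min => /and3P[st s1 s2] i.
  have s0 : 0 < s by move: st; rewrite ltr_norml => /andP[]; lra.
  rewrite /glue t0 s0; have -> : s = t + (s - t) by ring.
  by split; [exact: H1|exact: H2].
apply/cvgrPdist_le => e e0.
have e'0 : 0 < e / (2 * k.+1%:R) by rewrite divr_gt0// mulr_gt0.
have [d d0 Hd] := near _ e'0.
rewrite near_withinE; apply/nbhs_ballP; exists d => // s; rewrite /ball/= distrC => st sT.
rewrite sub0r normrN ger0_norm ?sqrtr_ge0//.
have s0 : 0 <= s by move: sT; rewrite in_itv/= => /andP[].
have t0 : 0 <= t by move: tT; rewrite in_itv/= => /andP[].
have dE (v v' : R -> 'rV[R]_k.+1) i : (fun x => (v \- v') x 0 i) = (fun x => v x 0 i - v' x 0 i).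
  by apply/funext => x; rewrite /= !mxE.
have -> : e = 2 * k.+1%:R * (e / (2 * k.+1%:R)) by rewrite mulrC mulfVK// mulf_neq0// pnatr_eq0.
apply: H1_norm_le => [|i|i|i|i]; rewrite ?dE ?(ltW e'0)//.
- by apply: L2iB; exact: cc.
- by apply: L2iB; exact: x2.
- by have [] := Hd s sT st i.
- by have [] := Hd s sT st i.
Qed.

(** The tested state and the tested right-hand side are continuous on [[0, T]]. Inside, the former
    is differentiated under the integral and the equation is integrated by parts in [x]. *)
Lemma glue_solution : HMHF_solution omega T f v0 u.
Proof.
exists ux; split; [exact: glue_C_H1|by move=> x; rewrite /glue ltxx|].
move=> phi sphi i t tT; rewrite /circle.
have Cu := glue_C_H1.
have c0 : continuous phi := is_derive_continuous (smooth_is_derive sphi).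
have c1 := smooth_derive_continuous sphi.
have [us u2 _] := C_H1_coord Cu i; have Nu := nonlin_CL1 omega_open cf Cu i.
pose F := rhs (fun s x => ux s x 0 i) (fun s x => nonlin omega f u ux s x 0 i) phi (derive1 phi).
pose G (t : R) : R := \int[mu]_(x in `[0, P]) (u t x 0 i * phi x).
have cG : cont_in T G by apply: in_CL1_int; apply: in_CL1M us _; apply: in_CL1_cst; exact: itg_cont.
have cF : cont_in T F.
  by apply: rhs_cont; [exact: u2.1|exact: Nu.1|exact: u2.2|exact: Nu.2|exact: c0|exact: L2i_cont].
rewrite -/(G t) -/(G 0).
rewrite (@eq_int _ _ F 0 t); last first.
  move=> s st; apply: (test_split omega_open cf _ Cu sphi).
  by move: st tT; rewrite !in_itv/= => /andP[-> /le_trans st] /andP[_ /st].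
apply: (cont_in_ftc T0 cG cF _ tT) => s.
rewrite in_itv/= => /andP[s0 sT].
have sT' : s \in `[0, T] by rewrite in_itv/= !ltW.
have dUx x : is_derive x (1 : R) (fun x => Ux s x 0 i) (Uxx s x 0 i).
  by have [[]] := @rU i s x s0 I.
have cUt : continuous (fun x => Ut s x 0 i).
  move=> x; have [_ [_ c _ _]] := @rU i s x s0 I.
  exact: (continuous_slice (f := fun p : R * R => Ut p.1 p.2 0 i) c).
have FE : F s = \int[mu]_(x in `[0, P]) (Ut s x 0 i * phi x).
  have -> : F s = - (\int[mu]_(x in `[0, P]) (Ux s x 0 i * derive1 phi x)) +
     \int[mu]_(x in `[0, P]) (nonlin omega f U Ux s x 0 i * phi x).
    by rewrite /F /rhs; congr (- _ + _); apply: eq_int => x _; rewrite /nonlin /glue s0.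
  have Ni : itg 0 P (fun x => nonlin omega f U Ux s x 0 i).
    by apply: eq_itg (Nu.1 s sT') => x _; rewrite /nonlin /glue s0.
  have pUxs : Ux s P 0 i = Ux s 0 0 i by rewrite -[in LHS](add0r P) pUx.
  have H := AC_by_parts (AC_C1 0 P (@cUxx s i s0) dUx) pUxs c1 (smooth_is_derive sphi) (smooth_period sphi).
  rewrite -H -intD; [|by apply: itg_contM => //; apply: itg_cont; exact: cUxx|exact: itg_contM].
  apply: eq_int => x _; have := @eqU s x s0; move: (nonlin omega f U Ux s x) => nl ->.
  by rewrite mxE; ring.
rewrite FE.
apply: (is_derive_near s0 (g := fun t => \int[mu]_(x in `[0, P]) (U t x 0 i * phi x))).
  move=> y; rewrite ltr_norml => /andP[y0 _]; have yp : 0 < y by lra.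
  by apply: eq_int => x _; rewrite /glue yp.
apply/is_derive_epsP => e e0; have P0 := @period_gt0 R.
have [M M0 HM] := continuous_bounded 0 P c0.
have e'0 : 0 < e / (M * P) by rewrite divr_gt0// mulr_gt0.
have [d d0 Hd] := @sup_near R (fun t x => Ut t x 0 i) s _ (fun x => let: conj _ (And4 _ c _ _) := @rU i s x s0 I in c) e'0.
exists (Num.min s d) => [|h]; first by rewrite lt_min s0 d0.
rewrite lt_min => /andP[hs hd].
have sh : 0 < s + h by move: hs; rewrite ltr_norml => /andP[]; lra.
have i1 t' : 0 < t' -> itg 0 P (fun x => U t' x 0 i * phi x).
  by move=> t'0; apply: itg_cont; apply: continuousM_fun => //; exact: cU.
have i2 : itg 0 P (fun x => h * (Ut s x 0 i * phi x)).
  by apply: itgZ; apply: itg_cont; exact: continuousM_fun.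
rewrite -(intZ h); last by apply: itg_cont; exact: continuousM_fun.
rewrite -(intB (i1 _ sh) (i1 _ s0)) -(intB (itgB (i1 _ sh) (i1 _ s0)) i2).
have -> : e * `|h| = (e / (M * P) * `|h| * M) * (P - 0).
  by field; rewrite !gt_eqF.
apply: int_bound (ltW P0) (itgB (itgB (i1 _ sh) (i1 _ s0)) i2) _ => x xP.
have -> : U (s + h) x 0 i * phi x - U s x 0 i * phi x - h * (Ut s x 0 i * phi x) =
  (U (s + h) x 0 i - U s x 0 i - h * Ut s x 0 i) * phi x by ring.
rewrite normrM; apply: ler_pM => //; last exact: HM.
apply: (@linear_approx (fun t => U t x 0 i) (fun t => Ut t x 0 i) s (Num.min s d)).
- move=> r; rewrite lt_min ltr_norml => /andP[/andP[r1 _] _]; have r0 : 0 < r by lra.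
  by have [[]] := @rU i r x r0 I.
- by move=> r; rewrite lt_min => /andP[_ rd]; exact: Hd.
- by rewrite lt_min hs hd.
Qed.

End fixed.
End assembly.

(** * Cut-offs in time and space *)

Section bumps.
Context {R : realType}.
Notation P := (@period R).

(** The timetable in units of [s]: zero before [1], [pi / 2] between [2] and [6], zero after [7].
    The angle is steered between [3] and [5], and the margin of one unit lets the gluing condition
    hold on neighbourhoods. *)
Lemma time_bump (s : R) : 0 < s -> exists be be' : R -> R,
  [/\ forall t, is_derive t (1 : R) be (be' t), continuous be',
      forall t, t < s -> be t = 0 /\ be' t = 0,
      forall t, 2 * s < t -> t < 6 * s -> be t = pi / 2 &
      forall t, 7 * s < t -> be t = 0].
Proof.
move=> s0; have s1 : s < 2 * s by lra. have s6 : 6 * s < 7 * s by lra.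
have [phi [dphi phi1 phi0 _]] := cutoff_ex s1 ltr01.
have [psi [dpsi psi1 psi0 _]] := cutoff_ex s6 ltr01.
have fl := cutoff_flat dphi (fun t ts => phi1 t (ltW ts)).
have d1 t : is_derive t (1 : R) (fun t => (1 - phi 0%N t) * psi 0%N t)
   ((- phi 1%N t) * psi 0%N t + (1 - phi 0%N t) * psi 1%N t).
  have d0 : is_derive t (1 : R) (fun _ : R => 1 : R) (0 : R) by exact: is_derive_cst.
  have d2 : is_derive t (1 : R) (fun t => 1 - phi 0%N t) (- phi 1%N t).
    by apply: (is_derive_eq (is_deriveB d0 (dphi 0%N t))); rewrite sub0r.
  exact: is_derive_mulE d2 (dpsi 0%N t).
have c n : continuous (phi n) := is_derive_continuous (dphi n).
have c' n : continuous (psi n) := is_derive_continuous (dpsi n).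
exists (fun t => pi / 2 * ((1 - phi 0%N t) * psi 0%N t)).
exists (fun t => pi / 2 * ((- phi 1%N t) * psi 0%N t + (1 - phi 0%N t) * psi 1%N t)).
split=> [t||t ts|t t1 t2|t t1].
- exact: is_deriveZ.
- apply: continuousZ_fun; apply: continuousD_fun; apply: continuousM_fun => //.
    by move=> x; apply: (@continuousN _ _ _ (phi 1%N)); exact: c.
  by apply: continuousD_fun => x; [exact: cst_continuous|apply: (@continuousN _ _ _ (phi 0%N)); exact: c].
- by rewrite fl// phi1 ?ltW// subrr !mul0r oppr0 mul0r addr0 mulr0.
- by rewrite phi0 ?psi1 ?ltW// subr0 !mulr1.
- by rewrite psi0 ?ltW// !mulr0.
Qed.

(** A cut-off composed with [1 - cos (x - c)], which is smooth and periodic and measures the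
    distance to [c] on the circle. *)
Lemma space_bump (c b : R) : 0 < b -> exists ch ch' ch'' : R -> R,
  [/\ forall x, is_derive x (1 : R) ch (ch' x) /\ is_derive x (1 : R) ch' (ch'' x), continuous ch'',
      forall x, [/\ ch (x + P) = ch x, ch' (x + P) = ch' x & ch'' (x + P) = ch'' x],
      exists2 d : R, 0 < d & forall x, `|x - c| < d -> ch x = 1 &
      forall x, b <= 1 - cos (x - c) -> [/\ ch x = 0, ch' x = 0 & ch'' x = 0]].
Proof.
move=> b0; have b1 : b / 4 < b / 2 by lra.
have [psi [dpsi psi1 psi0 _]] := cutoff_ex b1 ltr01.
have fl := cutoff_flat_right dpsi (fun t ts => psi0 t (ltW ts)).
pose y (x : R) : R := 1 - cos (x - c).
have ds x : is_derive x (1 : R) (fun x => x - c) (1 : R).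
  by apply: is_derive_eq; rewrite subr0.
have dsin x : is_derive x (1 : R) (fun x => sin (x - c)) (cos (x - c)).
  by apply: (is_derive_eq (is_derive_chain (is_derive_sin _) (ds x))); rewrite mulr1.
have dcos x : is_derive x (1 : R) (fun x => cos (x - c)) (- sin (x - c)).
  by apply: (is_derive_eq (is_derive_chain (is_derive_cos _) (ds x))); rewrite mulr1.
have dy x : is_derive x (1 : R) y (sin (x - c)).
  have d0 : is_derive x (1 : R) (fun _ : R => 1 : R) (0 : R) by exact: is_derive_cst.
  by apply: (is_derive_eq (is_deriveB d0 (dcos x))); rewrite sub0r opprK.
have cy := is_derive_continuous dy; have csin := is_derive_continuous dsin.
have ccos := is_derive_continuous dcos.
have cpsi n : continuous (fun x => psi n (y x)).
  by apply: is_derive_continuous => x; exact: is_derive_chain (dpsi n _) (dy x).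
exists (fun x => psi 0%N (y x)), (fun x => psi 1%N (y x) * sin (x - c)).
exists (fun x => psi 2%N (y x) * sin (x - c) * sin (x - c) + psi 1%N (y x) * cos (x - c)).
have sP x : cos (x + P - c) = cos (x - c) /\ sin (x + P - c) = sin (x - c).
  have -> : x + P - c = x - c + P by ring.
  by have := cos_natmul_period 1 (x - c); have := sin_natmul_period 1 (x - c); rewrite !mul1r.
split.
- move=> x; split; first exact: is_derive_chain (dpsi 0%N _) (dy x).
  exact: is_derive_mulE (is_derive_chain (dpsi 1%N _) (dy x)) (dsin x).
- by apply: continuousD_fun; repeat apply: continuousM_fun.
- by move=> x; have [h1 h2] := sP x; rewrite /y h1 h2.
- have := cy c; move=> /cvgrPdist_lt/(_ (b / 4))[|d /= d0 Hd]; first by lra.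
  exists d => // x xc; apply: psi1; have := Hd x; rewrite /= distrC => /(_ xc).
  by rewrite {1}/y subrr cos0 subrr sub0r normrN => /(le_lt_trans (ler_norm _))/ltW.
- move=> x bx; have yx : b / 2 < y x by rewrite /y; lra.
  by rewrite psi0 ?(ltW yx)// !fl// !mul0r addr0.
Qed.

End bumps.

(** * Algebra of the control *)

Section residual.
Context {R : comNzRingType}.
Variables (sB cB sT cT Bt Bx Bxx Tx Txx : R).
Hypotheses (B1 : sB ^+ 2 + cB ^+ 2 = 1) (T1 : sT ^+ 2 + cT ^+ 2 = 1).

Let w1x := - sB * Bx * cT + cB * (- sT * Tx).
Let w2x := - sB * Bx * sT + cB * (cT * Tx).
Let w3x := cB * Bx.
(** Components of [u_t - u_xx - |u_x|^2 u] for latitude [B] and longitude [Theta], with metric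
    [dB^2 + cos^2 B dTheta^2]: [A] along the unit vector of increasing latitude, and [b] along that
    of increasing longitude, where [Theta_t - Theta_xx] has cancelled. *)
Let A := Bt - Bxx - sB * cB * Tx ^+ 2.
Let b := 2 * sB * Bx * Tx.

Lemma speed_sqr : w1x * w1x + w2x * w2x + w3x * w3x = Bx ^+ 2 + cB ^+ 2 * Tx ^+ 2.
Proof.
transitivity (((sB * Bx) ^+ 2 + (cB * Tx) ^+ 2) * (sT ^+ 2 + cT ^+ 2) + cB ^+ 2 * Bx ^+ 2).
  by rewrite /w1x /w2x /w3x; ring.
rewrite T1; transitivity ((sB ^+ 2 + cB ^+ 2) * Bx ^+ 2 + cB ^+ 2 * Tx ^+ 2); first by ring.
by rewrite B1; ring.
Qed.

(** The two sides differ by a multiple of [1 - (sB^2 + cB^2)]. *)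
Lemma residual1 : - sB * Bt * cT + cB * (- sT * Txx) =
  (- cB * Bx * Bx + - sB * Bxx) * cT + - sB * Bx * (- sT * Tx) +
   (- sB * Bx * (- sT * Tx) + cB * (- cT * Tx * Tx + - sT * Txx)) +
  ((Bx ^+ 2 + cB ^+ 2 * Tx ^+ 2) * (cB * cT) + (- A * sB * cT - b * sT)).
Proof.
apply/eqP; rewrite -subr_eq0; apply/eqP.
transitivity ((1 - (sB ^+ 2 + cB ^+ 2)) * cB * cT * Tx ^+ 2); first by rewrite /A /b; ring.
by rewrite B1; ring.
Qed.

Lemma residual2 : - sB * Bt * sT + cB * (cT * Txx) =
  (- cB * Bx * Bx + - sB * Bxx) * sT + - sB * Bx * (cT * Tx) +
   (- sB * Bx * (cT * Tx) + cB * (- sT * Tx * Tx + cT * Txx)) +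
  ((Bx ^+ 2 + cB ^+ 2 * Tx ^+ 2) * (cB * sT) + (- A * sB * sT + b * cT)).
Proof.
apply/eqP; rewrite -subr_eq0; apply/eqP.
transitivity ((1 - (sB ^+ 2 + cB ^+ 2)) * cB * sT * Tx ^+ 2); first by rewrite /A /b; ring.
by rewrite B1; ring.
Qed.

Lemma residual3 : cB * Bt = - sB * Bx * Bx + cB * Bxx +
  ((Bx ^+ 2 + cB ^+ 2 * Tx ^+ 2) * sB + A * cB).
Proof. by rewrite /A; ring. Qed.

Lemma residual_tangent :
  (- A * sB * cT - b * sT) * (cB * cT) + (- A * sB * sT + b * cT) * (cB * sT) + A * cB * sB = 0.
Proof.
transitivity (A * cB * sB * (1 - (sT ^+ 2 + cT ^+ 2))); first by ring.
by rewrite T1; ring.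
Qed.

Lemma unit_length : cB * cT * (cB * cT) + cB * sT * (cB * sT) + sB * sB = 1.
Proof.
transitivity (cB ^+ 2 * (sT ^+ 2 + cT ^+ 2) + sB ^+ 2); first by ring.
by rewrite T1 mulr1 addrC.
Qed.

End residual.

(** * The flow in an orthonormal frame *)

Section frames.
Context {R : realType}.
Variable k : nat.
Variables e1 e2 e3 : 'rV[R]_k.+1.
Hypotheses (e11 : dotv e1 e1 = 1) (e22 : dotv e2 e2 = 1) (e12 : dotv e1 e2 = 0)
  (e33 : dotv e3 e3 = 1) (e13 : dotv e1 e3 = 0) (e23 : dotv e2 e3 = 0).

Definition comb (a1 a2 a3 : R) : 'rV[R]_k.+1 := a1 *: e1 + a2 *: e2 + a3 *: e3.

Lemma comb_coord a1 a2 a3 i : comb a1 a2 a3 0 i = e1 0 i * a1 + (e2 0 i * a2 + e3 0 i * a3).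
Proof. by rewrite /comb !mxE; ring. Qed.

Lemma dot_comb a1 a2 a3 b1 b2 b3 :
  dotv (comb a1 a2 a3) (comb b1 b2 b3) = a1 * b1 + a2 * b2 + a3 * b3.
Proof.
rewrite /comb !dotvDl !dotvDr !dotvZl !dotvZr e11 e22 e33 e12 e13 e23.
by rewrite (dotvC e2 e1) (dotvC e3 e1) (dotvC e3 e2) e12 e13 e23; ring.
Qed.

Lemma coord_le1 (e : 'rV[R]_k.+1) i : dotv e e = 1 -> `|e 0 i| <= 1.
Proof.
move=> ee; rewrite -ler_sqr ?nnegrE// real_normK ?num_real// expr1n -ee /dotv (bigD1 i)//= expr2 lerDl.
by apply: sumr_ge0 => j _; rewrite -expr2 sqr_ge0.
Qed.

Section profile.
Variables (D : R -> Prop) (B Bt Bx Bxx Th Thx Thxx : R -> R -> R).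
Hypotheses (rB : regular D B Bt Bx Bxx) (rT : regular D Th Thxx Thx Thxx).

Definition V t x := comb (cos (B t x) * cos (Th t x)) (cos (B t x) * sin (Th t x)) (sin (B t x)).

(** [Thxx] also stands for the time derivative of [Th], since the angle solves the heat equation. *)
Definition Vt t x := comb
  (- sin (B t x) * Bt t x * cos (Th t x) + cos (B t x) * (- sin (Th t x) * Thxx t x))
  (- sin (B t x) * Bt t x * sin (Th t x) + cos (B t x) * (cos (Th t x) * Thxx t x))
  (cos (B t x) * Bt t x).

Definition Vx t x := comb
  (- sin (B t x) * Bx t x * cos (Th t x) + cos (B t x) * (- sin (Th t x) * Thx t x))
  (- sin (B t x) * Bx t x * sin (Th t x) + cos (B t x) * (cos (Th t x) * Thx t x))
  (cos (B t x) * Bx t x).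

(** Left in the shape that the rules for products and compositions of regular functions produce, so
    that [regular_V] follows by comparison of terms. *)
Definition Vxx t x := comb
  ((- cos (B t x) * Bx t x * Bx t x + - sin (B t x) * Bxx t x) * cos (Th t x) +
     - sin (B t x) * Bx t x * (- sin (Th t x) * Thx t x) +
   (- sin (B t x) * Bx t x * (- sin (Th t x) * Thx t x) +
     cos (B t x) * (- cos (Th t x) * Thx t x * Thx t x + - sin (Th t x) * Thxx t x)))
  ((- cos (B t x) * Bx t x * Bx t x + - sin (B t x) * Bxx t x) * sin (Th t x) +
     - sin (B t x) * Bx t x * (cos (Th t x) * Thx t x) +
   (- sin (B t x) * Bx t x * (cos (Th t x) * Thx t x) +
     cos (B t x) * (- sin (Th t x) * Thx t x * Thx t x + cos (Th t x) * Thxx t x)))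
  (- sin (B t x) * Bx t x * Bx t x + cos (B t x) * Bxx t x).

(* The control [V_t - V_xx - |V_x|^2 V], written so that it visibly vanishes with [B] and its derivatives. *)
Definition Vf t x := comb
  (- (Bt t x - Bxx t x - sin (B t x) * cos (B t x) * Thx t x ^+ 2) * sin (B t x) * cos (Th t x)
     - 2 * sin (B t x) * Bx t x * Thx t x * sin (Th t x))
  (- (Bt t x - Bxx t x - sin (B t x) * cos (B t x) * Thx t x ^+ 2) * sin (B t x) * sin (Th t x)
     + 2 * sin (B t x) * Bx t x * Thx t x * cos (Th t x))
  ((Bt t x - Bxx t x - sin (B t x) * cos (B t x) * Thx t x ^+ 2) * cos (B t x)).

Lemma regular_V i : regular D (fun t x => V t x 0 i) (fun t x => Vt t x 0 i)
  (fun t x => Vx t x 0 i) (fun t x => Vxx t x 0 i).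
Proof.
have dcos (y : R) : is_derive y (1 : R) cos (- sin y) by exact: is_derive_cos.
have dsin (y : R) : is_derive y (1 : R) sin (cos y) by exact: is_derive_sin.
have dNsin (y : R) : is_derive y (1 : R) (fun y => - sin y) (- cos y) by exact: is_deriveN.
have cNcos : continuous (fun y : R => - cos y).
  by move=> y; apply: (@continuousN _ _ _ cos); exact: continuous_cos.
have cNsin : continuous (fun y : R => - sin y).
  by move=> y; apply: (@continuousN _ _ _ sin); exact: continuous_sin.
have cB := regular_comp dcos dNsin cNcos rB; have sB := regular_comp dsin dcos cNsin rB.
have cT := regular_comp dcos dNsin cNcos rT; have sT := regular_comp dsin dcos cNsin rT.
have r1 := regularM cB cT; have r2 := regularM cB sT.
have := regularD (regularZ (e1 0 i) r1) (regularD (regularZ (e2 0 i) r2) (regularZ (e3 0 i) sB)).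
by congr (regular _ _ _ _ _); apply/funext => t; apply/funext => x; rewrite comb_coord.
Qed.

Let trig1 (y : R) : sin y ^+ 2 + cos y ^+ 2 = 1.
Proof. by rewrite addrC cos2Dsin2. Qed.

Lemma V_sphere t x : dotv (V t x) (V t x) = 1.
Proof. by rewrite dot_comb unit_length. Qed.

Lemma Vf_tangent t x : dotv (Vf t x) (V t x) = 0.
Proof. by rewrite dot_comb residual_tangent. Qed.

Lemma V_equation t x : Vt t x = Vxx t x + (dotv (Vx t x) (Vx t x) *: V t x + Vf t x).
Proof.
apply/rowP => i.
have addE (u v : 'rV[R]_k.+1) : (u + v) 0 i = u 0 i + v 0 i by rewrite mxE.
have scaleE (a : R) (u : 'rV[R]_k.+1) : (a *: u) 0 i = a * u 0 i by rewrite mxE.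
rewrite /Vt /Vxx /Vf /Vx /V dot_comb speed_sqr// [RHS]addE [X in _ = _ + X]addE scaleE !comb_coord.
rewrite (residual1 _ _ (Bt t x) (Bx t x) (Bxx t x) (Thx t x) _ (trig1 (B t x))).
rewrite (residual2 _ _ (Bt t x) (Bx t x) (Bxx t x) (Thx t x) _ (trig1 (B t x))).
by rewrite (residual3 (sin (B t x)) _ (Bt t x) (Bx t x) (Bxx t x) (Thx t x)); ring.
Qed.

Lemma Vf_eq0 t x : B t x = 0 -> Bt t x = 0 -> Bx t x = 0 -> Bxx t x = 0 -> Vf t x = 0.
Proof.
move=> B0 Bt0 Bx0 Bxx0; rewrite /Vf B0 Bt0 Bx0 Bxx0 sin0 /comb.
by rewrite !(mul0r, mulr0, subr0, oppr0, addr0, scale0r, addr0).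
Qed.

Lemma V_flat t x : B t x = 0 -> V t x = comb (cos (Th t x)) (sin (Th t x)) 0.
Proof. by move=> B0; rewrite /V B0 cos0 sin0 !mul1r. Qed.

Lemma Vx_flat t x : B t x = 0 -> Bx t x = 0 ->
  Vx t x = comb (- sin (Th t x) * Thx t x) (cos (Th t x) * Thx t x) 0.
Proof.
by move=> B0 Bx0; rewrite /Vx B0 Bx0 cos0 sin0 !(mul1r, mulr0, mul0r, add0r).
Qed.

End profile.
End frames.

(** * Comparison of L^2 norms *)

Section initial_convergence.
Context {R : realType}.
Notation P := (@period R).

Lemma l2n_mono (f F : R -> R) : L2i 0 P f -> L2i 0 P F -> (forall x, x \in `[0, P] -> `|f x| <= F x) ->
  l2n f <= l2n F.
Proof.
move=> f2 F2 fF; apply: l2n_le; first exact: l2n_ge0.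
rewrite l2n_sqr; have [_ i1] := f2; have [_ i2] := F2; apply: le_int => // x xP.
rewrite -(real_normK (num_real (f x))) ler_sqr ?nnegrE ?fF//.
exact: le_trans (normr_ge0 _) (fF x xP).
Qed.

Lemma l2nZ (k : R) (f : R -> R) : itg 0 P (fun x => f x ^+ 2) -> 0 <= k -> l2n (fun x => k * f x) = k * l2n f.
Proof.
move=> fi k0; rewrite /l2n (@eq_int _ _ (fun x => k ^+ 2 * f x ^+ 2)) => [|x _]; last by rewrite exprMn.
by rewrite intZ// sqrtrM ?sqr_ge0// sqrtr_sqr ger0_norm.
Qed.

End initial_convergence.

(** * The initial state and the early flow *)

Section existence.
Context {R : realType}.
Notation mu := (@lebesgue_measure R).
Notation P := (@period R).

Lemma periodic_set_int (omega : set R) (m : int) x :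
  (forall x, omega (x + P) <-> omega x) -> omega (x + m%:~R * P) <-> omega x.
Proof.
move=> oP; have H : periodic (\1_omega : R -> R) P.
  by move=> y; rewrite !indicE; congr ((_ : bool)%:R); apply/idP/idP; rewrite !in_setE => /oP.
have := periodic_int m x H; rewrite !indicE.
by have [] := boolP (x + _ \in omega); have [] := boolP (x \in omega); rewrite ?in_setE ?notin_setE//= => ? ? /eqP; rewrite ?oner_eq0 ?(eq_sym 0) ?oner_eq0.
Qed.

(** Off [omega] a point is at distance at least some [e] from [c] modulo the period, and then
    [1 - cos (x - c) >= 1 - cos e]. This is the condition under which [space_bump] vanishes. *)
Lemma cos_away (omega : set R) (c : R) : open omega -> (forall x, omega (x + P) <-> omega x) ->
  omega c -> exists2 b : R, 0 < b & forall x, ~ omega x -> b <= 1 - cos (x - c).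
Proof.
move=> oo oP oc; have pi0 := pi_gt0 R.
have /nbhs_ballP[d /= d0 Hd] : nbhs c omega by exact: open_nbhs_nbhs.
have [e [e0 ed ep]] : exists e : R, [/\ 0 < e, e <= d & e <= pi].
  by exists (Num.min d pi); rewrite lt_min d0 pi0 !ge_min !lexx orbT.
have near y m : `|y| < e -> omega (c + y + m%:~R * P).
  move=> ye; apply/periodic_set_int => //; apply: Hd; rewrite /ball/= opprD addrA subrr add0r normrN.
  exact: lt_le_trans ye ed.
exists (1 - cos e).
  rewrite subr_gt0 -cos0 ltr_cos// !in_itv/= ?lexx ?(ltW pi0)// ep ltW//.
move=> x ox; have [m] := period_reduce (x - c); set y := _ + _ * P; rewrite in_itv/= => /andP[y0 yP].
have <- : cos y = cos (x - c).
  by have := @periodic_int R R (@cos R) m (x - c) (fun x => _); apply => z; have := cos_natmul_period 1 z; rewrite !mul1r.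
have ye : e <= y.
  rewrite leNgt; apply/negP => ye; apply: ox.
  have -> : x = c + y + (- m)%:~R * P by rewrite /y mulrNz; ring.
  by apply: near; rewrite ger0_norm.
have yPe : y <= P - e.
  rewrite leNgt; apply/negP => yPe; apply: ox.
  have -> : x = c + (y - P) + (1 - m)%:~R * P by rewrite /y intrB; ring.
  by apply: near; rewrite ler0_norm ?subr_le0//; lra.
rewrite lerD2l lerN2; have [ypi|/ltW ypi] := leP y pi; first by apply: cos_ndecr => //; exact: ltW.
have -> : cos y = cos (P - y).
  have := cos_natmul_period 1 (- y); rewrite !mul1r cosN addrC => <-.
  by congr cos; rewrite addrC.
by move: ypi yPe yP; rewrite /period => ypi yPe yP; apply: cos_ndecr; [exact: ltW| lra | lra].
Qed.

Section fixed.
Variables (k : nat) (e1 e2 e3 : 'rV[R]_k.+1).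
Hypotheses (e11 : dotv e1 e1 = 1) (e22 : dotv e2 e2 = 1) (e12 : dotv e1 e2 = 0)
  (e33 : dotv e3 e3 = 1) (e13 : dotv e1 e3 = 0) (e23 : dotv e2 e3 = 0).
Variables (N0 : int) (p g : R -> R) (v0 : R -> 'rV[R]_k.+1).
Hypotheses (cp : continuous p) (pP : periodic p P) (gP : periodic g P) (g2 : L2i 0 P g)
  (pg : AC 0 P p (fun x => g x - N0%:~R)) (v0H1 : H1_sphere v0)
  (v0E : forall x, v0 x = comb e1 e2 e3 (cos (N0%:~R * x + p x)) (sin (N0%:~R * x + p x)) 0).

Definition angle0 x := N0%:~R * x + p x.

(** The derivative of [v0] by the chain rule from the lifted angle. It replaces the unspecified one
    in [H1_sphere v0], because the slopes of the early flow converge to this formula. *)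
Definition v0x x := comb e1 e2 e3 (- sin (angle0 x) * g x) (cos (angle0 x) * g x) 0.

Let P0 := @period_gt0 R.

(** With winding number [n], moving by [m] periods turns the angle by [m n] full turns. *)
Lemma trig_periodic_int (m n : int) (y z : R) : y = z + m%:~R * (n%:~R * P) ->
  cos y = cos z /\ sin y = sin z.
Proof.
move=> ->; rewrite mulrA -intrM.
split.
  have := @periodic_int R R (@cos R) (m * n) z (fun x => _); apply => x.
  by have := cos_natmul_period 1 x; rewrite !mul1r.
have := @periodic_int R R (@sin R) (m * n) z (fun x => _); apply => x.
by have := sin_natmul_period 1 x; rewrite !mul1r.
Qed.

Lemma H1_initial : H1_sphere_with v0 v0x.
Proof.
have [w [v0P cv0 sv0 _ _]] := v0H1; split => //.
  apply/L2_circleP; split => [x|i].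
    have [h1 h2] : cos (angle0 (x + P)) = cos (angle0 x) /\ sin (angle0 (x + P)) = sin (angle0 x).
      by apply: (@trig_periodic_int 1 N0); rewrite /angle0 pP; ring.
    by rewrite /v0x h1 h2 gP.
  have ca : continuous angle0.
    by apply: continuousD_fun => //; apply: continuousZ_fun => x; exact: cvg_id.
  have ccos : continuous (fun x => cos (angle0 x)).
    by move=> x; apply: (@continuous_comp _ _ _ angle0 cos); [exact: ca|exact: continuous_cos].
  have csin : continuous (fun x => - sin (angle0 x)).
    move=> x; apply: (@continuousN _ _ _ (fun x => sin (angle0 x))).
    by apply: (@continuous_comp _ _ _ angle0 sin); [exact: ca|exact: continuous_sin].
  apply: (@eq_L2i _ (fun x => e1 0 i * (- sin (angle0 x) * g x) + e2 0 i * (cos (angle0 x) * g x))).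
    by move=> x _; rewrite comb_coord mulr0 addr0.
  by apply: L2iD; apply: L2iZ; exact: L2i_contM.
move=> phi sphi i; rewrite /circle.
have lin : AC 0 P (fun x : R => N0%:~R * x) (fun=> N0%:~R : R).
  apply: AC_C1 => [x|x]; first exact: cst_continuous.
  by apply: is_derive_eq; rewrite /GRing.scale /= mulr1.
have aA : AC 0 P angle0 g.
  have := AC_add lin pg; congr (AC _ _ _ _).
  by apply/funext => x; ring.
have A1 := AC_scale (e1 0 i) (AC_cos (ltW P0) aA).
have A2 := AC_scale (e2 0 i) (AC_sin (ltW P0) aA).
have A : AC 0 P (fun x => v0 x 0 i) (fun x => v0x x 0 i).
  have := AC_add A1 A2; congr (AC _ _ _ _); apply/funext => x.
    by rewrite v0E comb_coord mulr0 addr0.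
  by rewrite /v0x comb_coord mulr0 addr0.
have := AC_by_parts A _ (smooth_derive_continuous sphi) (smooth_is_derive sphi) (smooth_period sphi).
move=> -> //; first by rewrite opprK.
by rewrite -[in LHS](add0r P) v0P.
Qed.

Let g02 : L2i 0 P (fun x => g x - N0%:~R).
Proof. by apply: L2iB => //; apply: L2i_cont => x; exact: cst_continuous. Qed.

Definition early t x := comb e1 e2 e3 (cos (N0%:~R * x + free p t x)) (sin (N0%:~R * x + free p t x)) 0.

Definition early_x t x := comb e1 e2 e3
  (- sin (N0%:~R * x + free p t x) * (N0%:~R + free_x p t x))
  (cos (N0%:~R * x + free p t x) * (N0%:~R + free_x p t x)) 0.

Lemma free_continuous t : 0 < t -> continuous (free p t) /\ continuous (free_x p t).
Proof.
move=> t0; split; first exact: (is_derive_continuous (fun x => free_derive pg pP g02 x t0)).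
exact: (@free_x_continuous _ _ _ pg pP g02 t t0).
Qed.

(** Angles converge uniformly and their slopes in L^2, and sine and cosine are Lipschitz; [K] adds
    up the resulting constants. *)
Lemma early_cvg (e : R) : 0 < e -> exists2 d : R, 0 < d & forall t, 0 < t -> t < d -> forall i,
  l2n (fun x => early t x 0 i - v0 x 0 i) <= e /\ l2n (fun x => early_x t x 0 i - v0x x 0 i) <= e.
Proof.
move=> e_0; pose K : R := 2 * (1 + P) + 2 * l2n g + 2.
have P0' : 0 < P := P0; have l0 := l2n_ge0 g; have K0 : 0 < K by rewrite /K; lra.
pose e' : R := e / K; have e'0 : 0 < e' by rewrite divr_gt0.
have eE : e = K * e' by rewrite /e' mulrC mulfVK// gt_eqF.
have [d1 d10 H1] := free_cvg cp pg pP g02 e'0.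
have [d2 d20 H2] := free_x_cvg cp pg pP g02 e'0.
exists (Num.min d1 d2) => [|t t0]; first by rewrite lt_min d10 d20.
rewrite lt_min => /andP[t1 t2] i; have q := H1 t t0 t1; have h := H2 t t0 t2.
have [cf cfx] := free_continuous t0.
pose th x := N0%:~R * x + free p t x.
have cth : continuous th by apply: continuousD_fun => //; apply: continuousZ_fun => x; exact: cvg_id.
have ca : continuous angle0 by apply: continuousD_fun => //; apply: continuousZ_fun => x; exact: cvg_id.
have cc (f : R -> R) : continuous f -> continuous (fun x => cos (f x)) /\ continuous (fun x => sin (f x)).
  by move=> c; split=> x; apply: (@continuous_comp _ _ _ f); [exact: c|exact: continuous_cos|exact: c|exact: continuous_sin].
have [ct st] := cc th cth; have [ca' sa] := cc angle0 ca.
have dcos x : `|cos (th x) - cos (angle0 x)| <= e'.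
  by apply: le_trans (cos_lipschitz _ _) _; rewrite /th /angle0 opprD addrACA subrr add0r; exact: q.
have dsin x : `|sin (th x) - sin (angle0 x)| <= e'.
  by apply: le_trans (sin_lipschitz _ _) _; rewrite /th /angle0 opprD addrACA subrr add0r; exact: q.
have n1 := coord_le1 i e11; have n2 := coord_le1 i e22.
have cB (f f' : R -> R) : continuous f -> continuous f' -> continuous (fun x => f x - f' x).
  by move=> c c'; apply: continuousD_fun => // x; apply: (@continuousN _ _ _ f'); exact: c'.
split.
  pose D x := e1 0 i * (cos (th x) - cos (angle0 x)) + e2 0 i * (sin (th x) - sin (angle0 x)).
  have -> : (fun x => early t x 0 i - v0 x 0 i) = D.
    by apply/funext => x; rewrite v0E !comb_coord /D /th /angle0; ring.
  apply: (@le_trans _ _ ((1 + P) * (2 * e'))); last first.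
    by rewrite eE mulrA (mulrC _ 2) ler_wpM2r ?(ltW e'0)// /K; lra.
  apply: l2n_sup => [||x _]; [|lra|].
    by apply: continuousD_fun; apply: continuousZ_fun; exact: cB.
  rewrite /D; apply: le_trans (ler_normD _ _) _; rewrite !normrM.
  have := ler_pM (normr_ge0 _) (normr_ge0 _) n1 (dcos x).
  have := ler_pM (normr_ge0 _) (normr_ge0 _) n2 (dsin x); lra.
pose h1 x := free_x p t x - (g x - N0%:~R).
have h12 : L2i 0 P h1 by apply: L2iB => //; exact: L2i_cont.
pose D x := e1 0 i * (- sin (th x) * h1 x - (sin (th x) - sin (angle0 x)) * g x) +
  e2 0 i * (cos (th x) * h1 x + (cos (th x) - cos (angle0 x)) * g x).
have -> : (fun x => early_x t x 0 i - v0x x 0 i) = D.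
  by apply/funext => x; rewrite !comb_coord /D /h1 -/(th x); ring.
have D2 : L2i 0 P D.
  apply: L2iD; apply: L2iZ.
    apply: L2iB; last by apply: L2i_contM => //; exact: cB.
    by apply: L2i_contM => // x; apply: (@continuousN _ _ _ (fun x => sin (th x))); exact: st.
  by apply: L2iD; apply: L2i_contM => //; exact: cB.
have a1 := L2iZ (2 * e') (L2i_abs g2); have a2 := L2iZ 2 (L2i_abs h12).
apply: le_trans (l2n_mono D2 (L2iD a1 a2) _) _ => [x _|].
  rewrite /D; apply: le_trans (ler_normD _ _) _; rewrite !normrM.
  have b1 : `|- sin (th x) * h1 x - (sin (th x) - sin (angle0 x)) * g x| <= `|h1 x| + e' * `|g x|.
    apply: le_trans (ler_normB _ _) _; rewrite !normrM normrN; apply: lerD.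
      by rewrite ler_piMl// sin_max.
    by rewrite ler_wpM2r.
  have b2 : `|cos (th x) * h1 x + (cos (th x) - cos (angle0 x)) * g x| <= `|h1 x| + e' * `|g x|.
    apply: le_trans (ler_normD _ _) _; rewrite !normrM; apply: lerD.
      by rewrite ler_piMl// cos_max.
    by rewrite ler_wpM2r.
  have := ler_pM (normr_ge0 _) (normr_ge0 _) n1 b1.
  have := ler_pM (normr_ge0 _) (normr_ge0 _) n2 b2; lra.
apply: le_trans (l2n_add a1 a2) _.
have l2nabs (f : R -> R) : l2n (fun x => `|f x|) = l2n f.
  by congr Num.sqrt; apply: eq_int => x _; rewrite real_normK ?num_real.
have [_ ig] := L2i_abs g2; have [_ ih] := L2i_abs h12.
rewrite !l2nZ//; last by lra.
rewrite !l2nabs eE /K; have := mulr_ge0 (ltW e'0) (ltW P0); lra.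
Qed.

End fixed.
End existence.

(** * Assembling the control *)

Section control.
Context {R : realType}.
Notation mu := (@lebesgue_measure R).
Notation P := (@period R).

Lemma jcont_sum (I : Type) (s : seq I) (F : I -> R -> R -> R) t x :
  (forall i, jcont (F i) t x) -> jcont (fun t x => \sum_(i <- s) F i t x) t x.
Proof.
move=> cF; elim: s => [|i s IH].
  rewrite (_ : (fun t x => _) = fun _ _ => 0); first exact: jcont_cst.
  by apply/funext => ?; apply/funext => ?; rewrite big_nil.
rewrite (_ : (fun t x => _) = fun t x => F i t x + \sum_(j <- s) F j t x); first exact: jcontD.
by apply/funext => ?; apply/funext => ?; rewrite big_cons.
Qed.

Lemma series_mode_periodic (a b : nat -> R) : periodic (fun x => limn (series (mode a b ^~ x))) P.
Proof. by move=> x; congr (limn (series _)); apply/funext => n; exact: mode_periodic. Qed.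

Variables (k : nat) (e1 e2 e3 : 'rV[R]_k.+1).
Hypotheses (e11 : dotv e1 e1 = 1) (e22 : dotv e2 e2 = 1) (e12 : dotv e1 e2 = 0)
  (e33 : dotv e3 e3 = 1) (e13 : dotv e1 e3 = 0) (e23 : dotv e2 e3 = 0).
Variables (N0 : int) (p g : R -> R) (v0 : R -> 'rV[R]_k.+1).
Hypotheses (cp : continuous p) (pP : periodic p P) (gP : periodic g P) (g2 : L2i 0 P g)
  (pg : AC 0 P p (fun x => g x - N0%:~R)) (v0H1 : H1_sphere v0)
  (v0E : forall x, v0 x = comb e1 e2 e3 (cos (N0%:~R * x + p x)) (sin (N0%:~R * x + p x)) 0).
Variables (omega : set R) (T r : R) (N1 : int).
Hypotheses (T0 : 0 < T) (omega_open : open omega) (omega_neq0 : omega !=set0)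
  (omega_periodic : forall x, omega (x + P) <-> omega x).

(** The control is delivered jointly continuous in time and space, which is what the measurability
    and uniqueness arguments consume. *)
Lemma control_exists : exists f u : R -> R -> 'rV[R]_k.+1,
  [/\ forall t, periodic (f t) P, forall i, continuous (fun q : R * R => f q.1 q.2 0 i),
      HMHF_solution omega T f v0 u &
      forall x, u T x = comb e1 e2 e3 (cos (N1%:~R * x + r)) (sin (N1%:~R * x + r)) 0].
Proof.
have P0 := @period_gt0 R; have T0' := T0.
(* [time_bump] ends at [7 tau], before [T]. *)
pose tau : R := T / 8; have tau0 : 0 < tau by rewrite /tau; lra.
have [c oc cP] : exists2 c, omega c & c \in `[0, P].
  have [c0 oc0] := omega_neq0; have [m cm] := period_reduce c0.
  by exists (c0 + m%:~R * P) => //; apply/periodic_set_int.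
have /andP[c_0 c_P] : 0 <= c <= P by move: cP; rewrite in_itv.
have [b b0 Hb] := cos_away omega_open omega_periodic oc.
have [be [be' [dbe cbe' be0 beh be7]]] := time_bump tau0.
have [ch [ch' [ch'' [dch cch'' chP [d1 d10 ch1] ch0]]]] := space_bump c b0.
(* Large enough for [(- X, X)] to contain [[c, c + P]], as [c] lies in [[0, P]]. *)
pose X : R := 3 * P.
have cX : - X < c by rewrite /X; lra.
have cPX : c + P < X by rewrite /X; lra.
have X0 : 0 < X by rewrite /X; lra.
(* The angle is steered well inside the interval from [2 tau] to [6 tau], where [be] is [pi / 2]. *)
have t12 : 3 * tau < 5 * tau by lra.
have pP0 : p P = p 0 by rewrite -[in LHS](add0r P) pP.
have g02 : L2i 0 P (fun x => g x - N0%:~R).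
  by apply: L2iB => //; apply: L2i_cont => x; exact: cst_continuous.
have sab := coef_summable pg pP0 g02.
have [Th [Thx [Thxx [dTh cTh Th0 Th1]]]] := @heat_control R X N0%:~R N1%:~R r _ _ _ _ X0 t12 sab.
have cbe := is_derive_continuous dbe.
have cch : continuous ch by apply: is_derive_continuous => x; have [] := dch x.
have cch' : continuous ch' by apply: (@is_derive_continuous R _ ch'') => x; have [] := dch x.
pose B (t x : R) := be t * ch x; pose Bt (t x : R) := be' t * ch x.
pose Bx (t x : R) := be t * ch' x; pose Bxx (t x : R) := be t * ch'' x.
have rB : regular (fun x : R => `|x| < X) B Bt Bx Bxx.
  move=> t x t0 Dx; have [h1 h2] := dch x; split; split.
  - have h3 : is_derive t (1 : R) (fun _ : R => ch x) (0 : R) by exact: is_derive_cst.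
    by apply: (is_derive_eq (is_derive_mulE (dbe t) h3)); rewrite mulr0 addr0.
  - exact: is_deriveZ.
  - exact: is_deriveZ.
  - by apply: jcontM; [exact: jcont_t|exact: jcont_x].
  - by apply: jcontM; [exact: jcont_t|exact: jcont_x].
  - by apply: jcontM; [exact: jcont_t|exact: jcont_x].
  - by apply: jcontM; [exact: jcont_t|exact: jcont_x].
have rT : regular (fun x : R => `|x| < X) Th Thxx Thx Thxx.
  move=> t x t0 Dx; have [a1 a2 a3] := dTh t x t0 Dx; have [c1 c2 c3] := cTh t x t0 Dx.
  by split; split.
have BP t y : B t (y + P) = B t y by rewrite /B; have [-> _ _] := chP y.
pose W := V e1 e2 e3 B Th; pose Wt := Vt e1 e2 e3 B Bt Th Thxx.
pose Wx := Vx e1 e2 e3 B Bx Th Thx; pose Wxx := Vxx e1 e2 e3 B Bx Bxx Th Thx Thxx.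
pose Wf := Vf e1 e2 e3 B Bt Bx Bxx Th Thx.
have trigW t y (m : int) : Th t (y + P) = Th t y + m%:~R * P -> W t (y + P) = W t y.
  move=> h; have [hc hs] : cos (Th t (y + P)) = cos (Th t y) /\ sin (Th t (y + P)) = sin (Th t y).
    by apply: (@trig_periodic_int R 1 m); rewrite mul1r.
  by rewrite /W /V BP hc hs.
(* At the cut [c], the angle is periodic up to a multiple of the period before
   [3 tau] and after [5 tau]; in between [B = pi / 2] there, so that [W] is [e3]
   whatever the angle. *)
have mW i : matched c (fun t x => W t x 0 i).
  move=> t0 t00.
  suff [d d0 Hd] : exists2 d : R, 0 < d & forall t y, `|t - t0| < d -> `|y - c| < d -> W t (y + P) = W t y.
    by exists d => // t y h1 h2; rewrite Hd.
  have [lt3|le3] := ltP t0 (3 * tau).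
    have [e e0 He] := D_near cX cPX.
    exists (Num.min e (Num.min t0 (3 * tau - t0))) => [|t y]; first by rewrite !lt_min e0 t00 subr_gt0.
    rewrite !lt_min => /and3P[_ s2 s3] /and3P[y1 _ _]; have [D1 D2] := He y y1.
    have t_0 : 0 < t by move: s2; rewrite ltr_norml => /andP[]; lra.
    have t_3 : t < 3 * tau by move: s3; rewrite ltr_norml => /andP[_]; lra.
    by apply: (trigW _ _ N0); rewrite !Th0// series_mode_periodic; ring.
  have [lt5|le5] := ltP (5 * tau) t0.
    exists (t0 - 5 * tau) => [|t y]; first by rewrite subr_gt0.
    rewrite ltr_norml => /andP[s1 _] _; have t5 : 5 * tau < t by lra.
    by apply: (trigW _ _ N1); rewrite !Th1//; ring.
  exists (Num.min tau d1) => [|t y]; first by rewrite lt_min tau0 d10.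
  rewrite !lt_min !ltr_norml => /andP[/andP[s1 s2] _] /andP[_ y2].
  have BE : B t y = pi / 2.
    by rewrite /B beh ?ch1 ?mulr1// ?ltr_norml//; lra.
  by rewrite /W /V BP BE cos_pihalf !mul0r.
pose U t x := W t (cell c x); pose Ut t x := Wt t (cell c x).
pose Ux t x := Wx t (cell c x); pose Uxx t x := Wxx t (cell c x).
pose f t x := Wf t (cell c x).
have rU i := regular_per cX cPX (regular_V e1 e2 e3 rB rT i) (mW i).
have cellP x : cell c (x + P) = cell c x := @per_periodic R c (fun _ y => y) 0 x.
have cellE x : cell c x = x + (- Num.floor ((x - c) / P))%:~R * P by rewrite /cell mulrNz mulNr.
have cell_D x : `|cell c x| < X.
  by have /andP[h1 h2] := cell_in c x; rewrite ltr_norml /X; apply/andP; split; lra.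
have fP t : periodic (f t) P by move=> x; rewrite /f cellP.
have eqW t x : Ut t x = Uxx t x + (dotv (Ux t x) (Ux t x) *: U t x + f t x).
  exact: V_equation.
have f0 t x : be t = 0 -> be' t = 0 -> f t x = 0.
  by move=> h h'; apply: Vf_eq0; rewrite /B /Bt /Bx /Bxx ?h ?h' mul0r.
(* The definition of [f] through [cell] jumps in appearance only: before [tau] the control is zero,
   and afterwards the equation expresses it by [U] and its derivatives, which are continuous across
   the cut. *)
have cf i : continuous (fun q : R * R => f q.1 q.2 0 i).
  move=> [t x]; change (jcont (fun t x => f t x 0 i) t x).
  have [t_tau|tau_t] := ltP t tau.
    apply: (@jcont_near _ _ (fun _ _ => 0) t x (tau - t)); [by rewrite subr_gt0| |exact: jcont_cst].
    move=> s y st _; have [h h'] : be s = 0 /\ be' s = 0.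
      by apply: be0; move: st; rewrite ltr_norml => /andP[]; lra.
    by rewrite f0// mxE.
  have t0 : 0 < t by exact: lt_le_trans tau_t.
  have -> : (fun t x => f t x 0 i) = (fun t x => Ut t x 0 i - (Uxx t x 0 i +
      (\sum_j Ux t x 0 j * Ux t x 0 j) * U t x 0 i)).
    apply/funext => s; apply/funext => y; have := eqW s y.
    rewrite -/(dotv (Ux s y) (Ux s y)).
    move: (dotv _ _) (Ut s y) (Uxx s y) (U s y) (f s y) => q w w' w'' w3 ->.
    by rewrite !mxE; ring.
  have cU j : [/\ jcont (fun t x => U t x 0 j) t x, jcont (fun t x => Ut t x 0 j) t x,
      jcont (fun t x => Ux t x 0 j) t x & jcont (fun t x => Uxx t x 0 j) t x].
    by have [] := @rU j t x t0 I.
  have [c1 c2 c3 c4] := cU i.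
  apply: jcontB => //; apply: jcontD => //; apply: jcontM => //; apply: jcont_sum => j.
  by have [_ _ h _] := cU j; exact: jcontM.
exists f, (glue U v0); split => //.
- apply: (@glue_solution R k omega T f U Ut Ux Uxx v0 (v0x e1 e2 e3 N0 p g) T0 omega_open cf rU).
  + by move=> t x; rewrite /U cellP.
  + by move=> t x; rewrite /Ux cellP.
  + by move=> t x t0; apply/sphereP; exact: V_sphere.
  + move=> t x t0; rewrite eqW /nonlin enorm_sqr; congr (_ + (_ + _)).
    have -> : tangent_proj (U t x) (f t x) = f t x.
      by rewrite /tangent_proj Vf_tangent// scale0r subr0.
    (* Outside [omega] the bump and its derivatives vanish, so the control is already zero where the
       indicator would remove it. *)
    rewrite indicE; have [xo|xo] := boolP (x \in omega); first by rewrite scale1r.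
    rewrite scale0r; have no : ~ omega (cell c x).
      by rewrite cellE => /(periodic_set_int _ _ omega_periodic); move: xo; rewrite notin_setE.
    by have [h1 h2 h3] := ch0 _ (Hb _ no); apply: Vf_eq0; rewrite /B /Bt /Bx /Bxx ?h1 ?h2 ?h3 mulr0.
  + exact: H1_initial cp pP gP g2 pg v0H1 v0E.
  + move=> e e0; have [d d0 Hd] := early_cvg e11 e22 cp pP g2 pg v0E e0.
    exists (Num.min d tau) => [|t t0]; first by rewrite lt_min d0.
    rewrite lt_min => /andP[td ttau] i; have := Hd t t0 td i.
    have [bt bt'] := be0 t ttau.
    have t3 : t < 3 * tau by lra.
    have ThE y : `|y| < X -> Th t y = N0%:~R * y + free p t y by move=> yX; exact: Th0.
    (* [heat_control] describes [Th] alone at early times; uniqueness of derivatives transfers the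
       description to its slope. *)
    have ThxE y : `|y| < X -> Thx t y = N0%:~R + free_x p t y.
      move=> yX; have [_ h _] := dTh t y t0 yX; apply: is_derive_unique h _.
      apply: (is_derive_near (d := X - `|y|) (g := fun y => N0%:~R * y + free p t y)).
      * by rewrite subr_gt0.
      * move=> z zy; apply: ThE; rewrite -(subrK y z); apply: le_lt_trans (ler_normD _ _) _; lra.
      * have h1 : is_derive y (1 : R) (fun y : R => N0%:~R * y) (N0%:~R : R).
          by apply: is_derive_eq; rewrite /GRing.scale /= mulr1.
        exact: is_deriveD h1 (free_derive pg pP g02 y t0).
    have trigE x : cos (Th t (cell c x)) = cos (N0%:~R * x + free p t x) /\
        sin (Th t (cell c x)) = sin (N0%:~R * x + free p t x).
      have fp : periodic (free p t) P by exact: series_mode_periodic.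
      rewrite ThE// cellE (periodic_int _ _ fp).
      by apply: (@trig_periodic_int R (- Num.floor ((x - c) / P)) N0); ring.
    have UE x : U t x = early e1 e2 e3 N0 p t x.
      by rewrite /U /W V_flat ?/B ?bt ?mul0r//; have [-> ->] := trigE x.
    have UxE x : Ux t x = early_x e1 e2 e3 N0 p t x.
      rewrite /Ux /Wx Vx_flat ?/B ?/Bx ?bt ?mul0r//; have [-> ->] := trigE x.
      have fp : periodic (free_x p t) P by exact: series_mode_periodic.
      by rewrite ThxE// cellE (periodic_int _ _ fp).
    have -> : (fun x => U t x 0 i - v0 x 0 i) = (fun x => early e1 e2 e3 N0 p t x 0 i - v0 x 0 i).
      by apply/funext => x; rewrite UE.
    have -> : (fun x => Ux t x 0 i - v0x e1 e2 e3 N0 p g x 0 i) =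
       (fun x => early_x e1 e2 e3 N0 p t x 0 i - v0x e1 e2 e3 N0 p g x 0 i).
      by apply/funext => x; rewrite UxE.
    by [].
(* At time [T = 8 tau] the bump is off and the angle has reached its target. *)
- move=> x; rewrite /glue T0 /U /W V_flat; last by rewrite /B be7 ?mul0r// /tau; lra.
  have T5 : 5 * tau < T by rewrite /tau; lra.
  rewrite Th1// cellE.
  set y := N1%:~R * (_ + _ * P) + r; have [-> ->] // : cos y = cos (N1%:~R * x + r) /\ sin y = sin (N1%:~R * x + r).
  apply: (@trig_periodic_int R (- Num.floor ((x - c) / P)) N1); rewrite /y.
  ring.
Qed.

End control.

Theorem theorem1p12 (R : realType) (k : nat) (hk : (2 <= k)%N)
  (omega : set R) (omega_open : open omega) (omega_neq0 : omega !=set0)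
  (omega_periodic : forall x, omega (x + period) <-> omega x)
  (T : R) (T_gt0 : 0 < T)
  (gamma : R -> 'rV[R]_k.+1) (gamma_geodesic : closed_geodesic gamma)
  (v0 v1 : R -> 'rV[R]_k.+1)
  (v0_H1 : H1_sphere v0) (v1_H1 : H1_sphere v1)
  (v0_C : forall x, range gamma (v0 x)) (v1_C : forall x, range gamma (v1 x))
  (v1_gamma : exists (N1 : int) (r : R), forall x, v1 x = gamma (N1%:~R * x + r)) :
  exists f : R -> R -> 'rV[R]_k.+1,
    Loo_L2 T f /\
    exists u : R -> R -> 'rV[R]_k.+1,
      [/\ HMHF_solution omega T f v0 u,
          forall u', HMHF_solution omega T f v0 u' ->
            forall t, t \in `[0, T] -> forall x, u' t x = u t x &
          forall x, u T x = v1 x].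
Proof.
have [e1 [e2 [e11 e22 e12 gE]]] := geodesic_form gamma_geodesic.
have [e3 [e33 e13 e23]] := orthogonal_unit e1 e2 hk.
have combE a : comb e1 e2 e3 (cos a) (sin a) 0 = gamma a.
  by rewrite gE /comb scale0r addr0.
have [N0 [p [g [cp [pP gP] g2 pg v0E]]]] := lifting e11 e22 e12 gE v0_H1 v0_C.
have v0E' x : v0 x = comb e1 e2 e3 (cos (N0%:~R * x + p x)) (sin (N0%:~R * x + p x)) 0.
  by rewrite combE.
have [N1 [r v1E]] := v1_gamma.
have [f [u [fP cf su uT]]] := control_exists e11 e22 e12 e33 e13 e23 cp pP gP g2 pg
  v0_H1 v0E' r N1 T_gt0 omega_open omega_neq0 omega_periodic.
exists f; split; first exact: Loo_L2_joint.
exists u; split=> // [u' su'|x]; last by rewrite uT combE v1E.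
exact: (solution_unique T_gt0 omega_open cf su su').
Qed.
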